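(* Let $n\ge 2$ and let $\Omega\subset\mathbb{R}^n$ be a convex set that has a $C^2$ boundary neighborhood with nonzero curvature. Then Nehari's theorem fails for $\Omega$ for all $p>4$; that is, for every $p\in(4,\infty)$ there exists a Hankel operator $\mathrm{H}_\phi$ in the Schatten class $S^p(\mathrm{PW}(\Omega))$ which does not admit a bounded symbol.
   Context: $\Omega$ has a $C^2$ boundary neighborhood with nonzero curvature if there is an open ball $B$ such that $\partial\Omega\cap B$ is a (nonempty) $C^2$ manifold (hypersurface) of strictly positive Gaussian curvature. Since the boundary of a convex set has Lebesgue measure zero, convex sets may be taken to be open when spaces and operators attached to them are considered. The Fourier transform is $\widehat f(x)=\int_{\mathbb{R}^n}f(\xi)e^{-2\pi i\langle x,\xi\rangle}d\xi$, extended to tempered distributions. The Paley--Wiener space is $\mathrm{PW}(\Omega)=\{f\in L^2(\mathbb{R}^n):\operatorname{supp}\widehat f\subset\Omega\}$, a closed subspace of $L^2(\mathbb{R}^n)$. Write $2\Omega=\{2x:x\in\Omega\}=\Omega+\Omega$. Given a distribution $\widehat\phi$ on $2\Omega$ (it need not come from a tempered distribution; one still refers to the symbol $\phi$), the Hankel operator $\mathrm{H}_\phi$ on $\mathrm{PW}(\Omega)$ is the operator densely defined (e.g. on $f$ with $\widehat f\in C_c^\infty(\Omega)$) by $$\widehat{\mathrm{H}_\phi f}(x)=\int_\Omega\widehat\phi(x+y)\widehat f(y)\,dy,\qquad x\in\Omega.$$ $\mathrm{H}_\phi$ belongs to $S^p(\mathrm{PW}(\Omega))$ if it extends to an operator on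 $\mathrm{PW}(\Omega)$ in the Schatten class $S^p$. It admits a bounded symbol if there is $\psi\in L^\infty(\mathbb{R}^n)$ with $\widehat\psi|_{2\Omega}=\widehat\phi|_{2\Omega}$ (equivalently $\mathrm{H}_\phi=\mathrm{H}_\psi$). Nehari's theorem holds for $\Omega$ for $p\in[1,\infty)$ if every Hankel operator in $S^p(\mathrm{PW}(\Omega))$ admits a bounded symbol; otherwise it fails for $p$. *)

(* Defs.v *)
From HB Require Import structures.
From mathcomp Require Import all_boot all_order all_algebra.
From mathcomp Require Import complex.
From mathcomp Require Import all_classical all_reals all_analysis.

Set Implicit Arguments.
Unset Strict Implicit.
Unset Printing Implicit Defensive.

Import Order.TTheory GRing.Theory Num.Theory.
Import numFieldNormedType.Exports.

Local Open Scope classical_set_scope.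
Local Open Scope ring_scope.
Local Open Scope complex_scope.

Fact rV_display : measure_display. Proof. exact: default_measure_display. Qed.

Section rV_measure.
Context {R : realType}.

Let coors n : 'I_n -> 'rV[R]_n -> measurableTypeR R := fun i x => x ord0 i.

Let rV_set0 n : g_sigma_preimage (@coors n) set0.
Proof. exact: sigma_algebra0. Qed.

Let rV_setC n A : g_sigma_preimage (@coors n) A ->
  g_sigma_preimage (@coors n) (~` A).
Proof. exact: sigma_algebraC. Qed.

Let rV_bigcup n (F : _^nat) : (forall i, g_sigma_preimage (@coors n) (F i)) ->
  g_sigma_preimage (@coors n) (\bigcup_i (F i)).
Proof. exact: sigma_algebra_bigcup. Qed.

HB.instance Definition _ n := @isMeasurable.Build rV_display 'rV[R]_n
  (g_sigma_preimage (@coors n)) (@rV_set0 n) (@rV_setC n) (@rV_bigcup n).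

Lemma measurable_coord n (i : 'I_n) :
  measurable_fun setT (fun x : 'rV[R]_n => x ord0 i : measurableTypeR R).
Proof.
move=> _ Y mY; rewrite setTI; apply: sub_sigma_algebra => /=.
rewrite -bigcup_seq/=; exists i => /=; first by rewrite mem_index_enum.
by exists Y => //; rewrite setTI.
Qed.

Lemma measurable_fun_rV d (T : measurableType d) n (f : T -> 'rV[R]_n) :
  (forall i, measurable_fun setT (fun t => f t ord0 i : measurableTypeR R)) ->
  measurable_fun setT f.
Proof.
move=> mf; suff gf : g_sigma_preimage (fun i => @coors n i \o f) `<=` measurable.
  move=> _ A mA; rewrite setTI; apply: gf; rewrite g_sigma_preimage_comp.
  by exists A => //; rewrite setTI.
apply: smallest_sub; first exact: sigma_algebra_measurable.
rewrite -bigcup_seq/=; apply: bigcup_sub => i _ A [B mB <-].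
exact: mf.
Qed.

Definition rV_cons n (p : measurableTypeR R * 'rV[R]_n) : 'rV[R]_n.+1 :=
  \row_(i < n.+1) if unlift ord0 i is Some j then p.2 ord0 j else p.1.

Definition rV_uncons n (x : 'rV[R]_n.+1) : measurableTypeR R * 'rV[R]_n :=
  (x ord0 ord0, \row_(j < n) x ord0 (lift ord0 j)).

Lemma rV_consK n : cancel (@rV_cons n) (@rV_uncons n).
Proof.
move=> [a x]; rewrite /rV_uncons /rV_cons mxE unlift_none; congr pair.
by apply/rowP => j; rewrite !mxE liftK.
Qed.

Lemma rV_unconsK n : cancel (@rV_uncons n) (@rV_cons n).
Proof.
move=> x; apply/rowP => i; rewrite mxE.
by case: unliftP => [j ->|->] //=; rewrite mxE.
Qed.

Lemma measurable_rV_cons n : measurable_fun setT (@rV_cons n).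
Proof.
apply: measurable_fun_rV => i.
under eq_fun do rewrite mxE.
case: (unlift ord0 i) => [j|]; last exact: measurable_fst.
exact: (measurableT_comp (@measurable_coord n j) measurable_snd).
Qed.

Lemma measurable_rV_uncons n : measurable_fun setT (@rV_uncons n).
Proof.
apply: measurable_fun_pair; first exact: measurable_coord.
apply: measurable_fun_rV => i; under eq_fun do rewrite mxE.
exact: measurable_coord.
Qed.

Section cons_measure.
Variables (n : nat) (mu : {sigma_finite_measure set 'rV[R]_n -> \bar R}).

Definition lebesgue_cons : set 'rV[R]_n.+1 -> \bar R :=
  pushforward (@lebesgue_measure R \x mu)%E (@rV_cons n).

Let lebesgue_cons0 : lebesgue_cons set0 = 0%E.
Proof. by rewrite /lebesgue_cons /pushforward preimage_set0 measure0. Qed.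

Let lebesgue_cons_ge0 A : (0 <= lebesgue_cons A)%E.
Proof. by rewrite /lebesgue_cons /pushforward measure_ge0. Qed.

Let lebesgue_cons_sigma_additive : semi_sigma_additive lebesgue_cons.
Proof.
have mc A : measurable A -> measurable (@rV_cons n @^-1` A).
  by move=> mA; rewrite -[X in measurable X]setTI; exact: measurable_rV_cons.
move=> F mF tF mUF; rewrite /lebesgue_cons /pushforward preimage_bigcup.
apply: measure_semi_sigma_additive.
- by move=> k; exact: mc.
- apply/trivIsetP => /= i j _ _ ij; rewrite -preimage_setI.
  by move/trivIsetP : tF => /(_ _ _ _ _ ij) ->//; rewrite preimage_set0.
- by rewrite -preimage_bigcup; exact: mc.
Qed.

HB.instance Definition _ := isMeasure.Build _ _ _ lebesgue_cons
  lebesgue_cons0 lebesgue_cons_ge0 lebesgue_cons_sigma_additive.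

Let lebesgue_cons_sigma_finite : sigma_finite setT lebesgue_cons.
Proof.
have /sigma_finiteP[F [FT ndF Foo]] := sigma_finiteT (@lebesgue_measure R).
have /sigma_finiteP[G [GT ndG Goo]] := sigma_finiteT mu.
exists (fun k => @rV_uncons n @^-1` (F k `*` G k)) => [|k].
  rewrite -preimage_bigcup (_ : \bigcup_k (F k `*` G k) = setT) ?preimage_setT//.
  rewrite -subTset => -[a x] _.
  have [i _ Fi] : (\bigcup_i F i) a by rewrite -FT.
  have [j _ Gj] : (\bigcup_i G i) x by rewrite -GT.
  exists (maxn i j) => //; split => /=.
    by apply: (subsetPset _ _ (ndF _ _ (leq_maxl i j))).
  by apply: (subsetPset _ _ (ndG _ _ (leq_maxr i j))).
have [mF ltF] := Foo k; have [mG ltG] := Goo k; split.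
  rewrite -[X in measurable X]setTI; apply: measurable_rV_uncons => //.
  exact: measurableX.
rewrite /lebesgue_cons /pushforward -comp_preimage.
have -> : @rV_uncons n \o @rV_cons n = id.
  by apply/funext => p; exact: rV_consK.
by rewrite preimage_id product_measure1E// lte_mul_pinfty// ge0_fin_numE.
Qed.

HB.instance Definition _ := Measure_isSigmaFinite.Build _ _ _ lebesgue_cons
  lebesgue_cons_sigma_finite.

End cons_measure.

Fixpoint lebesgue_rV n : {sigma_finite_measure set 'rV[R]_n -> \bar R} :=
  if n is n'.+1 then lebesgue_cons (lebesgue_rV n') else \d_ (0 : 'rV[R]_0).

Lemma lebesgue_rV_box n (A : 'I_n -> set (measurableTypeR R)) :
  (forall i, measurable (A i)) ->
  lebesgue_rV n [set x | forall i, A i (x ord0 i)] =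
  (\prod_(i < n) lebesgue_measure (A i))%E.
Proof.
elim: n A => [|n IHn] A mA.
  rewrite big_ord0 /= diracE mem_set//; by case.
rewrite big_ord_recl -IHn => [|i]; last exact: mA.
rewrite -[LHS]/(lebesgue_cons _ _) /lebesgue_cons /pushforward.
rewrite -product_measure1E//.
  congr (_ _); apply/seteqP; split => [[a x]/= Aax|[a x]/= [Aa Ax] i].
    split => [|i] /=; first by have := Aax ord0; rewrite mxE unlift_none.
    by have := Aax (lift ord0 i); rewrite mxE liftK.
  by rewrite mxE; case: unliftP => [j ->|->].
suff -> : (fun x : 'rV[R]_n => forall i, A (lift ord0 i) (x ord0 i)) =
    \bigcap_(i in [set: 'I_n])
      (fun x : 'rV[R]_n => x ord0 i : measurableTypeR R) @^-1` A (lift ord0 i).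
  apply: fin_bigcap_measurable => // i _.
  by rewrite -[X in measurable X]setTI; exact: measurable_coord.
by apply/seteqP; split => [x Ax i _|x Ax i]; [exact: Ax|exact: (Ax i I)].
Qed.

End rV_measure.

Section calculus.
Context {R : realType} {n : nat}.
Implicit Types (x y : 'rV[R]_n) (U : set 'rV[R]_n).

Definition dotr x y : R := \sum_(i < n) x ord0 i * y ord0 i.

(* The library norm on 'rV[R]_n is the sup norm. *)
Definition enorm x : R := Num.sqrt (dotr x x).

Definition eball x (r : R) : set 'rV[R]_n := [set y | enorm (y - x) < r].

Definition pderiv (l : seq 'I_n) (f : 'rV[R]_n -> R) : 'rV[R]_n -> R :=
  foldr (fun i (g : 'rV[R]_n -> R) => 'D_(delta_mx ord0 i) g) f l.

(* f of class C^k on the open set U *)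
Definition Ck_on (k : nat) U (f : 'rV[R]_n -> R) :=
  forall (l : seq 'I_n) x, U x -> (size l <= k)%N ->
    {for x, continuous (pderiv l f)} /\
    ((size l < k)%N ->
      forall i, derivable (pderiv l f) x (delta_mx ord0 i : 'rV[R]_n)).

Definition smooth (f : 'rV[R]_n -> R) := forall k, Ck_on k setT f.

Definition gradient (f : 'rV[R]_n -> R) x : 'rV[R]_n :=
  \row_(i < n) 'D_(delta_mx ord0 i) f x.

End calculus.

Section hypersurface.
Context {R : realType} {n : nat}.
Implicit Types (Omega M U : set 'rV[R]_n) (rho : 'rV[R]_n -> R).

Definition C2_defining_function M U rho :=
  [/\ open U, Ck_on 2 U rho, forall y, U y -> gradient rho y != 0 &
      M `&` U = [set y | U y /\ rho y = 0]].

Definition C2_hypersurface M := forall x, M x ->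
  exists U rho, U x /\ C2_defining_function M U rho.

Definition unit_normal rho (y : 'rV[R]_n) : 'rV[R]_n :=
  (enorm (gradient rho y))^-1 *: gradient rho y.

(* k is the determinant, in an orthonormal basis (the rows of T) of the
   tangent space at x, of the differential of the Gauss map of {rho = 0}.
   With the normal pointing towards {rho > 0}, the boundary of the unit ball
   {|x|^2 - 1 < 0} has curvature 1. *)
Definition gauss_curvature rho (x : 'rV[R]_n) (k : R) :=
  exists T : 'M[R]_(n.-1, n),
    [/\ T *m T^T = 1%:M, T *m (gradient rho x)^T = 0 &
        k = \det (T *m 'J (unit_normal rho) x *m T^T)].

Definition boundary Omega := closure Omega `\` Omega°.

(* Orienting the normal outwards from Omega fixes the sign of the curvature
   when n is even. *)
Definition positively_curved Omega M := forall x, M x ->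
  exists U rho, [/\ U x, C2_defining_function M U rho,
    (forall y, (Omega `&` U) y -> rho y <= 0) &
    exists2 k, gauss_curvature rho x k & 0 < k].

Definition curved_boundary_neighborhood Omega := exists c r,
  let M := boundary Omega `&` eball c r in
  [/\ 0 < r, M !=set0, C2_hypersurface M & positively_curved Omega M].

End hypersurface.

Section fourier.
Context {R : realType} {n : nat}.
Local Notation E := 'rV[R]_n.
Local Notation mu := (@lebesgue_rV R n).
Implicit Types (f g F : E -> R[i]) (U K : set E) (T : (E -> R[i]) -> R[i]).

Definition cabs (z : R[i]) : R := Normc.normc z.

Definition cintegral f : R[i] :=
  (\int[mu]_x complex.Re (f x)) +i* (\int[mu]_x complex.Im (f x)).

Definition Lp_norm (p : \bar R) f : \bar R :=
  Lnorm mu p (fun x => (cabs (f x))%:E).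

Definition Lp (p : \bar R) f :=
  [/\ measurable_fun setT (fun x => complex.Re (f x)),
      measurable_fun setT (fun x => complex.Im (f x)) &
      (Lp_norm p f < +oo)%E].

Definition ae_equal f g := {ae mu, forall x, f x = g x}.

Definition cpderiv (l : seq 'I_n) f x : R[i] :=
  pderiv l (fun y => complex.Re (f y)) x +i* pderiv l (fun y => complex.Im (f y)) x.

Definition csmooth f :=
  smooth (fun y => complex.Re (f y)) /\ smooth (fun y => complex.Im (f y)).

Definition vanishes_off K f := forall x, ~ K x -> f x = 0.

(* C_c^oo(U) *)
Definition test_function U f :=
  csmooth f /\ exists K, [/\ compact K, K `<=` U & vanishes_off K f].

Definition schwartz f := csmooth f /\
  forall (k : nat) (l : seq 'I_n), exists M : R,
    forall x, enorm x ^+ k * cabs (cpderiv l f x) <= M.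

(* Distributions on the open set U; only the values of T on C_c^oo(U) matter. *)
Definition distribution_on U T :=
  (forall (a : R[i]) f g, test_function U f -> test_function U g ->
     T (fun x => a * f x + g x) = a * T f + T g) /\
  (forall K, compact K -> K `<=` U -> exists (C : R) (N : nat),
     forall f (M : R), csmooth f -> vanishes_off K f ->
       (forall l x, (size l <= N)%N -> cabs (cpderiv l f x) <= M) ->
       cabs (T f) <= C * M).

Definition regular_distribution f : (E -> R[i]) -> R[i] :=
  fun g => cintegral (fun x => f x * g x).

Definition cis (t : R) : R[i] := cos t +i* sin t.

Definition fourier f (x : E) : R[i] :=
  cintegral (fun xi => f xi * cis (- (2 * pi * dotr x xi))).

Definition distribution_fourier T : (E -> R[i]) -> R[i] := fun g => T (fourier g).

(* F in L^2 is the Fourier transform of f, as tempered distributions. *)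
Definition L2_fourier f F := Lp 2%:E F /\
  forall g, schwartz g ->
    distribution_fourier (regular_distribution f) g = regular_distribution F g.

(* supp fhat `<=` U up to a null set: for U open this is what makes PW(U)
   closed in L^2. *)
Definition paley_wiener U : set (E -> R[i]) := [set f | Lp 2%:E f /\
  exists2 F, L2_fourier f F & {ae mu, forall x, ~ U x -> F x = 0}].

End fourier.

Section schatten.
Context {R : realType} {n : nat}.
Local Notation E := 'rV[R]_n.
Local Notation "'N2 f" := (Lp_norm 2%:E f) (at level 10, f at level 9).
Implicit Types (f g : E -> R[i]) (H : set (E -> R[i]))
  (A B : (E -> R[i]) -> E -> R[i]).

Definition L2_inner f g : R[i] := cintegral (fun x => f x * (g x)^*).

(* Elements of L^2 are represented by functions; operators act on
   representatives, and boundedness makes them respect a.e. equality. *)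
Definition bounded_operator H A :=
  [/\ forall f, H f -> H (A f),
      forall (a : R[i]) f g, H f -> H g ->
        ae_equal (A (fun x => a * f x + g x)) (fun x => a * A f x + A g x) &
      exists C : R, forall f, H f -> ('N2 (A f) <= C%:E * 'N2 f)%E].

Definition compact_operator H A :=
  forall (u : nat -> E -> R[i]) (M : R),
    (forall k, H (u k)) -> (forall k, 'N2 (u k) <= M%:E)%E ->
    exists (s : nat -> nat) (g : E -> R[i]),
      [/\ forall k, (s k < s k.+1)%N, H g &
          (fun k => 'N2 (fun x => A (u (s k)) x - g x)) @ \oo --> 0%E].

Definition adjoint_operator H A B := bounded_operator H B /\
  forall f g, H f -> H g -> L2_inner (A f) g = L2_inner f (B g).

(* The supremum over orthonormal families of eigenvectors of A^*A is the sum
   of the p-th powers of the singular values (square roots of the eigenvalues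
   of A^*A), counted with multiplicity. *)
Definition schatten_class (p : R) H A :=
  [/\ bounded_operator H A, compact_operator H A &
  exists2 B, adjoint_operator H A B &
  exists C : R, forall (m : nat) (e : 'I_m -> E -> R[i]) (s : 'I_m -> R),
    (forall i, H (e i)) ->
    (forall i j, L2_inner (e i) (e j) = (i == j)%:R) ->
    (forall i, 0 <= s i /\
       ae_equal (B (A (e i))) (fun x => ((s i) ^+ 2)%:C * e i x)) ->
    \sum_(i < m) s i `^ p <= C].

End schatten.

Section hankel.
Context {R : realType} {n : nat}.
Local Notation E := 'rV[R]_n.
Local Notation mu := (@lebesgue_rV R n).
Implicit Types (Omega : set E) (phihat : (E -> R[i]) -> R[i]).

(* In this section Omega is meant to be open; a convex set is replaced by its
   interior, from which it differs by a Lebesgue null set. *)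

Definition dilate2 Omega : set E := [set 2 *: x | x in Omega].

(* \int_Omega phihat(x + y) F(y) dy, that is, phihat paired with z |-> F (z - x) *)
Definition hankel_kernel phihat (F : E -> R[i]) (x : E) : R[i] :=
  phihat (fun z => F (z - x)).

(* A extends the Hankel operator with symbol phi from its dense domain
   {f in PW(Omega) | fhat in C_c^oo(Omega)}. *)
Definition hankel_extension Omega phihat (A : (E -> R[i]) -> E -> R[i]) :=
  forall f F, paley_wiener Omega f -> L2_fourier f F -> test_function Omega F ->
  exists2 G, L2_fourier (A f) G &
    {ae mu, forall x, Omega x -> G x = hankel_kernel phihat F x}.

Definition hankel_in_schatten (p : R) Omega phihat := exists2 A,
  schatten_class p (paley_wiener Omega) A & hankel_extension Omega phihat A.

Definition admits_bounded_symbol Omega phihat := exists2 psi : E -> R[i],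
  Lp +oo%E psi &
  forall g, test_function (dilate2 Omega) g ->
    distribution_fourier (regular_distribution psi) g = phihat g.

End hankel.

(* Main.v *)
Require Import Defs.
From HB Require Import structures.
From mathcomp Require Import all_boot all_order all_algebra.
From mathcomp Require Import complex.
From mathcomp Require Import all_classical all_reals all_analysis.
From mathcomp Require Import measurable_realfun.
From mathcomp Require Import ring lra zify.

Set Implicit Arguments.
Unset Strict Implicit.
Unset Printing Implicit Defensive.

Import Order.TTheory GRing.Theory Num.Theory.
Import numFieldNormedType.Exports.

Local Open Scope classical_set_scope.
Local Open Scope ring_scope.
Local Open Scope complex_scope.

(** Nehari's theorem fails for p > 4 near a curved piece of the boundary because there is
   room for many independent symbols that each look like a bump at the boundary of the
   dilate of Omega.

   Take a ball of radius of order s^2 at distance of order s^2 from a boundary point 2 p of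
   the dilate, and a symbol supported in that ball. Its Hankel kernel phi (x + y) lives on
   pairs of points of Omega with sum in the ball. Since the surface is strictly convex, such
   points lie in a lens at p, of width of order s and thickness of order s^2
   (surface_lenses), and bumps at boundary points separated by much more than s have
   disjoint lenses. The operator is therefore block diagonal, and its Schatten norms are
   computed block by block: the Schur test bounds the norm of a block by the mass d of the
   bump, and the supremum of the bump with the volume of the lens bounds its
   Hilbert-Schmidt norm (symbol_hankel_schatten, from eigen_block, bessel_block and
   schatten_sum). With m = n - 1, a block of width s costs at most d^p s^(-m) in the p-th
   power of the Schatten norm, and about s^(-m) disjoint lenses fit along the boundary: for
   N of them the total is about d^p N^2.

   Against this, test the symbol on the sum g of N bumps with signs. Their Fourier
   transforms have the same modulus and differ by unimodular factors, so that suitable signs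
   give square root cancellation: the L^1 norm of the transform of g is at most a constant
   times sqrt N (signs_fourier). A bounded symbol would thus pair with g by at most C sqrt N,
   whereas the actual pairing is d N up to a constant, so that d sqrt N has to stay bounded
   (symbol_unbounded). With d = 2^k / sqrt N this fails as k grows, and
   d^p N^2 = 2^(k p) N^(2 - p/2) is summable over the levels k as soon as p > 4 and N grows
   fast enough with k. To place all levels side by side along the boundary, level k gets a
   region of size 2^(-k), which only costs another factor 2^(k m)
   (lens_family_counterexample).

   The strict convexity comes from the sign of the Hessian on tangent vectors, which is
   nonnegative by convexity (hess_psd) and nondegenerate because its determinant is the
   curvature up to a positive factor (jacobian_unit_normal, psd_det_pd).

   The operator acts on functions f whose transform in L^2 is only given weakly, by testing
   against Schwartz functions. To move it to the Fourier side one needs Plancherel's theorem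
   for such f (weak_ip), which is obtained from the isometry on integrable
   square-integrable functions (plancherel). The latter is proved for indicators of
   intervals, where the inner products of transforms follow from translation and dilation
   invariance up to one constant, for products of these by Fubini's theorem, and then by
   approximation. *)

(** * The complex modulus *)

Notation cRe := complex.Re.
Notation cIm := complex.Im.

Section complex_modulus.
Context {R : realType}.
Implicit Types z w : R[i].

Definition cj z : R[i] := z^*.

Lemma cReD z w : cRe (z + w) = cRe z + cRe w. Proof. by case: z w => [? ?] [? ?]. Qed.
Lemma cImD z w : cIm (z + w) = cIm z + cIm w. Proof. by case: z w => [? ?] [? ?]. Qed.
Lemma cReN z : cRe (- z) = - cRe z. Proof. by case: z. Qed.
Lemma cImN z : cIm (- z) = - cIm z. Proof. by case: z. Qed.
Lemma cReM z w : cRe (z * w) = cRe z * cRe w - cIm z * cIm w.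
Proof. by case: z w => [? ?] [? ?]. Qed.
Lemma cImM z w : cIm (z * w) = cRe z * cIm w + cIm z * cRe w.
Proof. by case: z w => [? ?] [? ?]. Qed.
Lemma cReJ z : cRe (cj z) = cRe z. Proof. by case: z. Qed.
Lemma cImJ z : cIm (cj z) = - cIm z. Proof. by case: z. Qed.
Definition cE := (cReD, cImD, cReN, cImN, cReM, cImM, cReJ, cImJ).

Lemma ceqP z w : cRe z = cRe w -> cIm z = cIm w -> z = w.
Proof. by case: z w => [? ?] [? ?] /= -> ->. Qed.

Lemma cJM z w : cj (z * w) = cj z * cj w.
Proof. by apply: ceqP; rewrite !cE; ring. Qed.
Lemma cJD z w : cj (z + w) = cj z + cj w.
Proof. by apply: ceqP; rewrite !cE; ring. Qed.
Lemma cJN z : cj (- z) = - cj z.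
Proof. by apply: ceqP; rewrite !cE; ring. Qed.
Lemma cJK z : cj (cj z) = z.
Proof. by apply: ceqP; rewrite !cE ?opprK. Qed.
Lemma cJR (r : R) : cj (r%:C) = r%:C.
Proof. by apply: ceqP => /=; rewrite ?oppr0. Qed.
Lemma cabsE z : cabs z = Num.sqrt (cRe z ^+ 2 + cIm z ^+ 2).
Proof. by case: z. Qed.

Lemma cabs_sqr z : cabs z ^+ 2 = cRe z ^+ 2 + cIm z ^+ 2.
Proof. by rewrite cabsE sqr_sqrtr// addr_ge0// sqr_ge0. Qed.

Lemma cabs_ge0 z : 0 <= cabs z. Proof. by rewrite cabsE sqrtr_ge0. Qed.

Lemma cabs0 : cabs (0 : R[i]) = 0. Proof. exact: Normc.normc0. Qed.
Lemma cabs1 : cabs (1 : R[i]) = 1. Proof. exact: Normc.normc1. Qed.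
Lemma cabs_eq0 z : cabs z = 0 -> z = 0. Proof. exact: Normc.eq0_normc. Qed.
Lemma cabsM z w : cabs (z * w) = cabs z * cabs w. Proof. exact: Normc.normcM. Qed.
Lemma cabsD z w : cabs (z + w) <= cabs z + cabs w.
Proof. exact: le_normcD. Qed.
Lemma cabsN z : cabs (- z) = cabs z. Proof. exact: normcN. Qed.
Lemma cabsB z w : cabs (z - w) = cabs (w - z).
Proof. by rewrite -cabsN opprB. Qed.
Lemma cabsJ z : cabs (cj z) = cabs z.
Proof. by rewrite !cabsE !cE sqrrN. Qed.
Lemma cabsR (r : R) : cabs r%:C = `|r|.
Proof. by rewrite cabsE /= expr0n /= addr0 sqrtr_sqr. Qed.

Lemma cRe_le_cabs z : `|cRe z| <= cabs z.
Proof.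
rewrite -[leLHS]sqrtr_sqr cabsE ler_wsqrtr// lerDl sqr_ge0//.
Qed.
Lemma cIm_le_cabs z : `|cIm z| <= cabs z.
Proof.
rewrite -[leLHS]sqrtr_sqr cabsE ler_wsqrtr// lerDr sqr_ge0//.
Qed.
Lemma cabs_le_ReIm z : cabs z <= `|cRe z| + `|cIm z|.
Proof.
rewrite -[leRHS]ger0_norm ?addr_ge0// -sqrtr_sqr cabsE ler_wsqrtr//.
rewrite sqrrD !real_normK ?num_real// addrAC lerDl.
by rewrite mulrn_wge0// mulr_ge0.
Qed.

Lemma mulcJ z : z * cj z = (cabs z ^+ 2)%:C.
Proof. by apply: ceqP; rewrite !cE /= ?cabs_sqr; ring. Qed.

Lemma cis_cabs (t : R) : cabs (cis t) = 1.
Proof. by rewrite cabsE /= cos2Dsin2 sqrtr1. Qed.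
Lemma cisD (s t : R) : cis (s + t) = cis s * cis t.
Proof. by apply: ceqP; rewrite !cE /= ?cosD ?sinD; ring. Qed.
Lemma cis0 : cis (0 : R) = 1.
Proof. by rewrite /cis cos0 sin0. Qed.
Lemma cisN (t : R) : cis (- t) = cj (cis t).
Proof. by rewrite /cis cosN sinN. Qed.

Lemma rotation z : exists2 u, cabs u = 1 & u * z = (cabs z)%:C.
Proof.
have [z0|z0] := eqVneq (cabs z) 0.
  by exists 1; rewrite ?cabs1// mul1r z0 (cabs_eq0 z0).
exists ((cabs z)^-1%:C * cj z).
  by rewrite cabsM cabsR cabsJ ger0_norm ?invr_ge0 ?cabs_ge0// mulVf.
rewrite -mulrA [cj z * z]mulrC mulcJ.
apply: ceqP; rewrite !cE/=; last by ring.
by rewrite !mul0r subr0 expr2 mulrA mulVf// mul1r.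
Qed.

End complex_modulus.

(** * Integration of complex functions *)

Section real_integration.
Context d (T : measurableType d) (R : realType) (mu : {measure set T -> \bar R}).
Implicit Types f g : T -> R.

Definition rI f := mu.-integrable setT (EFin \o f).

Lemma rI_meas f : rI f -> measurable_fun setT f.
Proof. by move=> /integrableP[/measurable_EFinP]. Qed.

Lemma rI_le f g : rI f -> measurable_fun setT g -> (forall x, `|g x| <= f x) -> rI g.
Proof.
move=> If mg gf; apply: le_integrable If => //; first exact/measurable_EFinP.
by move=> x _ /=; rewrite lee_fin (le_trans (gf x))// ler_norm.
Qed.

Lemma rI_ltoo f : measurable_fun setT f -> (forall x, 0 <= f x) ->
  (\int[mu]_x (f x)%:E < +oo)%E -> rI f.
Proof.
move=> mf f0 foo; apply/integrableP; split; first exact/measurable_EFinP.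
by under eq_integral => x _ do rewrite /= ger0_norm//.
Qed.

Lemma rI_EFin f : rI f -> (\int[mu]_x f x)%:E = (\int[mu]_x (f x)%:E)%E.
Proof. by move=> If; rewrite fineK//; apply: integrable_fin_num. Qed.

Lemma rI_lt_oo f : rI f -> (\int[mu]_x (f x)%:E < +oo)%E.
Proof. by move=> /rI_EFin <-; rewrite ltry. Qed.

Lemma rI0 : rI (fun=> 0). Proof. exact: integrable0. Qed.

Lemma rID f g : rI f -> rI g -> rI (fun x => f x + g x).
Proof. by move=> If Ig; have := @integrableD _ _ _ mu setT _ _ _ If Ig; exact. Qed.

Lemma rIZ (a : R) f : rI f -> rI (fun x => a * f x).
Proof. by move=> If; have := @integrableZl _ _ _ mu setT _ a _ If; exact. Qed.

Lemma rI_norm f : rI f -> rI (fun x => `|f x|).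
Proof. by move=> If; have := integrable_norm If; exact. Qed.

Lemma rI_sum (I : Type) (s : seq I) (P : pred I) (F : I -> T -> R) :
  (forall i, P i -> rI (F i)) -> rI (fun x => \sum_(i <- s | P i) F i x).
Proof.
move=> IF; elim: s => [|i s IHs].
  by under eq_fun do rewrite big_nil; exact: rI0.
have [Pi|/negbTE nPi] := boolP (P i); last by under eq_fun do rewrite big_cons nPi.
by under eq_fun do rewrite big_cons Pi; apply: rID => //; exact: IF.
Qed.

Lemma rintD f g : rI f -> rI g ->
  \int[mu]_x (f x + g x) = \int[mu]_x f x + \int[mu]_x g x.
Proof. by move=> If Ig; rewrite RintegralD. Qed.

Lemma rintB f g : rI f -> rI g ->
  \int[mu]_x (f x - g x) = \int[mu]_x f x - \int[mu]_x g x.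
Proof. by move=> If Ig; rewrite RintegralB. Qed.

Lemma rintZ (a : R) f : rI f -> \int[mu]_x (a * f x) = a * \int[mu]_x f x.
Proof. by move=> If; rewrite RintegralZl. Qed.

Lemma rint0 : \int[mu]_x (0 : R) = 0.
Proof. by rewrite /Rintegral integral0. Qed.

Lemma rintN f : rI f -> \int[mu]_x (- f x) = - \int[mu]_x f x.
Proof.
by move=> If; under eq_Rintegral do rewrite -mulN1r; rewrite rintZ// mulN1r.
Qed.

Lemma rint_sum (I : Type) (s : seq I) (P : pred I) (F : I -> T -> R) :
  (forall i, P i -> rI (F i)) ->
  \int[mu]_x (\sum_(i <- s | P i) F i x) = \sum_(i <- s | P i) \int[mu]_x F i x.
Proof.
move=> IF; elim: s => [|i s IHs].
  by under eq_Rintegral do rewrite big_nil; rewrite rint0 big_nil.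
rewrite big_cons; have [Pi|/negbTE nPi] := boolP (P i).
  2: by under eq_Rintegral do rewrite big_cons nPi.
under eq_Rintegral do rewrite big_cons Pi.
by rewrite rintD ?IHs//; [exact: IF|exact: rI_sum].
Qed.

Lemma rint_le f g : rI f -> rI g -> (forall x, f x <= g x) ->
  \int[mu]_x f x <= \int[mu]_x g x.
Proof. by move=> If Ig fg; apply: le_Rintegral. Qed.

Lemma rint_ge0 f : (forall x, 0 <= f x) -> 0 <= \int[mu]_x f x.
Proof. by move=> f0; apply: Rintegral_ge0. Qed.

Lemma rint_norm f : rI f -> `|\int[mu]_x f x| <= \int[mu]_x `|f x|.
Proof. by move=> If; apply: le_normr_Rintegral. Qed.

Lemma rint_ae f g : measurable_fun setT f -> measurable_fun setT g ->
  {ae mu, forall x, f x = g x} -> \int[mu]_x f x = \int[mu]_x g x.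
Proof.
move=> mf mg fg; congr fine; apply: ae_eq_integral => //.
- exact/measurable_EFinP.
- exact/measurable_EFinP.
- by apply: filterS fg => x /= -> _.
Qed.

Lemma rint_eq0_ae f : rI f -> (forall x, 0 <= f x) -> \int[mu]_x f x = 0 ->
  {ae mu, forall x, f x = 0}.
Proof.
move=> If f0 e; have : (\int[mu]_x `|(f x)%:E| = 0)%E.
  under eq_integral => x _ do rewrite gee0_abs ?lee_fin//.
  by rewrite -rI_EFin// e.
have mf : measurable_fun setT (EFin \o f) by apply/measurable_EFinP; exact: rI_meas.
move/(ae_eq_integral_abs mu measurableT mf).
by apply: filterS => x /= /(_ I) [].
Qed.

Lemma rint_dct (F : nat -> T -> R) f g :
  (forall m, measurable_fun setT (F m)) -> measurable_fun setT f -> rI g ->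
  (forall x, F^~ x @ \oo --> f x) -> (forall m x, `|F m x| <= g x) ->
  [/\ rI f, \int[mu]_x `|F m x - f x| @[m --> \oo] --> 0 &
      \int[mu]_x F m x @[m --> \oo] --> \int[mu]_x f x].
Proof.
move=> mF mf Ig Ff Fg.
have IF m : rI (F m) by apply: rI_le (Fg m).
have [||||If h1 h2] := @dominated_convergence _ _ _ mu setT measurableT
    (fun m => EFin \o F m) (EFin \o f) (EFin \o g) _ _ _ Ig _.
- by move=> m; apply/measurable_EFinP.
- exact/measurable_EFinP.
- by apply: aeW => x _; apply: cvg_EFin (Ff x); exact: nearW.
- by apply: aeW => x m _; rewrite /= lee_fin.
split => //.
- exact: (fine_cvg h1).
- have : (\int[mu]_x (f x)%:E)%E = (\int[mu]_x f x)%:E by rewrite rI_EFin.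
  by move=> e; apply: fine_cvg; rewrite /= -e; exact: h2.
Qed.

End real_integration.

Section complex_integration.
Context d (T : measurableType d) (R : realType).
Implicit Types f g : T -> R[i].

Definition cmeas f :=
  measurable_fun setT (fun x => cRe (f x)) /\ measurable_fun setT (fun x => cIm (f x)).

Lemma cmeas_cst (a : R[i]) : cmeas (fun=> a).
Proof. by split; exact: measurable_cst. Qed.

Lemma cmeasD f g : cmeas f -> cmeas g -> cmeas (fun x => f x + g x).
Proof.
move=> [rf i_f] [rg ig]; split.
  by under eq_fun do rewrite cE; exact: measurable_funD.
by under eq_fun do rewrite cE; exact: measurable_funD.
Qed.

Lemma cmeasM f g : cmeas f -> cmeas g -> cmeas (fun x => f x * g x).
Proof.
move=> [rf i_f] [rg ig]; split; under eq_fun do rewrite cE.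
  by apply: measurable_funB; exact: measurable_funM.
by apply: measurable_funD; exact: measurable_funM.
Qed.

Lemma cmeasJ f : cmeas f -> cmeas (fun x => cj (f x)).
Proof.
move=> [rf i_f]; split; under eq_fun do rewrite cE; first exact: rf.
exact: measurable_funN.
Qed.

Lemma cmeasR (f : T -> R) : measurable_fun setT f -> cmeas (fun x => (f x)%:C).
Proof. by move=> mf; split => //=; exact: measurable_cst. Qed.

Lemma cmeasN f : cmeas f -> cmeas (fun x => - f x).
Proof.
by move=> [rf i_f]; split; under eq_fun do rewrite cE; exact: measurable_funN.
Qed.

Lemma cmeasB f g : cmeas f -> cmeas g -> cmeas (fun x => f x - g x).
Proof. by move=> mf mg; apply: cmeasD => //; exact: cmeasN. Qed.

Lemma cmeas_sqr f : cmeas f -> measurable_fun setT (fun x => cabs (f x) ^+ 2).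
Proof.
move=> [rf i_f]; under eq_fun do rewrite cabs_sqr.
by apply: measurable_funD; exact: measurable_funX.
Qed.

Lemma cmeas_cabs f : cmeas f -> measurable_fun setT (fun x => cabs (f x)).
Proof.
move=> [rf i_f]; under eq_fun do rewrite cabsE.
apply: (@measurableT_comp _ _ _ _ _ _ (@Num.sqrt R)).
  by apply: continuous_measurable_fun; exact: sqrt_continuous.
by apply: measurable_funD; exact: measurable_funX.
Qed.

Lemma cmeas_comp d' (T' : measurableType d') (h : T' -> T) f :
  measurable_fun setT h -> cmeas f ->
  measurable_fun setT (fun x => cRe (f (h x))) /\
  measurable_fun setT (fun x => cIm (f (h x))).
Proof.
move=> mh [rf i_f]; split.
  exact: (measurableT_comp rf mh).
exact: (measurableT_comp i_f mh).
Qed.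

Variable mu : {measure set T -> \bar R}.

Definition ci f : R[i] := (\int[mu]_x cRe (f x)) +i* (\int[mu]_x cIm (f x)).

Definition cI f := cmeas f /\ rI mu (fun x => cabs (f x)).

Lemma cI_le f (g : T -> R) : rI mu g -> cmeas f -> (forall x, cabs (f x) <= g x) -> cI f.
Proof.
move=> Ig mf fg; split => //; apply: (rI_le Ig); first exact: cmeas_cabs.
by move=> x; rewrite ger0_norm ?cabs_ge0.
Qed.

Lemma cI_Re f : cI f -> rI mu (fun x => cRe (f x)).
Proof. by move=> [[mr mi] If]; apply: (rI_le If) => // x; exact: cRe_le_cabs. Qed.

Lemma cI_Im f : cI f -> rI mu (fun x => cIm (f x)).
Proof. by move=> [[mr mi] If]; apply: (rI_le If) => // x; exact: cIm_le_cabs. Qed.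

Lemma cI_ReIm f : rI mu (fun x => cRe (f x)) -> rI mu (fun x => cIm (f x)) -> cI f.
Proof.
move=> Ir Ii.
apply: (cI_le (rID (rI_norm Ir) (rI_norm Ii))).
  by split; [exact: rI_meas Ir|exact: rI_meas Ii].
by move=> x; exact: cabs_le_ReIm.
Qed.

Lemma cI0 : cI (fun=> 0).
Proof. by split; [exact: cmeas_cst|rewrite cabs0; exact: rI0]. Qed.

Lemma cID f g : cI f -> cI g -> cI (fun x => f x + g x).
Proof.
move=> [mf If] [mg Ig]; apply: (cI_le (rID If Ig)) => [|x]; first exact: cmeasD.
exact: cabsD.
Qed.

Lemma cIZ (a : R[i]) f : cI f -> cI (fun x => a * f x).
Proof.
move=> [mf If]; apply: (cI_le (rIZ (cabs a) If)) => [|x]; last by rewrite cabsM.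
by apply: cmeasM => //; exact: cmeas_cst.
Qed.

Lemma cIN f : cI f -> cI (fun x => - f x).
Proof.
move=> [mf If]; split; first exact: cmeasN.
by under eq_fun do rewrite cabsN.
Qed.

Lemma cIB f g : cI f -> cI g -> cI (fun x => f x - g x).
Proof. by move=> If Ig; apply: cID => //; exact: cIN. Qed.

Lemma cIJ f : cI f -> cI (fun x => cj (f x)).
Proof.
move=> [mf If]; split; first exact: cmeasJ.
by under eq_fun do rewrite cabsJ.
Qed.

Lemma cI_lin (a : R[i]) f g : cI f -> cI g -> cI (fun x => a * f x + g x).
Proof. by move=> If Ig; apply: cID => //; exact: cIZ. Qed.

Lemma cIR (f : T -> R) : rI mu f -> cI (fun x => (f x)%:C).
Proof.
move=> If; split; first exact: cmeasR (rI_meas If).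
by under eq_fun do rewrite cabsR; exact: rI_norm.
Qed.

Lemma cI_sum (I : Type) (s : seq I) (P : pred I) (F : I -> T -> R[i]) :
  (forall i, P i -> cI (F i)) -> cI (fun x => \sum_(i <- s | P i) F i x).
Proof.
move=> IF; elim: s => [|i s IHs].
  by under eq_fun do rewrite big_nil; exact: cI0.
have [Pi|/negbTE nPi] := boolP (P i); last by under eq_fun do rewrite big_cons nPi.
by under eq_fun do rewrite big_cons Pi; apply: cID => //; exact: IF.
Qed.

Lemma ciD f g : cI f -> cI g -> ci (fun x => f x + g x) = ci f + ci g.
Proof.
move=> If Ig; apply: ceqP; rewrite !cE /=.
  by under eq_Rintegral do rewrite cE; rewrite rintD//; exact: cI_Re.
by under eq_Rintegral do rewrite cE; rewrite rintD//; exact: cI_Im.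
Qed.

Lemma ciZ (a : R[i]) f : cI f -> ci (fun x => a * f x) = a * ci f.
Proof.
move=> If; have Ir := cI_Re If; have Ii := cI_Im If.
apply: ceqP; rewrite !cE /=; under eq_Rintegral do rewrite cE.
  by rewrite rintB ?rintZ//; exact: rIZ.
by rewrite rintD ?rintZ//; exact: rIZ.
Qed.

Lemma ci_lin (a : R[i]) f g : cI f -> cI g ->
  ci (fun x => a * f x + g x) = a * ci f + ci g.
Proof. by move=> If Ig; rewrite ciD ?ciZ//; exact: cIZ. Qed.

Lemma ciN f : cI f -> ci (fun x => - f x) = - ci f.
Proof.
by move=> If; rewrite -mulN1r -ciZ//; congr ci; apply/funext => x; rewrite mulN1r.
Qed.

Lemma ciB f g : cI f -> cI g -> ci (fun x => f x - g x) = ci f - ci g.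
Proof. by move=> If Ig; rewrite ciD ?ciN//; exact: cIN. Qed.

Lemma ci_sum (I : Type) (s : seq I) (P : pred I) (F : I -> T -> R[i]) :
  (forall i, P i -> cI (F i)) ->
  ci (fun x => \sum_(i <- s | P i) F i x) = \sum_(i <- s | P i) ci (F i).
Proof.
move=> IF; elim: s => [|i s IHs].
  under eq_fun do rewrite big_nil; rewrite big_nil.
  by apply: ceqP; rewrite /= rint0.
rewrite big_cons; have [Pi|/negbTE nPi] := boolP (P i).
  2: by under eq_fun do rewrite big_cons nPi.
under eq_fun do rewrite big_cons Pi.
by rewrite ciD ?IHs//; [exact: IF|exact: cI_sum].
Qed.

Lemma ciJ f : cI f -> ci (fun x => cj (f x)) = cj (ci f).
Proof.
move=> If; apply: ceqP; rewrite cE /=; under eq_Rintegral do rewrite cE; first by [].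
by rewrite rintN//; exact: cI_Im.
Qed.

Lemma ciR (f : T -> R) : ci (fun x => (f x)%:C) = (\int[mu]_x f x)%:C.
Proof. by apply: ceqP => //=; rewrite rint0. Qed.

Lemma ci0 : ci (fun=> 0) = 0.
Proof. by apply: ceqP => /=; rewrite rint0. Qed.

Lemma eq_ci f g : (forall x, f x = g x) -> ci f = ci g.
Proof. by move=> fg; congr ci; apply/funext. Qed.

Lemma ci_ae f g : cmeas f -> cmeas g -> {ae mu, forall x, f x = g x} -> ci f = ci g.
Proof.
move=> [rf i_f] [rg ig] fg; apply: ceqP => /=; apply: rint_ae => //.
  by apply: filterS fg => x ->.
by apply: filterS fg => x ->.
Qed.

(** After multiplication by a unimodular constant the integral is nonnegative, hence equal
   to the integral of a real part. *)
Lemma cabs_ci f : cI f -> cabs (ci f) <= \int[mu]_x cabs (f x).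
Proof.
move=> If; have [u u1 ue] := rotation (ci f).
rewrite -[leLHS]/(cRe (cabs (ci f))%:C) -ue -ciZ//=.
apply: rint_le => [||x]; first exact: cI_Re (cIZ u If); first by case: If.
by rewrite (le_trans (ler_norm _))// (le_trans (cRe_le_cabs _))// cabsM u1 mul1r.
Qed.

End complex_integration.

(** * Square-integrable complex functions *)

Section sequence_limits.
Context {R : realType}.
Implicit Types (u : nat -> R) (l b : R).

Lemma seq_le u l b : u @ \oo --> l -> (forall m, u m <= b) -> l <= b.
Proof. by move=> h ub; apply: (cvgr_to_le h); exact: nearW. Qed.

Lemma seq_ge u l b : u @ \oo --> l -> (forall m, b <= u m) -> b <= l.
Proof. by move=> h ub; apply: (cvgr_to_ge h); exact: nearW. Qed.

Lemma seq_sqrt u l : u @ \oo --> l -> (fun m => Num.sqrt (u m)) @ \oo --> Num.sqrt l.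
Proof. by move=> ul; apply: (continuous_cvg _ (@sqrt_continuous R l)). Qed.

Lemma seq_mul0 u (a : R) : u @ \oo --> (0 : R) -> (fun m => a * u m) @ \oo --> (0 : R).
Proof.
move=> u0; rewrite -[X in _ --> X](mulr0 a).
by apply: cvgM => //; exact: cvg_cst.
Qed.

Lemma seq_add0 u (v : nat -> R) : u @ \oo --> (0 : R) -> v @ \oo --> (0 : R) ->
  (fun m => u m + v m) @ \oo --> (0 : R).
Proof. by move=> u0 v0; rewrite -[X in _ --> X](addr0 0); exact: cvgD. Qed.

Lemma seq_squeeze0 u (v : nat -> R) : (forall m, 0 <= u m <= v m) ->
  v @ \oo --> (0 : R) -> u @ \oo --> (0 : R).
Proof. by move=> uv v0; apply: (squeeze_cvgr _ (cvg_cst 0) v0); exact: nearW. Qed.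

End sequence_limits.

Section ctend.
Context {R : realType}.
Implicit Types (u v : nat -> R[i]) (l : R[i]).

(** Complex limits are expressed by the modulus, so that only real limits are needed. *)
Definition ctend u l := (fun m => cabs (u m - l)) @ \oo --> (0 : R).

Lemma ctend_le u l (e : nat -> R) : e @ \oo --> (0 : R) ->
  (forall m, cabs (u m - l) <= e m) -> ctend u l.
Proof.
move=> e0 ue; apply: (squeeze_cvgr _ (cvg_cst 0) e0).
by apply: nearW => m; rewrite cabs_ge0 ue.
Qed.

Lemma ctend_cst l : ctend (fun=> l) l.
Proof. by apply: (ctend_le (cvg_cst 0)) => m; rewrite subrr cabs0. Qed.

Lemma ctend_uniq u l l' : ctend u l -> ctend u l' -> l = l'.
Proof.
move=> ul ul'; apply/eqP; rewrite -subr_eq0; apply/eqP/cabs_eq0.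
apply/eqP; rewrite eq_le cabs_ge0 andbT.
apply: (seq_ge (seq_add0 ul ul')) => m.
by rewrite [cabs (u m - l)]cabsB (le_trans _ (cabsD _ _))// addrA subrK.
Qed.

Lemma ctendD u v l l' : ctend u l -> ctend v l' -> ctend (fun m => u m + v m) (l + l').
Proof.
move=> ul vl.
have h : (fun m => cabs (u m - l) + cabs (v m - l')) @ \oo --> (0 + 0 : R).
  exact: cvgD.
rewrite addr0 in h; apply: (ctend_le h) => m.
by rewrite opprD addrACA cabsD.
Qed.

Lemma ctend_Re u l : ctend u l -> (fun m => cRe (u m)) @ \oo --> cRe l.
Proof.
move=> ul; apply/subr_cvg0/norm_cvg0P.
apply: (squeeze_cvgr _ (cvg_cst 0) ul); apply: nearW => m /=.
by rewrite normr_ge0/= (le_trans _ (cRe_le_cabs _))// !cE.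
Qed.

Lemma ctend_Im u l : ctend u l -> (fun m => cIm (u m)) @ \oo --> cIm l.
Proof.
move=> ul; apply/subr_cvg0/norm_cvg0P.
apply: (squeeze_cvgr _ (cvg_cst 0) ul); apply: nearW => m /=.
by rewrite normr_ge0/= (le_trans _ (cIm_le_cabs _))// !cE.
Qed.

Lemma ctend_cabs u l : ctend u l -> (fun m => cabs (u m)) @ \oo --> cabs l.
Proof.
move=> ul; apply/subr_cvg0/norm_cvg0P.
apply: (squeeze_cvgr _ (cvg_cst 0) ul); apply: nearW => m /=.
rewrite normr_ge0/= ler_norml; apply/andP; split.
  by rewrite lerNl opprB lerBlDl cabsB (le_trans _ (cabsD _ _))// addrC subrK.
by rewrite lerBlDr (le_trans _ (cabsD _ _))// subrK.
Qed.

End ctend.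

Section L2.
Context d (T : measurableType d) (R : realType) (mu : {measure set T -> \bar R}).
Implicit Types f g h : T -> R[i].

Definition L2 f := cmeas f /\ rI mu (fun x => cabs (f x) ^+ 2).
Definition nr f : R := \int[mu]_x cabs (f x) ^+ 2.
Definition ip f g : R[i] := ci mu (fun x => f x * cj (g x)).

Lemma nr_ge0 f : 0 <= nr f.
Proof. by apply: rint_ge0 => x; rewrite sqr_ge0. Qed.

Lemma L2_le f (g : T -> R) : rI mu g -> cmeas f ->
  (forall x, cabs (f x) ^+ 2 <= g x) -> L2 f.
Proof.
move=> Ig mf fg; split => //; apply: (rI_le Ig); first exact: cmeas_sqr.
by move=> x; rewrite ger0_norm ?sqr_ge0.
Qed.

Lemma L2_cI f g : L2 f -> L2 g -> cI mu (fun x => f x * g x).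
Proof.
move=> [mf If] [mg Ig]; apply: (cI_le (rID If Ig)); first exact: cmeasM.
move=> x; rewrite cabsM.
have := sqr_ge0 (cabs (f x) - cabs (g x)); have := cabs_ge0 (f x).
by have := cabs_ge0 (g x); nra.
Qed.

Lemma L20 : L2 (fun=> 0).
Proof.
split; first exact: cmeas_cst.
by under eq_fun do rewrite cabs0 expr0n/=; exact: rI0.
Qed.

Lemma L2D f g : L2 f -> L2 g -> L2 (fun x => f x + g x).
Proof.
move=> [mf If] [mg Ig].
apply: (L2_le (rID (rIZ 2 If) (rIZ 2 Ig))); first exact: cmeasD.
move=> x; have := cabsD (f x) (g x); have := cabs_ge0 (f x + g x).
have := sqr_ge0 (cabs (f x) - cabs (g x)).
by have := cabs_ge0 (f x); have := cabs_ge0 (g x); nra.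
Qed.

Lemma L2Z (a : R[i]) f : L2 f -> L2 (fun x => a * f x).
Proof.
move=> [mf If]; apply: (L2_le (rIZ (cabs a ^+ 2) If)).
  by apply: cmeasM => //; exact: cmeas_cst.
by move=> x; rewrite cabsM exprMn.
Qed.

Lemma L2N f : L2 f -> L2 (fun x => - f x).
Proof.
move=> [mf If]; split; first exact: cmeasN.
by under eq_fun do rewrite cabsN.
Qed.

Lemma L2B f g : L2 f -> L2 g -> L2 (fun x => f x - g x).
Proof. by move=> Lf Lg; apply: L2D => //; exact: L2N. Qed.

Lemma L2J f : L2 f -> L2 (fun x => cj (f x)).
Proof.
move=> [mf If]; split; first exact: cmeasJ.
by under eq_fun do rewrite cabsJ.
Qed.

Lemma L2_lin (a : R[i]) f g : L2 f -> L2 g -> L2 (fun x => a * f x + g x).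
Proof. by move=> Lf Lg; apply: L2D => //; exact: L2Z. Qed.

Lemma L2_sum (I : Type) (s : seq I) (P : pred I) (F : I -> T -> R[i]) :
  (forall i, P i -> L2 (F i)) -> L2 (fun x => \sum_(i <- s | P i) F i x).
Proof.
move=> IF; elim: s => [|i s IHs].
  by under eq_fun do rewrite big_nil; exact: L20.
have [Pi|/negbTE nPi] := boolP (P i); last by under eq_fun do rewrite big_cons nPi.
by under eq_fun do rewrite big_cons Pi; apply: L2D => //; exact: IF.
Qed.

Lemma L2_cabs f : L2 f -> L2 (fun x => (cabs (f x))%:C).
Proof.
move=> [mf If]; split; first exact: cmeasR (cmeas_cabs mf).
by under eq_fun do rewrite cabsR ger0_norm ?cabs_ge0//.
Qed.

Lemma ip_cI f g : L2 f -> L2 g -> cI mu (fun x => f x * cj (g x)).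
Proof. by move=> Lf Lg; apply: L2_cI => //; exact: L2J. Qed.

Lemma ip_nr f : ip f f = (nr f)%:C.
Proof.
rewrite /ip (eq_ci _ (g := fun x => (cabs (f x) ^+ 2)%:C)) ?ciR// => x.
by rewrite mulcJ.
Qed.

Lemma ip_lin (a : R[i]) f g h : L2 f -> L2 g -> L2 h ->
  ip (fun x => a * f x + g x) h = a * ip f h + ip g h.
Proof.
move=> Lf Lg Lh; rewrite /ip -ci_lin; [|exact: ip_cI..].
by apply: eq_ci => x; rewrite mulrDl mulrA.
Qed.

Lemma ipJ f g : L2 f -> L2 g -> ip g f = cj (ip f g).
Proof.
move=> Lf Lg; rewrite /ip -ciJ; last exact: ip_cI.
by apply: eq_ci => x; rewrite cJM cJK mulrC.
Qed.

Lemma ip_linr (a : R[i]) f g h : L2 f -> L2 g -> L2 h ->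
  ip h (fun x => a * f x + g x) = cj a * ip h f + ip h g.
Proof.
move=> Lf Lg Lh; rewrite ipJ//; last exact: L2_lin.
by rewrite ip_lin// cJD cJM -!ipJ.
Qed.

Lemma ipZ (a : R[i]) f h : L2 f -> L2 h -> ip (fun x => a * f x) h = a * ip f h.
Proof.
move=> Lf Lh; rewrite /ip -ciZ; last exact: ip_cI.
by apply: eq_ci => x; rewrite mulrA.
Qed.

Lemma ipB f g h : L2 f -> L2 g -> L2 h -> ip (fun x => f x - g x) h = ip f h - ip g h.
Proof.
move=> Lf Lg Lh; rewrite /ip -ciB; [|exact: ip_cI..].
by apply: eq_ci => x; rewrite mulrBl.
Qed.

Lemma ip_suml (I : Type) (s : seq I) (P : pred I) (F : I -> T -> R[i]) h :
  (forall i, P i -> L2 (F i)) -> L2 h ->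
  ip (fun x => \sum_(i <- s | P i) F i x) h = \sum_(i <- s | P i) ip (F i) h.
Proof.
move=> LF Lh; rewrite /ip -ci_sum => [|i Pi]; last by apply: ip_cI => //; exact: LF.
by apply: eq_ci => x; rewrite mulr_suml.
Qed.

Lemma nr_lin (a : R[i]) f g : L2 f -> L2 g ->
  nr (fun x => a * f x + g x) = cabs a ^+ 2 * nr f + nr g + 2 * cRe (a * ip f g).
Proof.
move=> Lf Lg; have Lfg := L2_lin a Lf Lg; rewrite -[LHS]/(cRe (_%:C)) -ip_nr.
rewrite ip_lin// !ip_linr// !ip_nr (ipJ Lf Lg).
set z := ip f g; rewrite !cE /= cabs_sqr; ring.
Qed.

Lemma nrZ (a : R[i]) f : L2 f -> nr (fun x => a * f x) = cabs a ^+ 2 * nr f.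
Proof.
move=> [_ If]; rewrite /nr -rintZ//.
by apply: eq_Rintegral => x _; rewrite cabsM exprMn.
Qed.

Lemma nrN f : nr (fun x => - f x) = nr f.
Proof. by apply: eq_Rintegral => x _; rewrite cabsN. Qed.

Lemma nrBC f g : nr (fun x => f x - g x) = nr (fun x => g x - f x).
Proof. by apply: eq_Rintegral => x _; rewrite cabsB. Qed.

Lemma nrD f g : L2 f -> L2 g ->
  nr (fun x => f x + g x) = nr f + nr g + 2 * cRe (ip f g).
Proof.
move=> Lf Lg; have := nr_lin 1 Lf Lg; rewrite cabs1 expr1n !mul1r => <-.
by apply: eq_Rintegral => x _; rewrite mul1r.
Qed.

Lemma nrB f g : L2 f -> L2 g ->
  nr (fun x => f x - g x) = nr f + nr g - 2 * cRe (ip f g).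
Proof.
move=> Lf Lg; rewrite nrD//; last exact: L2N.
rewrite nrN; congr (_ + _); rewrite -mulrN; congr (_ * _).
rewrite (_ : ip f (fun x => - g x) = - ip f g) ?cE//.
rewrite /ip -ciN; last exact: ip_cI.
by apply: eq_ci => x; rewrite cJN mulrN.
Qed.

Lemma nrD_le f g : L2 f -> L2 g -> nr (fun x => f x + g x) <= 2 * nr f + 2 * nr g.
Proof.
move=> Lf Lg; have := nr_ge0 (fun x => f x - g x).
rewrite nrB// nrD//; lra.
Qed.

Lemma nrB_le f g : L2 f -> L2 g -> nr (fun x => f x - g x) <= 2 * nr f + 2 * nr g.
Proof.
by move=> Lf Lg; rewrite (le_trans (nrD_le Lf (L2N Lg)))// nrN.
Qed.

Lemma cauchy_schwarz f g : L2 f -> L2 g -> cabs (ip f g) ^+ 2 <= nr f * nr g.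
Proof.
move=> Lf Lg; set z := ip f g.
have h (t : R) : 0 <= t ^+ 2 * (cabs z ^+ 2 * nr f) + nr g - 2 * t * cabs z ^+ 2.
  have := nr_ge0 (fun x => (- t%:C * cj z) * f x + g x).
  rewrite nr_lin// -/z cabsM cabsN cabsR cabsJ exprMn real_normK ?num_real//.
  have -> : cRe (- t%:C * cj z * z) = - (t * cabs z ^+ 2).
    by rewrite -mulrA [cj z * z]mulrC mulcJ !cE /=; ring.
  lra.
have [z0|z0] := eqVneq (cabs z) 0.
  by rewrite z0 expr0n mulr_ge0// nr_ge0.
have z2 : 0 < cabs z ^+ 2 by rewrite exprn_gt0// lt_def z0 cabs_ge0.
have [f0|f0] := eqVneq (nr f) 0.
  exfalso; have := h ((nr g + 1) / cabs z ^+ 2).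
  rewrite f0 !mulr0 add0r -mulrA divfK ?gt_eqF//.
  have := nr_ge0 g; lra.
have fp : 0 < nr f by rewrite lt_def f0 nr_ge0.
have := h (nr f)^-1.
have -> : (nr f)^-1 ^+ 2 * (cabs z ^+ 2 * nr f) + nr g - 2 * (nr f)^-1 * cabs z ^+ 2
   = nr g - cabs z ^+ 2 / nr f by field.
by rewrite subr_ge0 ler_pdivrMr// mulrC.
Qed.

Lemma cauchy_schwarz_abs f g : L2 f -> L2 g ->
  (\int[mu]_x (cabs (f x) * cabs (g x))) ^+ 2 <= nr f * nr g.
Proof.
move=> Lf Lg; have := cauchy_schwarz (L2_cabs Lf) (L2_cabs Lg).
have -> : ip (fun x => (cabs (f x))%:C) (fun x => (cabs (g x))%:C) =
    (\int[mu]_x (cabs (f x) * cabs (g x)))%:C.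
  rewrite /ip -ciR; apply: eq_ci => x.
  by apply: ceqP; rewrite !cE/=; ring.
rewrite cabsR ger0_norm; last by apply: rint_ge0 => x; rewrite mulr_ge0 ?cabs_ge0.
have nrabs k : nr (fun x => (cabs (k x))%:C) = nr k.
  by apply: eq_Rintegral => x _; rewrite cabsR ger0_norm ?cabs_ge0.
by rewrite !nrabs.
Qed.

Lemma nr_ae f g : cmeas f -> cmeas g -> {ae mu, forall x, f x = g x} -> nr f = nr g.
Proof.
move=> mf mg fg; apply: rint_ae; [exact: cmeas_sqr..|].
by apply: filterS fg => x ->.
Qed.

Lemma ip_ae f g f' g' : cmeas f -> cmeas f' -> cmeas g -> cmeas g' ->
  {ae mu, forall x, f x = f' x} -> {ae mu, forall x, g x = g' x} ->
  ip f g = ip f' g'.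
Proof.
move=> mf mf' mg mg' ff gg; apply: ci_ae.
- by apply: cmeasM => //; exact: cmeasJ.
- by apply: cmeasM => //; exact: cmeasJ.
- by apply: filterS2 ff gg => x -> ->.
Qed.

Lemma nr0_ae f g : L2 f -> L2 g -> nr (fun x => f x - g x) = 0 ->
  {ae mu, forall x, f x = g x}.
Proof.
move=> Lf Lg n0; have [_ Ifg] := L2B Lf Lg.
have := rint_eq0_ae Ifg (fun x => sqr_ge0 _) n0.
apply: filterS => x /eqP; rewrite sqrf_eq0 => /eqP/cabs_eq0/eqP.
by rewrite subr_eq0 => /eqP.
Qed.

Lemma bessel m (e : 'I_m -> T -> R[i]) h : (forall i, L2 (e i)) ->
  (forall i j, ip (e i) (e j) = (i == j)%:R) -> L2 h ->
  \sum_(i < m) cabs (ip h (e i)) ^+ 2 <= nr h.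
Proof.
move=> Le oe Lh.
pose s x := \sum_(i < m) ip h (e i) * e i x.
have Ls : L2 s by apply: L2_sum => i _; exact: L2Z.
have sh : ip s h = (\sum_(i < m) cabs (ip h (e i)) ^+ 2)%:C.
  rewrite /s ip_suml// => [|i _]; last exact: L2Z.
  rewrite rmorph_sum; apply: eq_bigr => i _.
  by rewrite ipZ// (ipJ Lh (Le i)) mulcJ.
have ss : nr s = \sum_(i < m) cabs (ip h (e i)) ^+ 2.
  apply: complexI; rewrite -ip_nr {1}/s ip_suml// => [|i _]; last exact: L2Z.
  rewrite rmorph_sum; apply: eq_bigr => i _.
  rewrite ipZ// (ipJ Ls (Le i)) /s ip_suml// => [|j _]; last exact: L2Z.
  rewrite (bigD1 i)//= big1 => [|j ji]; last by rewrite ipZ// oe (negbTE ji) mulr0.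
  by rewrite ipZ// oe eqxx mulr1 addr0 mulcJ.
have := nr_ge0 (fun x => s x - h x).
rewrite nrB// ss sh /=; lra.
Qed.

Lemma ip_ctend (F : nat -> T -> R[i]) f g : (forall m, L2 (F m)) -> L2 f -> L2 g ->
  (fun m => nr (fun x => F m x - f x)) @ \oo --> (0 : R) ->
  ctend (fun m => ip (F m) g) (ip f g).
Proof.
move=> LF Lf Lg Ff.
have h := seq_sqrt (seq_mul0 (nr g) Ff); rewrite sqrtr0 in h.
apply: (ctend_le h) => m; rewrite -ipB//.
rewrite -[leLHS]ger0_norm ?cabs_ge0// -sqrtr_sqr ler_wsqrtr// mulrC.
by apply: cauchy_schwarz => //; exact: L2B.
Qed.

Lemma nr_cvg (F : nat -> T -> R[i]) f : (forall m, L2 (F m)) -> L2 f ->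
  (fun m => nr (fun x => F m x - f x)) @ \oo --> (0 : R) ->
  (fun m => nr (F m)) @ \oo --> nr f.
Proof.
move=> LF Lf Ff.
have -> : (fun m => nr (F m)) = (fun m => nr (fun x => F m x - f x) +
    (- nr f + 2 * cRe (ip (F m) f))).
  by apply/funext => m; rewrite nrB//; ring.
have e : nr f = 0 + (- nr f + 2 * cRe (ip f f)) by rewrite ip_nr /=; ring.
rewrite [X in _ --> X]e; apply: cvgD => //.
apply: cvgD; first exact: cvg_cst.
apply: cvgM; first exact: cvg_cst.
by apply: ctend_Re; exact: ip_ctend.
Qed.

Lemma nr_dct (F : nat -> T -> R[i]) f (g : T -> R) :
  (forall m, cmeas (F m)) -> cmeas f -> rI mu (fun x => g x ^+ 2) ->
  (forall x, ctend (F^~ x) (f x)) -> (forall m x, cabs (F m x) <= g x) ->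
  L2 f /\ (fun m => nr (fun x => F m x - f x)) @ \oo --> (0 : R).
Proof.
move=> mF mf Ig Ff Fg.
have fg x : cabs (f x) <= g x.
  by apply: (seq_le (ctend_cabs (Ff x))) => m; exact: Fg.
have Lf : L2 f.
  apply: (L2_le Ig) => // x; rewrite ler_sqr ?nnegrE ?cabs_ge0//.
  exact: le_trans (cabs_ge0 _) (fg x).
split => //.
have mFf m : cmeas (fun x => F m x - f x) by exact: cmeasB.
have h1 x : (fun m => cabs (F m x - f x) ^+ 2) @ \oo --> (0 : R).
  rewrite -[X in _ --> X](mul0r 0); under eq_fun do rewrite expr2.
  by apply: cvgM; exact: Ff.
have h2 m x : `|cabs (F m x - f x) ^+ 2| <= 4 * g x ^+ 2.
  rewrite ger0_norm ?sqr_ge0//.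
  have : cabs (F m x - f x) <= 2 * g x.
    by rewrite (le_trans (cabsD _ _))// cabsN mulr_natl mulr2n lerD.
  by have := cabs_ge0 (F m x - f x); nra.
have [_ _] := rint_dct (fun m => cmeas_sqr (mFf m)) (measurable_cst (0 : R))
  (rIZ 4 Ig) h1 h2.
by rewrite rint0.
Qed.

Lemma ci_dct (F : nat -> T -> R[i]) f (g : T -> R) :
  (forall m, cmeas (F m)) -> cmeas f -> rI mu g ->
  (forall x, ctend (F^~ x) (f x)) -> (forall m x, cabs (F m x) <= g x) ->
  cI mu f /\ ctend (fun m => ci mu (F m)) (ci mu f).
Proof.
move=> mF mf Ig Ff Fg.
have IF m : cI mu (F m) by apply: (cI_le Ig).
have fg x : cabs (f x) <= g x.
  by apply: (seq_le (ctend_cabs (Ff x))) => m; exact: Fg.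
have If : cI mu f by apply: (cI_le Ig).
split => //.
have mFf m : cmeas (fun x => F m x - f x) by exact: cmeasB.
have h2 m x : `|cabs (F m x - f x)| <= 2 * g x.
  by rewrite ger0_norm ?cabs_ge0// (le_trans (cabsD _ _))// cabsN mulr_natl mulr2n lerD.
have [_ _] := rint_dct (fun m => cmeas_cabs (mFf m)) (measurable_cst (0 : R))
  (rIZ 2 Ig) Ff h2.
rewrite rint0 => h; apply: (ctend_le h) => m.
by rewrite -ciB//; apply: cabs_ci; exact: cIB.
Qed.

Lemma nr_fatou (F : nat -> T -> R[i]) f (C : R) :
  (forall m, L2 (F m)) -> cmeas f -> (forall x, ctend (F^~ x) (f x)) ->
  (forall m, nr (F m) <= C) -> L2 f /\ nr f <= C.
Proof.
move=> LF mf Ff FC.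
pose u m x := (cabs (F m x) ^+ 2)%:E.
have mu_ m : measurable_fun setT (u m).
  by apply/measurable_EFinP; apply: cmeas_sqr; have [] := LF m.
have le : (\int[mu]_x (cabs (f x) ^+ 2)%:E <= C%:E)%E.
  have -> : (\int[mu]_x (cabs (f x) ^+ 2)%:E = \int[mu]_x limn_einf (u^~ x))%E.
    apply: eq_integral => x _.
    have h : u^~ x @ \oo --> (cabs (f x) ^+ 2)%:E.
      apply: cvg_EFin; first exact: nearW.
      rewrite /= expr2 (_ : _ \o _ = (fun m => cabs (F m x) * cabs (F m x))).
        by apply: cvgM; apply: ctend_cabs; exact: Ff.
      by apply/funext => m; rewrite /= -expr2.
    by have [-> _] := cvg_limn_einf_sup h.
  apply: (le_trans (fatou mu measurableT mu_ _)).
    by move=> m x _; rewrite lee_fin sqr_ge0.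
    rewrite limn_einf_lim; apply: lime_le; first exact: is_cvg_einfs.
  apply: nearW => m; apply: (@le_trans _ _ (\int[mu]_x u m x)%E).
    by apply: ereal_inf_lbound; exists m => /=.
  by rewrite -rI_EFin ?lee_fin//; [exact: FC|have [] := LF m].
have Lf : L2 f.
  split => //; apply: rI_ltoo; [exact: cmeas_sqr|by move=> x; rewrite sqr_ge0|].
  by rewrite (le_lt_trans le)// ltry.
by split => //; rewrite -lee_fin rI_EFin//; case: Lf.
Qed.

End L2.

(** * Product measures and changes of variables *)

Section fubini_real.
Context d1 d2 (T1 : measurableType d1) (T2 : measurableType d2) (R : realType).
Variables (m1 : {sigma_finite_measure set T1 -> \bar R})
          (m2 : {sigma_finite_measure set T2 -> \bar R}).
Local Notation m12 := (m1 \x m2)%E.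
Implicit Types F : T1 * T2 -> R.

Lemma rI_prod F : measurable_fun setT F -> (forall x, rI m2 (fun y => F (x, y))) ->
  rI m1 (fun x => \int[m2]_y `|F (x, y)|) -> rI m12 F.
Proof.
move=> mF F2 F1; apply/integrable12ltyP; first exact/measurable_EFinP.
apply: le_lt_trans (rI_lt_oo F1); rewrite le_eqVlt; apply/orP; left; apply/eqP.
by apply: eq_integral => x _; rewrite rI_EFin//; exact: rI_norm.
Qed.

Let fine_int d (T : measurableType d) (m : {measure set T -> \bar R}) (u : T -> \bar R) :
  m.-integrable setT u -> rI m (fine \o u) /\ (\int[m]_x fine (u x))%:E = (\int[m]_x u x)%E.
Proof.
move=> Iu; have mu : measurable_fun setT u := measurable_int _ Iu.
have mfu : measurable_fun setT (fine \o u) by apply: measurableT_comp.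
have If : rI m (fine \o u).
  apply: le_integrable Iu => //; first exact/measurable_EFinP.
  by move=> x _ /=; case: (u x) => //=; rewrite ?normr0 ?leey.
split => //; rewrite rI_EFin//; apply: ae_eq_integral => //.
  exact/measurable_EFinP.
by apply: filterS (integrable_ae measurableT Iu) => x /= h _; rewrite fineK//; exact: h.
Qed.

Lemma rint_fubini1 F : rI m12 F ->
  rI m1 (fun x => \int[m2]_y F (x, y)) /\ \int[m1]_x (\int[m2]_y F (x, y)) = \int[m12]_z F z.
Proof.
move=> IF; have [h1 h2] := fine_int (integrable_fubini_F IF); split; first exact: h1.
by apply: EFin_inj; rewrite [LHS]h2 integral12_prod_meas1// rI_EFin.
Qed.

Let integrable_G (f : T1 * T2 -> \bar R) : m12.-integrable setT f ->
  m2.-integrable setT (fubini_G m1 f).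
Proof.
move=> If; have mf := measurable_int _ If.
apply/integrableP; split; first exact: (measurable_fubini_G If).
apply: le_lt_trans ((integrable21ltyP _ _ mf).1 If).
apply: ge0_le_integral => //.
- by apply: measurableT_comp => //; exact: (measurable_fubini_G If).
- by apply: (measurable_fun_fubini_tonelli_G (abse \o f)) => //=; exact: measurableT_comp.
- move=> y _; apply: le_abse_integral => //.
  by apply: (measurableT_comp mf); exact: measurable_pair2.
Qed.

Lemma rint_fubini2 F : rI m12 F ->
  rI m2 (fun y => \int[m1]_x F (x, y)) /\ \int[m2]_y (\int[m1]_x F (x, y)) = \int[m12]_z F z.
Proof.
move=> IF; have [h1 h2] := fine_int (integrable_G IF); split; first exact: h1.
by apply: EFin_inj; rewrite [LHS]h2 integral21_prod_meas1// rI_EFin.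
Qed.

Implicit Types G : T1 * T2 -> R[i].

Lemma cI_prod G : cmeas G -> (forall x, cI m2 (fun y => G (x, y))) ->
  rI m1 (fun x => \int[m2]_y cabs (G (x, y))) -> cI m12 G.
Proof.
move=> mG G2 G1; split => //; apply: rI_prod.
- exact: cmeas_cabs.
- by move=> x; case: (G2 x).
- rewrite (_ : (fun x => _) = (fun x => \int[m2]_y cabs (G (x, y))))//.
  by apply/funext => x; apply: eq_Rintegral => y _; rewrite ger0_norm ?cabs_ge0.
Qed.

Lemma ci_fubini1 G : cI m12 G ->
  cI m1 (fun x => ci m2 (fun y => G (x, y))) /\
  ci m1 (fun x => ci m2 (fun y => G (x, y))) = ci m12 G.
Proof.
move=> IG; have [r1 r2] := rint_fubini1 (cI_Re IG).
have [i1 i2] := rint_fubini1 (cI_Im IG); split; first exact: cI_ReIm.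
by apply: ceqP; rewrite /= ?r2 ?i2.
Qed.

Lemma ci_fubini2 G : cI m12 G ->
  cI m2 (fun y => ci m1 (fun x => G (x, y))) /\
  ci m2 (fun y => ci m1 (fun x => G (x, y))) = ci m12 G.
Proof.
move=> IG; have [r1 r2] := rint_fubini2 (cI_Re IG).
have [i1 i2] := rint_fubini2 (cI_Im IG); split; first exact: cI_ReIm.
by apply: ceqP; rewrite /= ?r2 ?i2.
Qed.

Lemma ci_tensor (f : T1 -> R[i]) (g : T2 -> R[i]) : cI m1 f -> cI m2 g ->
  cI m12 (fun z => f z.1 * g z.2) /\ ci m12 (fun z => f z.1 * g z.2) = ci m1 f * ci m2 g.
Proof.
move=> If Ig; have [mf _] := If; have [mg _] := Ig.
have Ifg : cI m12 (fun z => f z.1 * g z.2).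
  apply: cI_prod => [|x|/=].
  - apply: cmeasM; first exact: (cmeas_comp measurable_fst mf).
    exact: (cmeas_comp measurable_snd mg).
  - exact: (cIZ (f x) Ig).
  - rewrite (_ : (fun x => _) = (fun x => \int[m2]_y cabs (g y) * cabs (f x))).
      by apply: rIZ; case: If.
    apply/funext => x; rewrite mulrC -rintZ; last by case: Ig.
    by apply: eq_Rintegral => y _; rewrite cabsM.
split => //; have [_ <-] := ci_fubini1 Ifg => /=.
rewrite mulrC -ciZ//; apply: eq_ci => x.
by rewrite ciZ// mulrC.
Qed.

End fubini_real.

Section parametrised_integral.
Context d1 d2 (T1 : measurableType d1) (T2 : measurableType d2) (R : realType).
Variable m2 : {sigma_finite_measure set T2 -> \bar R}.

Lemma measurable_rint_param (F : T1 * T2 -> R) : measurable_fun setT F ->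
  measurable_fun setT (fun x => \int[m2]_y F (x, y)).
Proof.
move=> mF; have mEF : measurable_fun setT (EFin \o F) by exact/measurable_EFinP.
apply: (@measurableT_comp _ _ _ _ _ _ (@fine R)) => //.
under eq_fun do rewrite integralE.
apply: emeasurable_funB.
  have := @measurable_fun_fubini_tonelli_F _ _ T1 T2 R m2 (EFin \o F)^\+%E
    (measurable_funepos mEF) (fun z => funepos_ge0 _ z).
  apply: eq_measurable_fun => x _; apply: eq_integral => y _.
  by rewrite !funeposE.
have := @measurable_fun_fubini_tonelli_F _ _ T1 T2 R m2 (EFin \o F)^\-%E
  (measurable_funeneg mEF) (fun z => funeneg_ge0 _ z).
apply: eq_measurable_fun => x _; apply: eq_integral => y _.
by rewrite !funenegE.
Qed.

Lemma cmeas_ci_param (F : T1 * T2 -> R[i]) : cmeas F ->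
  cmeas (fun x => ci m2 (fun y => F (x, y))).
Proof.
move=> [rF iF]; split; [exact: (measurable_rint_param rF)|exact: (measurable_rint_param iF)].
Qed.

End parametrised_integral.

Section push_measure.
Context d1 d2 (X : measurableType d1) (Y : measurableType d2) (R : realType).
Variables (mu : {measure set X -> \bar R}) (phi : X -> Y) (mphi : measurable_fun setT phi).

Definition push_measure : {measure set Y -> \bar R}.
Proof. by refine (pushforward mu phi : {measure set Y -> \bar R}). Defined.

Lemma push_measureE A : push_measure A = mu (phi @^-1` A). Proof. by []. Qed.

End push_measure.

Lemma fine_scale (R : realType) (k : R) (a b : \bar R) : 0 < k ->
  fine (k%:E * a - k%:E * b)%E = k * fine (a - b)%E.
Proof.
move=> k0; have k0' : (0 < k%:E)%E by rewrite lte_fin.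
case: a => [a||]; case: b => [b||];
  rewrite ?(gt0_muley k0') ?(gt0_muleNy k0') -?EFinM //= ?mulr0 //.
by rewrite mulrBr.
Qed.

Section change_of_variables.
Context d1 d2 (X : measurableType d1) (Y : measurableType d2) (R : realType).
Variables (mu : {measure set X -> \bar R}) (nu : {measure set Y -> \bar R}).
Variables (phi : X -> Y) (mphi : measurable_fun setT phi) (k : R) (k0 : 0 < k).
Hypothesis nuE : forall A, measurable A -> nu A = (k%:E * mu (phi @^-1` A))%E.

Lemma ge0_change_var (f : Y -> \bar R) : measurable_fun setT f ->
  (forall y, 0 <= f y)%E -> (\int[nu]_y f y = k%:E * \int[mu]_x f (phi x))%E.
Proof.
move=> mf f0.
rewrite (eq_measure_integral (mscale (NngNum (ltW k0)) (push_measure mu mphi))); last first.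
  by move=> A mA _; rewrite nuE.
rewrite ge0_integral_mscale//=; congr (_ * _)%E.
by rewrite ge0_integral_pushforward.
Qed.

Lemma rI_change_var (f : Y -> R) : measurable_fun setT f ->
  rI nu f <-> rI mu (f \o phi).
Proof.
move=> mf; have e : (\int[nu]_y `|(f y)%:E| = k%:E * \int[mu]_x `|(f (phi x))%:E|)%E.
  by rewrite ge0_change_var//; apply/measurableT_comp => //; exact/measurable_EFinP.
have mfp : measurable_fun setT (f \o phi) by exact: measurableT_comp.
split=> /integrableP[_ foo]; apply/integrableP; split; try exact/measurable_EFinP.
  move: foo; rewrite [X in (X < _)%E -> _]e.
  have -> : (\int[mu]_x `|(f (phi x))%:E| = \int[mu]_x `|(EFin \o (f \o phi)) x|)%E by [].
  by case: (\int[mu]_x _)%E => [r||] //=; rewrite ?ltry// mulry gtr0_sg// mul1e.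
rewrite /= e; move: foo => /=; have : (0 <= \int[mu]_x `|(f (phi x))%:E|)%E by apply: integral_ge0.
by case: (\int[mu]_x _)%E => [r||] //= _ _; rewrite -EFinM ltry.
Qed.

Lemma rint_change_var (f : Y -> R) : measurable_fun setT f ->
  \int[nu]_y f y = k * \int[mu]_x f (phi x).
Proof.
move=> mf; rewrite /Rintegral (integralE nu) (integralE mu).
have mEf : measurable_fun setT (EFin \o f) by exact/measurable_EFinP.
rewrite !ge0_change_var//; [|exact: measurable_funeneg|exact: measurable_funepos].
set a := (\int[mu]_x ((EFin \o f)^\+ (phi x)))%E.
set b := (\int[mu]_x ((EFin \o f)^\- (phi x)))%E.
have a0 : (0 <= a)%E by apply: integral_ge0.
have b0 : (0 <= b)%E by apply: integral_ge0.
have -> : (\int[mu]_x ((fun x => (f (phi x))%:E)^\+ x))%E = a.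
  by rewrite /a; apply: eq_integral => x _; rewrite !funeposE.
have -> : (\int[mu]_x ((fun x => (f (phi x))%:E)^\- x))%E = b.
  by rewrite /b; apply: eq_integral => x _; rewrite !funenegE.
exact: fine_scale.
Qed.

Lemma ci_change_var (f : Y -> R[i]) : cmeas f ->
  ci nu f = k%:C * ci mu (f \o phi).
Proof.
move=> [rf i_f]; apply: ceqP; rewrite !cE /= mul0r ?subr0 ?addr0; exact: rint_change_var.
Qed.

Lemma cI_change_var (f : Y -> R[i]) : cmeas f -> cI nu f <-> cI mu (f \o phi).
Proof.
move=> mf; split => -[_ h]; split => //.
- exact: (cmeas_comp mphi mf).
- by move/rI_change_var : h; apply; exact: cmeas_cabs.
- by apply/rI_change_var => //; exact: cmeas_cabs.
Qed.

End change_of_variables.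

Section affine_line.
Context {R : realType}.
Local Notation leb := (@lebesgue_measure R).

Lemma lebesgue_affine (r c : R) : r != 0 -> forall A : set (measurableTypeR R),
  measurable A -> leb A = (`|r|%:E * leb ((fun x => (r * x + c)%R) @^-1` A))%E.
Proof.
move=> r0 A mA.
have mphi : measurable_fun setT (fun x : measurableTypeR R => (r * x + c : measurableTypeR R)).
  by apply: measurable_funD => //; exact: mulrl_measurable.
have r1 : 0 <= `|r| by [].
apply: (lebesgue_measure_unique (mu := mscale (NngNum r1) (push_measure leb mphi))) => //.
move=> _ [[a b] /= ab <-].
rewrite /mscale /= push_measureE.
have rp : 0 < `|r| by rewrite normr_gt0.
have [rneg|rpos] := ltP r 0.
  have -> : (fun x => r * x + c) @^-1` `]a, b] = `[(b - c) / r, (a - c) / r[%classic.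
    apply/seteqP; split => x /=; rewrite !in_itv /= => /andP[h1 h2]; apply/andP; split.
    - by rewrite ler_ndivrMr// lerBrDr mulrC.
    - by rewrite ltr_ndivlMr// ltrBlDr mulrC.
    - by move: h2; rewrite ltr_ndivlMr// ltrBlDr mulrC.
    - by move: h1; rewrite ler_ndivrMr// lerBrDr mulrC.
  rewrite [LHS]lebesgue_measure_itv [X in _ = (_ * X)%E]lebesgue_measure_itv /= !lte_fin.
  have -> : ((b - c) / r < (a - c) / r) = (a < b).
    by rewrite ltr_nM2r ?invr_lt0// ltrD2r.
  case: ifP => _; last by rewrite mule0.
  by rewrite -!EFinB -EFinM ltr0_norm//; congr EFin; field.
have r'0 : 0 < r by rewrite lt_def r0.
have -> : (fun x => r * x + c) @^-1` `]a, b] = `](a - c) / r, (b - c) / r]%classic.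
  apply/seteqP; split => x /=; rewrite !in_itv /= => /andP[h1 h2]; apply/andP; split.
  - by rewrite ltr_pdivrMr// ltrBlDr mulrC.
  - by rewrite ler_pdivlMr// lerBrDr mulrC.
  - by move: h1; rewrite ltr_pdivrMr// ltrBlDr mulrC.
  - by move: h2; rewrite ler_pdivlMr// lerBrDr mulrC.
rewrite [LHS]lebesgue_measure_itv [X in _ = (_ * X)%E]lebesgue_measure_itv /= !lte_fin.
have -> : ((a - c) / r < (b - c) / r) = (a < b).
  by rewrite ltr_pM2r ?invr_gt0// ltrD2r.
case: ifP => _; last by rewrite mule0.
  by rewrite -!EFinB -EFinM gtr0_norm//; congr EFin; field.
exact: mphi.
Qed.

End affine_line.

Section rV_integration.
Context {R : realType}.
Local Notation leb := (@lebesgue_measure R).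
Local Notation mu n := (@lebesgue_rV R n).

Definition tensor n (f : 'I_n -> R -> R[i]) (x : 'rV[R]_n) : R[i] :=
  \prod_(i < n) f i (x ord0 i).

Lemma lebesgue_rVS n A : mu n.+1 A = (1%:E * (leb \x mu n) (@rV_cons R n @^-1` A))%E.
Proof. by rewrite mul1e. Qed.

Lemma cI_rV_cons n (f : 'rV[R]_n.+1 -> R[i]) : cmeas f ->
  cI (mu n.+1) f <-> cI (leb \x mu n)%E (fun z => f (rV_cons z)).
Proof.
move=> mf; exact: (cI_change_var (@measurable_rV_cons R n) ltr01 (fun A _ => lebesgue_rVS A)).
Qed.

Lemma ci_rV_cons n (f : 'rV[R]_n.+1 -> R[i]) : cmeas f ->
  ci (mu n.+1) f = ci (leb \x mu n)%E (fun z => f (rV_cons z)).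
Proof.
move=> mf; rewrite (ci_change_var (@measurable_rV_cons R n) ltr01 (fun A _ => lebesgue_rVS A))//.
by rewrite mul1r.
Qed.

Lemma cmeas_tensor n (f : 'I_n -> R -> R[i]) : (forall i, cmeas (f i)) -> cmeas (tensor f).
Proof.
move=> mf; rewrite /tensor; elim: (index_enum _) => [|i s IHs].
  by under eq_fun do rewrite big_nil; exact: cmeas_cst.
under eq_fun do rewrite big_cons; apply: cmeasM => //.
exact: (cmeas_comp (@measurable_coord R n i) (mf i)).
Qed.

Lemma tensor_cons n (f : 'I_n.+1 -> R -> R[i]) z :
  tensor f (rV_cons z) = f ord0 z.1 * tensor (fun i => f (lift ord0 i)) z.2.
Proof.
case: z => a x; rewrite /tensor big_ord_recl /= /rV_cons mxE unlift_none /=; congr (_ * _).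
by apply: eq_bigr => i _; rewrite mxE liftK.
Qed.

Lemma ci_tensor_rV n (f : 'I_n -> R -> R[i]) : (forall i, cI leb (f i)) ->
  cI (mu n) (tensor f) /\ ci (mu n) (tensor f) = \prod_(i < n) ci leb (f i).
Proof.
elim: n f => [|n IHn] f If.
  have -> : tensor f = (fun=> (1%R)%:C) by apply/funext => x; rewrite /tensor big_ord0.
  have I1 : rI (mu 0) (fun=> 1%R).
    apply: rI_ltoo => //.
    by rewrite integral_dirac//= diracE mem_set// mul1e ltry.
  rewrite big_ord0 ciR; split; first exact: cIR.
  by rewrite /Rintegral integral_dirac// diracE mem_set// mul1e.
have mt : cmeas (tensor f) by apply: cmeas_tensor => i; case: (If i).
have [I2 e2] := IHn _ (fun i => If (lift ord0 i)).
have [I12 e12] := ci_tensor (If ord0) I2.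
have E : (fun z => tensor f (rV_cons z)) =
    (fun z => f ord0 z.1 * tensor (fun i => f (lift ord0 i)) z.2).
  by apply/funext => z; rewrite tensor_cons.
split; first by apply/cI_rV_cons; rewrite ?E.
by rewrite ci_rV_cons// E e12 e2 big_ord_recl.
Qed.

Lemma cabs_prod (I : Type) (s : seq I) (F : I -> R[i]) :
  cabs (\prod_(i <- s) F i) = \prod_(i <- s) cabs (F i).
Proof. by elim/big_rec2 : _ => [|i x y _ <-]; rewrite ?cabs1 ?cabsM. Qed.

Lemma real_prod (I : Type) (s : seq I) (F : I -> R) :
  \prod_(i <- s) (F i)%:C = (\prod_(i <- s) F i)%:C.
Proof. by rewrite rmorph_prod. Qed.

Lemma rint_tensor n (f : 'I_n -> R -> R) : (forall i, rI leb (f i)) ->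
  rI (mu n) (fun x => \prod_(i < n) f i (x ord0 i)) /\
  \int[mu n]_x (\prod_(i < n) f i (x ord0 i)) = \prod_(i < n) \int[leb]_x f i x.
Proof.
move=> If; have [I1 e1] := ci_tensor_rV (fun i => cIR (If i)).
have E : tensor (fun i x => (f i x)%:C) = fun x => (\prod_(i < n) f i (x ord0 i))%:C.
  by apply/funext => x; rewrite /tensor real_prod.
rewrite E in I1 e1; split; first exact: (cI_Re I1).
by apply: complexI; rewrite -ciR e1 -real_prod; apply: eq_bigr => i _; rewrite ciR.
Qed.

Definition ibox n (a b : 'I_n -> R) : set 'rV[R]_n :=
  [set x | forall i, a i < x ord0 i <= b i].

Lemma measurable_rectangle n (A : 'I_n -> set (measurableTypeR R)) :
  (forall i, measurable (A i)) ->
  measurable [set x : 'rV[R]_n | forall i, A i (x ord0 i)].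
Proof.
move=> mA; have -> : [set x : 'rV[R]_n | forall i, A i (x ord0 i)] =
    \bigcap_(i in [set: 'I_n])
      (fun x : 'rV[R]_n => x ord0 i : measurableTypeR R) @^-1` A i.
  by apply/seteqP; split => [x Ax i _|x Ax i]; [exact: Ax|exact: (Ax i I)].
apply: fin_bigcap_measurable => // i _.
by rewrite -[X in measurable X]setTI; exact: measurable_coord.
Qed.

Lemma iboxE n (a b : 'I_n -> R) :
  ibox a b = [set x | forall i, (fun i => `]a i, b i]%classic) i (x ord0 i)].
Proof. by apply/seteqP; split => x h i; have := h i; rewrite /= in_itv. Qed.

Lemma measurable_ibox n (a b : 'I_n -> R) : measurable (ibox a b).
Proof.
by rewrite iboxE; apply: (measurable_rectangle (A := fun i => `]a i, b i]%classic)).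
Qed.

Definition is_ibox n : set (set 'rV[R]_n) := [set A | exists a b, A = ibox a b].

Lemma is_iboxI n : setI_closed (@is_ibox n).
Proof.
move=> A B [a [b ->]] [c [d ->]].
exists (fun i => Num.max (a i) (c i)), (fun i => Num.min (b i) (d i)).
apply/seteqP; split => x /=.
  by move=> [h1 h2] i; rewrite gt_max le_min; move/andP: (h1 i) => [-> ->]; exact: h2.
by move=> h; split => i; have := h i;
  rewrite /= gt_max le_min => /andP[/andP[h1 h2] /andP[h3 h4]]; rewrite ?h1 ?h2 ?h3 ?h4.
Qed.

Lemma ibox_cover n : \bigcup_k ibox (fun=> - k%:R) (fun _ : 'I_n => k%:R) = [set: 'rV[R]_n].
Proof.
apply/seteqP; split => // x _.
have [k kx] : exists k : nat, \sum_(i < n) `|x ord0 i| < k%:R.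
  by exists (Num.trunc (\sum_(i < n) `|x ord0 i|)).+1; rewrite truncnS_gt.
exists k => // i.
have xi : `|x ord0 i| < k%:R.
  by apply: le_lt_trans kx; rewrite (bigD1 i)//= lerDl sumr_ge0.
by move: xi; rewrite ltr_norml => /andP[-> /ltW ->].
Qed.

Lemma rV_measurableE n : @measurable _ 'rV[R]_n = <<s @is_ibox n >>.
Proof.
apply/seteqP; split; last first.
  apply: smallest_sub; first exact: sigma_algebra_measurable.
  by move=> _ [a [b ->]]; exact: measurable_ibox.
apply: smallest_sub; first exact: smallest_sigma_algebra.
rewrite -bigcup_seq/=; apply: bigcup_sub => i _ _ [B mB <-]; rewrite setTI.
pose P := [set B : set R | <<s @is_ibox n >> ((fun x : 'rV[R]_n => x ord0 i) @^-1` B)].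
have sP : sigma_algebra setT P.
  split.
  - by rewrite /P /= preimage_set0; exact: sigma_algebra0.
  - move=> A PA; rewrite /P /= setTD preimage_setC -setTD; exact: sigma_algebraCD.
  - by move=> F PF; rewrite /P /= preimage_bigcup; apply: sigma_algebra_bigcup.
suff : measurable `<=` P by exact.
apply: smallest_sub => // _ [[a b] /= _ <-].
rewrite /P /=.
have -> : (fun x : 'rV[R]_n => x ord0 i) @^-1` `]a, b] =
    \bigcup_k ibox (fun j => if j == i then a else - k%:R)
                   (fun j => if j == i then b else k%:R).
  apply/seteqP; split => x /=.
    rewrite in_itv/= => xab.
    have : (\bigcup_k ibox (fun=> - k%:R) (fun _ : 'I_n => k%:R)) x by rewrite ibox_cover.
    by move=> [k _ xk]; exists k => // j; case: eqP => [->//|_]; exact: xk.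
  by move=> [k _ /(_ i)]; rewrite eqxx in_itv.
by apply: sigma_algebra_bigcup => k; apply: sub_sigma_algebra; do 2 eexists.
Qed.

Lemma lebesgue_ibox n (a b : 'I_n -> R) :
  mu n (ibox a b) = (\prod_(i < n) Num.max 0 (b i - a i))%:E.
Proof.
rewrite iboxE (lebesgue_rV_box (A := fun i => `]a i, b i]%classic))// -prodEFin; apply: eq_bigr => i _.
rewrite lebesgue_measure_itv /= lte_fin; case: ltP => h.
  by rewrite -EFinB max_r// subr_ge0 ltW.
by rewrite max_l// subr_le0.
Qed.

Lemma rV_measure_unique n (m : {measure set 'rV[R]_n -> \bar R}) :
  (forall a b, m (ibox a b) = mu n (ibox a b)) -> forall A, measurable A -> mu n A = m A.
Proof.
move=> h; apply: (@measure_unique _ _ _ (@is_ibox n)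
  (fun k => ibox (fun=> - k%:R) (fun=> k%:R)) (@rV_measurableE n) (@is_iboxI n)).
- by move=> k; do 2 eexists.
- exact: ibox_cover.
- by move=> _ [a [b ->]]; rewrite h.
- by move=> k; rewrite [X in (X < _)%E](lebesgue_ibox _ _) ltry.
Qed.

Lemma measurable_translate n (c : 'rV[R]_n) : measurable_fun setT (fun x : 'rV[R]_n => x + c).
Proof.
apply: measurable_fun_rV => i; under eq_fun do rewrite mxE.
by apply: measurable_funD => //; exact: measurable_coord.
Qed.

Lemma lebesgue_translate n (c : 'rV[R]_n) A : measurable A ->
  mu n A = (1%:E * mu n ((fun x => x + c)%R @^-1` A))%E.
Proof.
move=> mA; rewrite mul1e.
rewrite (rV_measure_unique (m := push_measure (mu n) (measurable_translate c)))//.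
move=> a b; rewrite push_measureE.
have -> : (fun x => x + c) @^-1` ibox a b =
    ibox (fun i => a i - c ord0 i) (fun i => b i - c ord0 i).
  by apply/seteqP; split => x h i; have := h i; rewrite /= mxE ltrBlDr lerBrDr.
rewrite [LHS](lebesgue_ibox _ _) [RHS](lebesgue_ibox _ _); congr EFin; apply: eq_bigr => i _.
by congr Num.max; ring.
Qed.

Lemma ci_translate n (c : 'rV[R]_n) (f : 'rV[R]_n -> R[i]) : cmeas f ->
  ci (mu n) (fun x => f (x + c)) = ci (mu n) f.
Proof.
move=> mf; rewrite [RHS](ci_change_var (measurable_translate c) ltr01
  (lebesgue_translate c))//.
by rewrite mul1r.
Qed.

Lemma rI_translate n (c : 'rV[R]_n) (f : 'rV[R]_n -> R) : measurable_fun setT f ->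
  rI (mu n) f <-> rI (mu n) (fun x => f (x + c)).
Proof.
move=> mf; exact: (rI_change_var (measurable_translate c) ltr01 (lebesgue_translate c)).
Qed.

Lemma rint_translate n (c : 'rV[R]_n) (f : 'rV[R]_n -> R) : measurable_fun setT f ->
  \int[mu n]_x f (x + c) = \int[mu n]_x f x.
Proof.
move=> mf; rewrite [RHS](rint_change_var (measurable_translate c) ltr01
  (lebesgue_translate c))//.
by rewrite mul1r.
Qed.

Lemma open_measurable_rV n (U : set 'rV[R]_n) : open U -> measurable U.
Proof.
move=> oU.
pose B (k : {ffun 'I_n -> rat} * nat) := ibox (fun i => ratr (k.1 i) - k.2.+1%:R^-1)
  (fun i => ratr (k.1 i) + k.2.+1%:R^-1 : R).
pose F m := if @unpickle ({ffun 'I_n -> rat} * nat)%type m is Some k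
  then (if `[< B k `<=` U >] then B k else set0) else set0.
have -> : U = \bigcup_m F m.
  apply/seteqP; split => [x Ux|x [m _]]; last first.
    rewrite /F; case: unpickle => // k; case: ifP => // /asboolP; exact.
  have : nbhs x U by exact: open_nbhs_nbhs.
  move=> /nbhs_ballP[e /= e0 xeU].
  have [m me] : exists m : nat, m.+1%:R^-1 < e / 2.
    exists (Num.trunc (e / 2)^-1); rewrite invf_plt ?posrE// ?divr_gt0//.
    by rewrite truncnS_gt.
  have m0 : 0 < m.+1%:R^-1 :> R by rewrite invr_gt0.
  have qP i : exists q : rat, x ord0 i < ratr q < x ord0 i + m.+1%:R^-1.
    have [q] := rat_in_itvoo (x := x ord0 i) (y := x ord0 i + m.+1%:R^-1) ltac:(by rewrite ltrDl).
    by rewrite in_itv/=; exists q.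
  pose q := [ffun i => projT1 (cid (qP i))].
  have xq i : x ord0 i < ratr (q i) < x ord0 i + m.+1%:R^-1.
    by rewrite /q ffunE; case: cid.
  exists (pickle (q, m)) => //; rewrite /F pickleK.
  have xB : B (q, m) x.
    by move=> i /=; have /andP[h1 h2] := xq i; rewrite ltrBlDr h2/= (le_trans (ltW h1))// lerDl ltW.
  case: asboolP => // h; exfalso; apply: h => y By; apply: xeU.
  split => // i j; rewrite (ord1 i); have /andP[h1 h2] := xq j.
  have /andP[/= h3 h4] := By j.
  change (`|x ord0 j - y ord0 j| < e); rewrite ltr_norml.
  move: (x ord0 j) (y ord0 j) (ratr (q j)) (m.+1%:R^-1) h1 h2 h3 h4 me m0.
  move=> X Y Q M h1 h2 h3 h4 me m0; apply/andP; split; lra.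
apply: bigcupT_measurable => m; rewrite /F; case: unpickle => // k.
by case: ifP => // _; exact: measurable_ibox.
Qed.

Lemma continuous_measurable_rV n (f : 'rV[R]_n -> R) : continuous f ->
  measurable_fun setT f.
Proof.
move=> cf; apply: (measurability _ (RGenOInfty.measurableE R)) => //.
move=> _ [_ [a ->] <-]; rewrite setTI; apply: open_measurable_rV.
by move/continuousP : cf; apply; exact: interval_open.
Qed.

End rV_integration.

(** * One-variable calculus *)

Section derivatives.
Context {R : realType}.
Implicit Types (f g : R -> R) (x c df dg : R).

Lemma derD f g x df dg : is_derive x 1 f df -> is_derive x 1 g dg ->
  is_derive x 1 (fun t => f t + g t) (df + dg).
Proof. by move=> hf hg; exact: is_deriveD. Qed.

Lemma derN f x df : is_derive x 1 f df -> is_derive x 1 (fun t => - f t) (- df).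
Proof. by move=> hf; exact: is_deriveN. Qed.

Lemma derB f g x df dg : is_derive x 1 f df -> is_derive x 1 g dg ->
  is_derive x 1 (fun t => f t - g t) (df - dg).
Proof. by move=> hf hg; exact: is_deriveB. Qed.

Lemma derM f g x df dg : is_derive x 1 f df -> is_derive x 1 g dg ->
  is_derive x 1 (fun t => f t * g t) (df * g x + f x * dg).
Proof.
move=> hf hg; have := is_deriveM hf hg; rewrite addrC => h.
by apply: is_derive_eq h _; rewrite /GRing.scale /= mulrC [f x * dg]mulrC.
Qed.

Lemma derZ f x c df : is_derive x 1 f df -> is_derive x 1 (fun t => c * f t) (c * df).
Proof. by move=> hf; have := is_deriveZ c hf; exact. Qed.

Lemma der_cst x c : is_derive x 1 (fun=> c) 0.
Proof. exact: is_derive_cst. Qed.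

Lemma der_id x : is_derive x 1 (fun t => t) 1.
Proof. exact: is_derive_id. Qed.

Lemma der_comp f g x df dg : is_derive (g x) 1 f df -> is_derive x 1 g dg ->
  is_derive x 1 (fun t => f (g t)) (df * dg).
Proof. by move=> hf hg; exact: is_derive1_comp. Qed.

Lemma der_affine f x c b df : is_derive (c * x + b) 1 f df ->
  is_derive x 1 (fun t => f (c * t + b)) (c * df).
Proof.
move=> hf; have h := derD (derZ c (der_id x)) (der_cst x b).
have := @der_comp f (fun t => c * t + b) x df _ hf h.
by rewrite addr0 mulr1 mulrC.
Qed.

Lemma der_lin f x c df : is_derive (c * x) 1 f df ->
  is_derive x 1 (fun t => f (c * t)) (c * df).
Proof.
move=> hf; have := @der_affine f x c 0 df; rewrite addr0 => /(_ hf).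
by under eq_fun do rewrite addr0.
Qed.

Lemma der_eq f x a b : is_derive x 1 f a -> a = b -> is_derive x 1 f b.
Proof. by move=> h <-. Qed.

Lemma der_cts f x df : is_derive x 1 f df -> {for x, continuous f}.
Proof. by move=> h; apply: differentiable_continuous; apply/derivable1_diffP. Qed.

Lemma der_cos x : is_derive x 1 cos (- sin x). Proof. exact: is_derive_cos. Qed.
Lemma der_sin x : is_derive x 1 sin (cos x). Proof. exact: is_derive_sin. Qed.

End derivatives.

Section calculus_line.
Context {R : realType}.
Local Notation leb := (@lebesgue_measure R).
Implicit Types (f F : R -> R) (a b : R).

Definition Iab a b : set R := `]a, b]%classic.

Lemma measurable_Iab a b : measurable (Iab a b : set (measurableTypeR R)).
Proof. exact: measurable_itv. Qed.

Lemma indIab a b x : \1_(Iab a b) x = ((a < x <= b)%R)%:R :> R.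
Proof.
have [h|h] := boolP (a < x <= b).
  by rewrite indicE mem_set// /Iab /= in_itv /= h.
by rewrite indicE memNset// /Iab /= in_itv /=; exact/negP.
Qed.

Lemma indpos x : \1_[set y : R | 0 < y] x = (0 < x)%R%:R :> R.
Proof.
have [h|h] := boolP (0 < x); first by rewrite indicE mem_set.
by rewrite indicE memNset//=; exact/negP.
Qed.

Lemma cts_cst (c : R) : continuous (fun _ : R => c).
Proof. by move=> x; exact: cvg_cst. Qed.

Lemma ind_le1 a b x : 0 <= (\1_(Iab a b) x : R) <= 1.
Proof. by rewrite indIab; case: (a < x <= b); rewrite ?lexx ?ler01. Qed.

Lemma rI_ind_mul (a b : R) f : continuous f -> rI leb (fun x => \1_(Iab a b) x * f x).
Proof.
move=> cf.
have If : leb.-integrable `[a, b] (EFin \o f).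
  apply: continuous_compact_integrable; first exact: segment_compact.
  exact: continuous_subspaceT.
have : leb.-integrable (Iab a b) (EFin \o f).
  by apply: integrableS If => //; [exact: measurable_Iab|exact: subset_itv_oc_cc].
move=> h; have := (integrable_restrict leb (measurable_Iab a b) measurableT (EFin \o f)).1.
rewrite setTI => /(_ h).
rewrite restrict_EFin (_ : f \_ _ = (fun x => \1_(Iab a b) x * f x))//.
by apply/funext => x; rewrite patchE indicE; case: ifP => xI; rewrite ?mul1r ?mul0r.
Qed.

(** Integrals over intervals are written with an indicator, to be integrals over the whole
   line, where the Fourier transform is defined. *)
Lemma ftc_ind f F a b : a <= b -> continuous f -> (forall x : R, is_derive x 1 F (f x)) ->
  \int[leb]_x (\1_(Iab a b) x * f x) = F b - F a.
Proof.
move=> ab cf dF.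
have -> : \int[leb]_x (\1_(Iab a b) x * f x) = \int[leb]_(x in Iab a b) f x.
  rewrite [RHS]Rintegral_mkcond; apply: eq_Rintegral => x _.
  by rewrite patchE indicE; case: ifP => xI; rewrite ?mul1r ?mul0r.
have [->|neab] := eqVneq a b.
  by rewrite /Iab set_itvoc0 Rintegral_set0 subrr.
have lab : a < b by rewrite lt_neqAle neab.
have If : leb.-integrable `[a, b] (EFin \o f).
  apply: continuous_compact_integrable; first exact: segment_compact.
  exact: continuous_subspaceT.
rewrite /Iab Rintegral_itv_obnd_cbnd; last first.
  by apply: integrableS If => //; exact: subset_itv_oc_cc.
rewrite /Rintegral (@continuous_FTC2 _ f F)//.
- exact: continuous_subspaceT.
- split.
  + by move=> x _; have := dF x; move=> [].
  + by apply: cvg_at_right_filter; exact: (der_cts (dF a)).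
  + by apply: cvg_at_left_filter; exact: (der_cts (dF b)).
- by move=> x _; rewrite derive1E; apply: derive_val.
Qed.

Lemma rI_oneDsqr : rI leb (fun x => (1 + x ^+ 2)^-1) /\
  \int[leb]_x (1 + x ^+ 2)^-1 = pi :> R.
Proof.
have c : continuous (fun x : R => (1 + x ^+ 2)^-1) by exact: continuous_oneDsqrV.
have p x : 0 <= (1 + x ^+ 2)^-1 :> R by rewrite invr_ge0 addr_ge0 ?sqr_ge0.
have E : (\int[leb]_x ((1 + x ^+ 2)^-1)%:E = (pi : R)%:E)%E.
  rewrite ge0_symfun_integralT//; last by move=> x /=; rewrite sqrrN.
  rewrite (_ : [set x : R | 0 <= x] = `[0, +oo[%classic); last first.
    by apply/seteqP; split => x /=; rewrite in_itv /= andbT.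
  by rewrite integral0y_oneDsqr -EFinM mulrC divfK.
split; last by rewrite /Rintegral E.
apply: rI_ltoo => //; first exact: continuous_measurable_fun.
by rewrite E ltry.
Qed.

(** The limit of the integrals over the intervals ]0, m], by dominated convergence. *)
Lemma ftc_halfline f F (g : R -> R) (l : R) : continuous f ->
  (forall x : R, is_derive x 1 F (f x)) -> rI leb g ->
  (forall x, `|\1_[set x | 0 < x] x * f x| <= g x) ->
  (fun m : nat => F m%:R) @ \oo --> l ->
  rI leb (fun x => \1_[set x | 0 < x] x * f x) /\
  \int[leb]_x (\1_[set x | 0 < x] x * f x) = l - F 0.
Proof.
move=> cf dF Ig fg Fl.
have mpos : measurable ([set x | 0 < x] : set (measurableTypeR R)).
  by rewrite -set_itvoy; exact: measurable_itv.
have mf : measurable_fun setT f by exact: continuous_measurable_fun.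
have h1 x : (fun m : nat => \1_(Iab 0 m%:R) x * f x) @ \oo --> \1_[set x | 0 < x] x * f x.
  apply: cvg_near_cst; near=> m; rewrite indIab indpos.
  have -> : x <= m%:R by near: m; exact: nbhs_infty_ger.
  by rewrite andbT.
have h2 m x : `|\1_(Iab 0 m%:R) x * f x| <= g x.
  apply: le_trans (fg x); rewrite !normrM ler_wpM2r// indIab indpos.
  by rewrite !normr_nat ler_nat; case: (0 < x)%R => //=; exact: leq_b1.
have [If _ h] := rint_dct
  (fun m => measurable_funM (measurable_indic (measurable_Iab 0 m%:R)) mf)
  (measurable_funM (measurable_indic mpos) mf) Ig h1 h2.
split => //; apply: (cvg_unique _ h) => //.
rewrite (_ : (fun m => \int[leb]_x (\1_(Iab 0 m%:R) \* f) x) = fun m => F m%:R - F 0).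
  2: by apply/funext => m; exact: ftc_ind.
by apply: cvgB => //; exact: cvg_cst.
Unshelve. all: by end_near. Qed.

End calculus_line.

Section four_points.
Context d (T : measurableType d) (R : realType) (mu : {measure set T -> \bar R}).

Lemma ipBr f g h : L2 mu f -> L2 mu g -> L2 mu h ->
  ip mu h (fun x => f x - g x) = ip mu h f - ip mu h g.
Proof.
move=> Lf Lg Lh; rewrite ipJ//; last exact: L2B.
by rewrite ipB// cJD cJN -!ipJ.
Qed.

(** Expansion of the squares. The distances between indicators of intervals are lengths of
   intervals, and by this identity they determine the inner products. *)
Lemma ip_four_points f g h k : L2 mu f -> L2 mu g -> L2 mu h -> L2 mu k ->
  2 * cRe (ip mu (fun x => f x - g x) (fun x => h x - k x)) =
  nr mu (fun x => f x - k x) + nr mu (fun x => g x - h x) -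
  nr mu (fun x => f x - h x) - nr mu (fun x => g x - k x).
Proof.
move=> Lf Lg Lh Lk; rewrite ipB//; last exact: L2B.
rewrite !ipBr// !nrB// !cE; ring.
Qed.

End four_points.

(** * The Fourier transform of an interval *)

Section line_transform.
Context {R : realType}.
Local Notation leb := (@lebesgue_measure R).
Implicit Types (f : R -> R[i]) (x a b : R).

Definition ft1 f x : R[i] := ci leb (fun t => f t * cis (- (2 * pi * x * t))).

Lemma cts_cos_lin (w : R) : continuous (fun t => cos (w * t)).
Proof. by move=> t; apply: der_cts; apply: der_lin; exact: der_cos. Qed.
Lemma cts_sin_lin (w : R) : continuous (fun t => sin (w * t)).
Proof. by move=> t; apply: der_cts; apply: der_lin; exact: der_sin. Qed.

Lemma cmeas_cis_lin (w : R) : @cmeas _ (measurableTypeR R) R (fun t => cis (- (w * t))).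
Proof.
split => /=; apply: continuous_measurable_fun.
  by under eq_fun do rewrite cosN; exact: cts_cos_lin.
under eq_fun do rewrite sinN -mulN1r.
by move=> t; apply: cvgM; [exact: cvg_cst|exact: cts_sin_lin].
Qed.

Lemma ft1_cI f x : cI leb f -> cI leb (fun t => f t * cis (- (2 * pi * x * t))).
Proof.
move=> [mf If]; split; first by apply: cmeasM => //; exact: cmeas_cis_lin.
by under eq_fun do rewrite cabsM cis_cabs mulr1.
Qed.

Definition cind a b : R -> R[i] := fun x => (\1_(Iab a b) x)%:C.

Lemma cI_cind a b : cI leb (cind a b).
Proof.
apply: cIR; have := @rI_ind_mul R a b (fun=> 1) (@cts_cst R 1).
by under eq_fun do rewrite mulr1.
Qed.

(** Translation and dilation reduce every interval to the unit interval. *)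
Lemma ft1_cind a b x : a < b ->
  ft1 (cind a b) x = (b - a)%:C * cis (- (2 * pi * x * a)) * ft1 (cind 0 1) ((b - a) * x).
Proof.
move=> ab; have ba : 0 < b - a by rewrite subr_gt0.
have mphi : measurable_fun setT (fun u : measurableTypeR R => ((b - a) * u + a : measurableTypeR R)).
  by apply: measurable_funD => //; exact: mulrl_measurable.
have nuE (A : set (measurableTypeR R)) : measurable A ->
    leb A = ((b - a)%:E * leb ((fun u => ((b - a) * u + a)%R) @^-1` A))%E.
  by move=> mA; rewrite {1}(lebesgue_affine a (lt0r_neq0 ba) mA) gtr0_norm.
rewrite /ft1 (ci_change_var mphi ba nuE); last by case: (ft1_cI x (cI_cind a b)).
rewrite -[RHS]mulrA; congr (_ * _); rewrite -(ciZ _ (ft1_cI _ (cI_cind 0 1))).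
apply: eq_ci => u /=; rewrite mulrCA; congr (_ * _).
  rewrite /cind !indIab; congr ((_ && _)%:R%:C).
    by rewrite -ltrBlDr subrr pmulr_rgt0.
  by rewrite -lerBrDr -[leRHS]mulr1 ler_pM2l.
by rewrite -cisD; congr cis; ring.
Qed.

Lemma ft1_unit_bound x : (1 + x ^+ 2) * cabs (ft1 (cind 0 1) x) ^+ 2 <= 2.
Proof.
set z := ft1 _ x.
have z1 : cabs z <= 1.
  have [_ I1] := cI_cind 0 1.
  apply: le_trans (cabs_ci (ft1_cI x (cI_cind 0 1))) _.
  rewrite (_ : \int[leb]_t _ = 1)//.
  have := @ftc_ind R (fun=> 1) (fun t => t) 0 1 ler01 (@cts_cst R 1) (fun t => der_id t).
  rewrite subr0 => e1; rewrite -[RHS]e1; apply: eq_Rintegral => t _.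
  by rewrite cabsM cis_cabs mulr1 cabsR mulr1 ger0_norm//; have /andP[] := @ind_le1 R 0 1 t.
have [->|x0] := eqVneq x 0.
  rewrite (_ : 1 + 0 ^+ 2 = 1 :> R) ?mul1r; last by ring.
  by have := exprn_ile1 2 (cabs_ge0 z) z1; lra.
set w := 2 * pi * x.
have w0 : w != 0 by rewrite /w mulf_neq0// mulf_neq0// gt_eqF ?pi_gt0.
have ds (t : R) : is_derive t 1 (fun t => w^-1 * sin (w * t)) (cos (w * t)).
  by apply: (der_eq (derZ _ (der_lin (der_sin _)))); rewrite mulKf.
have dc (t : R) : is_derive t 1 (fun t => w^-1 * cos (w * t)) (- sin (w * t)).
  by apply: (der_eq (derZ _ (der_lin (der_cos _)))); rewrite mulKf.
have cNs : continuous (fun t => - sin (w * t)).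
  by move=> t; apply: cvgN; exact: cts_sin_lin.
have zE : z = (w^-1 * sin w) +i* (w^-1 * (cos w - 1)).
  apply: ceqP => /=.
    have := ftc_ind ler01 (@cts_cos_lin w) ds.
    rewrite mulr1 mulr0 sin0 mulr0 subr0 => <-; apply: eq_Rintegral => t _.
    by rewrite -/w cosN mul0r subr0.
  have := ftc_ind ler01 cNs dc.
  rewrite mulr1 mulr0 cos0 -mulrBr => <-; apply: eq_Rintegral => t _.
  by rewrite -/w sinN mul0r addr0.
have e : w ^+ 2 * cabs z ^+ 2 = 2 - 2 * cos w.
  rewrite cabs_sqr zE /=.
  transitivity (sin w ^+ 2 + (cos w - 1) ^+ 2); first by field.
  by have := cos2Dsin2 w; lra.
have z2 : cabs z ^+ 2 <= 1 by have := cabs_ge0 z; nra.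
have : w ^+ 2 * cabs z ^+ 2 <= 4.
  by rewrite e; have := cos_geN1 w; lra.
have : 16 * x ^+ 2 <= w ^+ 2.
  have p4 : 4 <= pi ^+ 2 :> R by have := @pi_ge2 R; nra.
  rewrite /w !exprMn ler_wpM2r ?sqr_ge0//; lra.
have := sqr_ge0 (cabs z); have := sqr_ge0 x; nra.
Qed.

Lemma cmeas_cis_prod : @cmeas _ (measurableTypeR R * measurableTypeR R)%type R
  (fun z => cis (- (2 * pi * z.1 * z.2))).
Proof.
have m : measurable_fun setT (fun z : measurableTypeR R * measurableTypeR R =>
    - (2 * pi * z.1 * z.2) : measurableTypeR R).
  apply: measurable_funN; apply: measurable_funM => //.
  by apply: measurable_funM => //; exact: measurable_cst.
split.
  by apply: (measurableT_comp _ m); apply: continuous_measurable_fun; exact: continuous_cos.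
by apply: (measurableT_comp _ m); apply: continuous_measurable_fun; exact: continuous_sin.
Qed.

Lemma cmeas_ft1 f : cI leb f -> @cmeas _ (measurableTypeR R) R (ft1 f).
Proof.
move=> [mf _]; apply: (@cmeas_ci_param _ _ _ (measurableTypeR R) R leb
  (fun z => f z.2 * cis (- (2 * pi * z.1 * z.2)))).
apply: cmeasM; first exact: (cmeas_comp measurable_snd mf).
exact: cmeas_cis_prod.
Qed.

Lemma L2_ft1_unit : L2 leb (ft1 (cind 0 1)).
Proof.
apply: (L2_le (rIZ 2 (@rI_oneDsqr R).1)); first exact: cmeas_ft1 (cI_cind _ _).
move=> x; have p : 0 < 1 + x ^+ 2 by rewrite ltr_wpDr ?sqr_ge0.
by rewrite ler_pdivlMr// mulrC ft1_unit_bound.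
Qed.

(** The factor by which the transform multiplies squared norms; it is shown to be 1. *)
Definition pc : R := nr leb (ft1 (cind 0 1)).

Lemma cis_abs_eq (u v w : R[i]) : cabs u = 1 -> cabs (v * u * w) = cabs v * cabs w.
Proof. by move=> u1; rewrite !cabsM u1 mulr1. Qed.

Lemma nr_ft1_cind a b : a <= b ->
  L2 leb (ft1 (cind a b)) /\ nr leb (ft1 (cind a b)) = pc * (b - a).
Proof.
rewrite le_eqVlt => /orP[/eqP <-|ab].
  have -> : ft1 (cind a a) = fun=> 0.
    apply/funext => x; rewrite /ft1 -[RHS](ci0 leb); apply: eq_ci => t.
    by rewrite /cind indIab; case: (ltP a t) => h /=; rewrite mul0r.
  split; first exact: L20.
  by rewrite /nr; under eq_Rintegral do rewrite cabs0 expr0n/=; rewrite rint0 subrr mulr0.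
have ba : 0 < b - a by rewrite subr_gt0.
set G := ft1 (cind 0 1).
have e x : cabs (ft1 (cind a b) x) ^+ 2 = (b - a) ^+ 2 * cabs (G ((b - a) * x + 0)) ^+ 2.
  by rewrite addr0 ft1_cind// cis_abs_eq ?cis_cabs// exprMn cabsR ger0_norm// ltW.
have mphi : measurable_fun setT (fun u : measurableTypeR R => ((b - a) * u + 0 : measurableTypeR R)).
  by apply: measurable_funD => //; exact: mulrl_measurable.
have nuE (A : set (measurableTypeR R)) : measurable A ->
    leb A = ((b - a)%:E * leb ((fun u => ((b - a) * u + 0)%R) @^-1` A))%E.
  by move=> mA; rewrite {1}(lebesgue_affine 0 (lt0r_neq0 ba) mA) gtr0_norm.
have mG : measurable_fun setT (fun x => cabs (G x) ^+ 2).
  by apply: cmeas_sqr; exact: cmeas_ft1 (cI_cind _ _).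
have IG : rI leb (fun x => cabs (G ((b - a) * x + 0)) ^+ 2).
  by apply: (rI_change_var mphi ba nuE mG).1; case: L2_ft1_unit.
split.
  split; first exact: cmeas_ft1 (cI_cind _ _).
  by under eq_fun do rewrite e; exact: rIZ.
rewrite /nr; under eq_Rintegral do rewrite e.
rewrite rintZ// /pc /nr (rint_change_var mphi ba nuE mG).
by rewrite expr2 -mulrA mulrC.
Qed.

Lemma ft1B f g x : cI leb f -> cI leb g -> ft1 (fun t => f t - g t) x = ft1 f x - ft1 g x.
Proof.
move=> If Ig; rewrite /ft1 -ciB; [|exact: ft1_cI..].
by apply: eq_ci => t; rewrite mulrBl.
Qed.

Lemma cindB m a b : m <= a -> a <= b -> cind a b = (fun t => cind m b t - cind m a t).
Proof.
move=> ma ab; apply/funext => t; apply: ceqP; rewrite /cind !cE /= ?subrr// !indIab.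
have [h1|h1] := ltP a t; have [h2|h2] := leP t b; have [h3|h3] := ltP m t => //=;
  rewrite ?subr0 ?subrr//; lra.
Qed.

Lemma eq_opp0 (x : R) : x = - x -> x = 0.
Proof. by move=> h; lra. Qed.

(** Indicators are real-valued, which makes the inner products of their transforms real
   after the change of variables x to - x. *)
Lemma ft1_cind_opp a b x : ft1 (cind a b) (- x) = cj (ft1 (cind a b) x).
Proof.
rewrite /ft1 -ciJ; last exact: ft1_cI (cI_cind _ _).
by apply: eq_ci => t; rewrite cJM /cind cJR -cisN; congr (_ * cis _); ring.
Qed.

Lemma maxP0 (u v : R) : (0 <= v -> u = v) -> (v < 0 -> u = 0) -> u = Num.max 0 v.
Proof.
move=> h1 h2; have [h|h] := leP 0 v; first by rewrite h1.
by rewrite h2.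
Qed.

Lemma overlap_dist (a b c d : R) : a <= b -> c <= d ->
  (`|b - c| + `|a - d| - `|b - d| - `|a - c|) / 2 =
  Num.max 0 (Num.min b d - Num.max a c).
Proof.
move=> ab cd.
case: (lerP b d) => h1; case: (lerP a c) => h2; case: (lerP b c) => h3;
  case: (lerP a d) => h4; try lra; apply: maxP0 => h7; lra.
Qed.

Lemma ft1_cindB (m a b x : R) : m <= a -> a <= b ->
  ft1 (cind a b) x = ft1 (cind m b) x - ft1 (cind m a) x.
Proof.
move=> ma ab; rewrite (cindB ma ab).
exact: ft1B (cI_cind m b) (cI_cind m a).
Qed.

Lemma ip_ft1_cind (a b c d : R) : a <= b -> c <= d ->
  ip leb (ft1 (cind a b)) (ft1 (cind c d)) =
  (pc * Num.max 0 (Num.min b d - Num.max a c))%:C.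
Proof.
move=> ab cd; have [La na] := nr_ft1_cind ab; have [Lc nc] := nr_ft1_cind cd.
apply: ceqP; last first.
  apply: eq_opp0; rewrite /ip; set h := fun x => cIm (ft1 (cind a b) x * cj (ft1 (cind c d) x)).
  have mh : measurable_fun setT (h : measurableTypeR R -> R).
    by have [[]] := ip_cI La Lc.
  have mphi : measurable_fun setT (fun u : measurableTypeR R => (-1 * u + 0 : measurableTypeR R)).
    by apply: measurable_funD => //; exact: mulrl_measurable.
  have nuE (A : set (measurableTypeR R)) : measurable A ->
      leb A = (1%:E * leb ((fun u => (-1 * u + 0)%R) @^-1` A))%E.
    move=> mA; have n1 : -1 != 0 :> R by rewrite oppr_eq0 oner_neq0.
    by rewrite {1}(lebesgue_affine 0 n1 mA) normrN1.
  rewrite [LHS](rint_change_var mphi ltr01 nuE mh) mul1r -rintN; last first.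
    exact: cI_Im (ip_cI La Lc).
  apply: eq_Rintegral => x _; rewrite /h addr0 mulN1r !ft1_cind_opp cJK.
  by rewrite !cE; ring.
pose m := Num.min a c.
have ma : m <= a by rewrite ge_min lexx.
have mc : m <= c by rewrite ge_min lexx orbT.
pose U t := ft1 (cind m t).
have LU t : m <= t -> L2 leb (U t) by move=> mt; case: (nr_ft1_cind mt).
have nU s t : m <= s -> m <= t -> nr leb (fun x => U s x - U t x) = pc * `|s - t|.
  move=> ms mt; wlog st : s t ms mt / t <= s.
    move=> H; have [st|ts] := leP t s; first exact: H.
    by rewrite nrBC distrC; apply: H => //; exact: ltW.
  have <- : ft1 (cind t s) = fun x => U s x - U t x.
    by apply/funext => x; exact: ft1_cindB.
  by case: (nr_ft1_cind st) => _ ->; rewrite ger0_norm ?subr_ge0.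
have mb := le_trans ma ab; have md := le_trans mc cd.
have eab : ft1 (cind a b) = fun x => U b x - U a x.
  by apply/funext => x; exact: ft1_cindB.
have ecd : ft1 (cind c d) = fun x => U d x - U c x.
  by apply/funext => x; exact: ft1_cindB.
have E : cRe (ip leb (ft1 (cind a b)) (ft1 (cind c d))) =
    pc * (`|b - c| + `|a - d| - `|b - d| - `|a - c|) / 2.
  have := ip_four_points (LU _ mb) (LU _ ma) (LU _ md) (LU _ mc).
  rewrite (nU b c mb mc) (nU a d ma md) (nU b d mb md) (nU a c ma mc) eab ecd => h.
  have n2 : 2 != 0 :> R by [].
  by apply: (mulfI n2); rewrite {}h; field.
rewrite E -[RHS]/(pc * _) -mulrA; congr (_ * _).
exact: overlap_dist.
Qed.

(** The modulus of the transform of the one-sided exponential is explicit; comparing its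
   norm with that of the exponential determines the constant pc. *)
Definition hexp (t : R) : R := \1_[set y : R | 0 < y] t * expR (- t).

Lemma hexp_le (t : R) : 0 <= hexp t <= 4 * (1 + t ^+ 2)^-1.
Proof.
have p : 0 < 1 + t ^+ 2 by rewrite ltr_wpDr ?sqr_ge0.
rewrite /hexp indpos; have [t0|t0] := ltP 0 t; last first.
  by rewrite mul0r lexx/= mulr_ge0// invr_ge0 ltW.
rewrite mul1r expR_ge0/= ler_pdivlMr// expRN mulrC ler_pdivrMr ?expR_gt0//.
have h : 1 + t / 2 <= expR (t / 2) := expR_ge1Dx _.
have -> : expR t = expR (t / 2) ^+ 2.
  by rewrite expr2 -expRD; congr expR; field.
have : 0 < 1 + t / 2 by lra.
by move=> h0; nra.
Qed.

Lemma cts_exp (c : R) : continuous (fun t => expR (c * t)).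
Proof. by move=> t; apply: der_cts; apply: der_lin; exact: is_derive_expR. Qed.

Lemma der_exp (c x : R) : is_derive x 1 (fun t => expR (c * t)) (c * expR (c * x)).
Proof. by apply: der_lin; exact: is_derive_expR. Qed.

Lemma cvg_expNn : (fun m : nat => expR (- m%:R)) @ \oo --> (0 : R).
Proof.
apply: (seq_squeeze0 _ (@cvg_harmonic R)) => m.
rewrite expR_ge0/= expRN lef_pV2 ?posrE ?expR_gt0//.
by rewrite -natr1 addrC expR_ge1Dx.
Qed.

Lemma rI_hexp : [/\ rI leb hexp, rI leb (fun t => hexp t ^+ 2) &
  \int[leb]_t hexp t ^+ 2 = 1 / 2].
Proof.
have mh : measurable_fun setT (hexp : measurableTypeR R -> R).
  apply: measurable_funM.
    by apply: measurable_indic; rewrite -set_itvoy; exact: measurable_itv.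
  apply: continuous_measurable_fun; have := @cts_exp (-1).
  by under eq_fun do rewrite mulN1r.
have Ig := rIZ 4 (@rI_oneDsqr R).1.
have h1 t : `|hexp t| <= 4 * (1 + t ^+ 2)^-1.
  by have /andP[h0 h] := hexp_le t; rewrite ger0_norm.
have e t : hexp t ^+ 2 = \1_[set y : R | 0 < y] t * expR (-2 * t).
  rewrite /hexp exprMn indpos -expRM_natl; congr (_ * expR _); last by ring.
  by case: (0 < t)%R; rewrite ?expr1n ?expr0n.
have d2 (x : R) : is_derive x 1 (fun t => - (1 / 2) * expR (-2 * t)) (expR (-2 * x)).
  by apply: (der_eq (derZ _ (der_exp _ _))); field.
have b2 t : `|\1_[set y : R | 0 < y] t * expR (-2 * t)| <= 4 * (1 + t ^+ 2)^-1.
  rewrite -e; have /andP[h0 h] := hexp_le t; rewrite ger0_norm ?sqr_ge0//.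
  apply: le_trans h; rewrite expr2 ler_piMr// /hexp indpos.
  have [t0|t0] := ltP 0 t; last by rewrite mul0r ler01.
  by rewrite mul1r -[leRHS]expR0 ler_expR oppr_le0 ltW.
have l2 : (fun m : nat => - (1 / 2) * expR (-2 * m%:R)) @ \oo --> (0 : R).
  apply: seq_mul0; have h := seq_mul0 1 cvg_expNn.
  apply: (seq_squeeze0 _ h) => m; rewrite expR_ge0 mul1r ler_expR.
  have : 0 <= m%:R :> R by [].
  by move: (m%:R : R) => M; lra.
have [I2 v2] := ftc_halfline (@cts_exp (-2)) d2 Ig b2 l2.
split; first exact: (rI_le Ig).
  by under eq_fun do rewrite e.
by under eq_Rintegral do rewrite e; rewrite v2 mulr0 expR0; ring.
Qed.

Lemma ft1_hexp x : cabs (ft1 (fun t => (hexp t)%:C) x) ^+ 2 = (1 + (2 * pi * x) ^+ 2)^-1.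
Proof.
set w := 2 * pi * x.
have p : 1 + w ^+ 2 != 0 by rewrite gt_eqF// ltr_wpDr ?sqr_ge0.
have Ig := rIZ 4 (@rI_oneDsqr R).1.
have dom (h : R -> R) : (forall t, `|h t| <= 1) ->
    forall t, `|\1_[set y : R | 0 < y] t * (expR (-1 * t) * h t)| <= 4 * (1 + t ^+ 2)^-1.
  move=> h1 t; rewrite mulrA mulN1r -/(hexp t) normrM.
  have /andP[h0 hh] := hexp_le t.
  by rewrite (le_trans _ hh)// ger0_norm// ler_piMr.
have lim (h : R -> R) (C : R) : (forall t, `|h t| <= C) ->
    (fun m : nat => expR (-1 * m%:R) * h m%:R) @ \oo --> (0 : R).
  move=> hC; apply/norm_cvg0P.
  apply: (seq_squeeze0 _ (seq_mul0 C cvg_expNn)) => m /=.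
  by rewrite normr_ge0/= normrM mulN1r ger0_norm ?expR_ge0// mulrC ler_wpM2r ?expR_ge0.
have bnd (u v t : R) : `|u * sin (w * t) + v * cos (w * t)| <= `|u| + `|v|.
  rewrite (le_trans (ler_normD _ _))// lerD// normrM ler_piMr//.
    by rewrite ler_norml sin_geN1 sin_le1.
  by rewrite ler_norml cos_geN1 cos_le1.
have dsc (u v t : R) : is_derive t 1 (fun t => u * sin (w * t) + v * cos (w * t))
    (u * (w * cos (w * t)) + v * (w * - sin (w * t))).
  by apply: derD; apply: derZ; apply: der_lin.
have cE_ (h : R -> R) : continuous h -> continuous (fun t : R => expR (-1 * t) * h t).
  by move=> ch t; apply: cvgM; [exact: cts_exp|exact: ch].
have dr (t : R) : is_derive t 1 (fun t => expR (-1 * t) *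
    (w / (1 + w ^+ 2) * sin (w * t) + - (1 + w ^+ 2)^-1 * cos (w * t)))
    (expR (-1 * t) * cos (w * t)).
  by apply: (der_eq (derM (der_exp _ _) (dsc _ _ _))); field.
have di (t : R) : is_derive t 1 (fun t => expR (-1 * t) *
    ((1 + w ^+ 2)^-1 * sin (w * t) + w / (1 + w ^+ 2) * cos (w * t)))
    (expR (-1 * t) * - sin (w * t)).
  by apply: (der_eq (derM (der_exp _ _) (dsc _ _ _))); field.
have br t : `|cos (w * t)| <= 1 by rewrite ler_norml cos_geN1 cos_le1.
have bi t : `|- sin (w * t)| <= 1 by rewrite normrN ler_norml sin_geN1 sin_le1.
have cNs : continuous (fun t => - sin (w * t)).
  by move=> t; apply: cvgN; exact: cts_sin_lin.
have [_ vr] := ftc_halfline (cE_ _ (@cts_cos_lin w)) dr Ig (dom _ br)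
  (lim (fun t => w / (1 + w ^+ 2) * sin (w * t) + - (1 + w ^+ 2)^-1 * cos (w * t)) _ (bnd _ _)).
have [_ vi] := ftc_halfline (cE_ _ cNs) di Ig (dom _ bi)
  (lim (fun t => (1 + w ^+ 2)^-1 * sin (w * t) + w / (1 + w ^+ 2) * cos (w * t)) _ (bnd _ _)).
have -> : ft1 (fun t => (hexp t)%:C) x = (1 + w ^+ 2)^-1 +i* (- (w / (1 + w ^+ 2))).
  apply: ceqP; rewrite -[RHS]/(_ : R).
    transitivity (\int[leb]_t (\1_[set y : R | 0 < y] t * (expR (-1 * t) * cos (w * t)))).
      apply: eq_Rintegral => t _; by rewrite cE /= -/w cosN mulN1r mul0r subr0 mulrA.
    by rewrite vr !mulr0 sin0 cos0 expR0 /=; field.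
  transitivity (\int[leb]_t (\1_[set y : R | 0 < y] t * (expR (-1 * t) * - sin (w * t)))).
    apply: eq_Rintegral => t _; by rewrite cE /= -/w sinN mulN1r mul0r addr0 mulrA.
  by rewrite vi !mulr0 sin0 cos0 expR0 /=; field.
by rewrite cabs_sqr /=; field.
Qed.

Lemma nr_ft1_hexp : L2 leb (ft1 (fun t => (hexp t)%:C)) /\
  nr leb (ft1 (fun t => (hexp t)%:C)) = 1 / 2.
Proof.
have [I1 _ _] := rI_hexp; have [Iq vq] := @rI_oneDsqr R.
have tp : 0 < 2 * pi :> R by rewrite mulr_gt0// pi_gt0.
have mphi : measurable_fun setT (fun u : measurableTypeR R => (2 * pi * u + 0 : measurableTypeR R)).
  by apply: measurable_funD => //; exact: mulrl_measurable.
have nuE (A : set (measurableTypeR R)) : measurable A ->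
    leb A = ((2 * pi)%:E * leb ((fun u => (2 * pi * u + 0)%R) @^-1` A))%E.
  by move=> mA; rewrite {1}(lebesgue_affine 0 (lt0r_neq0 tp) mA) gtr0_norm.
have mq := rI_meas Iq.
have I2 := (rI_change_var mphi tp nuE mq).1 Iq.
have v2 := rint_change_var mphi tp nuE mq.
have e x : cabs (ft1 (fun t => (hexp t)%:C) x) ^+ 2 = (1 + (2 * pi * x + 0) ^+ 2)^-1.
  by rewrite ft1_hexp addr0.
split.
  split; first exact: cmeas_ft1 (cIR I1).
  by under eq_fun do rewrite e; exact: I2.
rewrite /nr; under eq_Rintegral do rewrite e.
move: v2; rewrite vq => v2; apply: (mulfI (lt0r_neq0 tp)).
by rewrite -v2; field.
Qed.

End line_transform.

(** * Plancherel's theorem *)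

Section polarization.
Context d1 d2 (T1 : measurableType d1) (T2 : measurableType d2) (R : realType).
Variables (m1 : {measure set T1 -> \bar R}) (m2 : {measure set T2 -> \bar R}).

Lemma polarization (c : R) (f g : T1 -> R[i]) (F G : T2 -> R[i]) :
  L2 m1 f -> L2 m1 g -> L2 m2 F -> L2 m2 G ->
  nr m2 F = c * nr m1 f -> nr m2 G = c * nr m1 g ->
  (forall a : R[i], nr m2 (fun x => a * F x + G x) = c * nr m1 (fun x => a * f x + g x)) ->
  ip m2 F G = c%:C * ip m1 f g.
Proof.
move=> Lf Lg LF LG eF eG e.
have h a : cRe (a * ip m2 F G) = c * cRe (a * ip m1 f g).
  have := e a; rewrite !nr_lin// eF eG.
  set A := cRe _; set B := cRe _; lra.
have h1 := h 1; have hi := h ('i%C); rewrite !mul1r in h1.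
have [ri ii] : cRe ('i%C : R[i]) = 0 /\ cIm ('i%C : R[i]) = 1 by [].
have [rc ic] : cRe (c%:C : R[i]) = c /\ cIm (c%:C : R[i]) = 0 by [].
apply: ceqP; rewrite !cE rc ic mul0r ?subr0 ?addr0 //.
move: hi; rewrite !cE ri ii !mul0r !mul1r !sub0r mulrN => /oppr_inj; exact.
Qed.

End polarization.

Section tensor_L2.
Context {R : realType} {n : nat}.
Local Notation leb := (@lebesgue_measure R).
Local Notation mu := (@lebesgue_rV R n).

Lemma tensorM (f g : 'I_n -> R -> R[i]) :
  (fun x => tensor f x * tensor g x) = tensor (fun i t => f i t * g i t).
Proof. by apply/funext => x; rewrite /tensor big_split. Qed.

Lemma cj_prod (I : Type) (s : seq I) (F : I -> R[i]) :
  cj (\prod_(i <- s) F i) = \prod_(i <- s) cj (F i).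
Proof.
elim/big_rec2 : _ => [|i x y _ <-]; last by rewrite cJM.
by apply: ceqP; rewrite !cE //= oppr0.
Qed.

Lemma L2_tensor (f : 'I_n -> R -> R[i]) : (forall i, L2 leb (f i)) ->
  L2 mu (tensor f) /\ nr mu (tensor f) = \prod_(i < n) nr leb (f i).
Proof.
move=> Lf; have [I1 e1] := rint_tensor (fun i => (Lf i).2).
have E x : cabs (tensor f x) ^+ 2 = \prod_(i < n) cabs (f i (x ord0 i)) ^+ 2.
  by rewrite /tensor cabs_prod prodrXl.
split; last by rewrite /nr; under eq_Rintegral do rewrite E.
split; first by apply: cmeas_tensor => i; case: (Lf i).
by under eq_fun do rewrite E.
Qed.

Lemma ip_tensor (f g : 'I_n -> R -> R[i]) : (forall i, L2 leb (f i)) ->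
  (forall i, L2 leb (g i)) ->
  ip mu (tensor f) (tensor g) = \prod_(i < n) ip leb (f i) (g i).
Proof.
move=> Lf Lg; rewrite /ip.
have [_ <-] := ci_tensor_rV (fun i => ip_cI (Lf i) (Lg i)).
congr ci; rewrite -tensorM; apply/funext => x; congr (_ * _).
by rewrite /tensor cj_prod.
Qed.

End tensor_L2.

Section fourier_rV.
Context {R : realType} {n : nat}.
Local Notation leb := (@lebesgue_measure R).
Local Notation mu := (@lebesgue_rV R n).
Local Notation E := 'rV[R]_n.
Implicit Types (f g u v : E -> R[i]).

Lemma measurable_dotr : measurable_fun setT (fun z : E * E => dotr z.1 z.2).
Proof.
rewrite /dotr; apply: measurable_sum => i.
apply: measurable_funM.
  exact: (measurableT_comp (@measurable_coord R n i) measurable_fst).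
exact: (measurableT_comp (@measurable_coord R n i) measurable_snd).
Qed.

Lemma cmeas_cis d (T : measurableType d) (h : T -> R) : measurable_fun setT h ->
  cmeas (fun x => cis (h x)).
Proof.
move=> mh; split.
  by apply: (measurableT_comp _ mh); apply: continuous_measurable_fun; exact: continuous_cos.
by apply: (measurableT_comp _ mh); apply: continuous_measurable_fun; exact: continuous_sin.
Qed.

Lemma cmeas_cis_dotr : cmeas (fun z : E * E => cis (- (2 * pi * dotr z.1 z.2))).
Proof.
apply: cmeas_cis; apply: measurable_funN; apply: measurable_funM.
  exact: measurable_cst.
exact: measurable_dotr.
Qed.

Lemma cmeas_cis_dotr1 (x : E) : cmeas (fun xi : E => cis (- (2 * pi * dotr x xi))).
Proof. exact: (cmeas_comp (measurable_pair1 x) cmeas_cis_dotr). Qed.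

Lemma fourier_cI f x : cI mu f -> cI mu (fun xi => f xi * cis (- (2 * pi * dotr x xi))).
Proof.
move=> [mf If]; split; first by apply: cmeasM => //; exact: cmeas_cis_dotr1.
by under eq_fun do rewrite cabsM cis_cabs mulr1.
Qed.

Lemma cmeas_fourier f : cmeas f -> cmeas (fourier f).
Proof.
move=> mf; apply: (@cmeas_ci_param _ _ _ E R mu
  (fun z => f z.2 * cis (- (2 * pi * dotr z.1 z.2)))).
apply: cmeasM; first exact: (cmeas_comp measurable_snd mf).
exact: cmeas_cis_dotr.
Qed.

Lemma fourier_bound f x : cI mu f -> cabs (fourier f x) <= \int[mu]_y cabs (f y).
Proof.
move=> If; apply: le_trans (cabs_ci (fourier_cI x If)) _.
by under eq_Rintegral do rewrite cabsM cis_cabs mulr1.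
Qed.

Lemma fourier_lin (a : R[i]) f g x : cI mu f -> cI mu g ->
  fourier (fun y => a * f y + g y) x = a * fourier f x + fourier g x.
Proof.
move=> If Ig; rewrite /fourier -[LHS]/(ci mu _) -ci_lin; [|exact: fourier_cI..].
by apply: eq_ci => y; rewrite mulrDl mulrA.
Qed.

Lemma fourierB f g x : cI mu f -> cI mu g ->
  fourier (fun y => f y - g y) x = fourier f x - fourier g x.
Proof.
move=> If Ig; rewrite /fourier -[LHS]/(ci mu _) -ciB; [|exact: fourier_cI..].
by apply: eq_ci => y; rewrite mulrBl.
Qed.

Lemma fourier_tensor (f : 'I_n -> R -> R[i]) x : (forall i, cI leb (f i)) ->
  fourier (tensor f) x = \prod_(i < n) ft1 (f i) (x ord0 i).
Proof.
move=> If; have [_ <-] := ci_tensor_rV (fun i => ft1_cI (x ord0 i) (If i)).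
apply: eq_ci => y; rewrite /tensor big_split /=; congr (_ * _).
rewrite /dotr mulr_sumr -sumrN (big_morph cis (@cisD R) (@cis0 R)).
by apply: eq_bigr => i _; congr cis; ring.
Qed.

(** On this class the transform is both given by the integral and an isometry of L^2. *)
Definition X f := cI mu f /\ L2 mu f.

Lemma X_lin (a : R[i]) f g : X f -> X g -> X (fun x => a * f x + g x).
Proof. by move=> [If Lf] [Ig Lg]; split; [exact: cI_lin|exact: L2_lin]. Qed.

Lemma XB f g : X f -> X g -> X (fun x => f x - g x).
Proof. by move=> [If Lf] [Ig Lg]; split; [exact: cIB|exact: L2B]. Qed.

Lemma X0 : X (fun=> 0). Proof. by split; [exact: cI0|exact: L20]. Qed.

Lemma X_tensor (f : 'I_n -> R -> R[i]) : (forall i, cI leb (f i)) ->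
  (forall i, L2 leb (f i)) -> X (tensor f).
Proof. by move=> If Lf; split; [case: (ci_tensor_rV If)|case: (L2_tensor Lf)]. Qed.

Definition ic (A : set E) : E -> R[i] := fun x => (\1_A x)%:C.

Lemma ic_ibox (a b : 'I_n -> R) : ic (ibox a b) = tensor (fun i => cind (a i) (b i)).
Proof.
apply/funext => x; rewrite /ic /tensor /cind real_prod; congr (_%:C).
under eq_bigr do rewrite indIab.
have [h|h] := pselect (ibox a b x).
  by rewrite indicE mem_set// big1// => i _; rewrite h.
have [i hi] : exists i, ~ (a i < x ord0 i <= b i) by apply/existsNP.
by rewrite indicE memNset// (bigD1 i)//=; move/negP/negbTE : hi => ->; rewrite mul0r.
Qed.

Lemma L2_cind a b : L2 leb (cind a b).
Proof.
have [m I] := cI_cind a b; split => //.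
under eq_fun do rewrite /cind cabsR real_normK ?num_real//.
apply: (rI_le I); first exact: measurable_funX (measurable_indic (measurable_Iab a b)).
move=> x; rewrite ger0_norm ?sqr_ge0// cabsR indIab; case: (a < x <= b)%R;
  by rewrite ?expr1n ?expr0n ?normr0 ?normr1.
Qed.

Lemma ip_cind a b c d : ip leb (cind a b) (cind c d) =
  (Num.max 0 (Num.min b d - Num.max a c))%:C.
Proof.
transitivity (ci leb (fun x => (\1_(Iab (Num.max a c) (Num.min b d)) x)%:C)); last first.
  rewrite ciR; congr (_%:C); set p := Num.max a c; set q := Num.min b d.
  have [h|h] := leP 0 (q - p).
    rewrite subr_ge0 in h; have := ftc_ind h (@cts_cst R 1) (fun x => der_id x).
    by under eq_Rintegral do rewrite mulr1.
  rewrite -[RHS](rint0 leb); apply: eq_Rintegral => x _; rewrite indIab.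
  have [h1|//] := ltP p x; have [h2|//] := leP x q; lra.
apply: eq_ci => x; rewrite /cind cJR !indIab gt_max le_min.
apply: ceqP; rewrite !cE/=; last by ring.
by case: (a < x); case: (x <= b); case: (c < x); case: (x <= d) => /=; ring.
Qed.

Inductive step : (E -> R[i]) -> Prop :=
| step_nil : step (fun=> 0)
| step_cons (c : R[i]) (a b : 'I_n -> R) s : (forall i, a i <= b i) -> step s ->
    step (fun x => c * ic (ibox a b) x + s x).

Lemma X_ibox a b : X (ic (ibox a b)).
Proof.
by rewrite ic_ibox; apply: X_tensor => i; [exact: cI_cind|exact: L2_cind].
Qed.

Lemma step_X s : step s -> X s.
Proof.
elim => [|c a b {}s ab ss IH]; first exact: X0.
by apply: X_lin => //; exact: X_ibox.
Qed.

Definition pcn : R := pc ^+ n.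

Lemma fourier_ibox a b : fourier (ic (ibox a b)) =
  tensor (fun i => ft1 (cind (a i) (b i))).
Proof.
by apply/funext => x; rewrite ic_ibox fourier_tensor// => i; exact: cI_cind.
Qed.

Lemma L2_fourier_ibox a b : (forall i, a i <= b i) -> L2 mu (fourier (ic (ibox a b))).
Proof.
move=> ab; rewrite fourier_ibox.
by apply: (L2_tensor _).1 => i; case: (nr_ft1_cind (ab i)).
Qed.

Lemma ip_fourier_ibox a b c d : (forall i, a i <= b i) -> (forall i, c i <= d i) ->
  ip mu (fourier (ic (ibox a b))) (fourier (ic (ibox c d))) =
  pcn%:C * ip mu (ic (ibox a b)) (ic (ibox c d)).
Proof.
move=> ab cd; rewrite !fourier_ibox !ic_ibox.
rewrite ip_tensor => [|i|i]; [|by case: (nr_ft1_cind (ab i))|by case: (nr_ft1_cind (cd i))].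
rewrite ip_tensor => [|i|i]; [|exact: L2_cind..].
have e i : ip leb (ft1 (cind (a i) (b i))) (ft1 (cind (c i) (d i))) =
    pc%:C * ip leb (cind (a i) (b i)) (cind (c i) (d i)).
  by rewrite ip_ft1_cind// ip_cind rmorphM.
under eq_bigr do rewrite e.
rewrite big_split /=; congr (_ * _).
by rewrite prodr_const card_ord /pcn rmorphXn.
Qed.

Lemma step_isometry s : step s -> L2 mu (fourier s) /\
  (forall a b, (forall i, a i <= b i) ->
     ip mu (fourier s) (fourier (ic (ibox a b))) = pcn%:C * ip mu s (ic (ibox a b))) /\
  (forall s', step s' -> L2 mu (fourier s') ->
     ip mu (fourier s) (fourier s') = pcn%:C * ip mu s s').
Proof.
have F0 : fourier (fun _ : E => 0 : R[i]) = fun=> 0.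
  by apply/funext => x; rewrite -[RHS](ci0 mu); apply: eq_ci => y; rewrite mul0r.
have ip0 (h : E -> R[i]) : ip mu (fun=> 0) h = 0.
  by rewrite -[RHS](ci0 mu); apply: eq_ci => y; rewrite mul0r.
have part1 s1 : step s1 -> L2 mu (fourier s1) /\
  (forall a b, (forall i, a i <= b i) ->
     ip mu (fourier s1) (fourier (ic (ibox a b))) = pcn%:C * ip mu s1 (ic (ibox a b))).
  elim => [|c a b t ab st [Lt IH]].
    by rewrite F0; split => [|a b ab]; [exact: L20|rewrite !ip0 mulr0].
  have [It Lt'] := step_X st; have [Ib Lb] := X_ibox a b.
  have -> : fourier (fun x => c * ic (ibox a b) x + t x) =
      (fun x => c * fourier (ic (ibox a b)) x + fourier t x).
    by apply/funext => x; rewrite fourier_lin.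
  have Lfb := L2_fourier_ibox ab.
  split; first exact: L2_lin.
  move=> a' b' ab'; have [_ Lb'] := X_ibox a' b'; have Lfb' := L2_fourier_ibox ab'.
  by rewrite !ip_lin// IH// ip_fourier_ibox// mulrDr; congr (_ + _); rewrite mulrCA.
move=> ss; have [Ls h] := part1 _ ss; do 2 split => //.
move=> s'; elim => [|c a b t ab st IH].
  move=> _; rewrite F0 (ipJ (@L20 _ _ _ mu) Ls) (ipJ (@L20 _ _ _ mu) (step_X ss).2) !ip0.
  by apply: ceqP; rewrite !cE /=; ring.
have [It Lt'] := step_X st; have [Ib Lb] := X_ibox a b.
have [Lt _] := part1 _ st; have Lfb := L2_fourier_ibox ab.
have -> : fourier (fun x => c * ic (ibox a b) x + t x) =
    (fun x => c * fourier (ic (ibox a b)) x + fourier t x).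
  by apply/funext => x; rewrite fourier_lin.
move=> _; have Ls' := (step_X ss).2.
by rewrite !ip_linr// IH// h// mulrDr; congr (_ + _); rewrite mulrCA.
Qed.

(** Both distances are needed: the first one controls the transforms pointwise, the second
   one is the distance of the isometry. *)
Definition approx u := X u /\ forall e, 0 < e -> exists s, [/\ step s,
  \int[mu]_x cabs (u x - s x) < e & nr mu (fun x => u x - s x) < e].

Definition L1d u v : R := \int[mu]_x cabs (u x - v x).

Lemma L1d_triangle u v w : cI mu u -> cI mu v -> cI mu w -> L1d u w <= L1d u v + L1d v w.
Proof.
move=> Iu Iv Iw; rewrite /L1d -rintD; [|by case: (cIB Iu Iv)|by case: (cIB Iv Iw)].
apply: rint_le; [by case: (cIB Iu Iw)| |move=> x].
  by apply: rID; [case: (cIB Iu Iv)|case: (cIB Iv Iw)].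
by rewrite (le_trans _ (cabsD _ _))// addrA subrK.
Qed.

Lemma nr_triangle u v w : L2 mu u -> L2 mu v -> L2 mu w ->
  nr mu (fun x => u x - w x) <= 2 * nr mu (fun x => u x - v x) + 2 * nr mu (fun x => v x - w x).
Proof.
move=> Lu Lv Lw; have := nrD_le (L2B Lu Lv) (L2B Lv Lw).
by under [X in nr _ X <= _ -> _]eq_fun do rewrite addrA subrK.
Qed.

Lemma approx_step s : step s -> approx s.
Proof.
move=> ss; split; first exact: step_X.
move=> e e0; exists s; split => //.
  by under eq_Rintegral do rewrite subrr cabs0; rewrite rint0.
by rewrite /nr; under eq_Rintegral do rewrite subrr cabs0 expr0n/=; rewrite rint0.
Qed.

Lemma stepD s t : step s -> step t -> step (fun x => s x + t x).
Proof.
move=> + st; elim => [|c a b {}s ab ss IH].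
  by under eq_fun do rewrite add0r.
by under eq_fun do rewrite -addrA; exact: step_cons.
Qed.

Lemma stepZ c s : step s -> step (fun x => c * s x).
Proof.
elim => [|c' a b {}s ab ss IH]; first by under eq_fun do rewrite mulr0; exact: step_nil.
by under eq_fun do rewrite mulrDr mulrA; exact: step_cons.
Qed.

Lemma approxD u v : approx u -> approx v -> approx (fun x => u x + v x).
Proof.
move=> [[Iu Lu] hu] [[Iv Lv] hv]; split; first by split; [exact: cID|exact: L2D].
move=> e e0; have e4 : 0 < e / 4 by rewrite divr_gt0.
have [s [ss s1 s2]] := hu _ e4; have [t [st t1 t2]] := hv _ e4.
have [Is Ls] := step_X ss; have [It Lt] := step_X st.
exists (fun x => s x + t x); split; first exact: stepD.
  apply: le_lt_trans (_ : L1d u s + L1d v t < e); last by rewrite /L1d; lra.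
  rewrite /L1d -rintD; [|by case: (cIB Iu Is)|by case: (cIB Iv It)].
  apply: rint_le; [by case: (cIB (cID Iu Iv) (cID Is It))| |move=> x].
    by apply: rID; [case: (cIB Iu Is)|case: (cIB Iv It)].
  by rewrite opprD addrACA cabsD.
have := nrD_le (L2B Lu Ls) (L2B Lv Lt).
have -> : (fun x => u x - s x + (v x - t x)) = (fun x => u x + v x - (s x + t x)).
  by apply/funext => x; rewrite opprD addrACA.
move: s2 t2; set A := nr _ _; set B := nr _ _; set C := nr _ _; lra.
Qed.

Lemma approxZ c u : approx u -> approx (fun x => c * u x).
Proof.
move=> [[Iu Lu] hu]; split; first by split; [exact: cIZ|exact: L2Z].
move=> e e0; pose K := 1 + cabs c + cabs c ^+ 2.
have c0 := cabs_ge0 c; have K0 : 0 < K by rewrite /K; have := sqr_ge0 (cabs c); lra.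
have eK : 0 < e / K by rewrite divr_gt0.
have [s [ss s1 s2]] := hu _ eK.
have [Is Ls] := step_X ss.
exists (fun x => c * s x); split; first exact: stepZ.
  under eq_Rintegral do rewrite -mulrBr cabsM.
  rewrite rintZ; last by case: (cIB Iu Is).
  rewrite -/(L1d u s) in s1 *.
  have h0 : 0 <= L1d u s by apply: rint_ge0 => x; exact: cabs_ge0.
  rewrite ltr_pdivlMr// in s1; apply: le_lt_trans s1; rewrite mulrC ler_wpM2l// /K.
  by have := sqr_ge0 (cabs c); lra.
under eq_fun do rewrite -mulrBr.
rewrite nrZ; last exact: L2B.
have h0 := nr_ge0 mu (fun x => u x - s x).
rewrite ltr_pdivlMr// in s2; apply: le_lt_trans s2; rewrite mulrC ler_wpM2l// /K.
by lra.
Qed.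

Lemma approxB u v : approx u -> approx v -> approx (fun x => u x - v x).
Proof.
move=> hu hv; have := approxD hu (approxZ (-1) hv).
by under eq_fun do rewrite mulN1r.
Qed.

Lemma approx_lim u (v : nat -> E -> R[i]) : X u -> (forall m, approx (v m)) ->
  (fun m => L1d u (v m)) @ \oo --> (0 : R) ->
  (fun m => nr mu (fun x => u x - v m x)) @ \oo --> (0 : R) -> approx u.
Proof.
move=> [Iu Lu] hv h1 h2; split => // e e0; have e4 : 0 < e / 4 by rewrite divr_gt0.
have [m [m1 m2]] : exists m, L1d u (v m) < e / 4 /\ nr mu (fun x => u x - v m x) < e / 4.
  near \oo => m; exists m; split.
    have : `|L1d u (v m)| < e / 4 by near: m; move/cvgr0Pnorm_lt : h1; exact.
    exact: le_lt_trans (ler_norm _).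
  have : `|nr mu (fun x => u x - v m x)| < e / 4 by near: m; move/cvgr0Pnorm_lt : h2; exact.
  exact: le_lt_trans (ler_norm _).
have [[Iv Lv] hvm] := hv m; have [s [ss s1 s2]] := hvm _ e4.
have [Is Ls] := step_X ss; exists s; split => //.
  have := L1d_triangle Iu Iv Is; move: s1; rewrite -/(L1d (v m) s) -/(L1d u s).
  by move: (L1d _ _) (L1d _ _) (L1d _ _) m1 => A B C; lra.
have := nr_triangle Lu Lv Ls; move: m2 s2.
by set A := nr _ _; set B := nr _ _; set C := nr _ _; lra.
Unshelve. all: by end_near. Qed.

Lemma approx_dct u (v : nat -> E -> R[i]) (g : E -> R) : (forall m, approx (v m)) ->
  cmeas u -> rI mu g -> rI mu (fun x => g x ^+ 2) ->
  (forall x, ctend (v^~ x) (u x)) -> (forall m x, cabs (v m x) <= g x) -> approx u.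
Proof.
move=> hv mu_ Ig Ig2 vu vg.
have mv m : cmeas (v m) by case: (hv m) => -[[]].
have [Lu h2] := nr_dct mv mu_ Ig2 vu vg.
have [Iu _] := ci_dct mv mu_ Ig vu vg.
have ug x : cabs (u x) <= g x.
  by apply: (seq_le (ctend_cabs (vu x))) => m; exact: vg.
have mvu m : cmeas (fun x => v m x - u x) by exact: cmeasB.
have b m x : `|cabs (v m x - u x)| <= 2 * g x.
  by rewrite ger0_norm ?cabs_ge0// (le_trans (cabsD _ _))// cabsN mulr_natl mulr2n lerD.
have [_ _] := rint_dct (fun m => cmeas_cabs (mvu m)) (measurable_cst (0 : R))
  (rIZ 2 Ig) vu b.
rewrite rint0 => h1; apply: (approx_lim (v := v)) => //.
  move: h1; apply: cvg_trans; apply: near_eq_cvg; apply: nearW => m.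
  by apply: eq_Rintegral => x _; rewrite cabsB.
move: h2; apply: cvg_trans; apply: near_eq_cvg; apply: nearW => m.
by rewrite nrBC.
Qed.

Definition cube (k : nat) : set E := ibox (fun=> - k%:R) (fun=> k%:R).

Lemma cube_dom k (c : R) : rI mu (fun x => c * \1_(cube k) x) /\
  rI mu (fun x => (c * \1_(cube k) x) ^+ 2).
Proof.
have [[_ I1] _] := X_ibox (fun=> - k%:R) (fun=> k%:R).
have I2 : rI mu (\1_(cube k) : E -> R).
  move: I1; under eq_fun do rewrite cabsR ger0_norm//.
  by [].
split; first exact: rIZ.
rewrite (_ : (fun x => _) = fun x => c ^+ 2 * \1_(cube k) x); first exact: rIZ.
apply/funext => x; rewrite exprMn indicE; case: (_ \in _); by rewrite ?expr1n ?expr0n.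
Qed.

Lemma approx_ibox a b : approx (ic (ibox a b)).
Proof.
have [ab|nab] := pselect (forall i, a i <= b i).
  rewrite (_ : ic _ = fun x => 1 * ic (ibox a b) x + 0).
    by apply: approx_step; apply: step_cons => //; exact: step_nil.
  by apply/funext => x; rewrite mul1r addr0.
have [i hi] : exists i, ~ (a i <= b i) by apply/existsNP.
rewrite (_ : ic _ = fun=> 0); first by apply: approx_step; exact: step_nil.
apply/funext => x; rewrite /ic indicE memNset// => /(_ i) /andP[h1 h2].
by apply: hi; apply: ltW; exact: lt_le_trans h1 h2.
Qed.

Lemma icI (A B : set E) x : \1_(A `&` B) x = \1_A x * \1_B x :> R.
Proof. by rewrite indicI. Qed.

Lemma approx_ic k (A : set E) : measurable A -> approx (ic (A `&` cube k)).
Proof.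
move=> mA; pose P (B : set E) := approx (ic (B `&` cube k)).
apply: (@dynkin_induction _ _ (@is_ibox R n) P (rV_measurableE n) (@is_iboxI R n)).
- by rewrite /P setTI; exact: approx_ibox.
- move=> _ [a [b ->]]; rewrite /P; have [c [e ->]] : is_ibox (ibox a b `&` cube k).
    by apply: is_iboxI; do 2 eexists.
  exact: approx_ibox.
- move=> B mB PB; rewrite /P.
  rewrite (_ : ic _ = fun x => ic (cube k) x - ic (B `&` cube k) x).
    by apply: approxB => //; exact: approx_ibox.
  apply/funext => x; rewrite /ic !icI; apply: ceqP; rewrite !cE /= ?subrr//.
  by rewrite !indicE in_setC; case: (x \in B); case: (x \in cube k) => /=; ring.
- move=> F mF tF PF; rewrite /P.
  have [g1 g2] := cube_dom k 1.
  have val m x : \sum_(i < m) \1_(F i `&` cube k) x =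
      \1_((\bigcup_(i in `I_m) F i) `&` cube k) x :> R.
    rewrite icI; under eq_bigr do rewrite icI; rewrite -mulr_suml; congr (_ * _).
    have [[j jm Fj]|nF] := pselect ((\bigcup_(i in `I_m) F i) x).
      rewrite [RHS]indicE mem_set; last by exists j.
      rewrite (bigD1 (Ordinal jm))//= indicE mem_set// big1 ?addr0// => i ij.
      rewrite indicE memNset// => Fi; move/negP : ij; apply.
      apply/eqP/val_inj => /=; apply: (tF _ _ I I); by exists x.
    rewrite [RHS]indicE memNset// big1// => i _.
    by rewrite indicE memNset// => Fi; apply: nF; exists i => //=.
  apply: (approx_dct (v := fun m x => \sum_(i < m) ic (F i `&` cube k) x)
    (g := fun x => 1 * \1_(cube k) x)) => //.
  + move=> m; elim: m => [|m IH].
      by under eq_fun do rewrite big_ord0; apply: approx_step; exact: step_nil.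
    by under eq_fun do rewrite big_ord_recr/=; apply: approxD => //; exact: PF.
  + apply: cmeasR; apply: measurable_indic; apply: measurableI; last exact: measurable_ibox.
    exact: bigcup_measurable.
  + move=> x; apply: (ctend_le (e := fun m => cabs ((\sum_(i < m) ic (F i `&` cube k) x) - ic ((\bigcup_i F i) `&` cube k) x))) => //.
    apply: cvg_near_cst.
    have [[j _ Fj]|nF] := pselect ((\bigcup_i F i) x).
      near=> m; rewrite -rmorph_sum val /ic !icI.
      rewrite [\1_(\bigcup_i F i) x]indicE mem_set; last by exists j.
      rewrite indicE mem_set; first by rewrite subrr cabs0.
      exists j => //=; near: m; exact: nbhs_infty_gt.
    near=> m; rewrite -rmorph_sum val /ic !icI.
    rewrite [\1_(\bigcup_i F i) x]indicE memNset//.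
    rewrite indicE memNset; first by rewrite subrr cabs0.
    by move=> [j _ Fj]; apply: nF; exists j.
  + move=> m x; rewrite -rmorph_sum val cabsR icI ger0_norm ?mulr_ge0//.
    rewrite ler_wpM2r// indicE; case: (_ \in _); by rewrite ?lexx ?ler01.
- by rewrite -rV_measurableE.
Unshelve. all: by end_near. Qed.

Lemma sum_ltn (q M : nat) : (\sum_(j < M) (j < q)%N)%N = minn q M.
Proof.
elim: M => [|M IH]; first by rewrite big_ord0 minn0.
by rewrite big_ord_recr /= IH; lia.
Qed.

(** Scaled sums of indicators of superlevel sets approximate u uniformly. *)
Lemma approx_bounded k (u : E -> R) : measurable_fun setT u ->
  (forall x, 0 <= u x <= k%:R * \1_(cube k) x) -> approx (fun x => (u x)%:C).
Proof.
move=> mu_ ub; have [g1 g2] := cube_dom k k%:R.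
pose A (m j : nat) : set E := u @^-1` `[j.+1%:R / m.+1%:R, +oo[.
have mA m j : measurable (A m j).
  by rewrite -[X in measurable X]setTI; apply: mu_ => //; exact: measurable_itv.
have E_ m x : (\sum_(j < k * m.+1) (m.+1%:R^-1 : R) * \1_(A m j `&` cube k) x) =
    (Num.trunc (m.+1%:R * u x))%:R / m.+1%:R.
  have /andP[u0 uk] := ub x.
  have m0 : 0 < m.+1%:R :> R by [].
  rewrite -mulr_sumr mulrC; congr (_ / _).
  set q := Num.trunc _.
  have q0 : 0 <= m.+1%:R * u x by rewrite mulr_ge0.
  have /andP[q1 q2] := truncn_itv q0.
  have [xc|xc] := pselect (cube k x); last first.
    have ux : u x = 0.
      by apply/eqP; rewrite eq_le u0 andbT (le_trans uk)// indicE memNset// mulr0.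
    rewrite /q ux mulr0 truncn0 big1// => i _.
    by rewrite icI [X in _ * X]indicE memNset// mulr0.
  have qk : (q <= k * m.+1)%N.
    rewrite -(ler_nat R) (le_trans q1)// natrM mulrC ler_wpM2r//.
    by rewrite (le_trans uk)// ler_piMr// indicE; case: (_ \in _).
  transitivity ((\sum_(j < k * m.+1) (j < q)%N)%N%:R : R).
    rewrite natr_sum; apply: eq_bigr => j _.
    rewrite icI [X in _ * X]indicE mem_set// mulr1.
    have e : (j < q)%N = (j.+1%:R <= m.+1%:R * u x).
      by rewrite [RHS]leNgt -truncn_le_nat -ltnNge.
    have [h|h] := boolP (j.+1%:R <= m.+1%:R * u x).
      by rewrite e h indicE mem_set// /A /= in_itv /= andbT ler_pdivrMr// mulrC.
    rewrite e (negbTE h) indicE memNset// /A /= in_itv /= andbT ler_pdivrMr// mulrC.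
    exact/negP.
  by rewrite sum_ltn (minn_idPl qk).
apply: (approx_dct (v := fun m x => \sum_(j < k * m.+1)
    (m.+1%:R^-1)%:C * ic (A m j `&` cube k) x) (g := fun x => k%:R * \1_(cube k) x)) => //.
- move=> m; elim: (k * m.+1)%N => [|M IH].
    by under eq_fun do rewrite big_ord0; apply: approx_step; exact: step_nil.
  under eq_fun do rewrite big_ord_recr/=.
  by apply: approxD => //; apply: approxZ; exact: approx_ic.
- move=> x; apply: (ctend_le (@cvg_harmonic R)) => m.
  under eq_bigr do rewrite -rmorphM.
  rewrite -rmorph_sum E_ -rmorphB cabsR /= /harmonic.
  have /andP[u0 uk] := ub x.
  have q0 : 0 <= m.+1%:R * u x by rewrite mulr_ge0.
  have /andP[q1] := truncn_itv q0; rewrite -[X in _ < X]natr1 => q2.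
  have m0 : 0 < m.+1%:R :> R by [].
  rewrite -(ler_pM2r m0) mulVf ?gt_eqF// -[X in _ * X](gtr0_norm m0) -normrM mulrBl.
  rewrite divfK ?gt_eqF// ler_norml; move: q1 q2; rewrite [u x * _]mulrC.
  by set Q := (Num.trunc _)%:R; set U := _ * u x; move: Q U => Q U; lra.
- move=> m x; under eq_bigr do rewrite -rmorphM.
  rewrite -rmorph_sum E_ cabsR.
  have /andP[u0 uk] := ub x.
  have q0 : 0 <= m.+1%:R * u x by rewrite mulr_ge0.
  have /andP[q1 q2] := truncn_itv q0.
  rewrite ger0_norm ?divr_ge0// (le_trans _ uk)// ler_pdivrMr//.
  by rewrite [X in _ <= X]mulrC.
Qed.

Lemma approx_X u : X u -> approx u.
Proof.
move=> [Iu Lu].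
have pos (h : E -> R) : rI mu h -> rI mu (fun x => h x ^+ 2) -> (forall x, 0 <= h x) ->
    approx (fun x => (h x)%:C).
  move=> Ih Ih2 h0; have mh := rI_meas Ih.
  apply: (approx_dct (v := fun k x => (Num.min (h x) k%:R * \1_(cube k) x)%:C) (g := h)) => //.
  - move=> k; apply: (@approx_bounded k).
      apply: measurable_funM; last exact: measurable_indic (measurable_ibox _ _).
      by apply: measurable_minr => //; exact: measurable_cst.
    move=> x; rewrite mulr_ge0 ?le_min ?h0//= ler_wpM2r// ge_min lexx orbT//.
    - move=> x; have : (\bigcup_k cube k) x by rewrite ibox_cover.
    move=> [k0 _ xk0].
    apply: (ctend_le (e := fun k => cabs ((Num.min (h x) k%:R * \1_(cube k) x)%:C - (h x)%:C))) => //.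
    apply: cvg_near_cst; near=> k.
    have hk : h x <= k%:R by near: k; exact: nbhs_infty_ger.
    rewrite indicE mem_set; first by rewrite mulr1 min_l// subrr cabs0.
    have kk : (k0 <= k)%N by near: k; exact: nbhs_infty_ge.
    move=> i; have /andP[x1 x2] := xk0 i.
    have : k0%:R <= k%:R :> R by rewrite ler_nat.
    by move: (k0%:R) (k%:R) x1 x2 => a b x1 x2 ab; apply/andP; split; lra.
  - move=> k x; rewrite cabsR ger0_norm; last by rewrite mulr_ge0// le_min h0 /=.
    apply: (@le_trans _ _ (Num.min (h x) k%:R)); last by rewrite ge_min lexx.
    rewrite ler_piMr//; first by rewrite le_min h0 ler0n.
have real (h : E -> R) : rI mu h -> rI mu (fun x => h x ^+ 2) -> approx (fun x => (h x)%:C).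
  move=> Ih Ih2; have mh := rI_meas Ih.
  have mp : measurable_fun setT (fun x => Num.max (h x) 0).
    by apply: measurable_maxr => //; exact: measurable_cst.
  have mn : measurable_fun setT (fun x => Num.max (- h x) 0).
    by apply: measurable_maxr; [exact: measurable_funN|exact: measurable_cst].
  have ab (t : R) : `|Num.max t 0| <= `|t|.
    by case: (leP t 0) => h1; rewrite ?normr0.
  have bp x : `|Num.max (h x) 0| <= `|h x| by exact: ab.
  have bn x : `|Num.max (- h x) 0| <= `|h x| by rewrite -[leRHS]normrN; exact: ab.
  rewrite (_ : (fun x => _) = fun x => (Num.max (h x) 0)%:C - (Num.max (- h x) 0)%:C).
    apply: approxB; apply: pos.
    - by apply: (rI_le (rI_norm Ih)).
    - apply: (rI_le Ih2) => [|x]; first exact: measurable_funX.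
      by rewrite normrX -[leRHS]real_normK ?num_real// ler_sqr ?nnegrE.
    - by move=> x; rewrite le_max lexx orbT.
    - by apply: (rI_le (rI_norm Ih)).
    - apply: (rI_le Ih2) => [|x]; first exact: measurable_funX.
      by rewrite normrX -[leRHS]real_normK ?num_real// ler_sqr ?nnegrE.
    - by move=> x; rewrite le_max lexx orbT.
  apply/funext => x; rewrite -rmorphB; congr (_%:C).
  by case: (leP (h x) 0) => h1; case: leP => h2; lra.
rewrite (_ : u = fun x => (cRe (u x))%:C + 'i%C * (cIm (u x))%:C); last first.
  by apply/funext => x; rewrite -complexE.
have [[mr mi] Iu2] := Lu.
apply: approxD; last apply: approxZ; apply: real.
- exact: cI_Re.
- apply: (rI_le Iu2) => [|x]; first exact: measurable_funX.
  by rewrite ger0_norm ?sqr_ge0// cabs_sqr lerDl sqr_ge0.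
- exact: cI_Im.
- apply: (rI_le Iu2) => [|x]; first exact: measurable_funX.
  by rewrite ger0_norm ?sqr_ge0// cabs_sqr lerDr sqr_ge0.
Unshelve. all: by end_near. Qed.


Lemma approx_seq u : X u -> exists s : nat -> E -> R[i], forall m,
  [/\ step (s m), L1d u (s m) < m.+1%:R^-1 & nr mu (fun x => u x - s m x) < m.+1%:R^-1].
Proof.
move=> /approx_X[_ h]; have p m : 0 < m.+1%:R^-1 :> R by rewrite invr_gt0.
exists (fun m => projT1 (cid (h _ (p m)))) => m; by case: cid.
Qed.

Lemma lin_aux (a b c e f : R) : a <= 2 * b + 2 * c -> b < e -> c < f -> e <= f ->
  a <= 4 * f.
Proof. by move=> *; lra. Qed.

Lemma pcn_ge0 : 0 <= pcn.
Proof. by rewrite /pcn exprn_ge0// nr_ge0. Qed.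

Lemma step_fourier_nr s : step s -> nr mu (fourier s) = pcn * nr mu s.
Proof.
move=> ss; have [Ls [_ h]] := step_isometry ss.
by apply: complexI; rewrite -ip_nr h// ip_nr rmorphM.
Qed.

Lemma fourier_isometry_const u : X u ->
  L2 mu (fourier u) /\ nr mu (fourier u) = pcn * nr mu u.
Proof.
move=> Xu; have [s hs] := approx_seq Xu; have [Iu Lu] := Xu.
have Xs m : X (s m) by apply: step_X; case: (hs m).
have Lfs m : L2 mu (fourier (s m)) by case: (hs m) => /step_isometry[].
have stepB m k : step (fun x => s m x - s k x).
  have := stepD (let: And3 h _ _ := hs m in h) (stepZ (-1) (let: And3 h _ _ := hs k in h)).
  by under eq_fun do rewrite mulN1r.
have inv_le (m k : nat) : (k <= m)%N -> m.+1%:R^-1 <= k.+1%:R^-1 :> R.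
  by move=> km; rewrite lef_pV2 ?posrE// ler_nat ltnS.
have nrs m k : (k <= m)%N ->
    nr mu (fun x => fourier (s m) x - fourier (s k) x) <= pcn * (4 * k.+1%:R^-1).
  move=> km; rewrite (_ : (fun x => _) = fourier (fun x => s m x - s k x)); last first.
    by apply/funext => x; rewrite fourierB//; [case: (Xs m)|case: (Xs k)].
  rewrite step_fourier_nr// ler_wpM2l ?pcn_ge0//.
  have [_ _ hm] := hs m; have [_ _ hk] := hs k.
  have := nr_triangle (Xs m).2 Lu (Xs k).2; rewrite nrBC in hm.
  by move=> h; exact: (lin_aux h hm hk (inv_le _ _ km)).
have lim x : ctend (fun m => fourier (s m) x) (fourier u x).
  apply: (ctend_le (@cvg_harmonic R)) => m; rewrite cabsB -fourierB//; last by case: (Xs m).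
  apply: le_trans (fourier_bound x (cIB Iu (Xs m).1)) _.
  by apply: ltW; have [_ h _] := hs m.
have mfu : cmeas (fourier u) by apply: cmeas_fourier; case: Iu.
have F k : L2 mu (fun x => fourier u x - fourier (s k) x) /\
    nr mu (fun x => fourier u x - fourier (s k) x) <= pcn * (4 * k.+1%:R^-1).
  apply: (nr_fatou (F := fun m x => fourier (s (m + k)%N) x - fourier (s k) x)).
  - by move=> m; exact: L2B.
  - by apply: cmeasB => //; case: (Lfs k).
  - move=> x; apply: ctendD; last exact: ctend_cst.
    have := lim x; rewrite /ctend => h.
    exact: (cvg_comp _ _ (cvg_addnr k) h).
  - by move=> m; apply: nrs; exact: leq_addl.
have Lfu : L2 mu (fourier u).
  have := L2D (F 0%N).1 (Lfs 0%N); by under eq_fun do rewrite subrK.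
split => //.
have c1 : (fun m => nr mu (fourier (s m))) @ \oo --> nr mu (fourier u).
  apply: nr_cvg => //.
  apply: (seq_squeeze0 (v := fun k => pcn * (4 * k.+1%:R^-1))) => [k|].
    by rewrite nr_ge0/= nrBC; exact: (F k).2.
  by apply: seq_mul0; apply: seq_mul0; exact: cvg_harmonic.
have c2 : (fun m => nr mu (s m)) @ \oo --> nr mu u.
  apply: nr_cvg => // [m|]; first exact: (Xs m).2.
  apply: (seq_squeeze0 (v := fun k => k.+1%:R^-1)) => [k|]; last exact: cvg_harmonic.
  by rewrite nr_ge0/= nrBC; have [_ _ /ltW] := hs k.
apply: (cvg_unique _ c1) => //.
have -> : (fun m => nr mu (fourier (s m))) = (fun m => pcn * nr mu (s m)).
  by apply/funext => m; apply: step_fourier_nr; case: (hs m).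
by apply: cvgM => //; exact: cvg_cst.
Qed.

Lemma pcn1 : pcn = 1.
Proof.
have [I1 I2 v] := @rI_hexp R; have [Lh vh] := @nr_ft1_hexp R.
pose h (i : 'I_n) := fun t : R => (hexp t)%:C.
have Lhh i : L2 leb (h i).
  split; first exact: cmeasR (rI_meas I1).
  by under eq_fun do rewrite cabsR real_normK ?num_real//.
have nh i : nr leb (h i) = 1 / 2.
  by rewrite -v; apply: eq_Rintegral => x _; rewrite cabsR real_normK ?num_real.
have Xh : X (tensor h) by apply: X_tensor => // i; exact: cIR.
have [_] := fourier_isometry_const Xh.
have -> : fourier (tensor h) = tensor (fun i => ft1 (h i)).
  by apply/funext => x; rewrite fourier_tensor// => i; exact: cIR.
have [_ ->] := L2_tensor (fun i : 'I_n => Lh).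
have [_ ->] := L2_tensor Lhh.
rewrite (eq_bigr (fun=> 1 / 2 : R)) => [|i _]; last exact: vh.
rewrite [X in _ = _ * X](eq_bigr (fun=> 1 / 2 : R)) => [|i _]; last exact: nh.
rewrite prodr_const => e; apply/esym/(mulIf _); last by rewrite mul1r; exact: e.
by rewrite expf_neq0// mulf_neq0// invr_neq0.
Qed.

Theorem plancherel u : X u -> L2 mu (fourier u) /\ nr mu (fourier u) = nr mu u.
Proof. by move=> /fourier_isometry_const; rewrite pcn1 mul1r. Qed.

Theorem plancherel_ip u v : X u -> X v ->
  ip mu (fourier u) (fourier v) = ip mu u v.
Proof.
move=> Xu Xv; have [Lfu nu] := plancherel Xu; have [Lfv nv] := plancherel Xv.
have [_ Lu] := Xu; have [_ Lv] := Xv.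
rewrite (polarization (c := 1) Lu Lv Lfu Lfv) ?mul1r// => a.
rewrite mul1r; have [_ <-] := plancherel (X_lin a Xu Xv).
by congr nr; apply/funext => x; rewrite fourier_lin//; [case: Xu|case: Xv].
Qed.

End fourier_rV.

(** * Smooth bumps *)

Section smooth_line.
Context {R : realType}.
Implicit Types (f g : R -> R) (P Q : {poly R}) (x t : R).

(** Smoothness is witnessed by a class stable under differentiation, so that iterated
   derivatives need not be computed. *)
Definition der_closed (C : set (R -> R)) := forall f, C f ->
  exists2 g, C g & forall x, is_derive x 1 f (g x).

Definition smooth1 f := exists2 C, der_closed C & C f.

Lemma smooth1_der f : smooth1 f -> (forall x, is_derive x 1 f (derive1 f x)) /\ smooth1 (derive1 f).
Proof.
move=> [C Cd Cf]; have [g Cg dg] := Cd _ Cf.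
have -> : derive1 f = g by apply/funext => x; rewrite derive1E; apply: derive_val.
by split => //; exists C.
Qed.

Lemma smooth1_dern f k : smooth1 f ->
  (forall x, is_derive x 1 (derive1n k f) (derive1n k.+1 f x)) /\ smooth1 (derive1n k f).
Proof.
move=> sf; elim: k => [|k [IH1 IH2]].
  by have [h1 h2] := smooth1_der sf; split.
have [h1 h2] := smooth1_der IH2; have [h3 h4] := smooth1_der h2.
by rewrite !derive1nS; split.
Qed.

Lemma smooth1_cts f : smooth1 f -> continuous f.
Proof. by move=> /smooth1_der[h _] x; exact: der_cts (h x). Qed.

Lemma smooth1_affine f (c b : R) : smooth1 f -> smooth1 (fun t => f (c * t + b)).
Proof.
move=> [C Cd Cf]; exists [set h | exists2 g, C g & exists a, h = fun t => a * g (c * t + b)].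
  move=> _ [g Cg [a ->]]; have [g' Cg' dg] := Cd _ Cg.
  exists (fun t => a * c * g' (c * t + b)); first by exists g' => //; exists (a * c).
  by move=> x; rewrite -mulrA; apply: derZ; apply: der_affine.
by exists f => //; exists 1; apply/funext => t; rewrite mul1r.
Qed.

Inductive span_prod (C D : set (R -> R)) : (R -> R) -> Prop :=
| span_prod1 f g : C f -> D g -> span_prod C D (fun t => f t * g t)
| span_prodD h k : span_prod C D h -> span_prod C D k -> span_prod C D (fun t => h t + k t).

Lemma smooth1M f g : smooth1 f -> smooth1 g -> smooth1 (fun t => f t * g t).
Proof.
move=> [C Cd Cf] [D Dd Dg]; exists (span_prod C D); last exact: span_prod1.
move=> h; elim => [u v Cu Dv|u v _ [u' hu du] _ [v' hv dv]].
  have [u' Cu' du] := Cd _ Cu; have [v' Dv' dv] := Dd _ Dv.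
  exists (fun t => u' t * v t + u t * v' t).
    by apply: span_prodD; exact: span_prod1.
  by move=> x; exact: derM.
exists (fun t => u' t + v' t); first exact: span_prodD.
by move=> x; exact: derD.
Qed.

(** The functions P(1/x) exp(-1/x), extended by 0 to the left of 0, are stable under
   differentiation, which replaces P by flat_next P. *)
Definition flat P x : R := if 0 < x then P.[x^-1] * expR (- x^-1) else 0.

Lemma flat_small P : exists C : R, forall x : R, `|flat P x| <= C * `|x|.
Proof.
exists (\sum_(i < size P) `|P`_i| * (i.+1)`!%:R) => x; rewrite /flat.
case: ltP => x0; last by rewrite normr0 mulr_ge0 ?sumr_ge0// => i _; rewrite mulr_ge0.
set y := x^-1; have y0 : 0 < y by rewrite invr_gt0.
rewrite horner_coef mulr_suml mulr_suml (le_trans (ler_norm_sum _ _ _))// ler_sum// => i _.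
rewrite !normrM -mulrA -mulrA ler_wpM2l// (gtr0_norm x0) normrX (gtr0_norm y0).
rewrite (ger0_norm (expR_ge0 _)) expRN ler_pdivrMr ?expR_gt0// mulrAC -ler_pdivrMr//.
have := expR_ge1Dxn i (ltW y0).
set F := (i.+1)`!%:R; have F0 : 0 < F :> R by rewrite ltr0n fact_gt0.
move=> h; rewrite ler_pdivrMr// -mulrA.
have -> : y ^+ i = y ^+ i.+1 * x by rewrite exprSr -mulrA mulVf ?mulr1 ?gt_eqF.
rewrite mulrA ler_pM2r// mulrC -ler_pdivrMr//.
by apply: le_trans h; rewrite lerDr.
Qed.

Lemma flat_cts0 P : {for 0, continuous (flat P)}.
Proof.
have [C hC] := flat_small P.
suff h : flat P x @[x --> (0 : R)] --> (0 : R).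
  have f0 : flat P 0 = 0 by rewrite /flat ltxx.
  by rewrite /prop_for /continuous_at f0.
have f0 : flat P 0 = 0 by rewrite /flat ltxx.
apply/norm_cvg0P.
have c : (fun x : R => C * `|x : R|) x @[x --> (0 : R)] --> (C * `|0 : R| : R).
  by apply: (@continuousM R R (cst C)); [exact: cst_continuous|exact: norm_continuous].
rewrite normr0 mulr0 in c.
apply: (squeeze_cvgr _ (cvg_cst 0) c).
by apply: nearW => x; rewrite normr_ge0 hC.
Qed.

Definition flat_next P : {poly R} := 'X^2 * (P - P^`()).

Lemma der_flat P x : is_derive x 1 (flat P) (flat (flat_next P) x).
Proof.
have [x0|x0|->] := ltgtP x 0.
- have -> : flat (flat_next P) x = 0 by rewrite /flat ltNge (ltW x0).
  have h : is_derive x 1 (fun=> 0 : R) (0 : R) by exact: is_derive_cst.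
  apply: near_eq_is_derive h.
  near=> y; rewrite /flat ltNge /=.
  have -> // : y <= 0.
  by apply: ltW; near: y; exact: lt_nbhsl.
- have xn : x != 0 by rewrite gt_eqF.
  have dV : is_derive x 1 (fun y : R => y^-1) (- x ^- 2).
    have h := is_deriveV (f := fun y => y) xn (der_id x).
    by apply: der_eq h _; rewrite /GRing.scale /= mulr1.
  have dP := der_comp (is_derive_poly P x^-1) dV.
  have dE : is_derive x 1 (fun y : R => expR (- y^-1)) (expR (- x^-1) * - - x ^- 2).
    exact: (@der_comp R expR (fun y : R => - y^-1) x _ _ (is_derive_expR (- x^-1)) (derN dV)).
  have h := derM dP dE.
  have -> : flat (flat_next P) x =
      (P^`()).[x^-1] * - x ^- 2 * expR (- x^-1) + P.[x^-1] * (expR (- x^-1) * - - x ^- 2).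
    rewrite /flat x0 /flat_next hornerM hornerXn hornerD hornerN -exprVn; ring.
  apply: near_eq_is_derive h.
    near=> y; rewrite /flat.
    have -> // : 0 < y.
    by near: y; exact: lt_nbhsr.
- have -> : flat (flat_next P) 0 = 0 by rewrite /flat ltxx.
  apply/is_derive1_caratheodory; exists (flat ('X * P)); split.
  + move=> z; rewrite subr0 {2}/flat ltxx subr0 /flat; case: ltP => z0; last by rewrite mul0r.
    have zn : z != 0 by rewrite gt_eqF.
    rewrite hornerM hornerX; move: (expR _) P.[_] => e q; by field.
  + exact: flat_cts0.
  + by rewrite /flat ltxx.
Unshelve. all: by end_near. Qed.

Lemma smooth1_flat P : smooth1 (flat P).
Proof.
exists (range flat) => [_ [Q _ <-]|]; last by exists P.
by exists (flat (flat_next Q)); [exists (flat_next Q)|move=> x; exact: der_flat].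
Qed.

(** The values on ]a, b[ increase to 1 with the sharpness c. *)
Definition sbump (c a b : R) (t : R) : R :=
  flat 1 (c * (t - a)) * flat 1 (c * (b - t)).

Lemma smooth1_sbump c a b : smooth1 (sbump c a b).
Proof.
rewrite (_ : sbump c a b = fun t => flat 1 (c * t + - (c * a)) * flat 1 (- c * t + c * b)).
  by apply: smooth1M; apply: smooth1_affine; exact: smooth1_flat.
by apply/funext => t; rewrite /sbump; congr (flat _ _ * flat _ _); ring.
Qed.

Lemma flat1_ge0_le1 x : 0 <= flat 1 x <= 1.
Proof.
rewrite /flat; case: ltP => x0; last by rewrite lexx ler01.
by rewrite hornerE mul1r expR_ge0/= -[leRHS]expR0 ler_expR oppr_le0 invr_ge0 ltW.
Qed.

Lemma sbump_ge0_le1 c a b t : 0 <= sbump c a b t <= 1.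
Proof.
have /andP[h1 h2] := flat1_ge0_le1 (c * (t - a)).
have /andP[h3 h4] := flat1_ge0_le1 (c * (b - t)).
by rewrite /sbump mulr_ge0//= mulr_ile1.
Qed.

Lemma sbump_off c a b t : 0 < c -> ~~ (a < t < b) -> sbump c a b t = 0.
Proof.
move=> c0; rewrite negb_and -!leNgt /sbump /flat !pmulr_rgt0// !subr_gt0.
move=> /orP[h|h]; first by rewrite ltNge h mul0r.
by rewrite [t < b]ltNge h mulr0.
Qed.

Lemma flat1_mono x y : x <= y -> flat 1 x <= flat 1 y.
Proof.
rewrite {2}/flat; case: (ltP 0 y) => y0 xy; last by rewrite /flat ltNge (le_trans xy y0).
rewrite /flat; case: ltP => x0; rewrite !hornerE ?mul1r ?expR_ge0//.
by rewrite ler_expR lerN2 lef_pV2.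
Qed.

Lemma flat1_cvg y : (fun m : nat => flat 1 (m.+1%:R * y)) @ \oo --> ((0 < y)%R%:R : R).
Proof.
have [y0|y0] := ltP 0 y; last first.
  apply: cvg_near_cst; apply: nearW => m.
  by rewrite /flat pmulr_rgt0// ltNge y0.
have -> : (fun m : nat => flat 1 (m.+1%:R * y)) = (fun m => expR (- y^-1 * m.+1%:R^-1)).
  apply/funext => m; rewrite /flat pmulr_rgt0// y0 hornerE mul1r; congr expR.
  by rewrite invfM mulrC mulNr.
have h : (fun m : nat => - y^-1 * m.+1%:R^-1) @ \oo --> (0 : R).
  by apply: seq_mul0; exact: cvg_harmonic.
have := continuous_cvg _ (@continuous_expR R 0) h.
by rewrite expR0; apply.
Qed.

(** The right end is shifted so that the limit is the indicator of a half-open interval. *)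
Lemma sbump_cvg a b t :
  (fun m : nat => sbump (m.+1%:R ^+ 2) a (b + m.+1%:R^-1) t) @ \oo --> ((a < t <= b)%R%:R : R).
Proof.
have sq (y : R) (u : nat -> R) : 0 < y -> (forall m : nat, m.+1%:R * y <= u m) ->
    (fun m => flat 1 (u m)) @ \oo --> (1 : R).
  move=> y0 h; have c : (fun m : nat => flat 1 (m.+1%:R * y)) @ \oo --> (1 : R).
    by have := @flat1_cvg y; rewrite y0.
  apply: (squeeze_cvgr _ c (cvg_cst (1 : R))); apply: nearW => m.
  by rewrite flat1_mono//=; have /andP[] := flat1_ge0_le1 (u m).
have ge1 (m : nat) : 1 <= m.+1%:R :> R by rewrite ler1n.
have h1 : (fun m : nat => flat 1 (m.+1%:R ^+ 2 * (t - a))) @ \oo --> ((a < t)%R%:R : R).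
  have [y0|y0] := ltP a t; last first.
    apply: cvg_near_cst; apply: nearW => m.
    by rewrite /flat pmulr_rgt0 ?exprn_gt0// subr_gt0 ltNge y0.
  apply: (sq (t - a)); first by rewrite subr_gt0.
  by move=> m; rewrite ler_pM2r ?subr_gt0// expr2 ler_peMl.
have h2 : (fun m : nat => flat 1 (m.+1%:R ^+ 2 * (b + m.+1%:R^-1 - t))) @ \oo --> ((t <= b)%R%:R : R).
  have e (m : nat) : m.+1%:R ^+ 2 * (b + m.+1%:R^-1 - t) = m.+1%:R * (m.+1%:R * (b - t) + 1).
    have : m.+1%:R != 0 :> R by rewrite pnatr_eq0.
    by move: (m.+1%:R) => q q0; field.
  have [y0|y0] := leP t b.
    apply: (sq 1) => // m; rewrite e ler_pM2l// lerDr mulr_ge0// subr_ge0//.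
  apply: cvg_near_cst; near=> m.
  rewrite /flat e pmulr_rgt0// ltNge.
  have -> // : m.+1%:R * (b - t) + 1 <= 0.
  have bt : 0 < t - b by rewrite subr_gt0.
  have h : (t - b)^-1 <= m%:R by near: m; exact: nbhs_infty_ger.
  have h' : 1 <= m.+1%:R * (t - b).
    rewrite -ler_pdivrMr// mul1r (le_trans h)// ler_nat//.
  by rewrite -opprB mulrN addrC subr_le0.
have := cvgM h1 h2; rewrite -natrM mulnb; exact.
Unshelve. all: by end_near. Qed.

End smooth_line.

Section smooth_rV.
Context {R : realType} {n : nat}.
Local Notation E := 'rV[R]_n.
Implicit Types (f g : E -> R) (x v : E).

Local Notation ei i := (delta_mx ord0 i : E).

Lemma line_derive f x v (d : R) :
  is_derive (0 : R) 1 (fun h => f (h *: v + x)) d <-> is_derive x v f d.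
Proof.
have e : (fun h : R => h^-1 *: (((fun h => f (h *: v + x)) \o shift 0) (h *: 1) - f (0 *: v + x)))
    = (fun h => h^-1 *: ((f \o shift x) (h *: v) - f x)).
  apply/funext => h /=; rewrite scale0r add0r addr0.
  by rewrite /GRing.scale /= mulr1.
split => -[h1 h2]; split.
- by move: h1; rewrite /derivable /= e.
- by rewrite -h2 /derive e.
- by rewrite /derivable /= e.
- by rewrite -h2 /derive e.
Qed.

Definition rtensor (f : 'I_n -> R -> R) : E -> R := fun x => \prod_(i < n) f i (x ord0 i).

Definition upd (f : 'I_n -> R -> R) i (u : R -> R) : 'I_n -> R -> R :=
  fun j => if j == i then u else f j.

Lemma rtensor_upd (f : 'I_n -> R -> R) i u x :
  rtensor (upd f i u) x = u (x ord0 i) * \prod_(j < n | j != i) f j (x ord0 j).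
Proof.
rewrite /rtensor (bigD1 i)//= /upd eqxx; congr (_ * _).
by apply: eq_bigr => j /negbTE ->.
Qed.

Lemma rtensor_split (f : 'I_n -> R -> R) i x :
  rtensor f x = f i (x ord0 i) * \prod_(j < n | j != i) f j (x ord0 j).
Proof. by rewrite /rtensor (bigD1 i). Qed.

Lemma der_rtensor (f : 'I_n -> R -> R) i (u : R -> R) x :
  (forall t : R, is_derive t 1 (f i) (u t)) ->
  is_derive x (ei i) (rtensor f) (rtensor (upd f i u) x).
Proof.
move=> df; apply/line_derive; rewrite rtensor_upd.
have -> : (fun h : R => rtensor f (h *: ei i + x)) =
    (fun h => (\prod_(j < n | j != i) f j (x ord0 j)) * f i (1 * h + x ord0 i)).
  apply/funext => h; rewrite (rtensor_split f i) mulrC; congr (_ * _).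
    by apply: eq_bigr => j ji; rewrite !mxE eqxx (negbTE ji) mulr0 add0r.
  by rewrite !mxE !eqxx mulr1 mul1r.
rewrite mulrC; apply: derZ.
have := @der_affine R (f i) 0 1 (x ord0 i) (u (x ord0 i)).
rewrite mulr0 add0r mul1r; apply; exact: df.
Qed.

Lemma continuous_coord (i : 'I_n) : continuous (fun x : E => x ord0 i).
Proof. by move=> x; exact: coord_continuous. Qed.

Lemma cts_sum (I : Type) (s : seq I) (f : I -> E -> R) : (forall i, continuous (f i)) ->
  continuous (fun x => \sum_(i <- s) f i x).
Proof.
move=> cf; elim: s => [|i s IHs] x.
  by under eq_fun do rewrite big_nil; exact: cst_continuous.
under eq_fun do rewrite big_cons.
by apply: continuousD; [exact: cf|exact: IHs].
Qed.

Lemma enorm_continuous : continuous (@enorm R n).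
Proof.
move=> x; apply: (@continuous_comp _ _ _ (fun y : E => dotr y y) (@Num.sqrt R)); last first.
  exact: sqrt_continuous.
apply: cts_sum => i y.
by apply: (@continuousM R E (fun y => y ord0 i)); exact: continuous_coord.
Qed.

Lemma cts_rtensor (f : 'I_n -> R -> R) : (forall i, continuous (f i)) ->
  continuous (rtensor f).
Proof.
move=> cf x; rewrite /rtensor; elim: (index_enum _) => [|i s IHs].
  by under eq_fun do rewrite big_nil; exact: cst_continuous.
under eq_fun do rewrite big_cons.
apply: (@continuousM R E (fun y => f i (y ord0 i)) _ x _ IHs).
by apply: continuous_comp; [exact: continuous_coord|exact: cf].
Qed.

Lemma pderiv_rtensor (f : 'I_n -> R -> R) l : (forall i, smooth1 (f i)) ->
  pderiv l (rtensor f) = rtensor (fun i => derive1n (count_mem i l) (f i)).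
Proof.
move=> sf; elim: l => [|i l IH].
  by congr rtensor; apply/funext => i; rewrite /= derive1n0.
rewrite /= IH; apply/funext => x.
have [h _] := smooth1_dern (count_mem i l) (sf i).
have := der_rtensor (f := fun i => derive1n (count_mem i l) (f i)) x h.
move=> [_ ->]; congr (rtensor _ x); apply/funext => j; rewrite /upd.
by rewrite eq_sym; have [->|ji] := eqVneq i j; rewrite ?add1n ?add0n// eq_sym (negbTE ji).
Qed.

Lemma smooth_rtensor (f : 'I_n -> R -> R) : (forall i, smooth1 (f i)) -> smooth (rtensor f).
Proof.
move=> sf k l x _ lk; rewrite pderiv_rtensor//; split.
  apply: cts_rtensor => i; apply: smooth1_cts.
  by have [] := smooth1_dern (count_mem i l) (sf i).
move=> _ i; have [h _] := smooth1_dern (count_mem i l) (sf i).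
by have [] := der_rtensor (f := fun i => derive1n (count_mem i l) (f i)) x h.
Qed.

Lemma smooth_der f l i x : smooth f -> derivable (pderiv l f) x (ei i).
Proof. by move=> /(_ (size l).+1 l x I (leqnSn _)) [_ ]; exact. Qed.

Lemma smooth_cts f l : smooth f -> continuous (pderiv l f).
Proof. by move=> sf x; have [] := sf (size l) l x I (leqnn _). Qed.

Lemma pderiv_lin (a : R) f g l : smooth f -> smooth g ->
  pderiv l (fun x => a * f x + g x) = (fun x => a * pderiv l f x + pderiv l g x).
Proof.
move=> sf sg; elim: l => [//|i l IH] /=; rewrite IH; apply/funext => x.
have df := @smooth_der f l i x sf; have dg := @smooth_der g l i x sg.
have h := is_deriveD (is_deriveZ a (DeriveDef df erefl)) (DeriveDef dg erefl).
by have [_ ->] := h.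
Qed.

Lemma smooth_lin (a : R) f g : smooth f -> smooth g -> smooth (fun x => a * f x + g x).
Proof.
move=> sf sg k l x _ lk; rewrite pderiv_lin//; split.
  apply: continuousD; last exact: (smooth_cts (l := l) sg).
  by apply: (@continuousM R E (cst a)); [exact: cst_continuous|exact: (smooth_cts (l := l) sf)].
move=> _ i; have df := @smooth_der f l i x sf; have dg := @smooth_der g l i x sg.
have h := is_deriveD (is_deriveZ a (DeriveDef df erefl)) (DeriveDef dg erefl).
by have [] := h.
Qed.

Lemma pderiv0 l : pderiv l (fun _ : E => 0 : R) = fun=> 0.
Proof.
elim: l => [//|i l IH] /=; rewrite IH; apply/funext => x; exact: derive_cst.
Qed.

Lemma smooth0 : smooth (fun _ : E => 0 : R).
Proof.
move=> k l x _ lk; rewrite pderiv0; split; first exact: cst_continuous.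
by move=> _ i; exact: derivable_cst.
Qed.

Lemma smooth_sum (I : Type) (s : seq I) (a : I -> R) (f : I -> E -> R) :
  (forall i, smooth (f i)) -> smooth (fun x => \sum_(i <- s) a i * f i x).
Proof.
move=> sf; elim: s => [|i s IH]; first by under eq_fun do rewrite big_nil; exact: smooth0.
by under eq_fun do rewrite big_cons; exact: smooth_lin.
Qed.

Lemma pderiv_vanish (U : set E) f l : open U -> (forall x, U x -> f x = 0) ->
  forall x, U x -> pderiv l f x = 0.
Proof.
move=> oU f0; elim: l => [//|i l IH] x Ux /=.
rewrite (near_eq_derive (g := fun=> 0)) ?derive_cst//.
by apply: filterS (open_nbhs_nbhs (conj oU Ux)) => y; exact: IH.
Qed.

Lemma csmooth_real f : smooth f -> csmooth (fun x => (f x)%:C).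
Proof. by move=> sf; split => //=; exact: smooth0. Qed.

Lemma compact_schwartz (K : set E) f : compact K -> smooth f ->
  (forall x, ~ K x -> f x = 0) -> schwartz (fun x => (f x)%:C).
Proof.
move=> cK sf f0; split; first exact: csmooth_real.
move=> k l.
have oK : open (~` K) by apply: closed_openC; apply: compact_closed cK.
have cd x : cabs (cpderiv l (fun x => (f x)%:C) x) = `|pderiv l f x|.
  transitivity (cabs (pderiv l f x)%:C); last by rewrite cabsR.
  by congr (cabs (_ +i* _)); exact: (congr1 (@^~ x) (pderiv0 l)).
have cts : continuous (fun x => enorm x ^+ k * `|pderiv l f x|).
  move=> x; apply: (@continuousM R E (fun x => enorm x ^+ k)).
    apply: (@continuous_comp _ _ _ (@enorm R n) (fun y => y ^+ k)); first exact: enorm_continuous.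
    exact: exprn_continuous.
  apply: (@continuous_comp _ _ _ (pderiv l f) (fun y => `|y|)); first exact: smooth_cts.
  exact: norm_continuous.
have [M [_ hM]] : bounded_set ((fun x => enorm x ^+ k * `|pderiv l f x|) @` K).
  apply: compact_bounded; apply: continuous_compact => //.
  exact: continuous_subspaceT.
exists (Num.max 0 (M + 1)) => x; rewrite cd.
have [Kx|nKx] := pselect (K x).
  rewrite le_max; apply/orP; right.
  apply: le_trans (ler_norm _) _; apply: (hM (M + 1)); first by rewrite ltrDl.
  by exists x.
by rewrite (pderiv_vanish l oK f0 nKx) normr0 mulr0 le_max lexx.
Qed.

Lemma cube_compact (a b : 'I_n -> R) : compact [set x : E | forall i, x ord0 i \in `[a i, b i]].
Proof. by have := @rV_compact R n (fun i => `[a i, b i]%classic) (fun i => @segment_compact R _ _). Qed.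

End smooth_rV.

(** * Fourier transforms in L2 *)

Section L2_norm.
Context {R : realType} {n : nat}.
Local Notation mu := (@lebesgue_rV R n).
Local Notation E := 'rV[R]_n.
Implicit Types f : E -> R[i].

Lemma Lp_norm2E f :
  Lp_norm 2%:E f = ((\int[mu]_x (cabs (f x) ^+ 2)%:E) `^ 2^-1)%E.
Proof.
rewrite /Lp_norm unlock; congr (_ `^ _)%E; apply: eq_integral => x _ /=.
by rewrite ger0_norm ?cabs_ge0// powR_mulrn ?cabs_ge0.
Qed.

Lemma Lp2_L2 f : Lp 2%:E f <-> L2 mu f.
Proof.
split=> [[m1 m2 Nf]|[[m1 m2] If]].
  split; first by split.
  apply: rI_ltoo; [exact: cmeas_sqr|by move=> x; rewrite exprn_ge0// cabs_ge0|].
  move: Nf; rewrite Lp_norm2E; apply: lty_poweRy.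
  by rewrite invr_eq0 pnatr_eq0.
split => //; rewrite Lp_norm2E; apply: poweR_lty; exact: rI_lt_oo.
Qed.

Lemma Lp_norm2 f : L2 mu f -> Lp_norm 2%:E f = (Num.sqrt (nr mu f))%:E.
Proof.
move=> [mf If]; rewrite Lp_norm2E -rI_EFin// poweR_EFin powR12_sqrt//.
by apply: rint_ge0 => x; rewrite exprn_ge0// cabs_ge0.
Qed.

End L2_norm.

Section schwartz_integrable.
Context {R : realType} {n : nat}.
Local Notation mu := (@lebesgue_rV R n).
Local Notation E := 'rV[R]_n.
Implicit Types (g : E -> R[i]).

Lemma dotr_ge0 (x : E) : 0 <= dotr x x.
Proof. by apply: sumr_ge0 => i _; rewrite -expr2 sqr_ge0. Qed.

Lemma enorm_sqr (x : E) : enorm x ^+ 2 = dotr x x.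
Proof. by rewrite /enorm sqr_sqrtr// dotr_ge0. Qed.

Lemma coord_le_enorm (x : E) i : `|x ord0 i| <= enorm x.
Proof.
rewrite /enorm -sqrtr_sqr ler_sqrt ?dotr_ge0// /dotr (bigD1 i)//= -expr2 lerDl.
by apply: sumr_ge0 => j _; rewrite -expr2 sqr_ge0.
Qed.

Lemma expr1D_le (s : R) k : 0 <= s -> (1 + s) ^+ k <= 2 ^+ k * (1 + s ^+ k).
Proof.
move=> s0; have [s1|s1] := leP s 1.
  rewrite (@le_trans _ _ (2 ^+ k))//.
    by apply: lerXn2r; rewrite ?nnegrE ?addr_ge0//; lra.
  by rewrite ler_peMr ?exprn_ge0// lerDl exprn_ge0.
rewrite (@le_trans _ _ ((2 * s) ^+ k))//.
  by apply: lerXn2r; rewrite ?nnegrE ?addr_ge0 ?mulr_ge0//; lra.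
by rewrite exprMn ler_wpM2l ?exprn_ge0// lerDr.
Qed.

Lemma schwartz_decay g : schwartz g -> exists2 C : R, 0 <= C &
  forall x, cabs (g x) <= C * \prod_(i < n) (1 + x ord0 i ^+ 2)^-1.
Proof.
move=> [_ dg]; have [M0 h0] := dg 0%N [::]; have [M1 h1] := dg (n.*2)%N [::].
have gE x : cpderiv [::] g x = g x by rewrite /cpderiv /=; case: (g x).
have h x : cabs (g x) * \prod_(i < n) (1 + x ord0 i ^+ 2) <= 2 ^+ n * (M0 + M1).
  have g0 := cabs_ge0 (g x).
  have l0 : cabs (g x) <= M0 by have := h0 x; rewrite expr0 mul1r gE.
  have l1 : enorm x ^+ n.*2 * cabs (g x) <= M1 by have := h1 x; rewrite gE.
  have p1 : \prod_(i < n) (1 + x ord0 i ^+ 2) <= (1 + enorm x ^+ 2) ^+ n.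
    rewrite -[X in _ <= _ ^+ X](card_ord n) -prodr_const; apply: ler_prod => i _.
    rewrite addr_ge0 ?sqr_ge0//= lerD2l -[leLHS]real_normK ?num_real//.
    by apply: lerXn2r; rewrite ?nnegrE ?normr_ge0 ?sqrtr_ge0// coord_le_enorm.
  have p2 := expr1D_le n (sqr_ge0 (enorm x)).
  rewrite -exprM mul2n in p2.
  apply: le_trans (ler_wpM2l g0 (le_trans p1 p2)) _.
  rewrite mulrCA ler_wpM2l ?exprn_ge0// mulrDr mulr1 lerD//.
  by rewrite mulrC.
exists (2 ^+ n * (M0 + M1)) => [|x].
  apply: le_trans (h 0); rewrite mulr_ge0 ?cabs_ge0// prodr_ge0// => i _.
  by rewrite addr_ge0// sqr_ge0.
rewrite prodfV ler_pdivlMr//; apply: prodr_gt0 => i _.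
by rewrite ltr_pwDl// sqr_ge0.
Qed.

Lemma csmooth_cmeas g : csmooth g -> cmeas g.
Proof.
move=> [s1 s2]; split; apply: continuous_measurable_rV.
  exact: (smooth_cts (l := [::]) s1).
exact: (smooth_cts (l := [::]) s2).
Qed.

Lemma schwartz_X g : schwartz g -> X g.
Proof.
move=> sg; have mg := csmooth_cmeas sg.1; have [C C0 hC] := schwartz_decay sg.
have [I1 _] := @rint_tensor R n (fun _ t => (1 + t ^+ 2)^-1) (fun _ => (@rI_oneDsqr R).1).
have IC := rIZ C I1.
split; first exact: (cI_le IC mg hC).
apply: (L2_le (rIZ C IC) mg) => x; have g0 := cabs_ge0 (g x).
have h := hC x; rewrite expr2; apply: ler_pM => //.
apply: le_trans h _; rewrite ler_piMr// prodr_ile1// => i _.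
rewrite invr_ge0 addr_ge0 ?sqr_ge0//= invf_le1 ?lerDl ?sqr_ge0//.
by rewrite ltr_pwDl// sqr_ge0.
Qed.

End schwartz_integrable.

Section inverse_transform.
Context {R : realType} {n : nat}.
Local Notation mu := (@lebesgue_rV R n).
Local Notation E := 'rV[R]_n.
Implicit Types (f g h u v F G : E -> R[i]).

Lemma dotrC (x y : E) : dotr x y = dotr y x.
Proof. by apply: eq_bigr => i _; rewrite mulrC. Qed.

(** Both sides are the same double integral. *)
Lemma fourier_transpose u v : cI mu u -> cI mu v ->
  ci mu (fun x => fourier u x * v x) = ci mu (fun x => u x * fourier v x).
Proof.
move=> Iu Iv.
pose G (z : E * E) := v z.1 * u z.2 * cis (- (2 * pi * dotr z.1 z.2)).
have [Ivu _] := ci_tensor Iv Iu.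
have IG : cI (mu \x mu)%E G.
  apply: (cI_le Ivu.2); first by apply: cmeasM; [exact: Ivu.1|exact: cmeas_cis_dotr].
  by move=> z; rewrite /G cabsM cis_cabs mulr1.
have [_ e1] := ci_fubini1 IG; have [_ e2] := ci_fubini2 IG.
transitivity (ci mu (fun x => ci mu (fun y => G (x, y)))).
  apply: eq_ci => x; rewrite mulrC -[fourier u x]/(ci mu _) -ciZ; last exact: fourier_cI.
  by apply: eq_ci => y; rewrite /G mulrA.
rewrite e1 -e2; apply: eq_ci => y; rewrite -[fourier v y]/(ci mu _) -ciZ; last exact: fourier_cI.
by apply: eq_ci => x; rewrite /G /= dotrC mulrA [v x * _]mulrC.
Qed.

Lemma XJ u : X u -> X (fun x => cj (u x)).
Proof. by move=> [h1 h2]; split; [exact: cIJ|exact: L2J]. Qed.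

Definition ift h : E -> R[i] := fun x => cj (fourier (fun y => cj (h y)) x).

Lemma nrJ f : nr mu (fun x => cj (f x)) = nr mu f.
Proof. by rewrite /nr; under eq_Rintegral do rewrite cabsJ. Qed.

Lemma ift_L2 h : X h -> L2 mu (ift h) /\ nr mu (ift h) = nr mu h.
Proof.
move=> /XJ Xh; have [h1 h2] := plancherel Xh.
by rewrite nrJ in h2; split; [exact: L2J|rewrite nrJ].
Qed.

Lemma ift_weak h v : X h -> X v -> ci mu (fun x => ift h x * fourier v x) = ci mu (fun x => h x * v x).
Proof.
move=> Xh Xv; have e := plancherel_ip Xv (XJ Xh).
transitivity (ip mu (fourier v) (fourier (fun y => cj (h y)))); first by apply: eq_ci => x; rewrite mulrC.
by rewrite e; apply: eq_ci => x; rewrite cJK mulrC.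
Qed.

Lemma ift_L2_fourier h : X h -> L2_fourier (ift h) h.
Proof.
move=> Xh; split; first by apply/Lp2_L2; case: Xh.
by move=> g /schwartz_X Xg; exact: ift_weak.
Qed.

Lemma ift_ip h v : X h -> X v -> ip mu v (ift h) = ip mu (fourier v) h.
Proof.
move=> Xh Xv; transitivity (ci mu (fun x => v x * fourier (fun y => cj (h y)) x)).
  by apply: eq_ci => x; rewrite /ift cJK.
by rewrite -fourier_transpose//; [exact: Xv.1|exact: (XJ Xh).1].
Qed.

(** The pairing with Fourier transforms passes to L2 limits of the test functions,
   since fourier is an isometry. *)
Lemma weak_lim f F u (v : nat -> E -> R[i]) : L2 mu f -> L2 mu F -> X u ->
  (forall m, X (v m)) -> (fun m => nr mu (fun x => v m x - u x)) @ \oo --> (0 : R) ->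
  (forall m, ci mu (fun x => f x * fourier (v m) x) = ci mu (fun x => F x * v m x)) ->
  ci mu (fun x => f x * fourier u x) = ci mu (fun x => F x * u x).
Proof.
move=> Lf LF Xu Xv vu h.
have [Lu _] := plancherel Xu.
have ef g w : ci mu (fun x => g x * w x) = ip mu w (fun x => cj (g x)).
  by apply: eq_ci => x; rewrite cJK mulrC.
have c1 : ctend (fun m => ip mu (v m) (fun x => cj (F x))) (ip mu u (fun x => cj (F x))).
  by apply: ip_ctend => //; [move=> m; case: (Xv m)|case: Xu|exact: L2J].
have c2 : ctend (fun m => ip mu (fourier (v m)) (fun x => cj (f x))) (ip mu (fourier u) (fun x => cj (f x))).
  apply: ip_ctend => //; [by move=> m; case: (plancherel (Xv m))|exact: L2J|].
  rewrite (_ : (fun m => _) = (fun m => nr mu (fun x => v m x - u x)))//.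
  apply/funext => m; rewrite -(plancherel (XB (Xv m) Xu)).2.
  by congr nr; apply/funext => x; rewrite fourierB//; [case: (Xv m)|case: Xu].
rewrite !ef; apply: ctend_uniq c2 _.
by rewrite (_ : (fun m => _) = (fun m => ip mu (v m) (fun x => cj (F x))))//; apply/funext => m; rewrite -!ef h.
Qed.

Definition bump_box m (a b : 'I_n -> R) : E -> R :=
  rtensor (fun i => sbump (m.+1%:R ^+ 2) (a i) (b i + m.+1%:R^-1)).

Lemma schwartz_bump_box m a b : schwartz (fun x => (bump_box m a b x)%:C).
Proof.
have h := @compact_schwartz R n _ (bump_box m a b) (@cube_compact R n a (fun i => b i + m.+1%:R^-1)).
apply: h.
  by apply: smooth_rtensor => i; exact: smooth1_sbump.
move=> x /=; move/existsNP; case=> i; rewrite in_itv/= => hi; rewrite /bump_box /rtensor (bigD1 i)//=.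
rewrite sbump_off ?mul0r ?exprn_gt0//; apply/negP => /andP[h1 h2].
by apply: hi; rewrite !ltW.
Qed.

Lemma cvg_prod (I : Type) (s : seq I) (u : nat -> I -> R) (l : I -> R) :
  (forall i, (fun m => u m i) @ \oo --> l i) ->
  (fun m => \prod_(i <- s) u m i) @ \oo --> \prod_(i <- s) l i.
Proof.
move=> h; elim: s => [|i s IH].
  by under eq_fun do rewrite big_nil; rewrite big_nil; exact: cvg_cst.
by under eq_fun do rewrite big_cons; rewrite big_cons; apply: cvgM.
Qed.

Lemma ind_iboxE a b (x : E) : \1_(ibox a b) x = \prod_(i < n) ((a i < x ord0 i <= b i)%R%:R : R).
Proof.
have [h|h] := pselect (ibox a b x).
  by rewrite indicE mem_set// big1// => i _; rewrite h.
rewrite indicE memNset//; move/existsNP: h => [i hi].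
by rewrite (bigD1 i)//= (negbTE (introN idP hi)) mul0r.
Qed.

Lemma bump_box_cvg a b : X (ic (ibox a b)) /\
  (fun m => nr mu (fun x => (bump_box m a b x)%:C - ic (ibox a b) x)) @ \oo --> (0 : R).
Proof.
split; first exact: X_ibox.
apply: (nr_dct (g := \1_(ibox a (fun i => b i + 1)) ) _ _ _ _ _).2.
- by move=> m; apply: csmooth_cmeas; exact: (schwartz_bump_box m a b).1.
- by case: (X_ibox a b) => -[].
- have := (X_ibox a (fun i => b i + 1)).2.2.
  by congr rI; apply/funext => x; rewrite cabsR real_normK ?num_real.
- move=> x; rewrite /ctend; under eq_fun do rewrite /ic -rmorphB cabsR.
  have c : (fun m => bump_box m a b x) @ \oo --> (\1_(ibox a b) x : R).
    by rewrite ind_iboxE; apply: cvg_prod => i; exact: sbump_cvg.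
  have := cvg_norm (cvgB c (cvg_cst (\1_(ibox a b) x : R))).
  by rewrite subrr normr0; apply.
- move=> m x; rewrite cabsR ger0_norm; last first.
    by apply: prodr_ge0 => i _; case/andP: (sbump_ge0_le1 (m.+1%:R ^+ 2) (a i) (b i + m.+1%:R^-1) (x ord0 i)).
  rewrite ind_iboxE /bump_box /rtensor; apply: ler_prod => i _.
  have /andP[-> h1] := sbump_ge0_le1 (m.+1%:R ^+ 2) (a i) (b i + m.+1%:R^-1) (x ord0 i).
  have [//|h] := boolP (a i < x ord0 i <= b i + 1).
  rewrite sbump_off ?lexx ?exprn_gt0//; apply: contraNN h => /andP[-> h] /=.
  by rewrite (le_trans (ltW h))// lerD2l invf_le1// ler1n.
Qed.

Lemma weak_X f F u : L2 mu f -> L2_fourier f F -> X u ->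
  ci mu (fun x => f x * fourier u x) = ci mu (fun x => F x * u x).
Proof.
move=> Lf [/Lp2_L2 LF wf] Xu.
have hb a b : ci mu (fun x => f x * fourier (ic (ibox a b)) x) = ci mu (fun x => F x * ic (ibox a b) x).
  have [X1 c1] := bump_box_cvg a b.
  apply: (weak_lim Lf LF X1 _ c1) => m; first exact: schwartz_X (schwartz_bump_box m a b).
  exact: wf (schwartz_bump_box m a b).
have hs s : step s -> ci mu (fun x => f x * fourier s x) = ci mu (fun x => F x * s x).
  elim=> [|c a b {}s ab ss IH].
    rewrite (eq_ci mu (g := fun=> 0)) ?ci0; last first.
      move=> x; rewrite (_ : fourier _ x = 0) ?mulr0//.
      by rewrite -[LHS]/(ci mu _) (eq_ci mu (g := fun=> 0)) ?ci0// => y; rewrite mul0r.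
    by rewrite (eq_ci mu (g := fun=> 0)) ?ci0// => x; rewrite mulr0.
  have [Xb Xs] := (X_ibox a b, step_X ss).
  have [Lb _] := plancherel Xb; have [Ls _] := plancherel Xs.
  transitivity (ci mu (fun x => c * (f x * fourier (ic (ibox a b)) x) + f x * fourier s x)).
    by apply: eq_ci => x; rewrite fourier_lin; [ring|case: Xb|case: Xs].
  rewrite ci_lin; [|exact: L2_cI..]; rewrite hb IH -ci_lin; last 2 first.
  - by apply: L2_cI => //; case: Xb.
  - by apply: L2_cI => //; case: Xs.
  by apply: eq_ci => x; ring.
have [s hs'] := approx_seq Xu.
apply: (weak_lim Lf LF Xu _ _ (fun m => hs (s m) _)).
- by move=> m; apply: step_X; case: (hs' m).
- apply: (seq_squeeze0 (v := fun m => m.+1%:R^-1)); last exact: cvg_harmonic.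
  by move=> m; rewrite nr_ge0 nrBC ltW//; case: (hs' m).
- by move=> m; case: (hs' m).
Qed.

Definition trunc m F : E -> R[i] := fun x => ic (cube m) x * F x.

Lemma ic01 (A : set E) x : (A x /\ ic A x = 1 :> R[i]) \/ (~ A x /\ ic A x = 0 :> R[i]).
Proof.
rewrite /ic; have [h|h] := pselect (A x).
  by left; rewrite indicE mem_set.
by right; rewrite indicE memNset.
Qed.

Lemma ic_le1 (A : set E) x : cabs (ic A x : R[i]) <= 1.
Proof. by have [[_ ->]|[_ ->]] := ic01 A x; rewrite ?cabs1 ?cabs0 ?ler01. Qed.

Lemma cmeas_ic (A : set E) : measurable A -> cmeas (ic A : E -> R[i]).
Proof. by move=> mA; apply: cmeasR; exact: measurable_indic. Qed.

Lemma L2_ic (A : set E) F : measurable A -> L2 mu F -> L2 mu (fun x => ic A x * F x).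
Proof.
move=> mA [mF IF]; apply: (L2_le IF); first by apply: cmeasM => //; exact: cmeas_ic.
move=> x; rewrite cabsM exprMn ler_piMl ?exprn_ge0 ?cabs_ge0//.
by rewrite exprn_ile1 ?cabs_ge0 ?ic_le1.
Qed.

Lemma trunc_X m F : L2 mu F -> X (trunc m F).
Proof.
move=> LF; split; last by apply: L2_ic => //; exact: measurable_ibox.
by apply: (L2_cI _ LF); exact: (X_ibox (fun _ : 'I_n => - m%:R) (fun=> m%:R)).2.
Qed.

Lemma trunc_cvg F : L2 mu F ->
  (fun m => nr mu (fun x => trunc m F x - F x)) @ \oo --> (0 : R).
Proof.
move=> LF; apply: (nr_dct (g := fun x => cabs (F x)) _ LF.1 _ _ _).2.
- by move=> m; case: (trunc_X m LF) => -[].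
- exact: LF.2.
- move=> x; have : (\bigcup_k cube k) x by rewrite ibox_cover.
  move=> [k0 _ xk0]; apply: cvg_near_cst; near=> k.
  have kk : (k0 <= k)%N by near: k; exact: nbhs_infty_ge.
  rewrite /trunc; have [[_ ->]|[h _]] := ic01 (cube k) x.
    by rewrite mul1r subrr cabs0.
  case: h => i; have /andP[x1 x2] := xk0 i.
  have : k0%:R <= k%:R :> R by rewrite ler_nat.
  by move: (k0%:R) (k%:R) x1 x2 => a b x1 x2 ab; apply/andP; split; lra.
- by move=> m x; rewrite cabsM ler_piMl ?cabs_ge0 ?ic_le1.
Unshelve. all: by end_near. Qed.

Lemma cJ0 : cj 0 = 0 :> R[i]. Proof. exact: (cJR 0). Qed.

Lemma ip_trunc m F : ip mu F (trunc m F) = (nr mu (trunc m F))%:C.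
Proof.
rewrite -ip_nr; apply: eq_ci => x; rewrite /trunc.
by have [[_ ->]|[_ ->]] := ic01 (cube m) x; rewrite ?mul1r// !mul0r cJ0 !mulr0.
Qed.

Lemma ip_weak f F h : L2 mu f -> L2_fourier f F -> X h -> ip mu f (ift h) = ip mu F h.
Proof.
move=> Lf wF Xh; rewrite -[RHS](weak_X Lf wF (XJ Xh)).
by apply: eq_ci => x; rewrite /ift cJK.
Qed.

(** Half of the weak Plancherel theorem: truncate F and test against its inverse
   transform. *)
Lemma weak_nr_le1 f F : L2 mu f -> L2_fourier f F -> nr mu F <= nr mu f.
Proof.
move=> Lf wF; have /Lp2_L2 LF := wF.1.
apply: (seq_le (nr_cvg (fun m => (trunc_X m LF).2) LF (trunc_cvg LF))) => m.
have Xm := trunc_X m LF.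
have := cauchy_schwarz Lf (ift_L2 Xm).1.
rewrite (ip_weak Lf wF Xm) ip_trunc (ift_L2 Xm).2 cabsR real_normK ?num_real// expr2 => h.
have [->|nz] := eqVneq (nr mu (trunc m F)) 0; first exact: nr_ge0.
by move: h; rewrite ler_pM2r// lt_neqAle eq_sym nz nr_ge0.
Qed.

(** The other half: the truncation of f is the L2 limit of inverse transforms of
   integrable functions. *)
Lemma weak_nr_ge1 f F : L2 mu f -> L2_fourier f F -> nr mu f <= nr mu F.
Proof.
move=> Lf wF; have /Lp2_L2 LF := wF.1.
apply: (seq_le (nr_cvg (fun m => (trunc_X m Lf).2) Lf (trunc_cvg Lf))) => m.
set v := trunc m f; have Xv : X v := trunc_X m Lf.
have [LG nG] := plancherel Xv; set G := fourier v in LG nG.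
pose w k := trunc k G; have Xw k : X (w k) := trunc_X k LG.
have cw : (fun k => nr mu (w k)) @ \oo --> nr mu G.
  by apply: nr_cvg => //; [move=> k; exact: (Xw k).2|exact: trunc_cvg].
have dist k : nr mu (fun x => ift (w k) x - v x) = nr mu G - nr mu (w k).
  rewrite nrB; [|exact: (ift_L2 (Xw k)).1|exact: Xv.2].
  rewrite (ift_L2 (Xw k)).2 ipJ; [|exact: Xv.2|exact: (ift_L2 (Xw k)).1].
  rewrite ift_ip// -/G ip_trunc -nG -/(w k) cJR.
  have -> : cRe (nr mu (w k))%:C = nr mu (w k) by [].
  ring.
have cv : (fun k => nr mu (fun x => ift (w k) x - v x)) @ \oo --> (0 : R).
  under eq_fun do rewrite dist.
  have := cvgB (cvg_cst (nr mu G)) cw.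
  by rewrite subrr; apply.
have c2 := ip_ctend (fun k => (ift_L2 (Xw k)).1) Xv.2 Lf cv.
have b k : cabs (ip mu (ift (w k)) f) ^+ 2 <= nr mu F * nr mu v.
  rewrite ipJ; [|exact: Lf|exact: (ift_L2 (Xw k)).1].
  rewrite cabsJ (ip_weak Lf wF (Xw k)).
  apply: le_trans (cauchy_schwarz LF (Xw k).2) _.
  rewrite ler_wpM2l ?nr_ge0// -nG -subr_ge0 -dist; exact: nr_ge0.
have h : cabs (ip mu v f) ^+ 2 <= nr mu F * nr mu v.
  have c3 := ctend_cabs c2.
  by apply: (seq_le (cvgM c3 c3)) => k; have := b k; rewrite expr2.
move: h; rewrite ipJ//; [|exact: Xv.2].
rewrite ip_trunc cabsJ cabsR real_normK ?num_real// expr2 -/v => h.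
have [->|nz] := eqVneq (nr mu v) 0; first exact: nr_ge0.
by move: h; rewrite ler_pM2r// lt_neqAle eq_sym nz nr_ge0.
Qed.

Lemma L2_fourier_lin (a : R[i]) f g F G : L2 mu f -> L2 mu g ->
  L2_fourier f F -> L2_fourier g G ->
  L2_fourier (fun x => a * f x + g x) (fun x => a * F x + G x).
Proof.
move=> Lf Lg [/Lp2_L2 LF wF] [/Lp2_L2 LG wG]; split; first by apply/Lp2_L2; exact: L2_lin.
move=> h sh; have Xh := schwartz_X sh; have [Lh _] := plancherel Xh.
have e1 : ci mu (fun x => f x * fourier h x) = ci mu (fun x => F x * h x) := wF h sh.
have e2 : ci mu (fun x => g x * fourier h x) = ci mu (fun x => G x * h x) := wG h sh.
have l (u v k : E -> R[i]) : L2 mu u -> L2 mu v -> L2 mu k ->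
    ci mu (fun x => (a * u x + v x) * k x) = a * ci mu (fun x => u x * k x) + ci mu (fun x => v x * k x).
  move=> Lu Lv Lk; rewrite -ci_lin; [|exact: L2_cI..].
  by apply: eq_ci => x; ring.
transitivity (ci mu (fun x => (a * f x + g x) * fourier h x)) => //.
by rewrite l// e1 e2 -l//; exact: Xh.2.
Qed.

Lemma weak_nr f F : L2 mu f -> L2_fourier f F -> nr mu f = nr mu F.
Proof. by move=> Lf wF; apply/eqP; rewrite eq_le; apply/andP; split; [exact: weak_nr_ge1|exact: weak_nr_le1]. Qed.

Lemma weak_ip f g F G : L2 mu f -> L2 mu g -> L2_fourier f F -> L2_fourier g G ->
  ip mu f g = ip mu F G.
Proof.
move=> Lf Lg wF wG; have /Lp2_L2 LF := wF.1; have /Lp2_L2 LG := wG.1.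
rewrite -[RHS]mul1r; apply/esym; rewrite -[1]/(1%:C : R[i]).
suff -> : ip mu F G = 1%:C * ip mu f g by rewrite !mul1r.
apply: polarization => //; rewrite ?mul1r//; [exact/esym/weak_nr..|].
move=> a; rewrite mul1r; apply/esym/weak_nr; first exact: L2_lin.
exact: L2_fourier_lin.
Qed.

Lemma L2_fourier_uniq f f' F F' : L2 mu f -> L2 mu f' -> {ae mu, forall x, f x = f' x} ->
  L2_fourier f F -> L2_fourier f' F' -> {ae mu, forall x, F x = F' x}.
Proof.
move=> Lf Lf' e wF wF'; have /Lp2_L2 LF := wF.1; have /Lp2_L2 LF' := wF'.1.
apply: (@nr0_ae _ _ _ mu) => //.
have eN : nr mu (fun x => F x - F' x) = nr mu (fun x => -1 * F' x + F x).
  by congr nr; apply/funext => x; rewrite mulN1r addrC.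
rewrite eN -(weak_nr _ (L2_fourier_lin (-1) Lf' Lf wF' wF)); last exact: L2_lin.
transitivity (nr mu (fun=> 0)); last first.
  by rewrite /nr; under eq_Rintegral do rewrite cabs0 expr0n; exact: rint0.
apply: nr_ae; [by case: (L2_lin (-1) Lf' Lf)|exact: cmeas_cst|].
by apply: filterS e => x ->; rewrite mulN1r addNr.
Qed.

End inverse_transform.

(** * Integral operators with block kernels *)

Section schur.
Context {R : realType} {n : nat}.
Local Notation mu := (@lebesgue_rV R n).
Local Notation E := 'rV[R]_n.
Implicit Types (K : E * E -> R) (F G : E -> R[i]) (D : R).

Definition schur_kernel K D := [/\ measurable_fun setT K,
  forall x y, K (x, y) = K (y, x),
  forall x, exists B : R, forall y, `|K (x, y)| <= B &
  forall x, rI mu (fun y => K (x, y)) /\ \int[mu]_y `|K (x, y)| <= D].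

Definition kop K F : E -> R[i] := fun x => ci mu (fun y => (K (x, y))%:C * F y).

Lemma schur_norm K D : schur_kernel K D -> schur_kernel (fun z => `|K z|) D.
Proof.
move=> [mK sK bK iK]; split.
- exact: measurableT_comp.
- by move=> x y; rewrite sK.
- by move=> x; have [B hB] := bK x; exists B => y; rewrite normr_id.
- move=> x; have [h1 h2] := iK x; split; first exact: rI_norm.
  by under eq_Rintegral do rewrite normr_id.
Qed.

Lemma schur_section K D x : schur_kernel K D -> L2 mu (fun y => (K (x, y))%:C).
Proof.
move=> [mK sK bK iK]; have [B hB] := bK x; have [iKx _] := iK x.
have B0 : 0 <= B by apply: le_trans (hB 0); rewrite normr_ge0.
apply: (L2_le (rIZ B (rI_norm iKx))); first by apply: cmeasR; exact: rI_meas iKx.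
by move=> y; rewrite cabsR expr2 ler_pM.
Qed.

Lemma kop_cI K D F x : schur_kernel K D -> L2 mu F -> cI mu (fun y => (K (x, y))%:C * F y).
Proof. by move=> sK LF; apply: L2_cI => //; exact: schur_section sK. Qed.

Lemma kop_lin K D (a : R[i]) F G x : schur_kernel K D -> L2 mu F -> L2 mu G ->
  kop K (fun y => a * F y + G y) x = a * kop K F x + kop K G x.
Proof.
move=> sK LF LG; rewrite /kop -ci_lin; [|exact: kop_cI sK _..].
by apply: eq_ci => y; rewrite mulrDr mulrCA.
Qed.

Lemma kop_ae K D F G x : schur_kernel K D -> L2 mu F -> L2 mu G ->
  {ae mu, forall y, F y = G y} -> kop K F x = kop K G x.
Proof.
move=> sK LF LG e; apply: ci_ae.
- by case: (kop_cI x sK LF).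
- by case: (kop_cI x sK LG).
- by apply: filterS e => y ->.
Qed.

Lemma cmeas_snd F : cmeas F -> cmeas (fun z : E * E => F z.2).
Proof. by move=> mF; exact: (cmeas_comp measurable_snd mF). Qed.

Lemma cmeas_fst F : cmeas F -> cmeas (fun z : E * E => F z.1).
Proof. by move=> mF; exact: (cmeas_comp measurable_fst mF). Qed.

Lemma cmeas_kop K F : measurable_fun setT K -> cmeas F -> cmeas (kop K F).
Proof.
move=> mK mF; apply: (@cmeas_ci_param _ _ _ _ R mu (fun z => (K z)%:C * F z.2)).
by apply: cmeasM; [exact: cmeasR|exact: cmeas_snd].
Qed.

(** The Schur test: by Cauchy-Schwarz against the measure |K(x,y)|dy,
   |KF(x)|^2 is at most D times the integral of |K(x,y)||F(y)|^2. *)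
Lemma schur_nr K D F : schur_kernel K D -> L2 mu F ->
  L2 mu (kop K F) /\ nr mu (kop K F) <= D ^+ 2 * nr mu F.
Proof.
move=> sK LF; have [mK yK bK iK] := sK.
pose H (z : E * E) := `|K (z.1, z.2)| * cabs (F z.1) ^+ 2.
have mH : measurable_fun setT H.
  apply: measurable_funM.
    apply: measurableT_comp => //.
    by rewrite (_ : (fun z => _) = K)//; apply/funext => -[].
  exact: (measurableT_comp (cmeas_sqr LF.1) measurable_fst).
have H0 z : 0 <= H z by rewrite /H mulr_ge0// exprn_ge0// cabs_ge0.
have iHx x : rI mu (fun y => H (x, y)).
  rewrite /H /=; under eq_fun do rewrite mulrC.
  by apply: rIZ; apply: rI_norm; exact: (iK x).1.
have bH x : \int[mu]_y `|H (x, y)| <= D * cabs (F x) ^+ 2.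
  under eq_Rintegral do rewrite (ger0_norm (H0 _)) /H /= mulrC.
  rewrite rintZ; last by apply: rI_norm; exact: (iK x).1.
  by rewrite mulrC ler_wpM2r ?exprn_ge0 ?cabs_ge0//; exact: (iK x).2.
have IDF : rI mu (fun x => D * cabs (F x) ^+ 2) by apply: rIZ; exact: LF.2.
have iH1 : rI mu (fun x => \int[mu]_y `|H (x, y)|).
  apply: (rI_le IDF).
    apply: (@measurable_rint_param _ _ _ _ R mu (fun z => `|H z|)).
    exact: measurableT_comp.
  by move=> x; rewrite ger0_norm ?bH//; apply: rint_ge0.
have IH : rI (mu \x mu)%E H by apply: rI_prod.
have [iH2 eH2] := rint_fubini2 IH; have [_ eH1] := rint_fubini1 IH.
have bHint : \int[mu]_y (\int[mu]_x H (x, y)) <= D * nr mu F.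
  rewrite eH2 -eH1 -rintZ; last exact: LF.2.
  have e x : \int[mu]_y H (x, y) = \int[mu]_y `|H (x, y)|.
    by under [RHS]eq_Rintegral do rewrite (ger0_norm (H0 _)).
  apply: rint_le => //; first by under eq_fun do rewrite e.
  by move=> x; rewrite e.
have D0 : 0 <= D by apply: le_trans (iK 0).2; apply: rint_ge0.
have pt x : cabs (kop K F x) ^+ 2 <= D * \int[mu]_y H (y, x).
  have LK : L2 mu (fun y => (Num.sqrt `|K (x, y)|)%:C).
    split.
      apply: cmeasR; apply: (@measurableT_comp _ _ _ _ _ _ (@Num.sqrt R)).
        by apply: continuous_measurable_fun; exact: sqrt_continuous.
      by apply: (@measurableT_comp _ _ _ _ _ _ (@Num.norm _ R)) => //; exact: rI_meas (iK x).1.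
    under eq_fun do rewrite cabsR real_normK ?num_real// sqr_sqrtr//.
    by apply: rI_norm; exact: (iK x).1.
  have nLK : nr mu (fun y => (Num.sqrt `|K (x, y)|)%:C) <= D.
    rewrite /nr; under eq_Rintegral do rewrite cabsR real_normK ?num_real// sqr_sqrtr//.
    exact: (iK x).2.
  have eKF y : cabs ((Num.sqrt `|K (x, y)|)%:C * F y) ^+ 2 = `|K (x, y)| * cabs (F y) ^+ 2.
    by rewrite cabsM exprMn cabsR real_normK ?num_real// sqr_sqrtr.
  have LKF : L2 mu (fun y => (Num.sqrt `|K (x, y)|)%:C * F y).
    have [B hB] := bK x.
    apply: (L2_le (rIZ B LF.2)); first by apply: cmeasM; [exact: LK.1|exact: LF.1].
    by move=> y; rewrite eKF ler_wpM2r// exprn_ge0// cabs_ge0.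
  have nLKF : nr mu (fun y => (Num.sqrt `|K (x, y)|)%:C * F y) = \int[mu]_y H (y, x).
    by rewrite /nr; apply: eq_Rintegral => y _; rewrite eKF /H yK.
  have c := cauchy_schwarz_abs LK LKF.
  apply: le_trans (_ : (\int[mu]_y (cabs (Num.sqrt `|K (x, y)|)%:C * cabs ((Num.sqrt `|K (x, y)|)%:C * F y))) ^+ 2 <= _).
    apply: lerXn2r; rewrite ?nnegrE ?cabs_ge0//.
      by apply: rint_ge0 => y; rewrite mulr_ge0// cabs_ge0.
    apply: le_trans (cabs_ci (kop_cI x sK LF)) _.
    rewrite le_eqVlt; apply/orP; left; apply/eqP; apply: eq_Rintegral => y _.
    by rewrite !cabsM mulrA !cabsR -normrM -expr2 sqr_sqrtr// normr_id.
  apply: le_trans c _; rewrite nLKF ler_wpM2r//.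
  by apply: rint_ge0.
have mk : cmeas (kop K F) by apply: cmeas_kop => //; exact: LF.1.
have ID := rIZ D iH2.
have Lk := L2_le ID mk pt; split => //.
apply: le_trans (_ : \int[mu]_x (D * \int[mu]_y H (y, x)) <= _).
  by apply: rint_le => //; exact: Lk.2.
by rewrite rintZ// expr2 -mulrA ler_wpM2l.
Qed.

Lemma kop_sym K D F G : schur_kernel K D -> L2 mu F -> L2 mu G ->
  ip mu (kop K F) G = ip mu F (kop K G).
Proof.
move=> sK LF LG; have [mK yK bK iK] := sK.
pose H (z : E * E) := (K z)%:C * F z.2 * cj (G z.1).
have mH : cmeas H.
  apply: cmeasM; last by apply: cmeasJ; apply: cmeas_fst; exact: LG.1.
  by apply: cmeasM; [exact: cmeasR|apply: cmeas_snd; exact: LF.1].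
have Ha x : \int[mu]_y cabs (H (x, y)) =
    cabs (kop (fun z => `|K z|) (fun y => (cabs (F y))%:C) x * G x).
  have -> : kop (fun z => `|K z|) (fun y => (cabs (F y))%:C) x =
      (\int[mu]_y (`|K (x, y)| * cabs (F y)))%:C.
    by rewrite -ciR; apply: eq_ci => y; rewrite rmorphM.
  rewrite cabsM cabsR ger0_norm; last by apply: rint_ge0 => y; rewrite mulr_ge0// cabs_ge0.
  rewrite mulrC -rintZ; last first.
    have [_] := kop_cI x (schur_norm sK) (L2_cabs LF).
    by under eq_fun do rewrite -rmorphM cabsR ger0_norm ?mulr_ge0 ?cabs_ge0//.
  by apply: eq_Rintegral => y _; rewrite /H !cabsM cabsR cabsJ mulrC.
have IH : cI (mu \x mu)%E H.
  apply: cI_prod => //.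
    move=> x; have := cIZ (cj (G x)) (kop_cI x sK LF).
    by congr cI; apply/funext => y; rewrite /H mulrC.
  under eq_fun do rewrite Ha.
  apply: (L2_cI _ LG).2; exact: (schur_nr (schur_norm sK) (L2_cabs LF)).1.
have [_ e1] := ci_fubini1 IH; have [_ e2] := ci_fubini2 IH.
transitivity (ci mu (fun x => ci mu (fun y => H (x, y)))).
  apply: eq_ci => x; rewrite mulrC /kop -ciZ; last exact: kop_cI sK LF.
  by apply: eq_ci => y; rewrite /H mulrC.
rewrite e1 -e2; apply: eq_ci => y; rewrite /kop -ciJ; last exact: kop_cI sK LG.
rewrite -ciZ; last by apply: cIJ; exact: kop_cI sK LG.
by apply: eq_ci => x; rewrite /H cJM cJR yK mulrAC mulrC mulrA.
Qed.

End schur.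
Section ultralimit.
Context {R : realType}.
Implicit Types (U : set_system nat).

(** Compactness of the operator is proved along an ultrafilter, which replaces the
   extraction of a diagonal subsequence. *)
Lemma ultra_lim U (u : nat -> R) b : UltraFilter U -> (forall k, `|u k| <= b) ->
  exists l, forall e, 0 < e -> U [set k | `|u k - l| < e].
Proof.
move=> UU hb; pose S := [set t | U [set k | t <= u k]].
have Sb t : S t -> t <= b.
  move=> St; have [k /= tk] := filter_ex St.
  by apply: le_trans tk (le_trans (ler_norm _) (hb k)).
have S0 : S (- b).
  by apply: filterE => k /=; rewrite lerNl; apply: le_trans (hb k); rewrite -normrN ler_norm.
have hS : has_sup S by split; [exists (- b)|exists b => t /Sb].
exists (sup S) => e e0.
have e2 : 0 < e / 2 by rewrite divr_gt0.
have [t St ht] := sup_adherent e2 hS.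
have nS : ~ S (sup S + e / 2).
  by move=> /(ub_le_sup hS.2); rewrite gerDl leNgt e2.
have [//|h2] := in_ultra_setVsetC [set k | sup S + e / 2 <= u k] UU.
apply: filterS (filterI St h2) => k /= [h3 /negP]; rewrite -ltNge => h4.
rewrite ltr_distl; apply/andP; split; lra.
Qed.

Lemma ultra_clim U (u : nat -> R[i]) b : UltraFilter U -> (forall k, cabs (u k) <= b) ->
  exists l, forall e, 0 < e -> U [set k | cabs (u k - l) < e].
Proof.
move=> UU hb.
have [l1 h1] := @ultra_lim U (fun k => cRe (u k)) b UU (fun k => le_trans (cRe_le_cabs _) (hb k)).
have [l2 h2] := @ultra_lim U (fun k => cIm (u k)) b UU (fun k => le_trans (cIm_le_cabs _) (hb k)).
exists (l1 +i* l2) => e e0; have e2 : 0 < e / 2 by rewrite divr_gt0.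
apply: filterS (filterI (h1 _ e2) (h2 _ e2)) => k /= [h3 h4].
apply: le_lt_trans (cabs_le_ReIm _) _; rewrite !cE /=; lra.
Qed.

End ultralimit.

Section blocks.
Context {R : realType} {n : nat}.
Local Notation mu := (@lebesgue_rV R n).
Local Notation E := 'rV[R]_n.
Implicit Types (F G : E -> R[i]) (A : set E) (d e s : R).

(** The operator of K splits into blocks. On the block L k the Schur bound D k controls
   the operator norm, and the sup bound B k, with D k and the measure V k, controls the
   Hilbert-Schmidt norm. Total boundedness of the rows of each block, together with the
   convergence of D to 0, makes the operator compact. *)
Definition block_kernel (K : E * E -> R) (L : nat -> set E) (D B V : nat -> R) := 
  [/\ measurable_fun setT K /\ (forall x y, K (x, y) = K (y, x)),
    (forall k, measurable (L k)) /\ (forall k l x, L k x -> L l x -> k = l),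
    forall x y, K (x, y) <> 0 -> exists2 k, L k x & L k y,
    forall k x, L k x -> [/\ forall y, `|K (x, y)| <= B k,
      rI mu (fun y => K (x, y)) & \int[mu]_y `|K (x, y)| <= D k] &
    [/\ forall k, 0 <= D k /\ 0 <= B k, forall k l, (k <= l)%N -> D l <= D k, D @ \oo --> (0 : R),
      forall k, rI mu (\1_(L k) : E -> R) /\ \int[mu]_x (\1_(L k) x : R) <= V k &
      forall k e, 0 < e -> exists s : seq E, forall y, L k y -> exists2 x, x \in s &
        nr mu (fun z => (K (y, z))%:C - (K (x, z))%:C) <= e]].

Variables (K : E * E -> R) (L : nat -> set E) (D B V : nat -> R).
Hypothesis bK : block_kernel K L D B V.

Let mK : measurable_fun setT K. Proof. by case: bK => -[]. Qed.
Let yK x y : K (x, y) = K (y, x). Proof. by case: bK => -[]. Qed.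
Let mL k : measurable (L k). Proof. by case: bK => _ []. Qed.
Let dL k l x : L k x -> L l x -> k = l. Proof. by case: bK => _ [_ h] _ _ _; exact: h. Qed.
Let K0 x y : K (x, y) <> 0 -> exists2 k, L k x & L k y.
Proof. by case: bK => _ _ h _ _; exact: h. Qed.
Let D0 k : 0 <= D k. Proof. by case: bK => _ _ _ _ [h _ _ _ _]; case: (h k). Qed.
Let B0 k : 0 <= B k. Proof. by case: bK => _ _ _ _ [h _ _ _ _]; case: (h k). Qed.
Let Ddec k l : (k <= l)%N -> D l <= D k. Proof. by case: bK => _ _ _ _ [_ h _ _ _]; exact: h. Qed.
Let Dlim : D @ \oo --> (0 : R). Proof. by case: bK => _ _ _ _ []. Qed.
Let KB k x y : L k x -> `|K (x, y)| <= B k.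
Proof. by case: bK => _ _ _ h _ Lx; have [h1 _ _] := h k x Lx. Qed.
Let KI k x : L k x -> rI mu (fun y => K (x, y)).
Proof. by case: bK => _ _ _ h _ Lx; have [_ h1 _] := h k x Lx. Qed.
Let KD k x : L k x -> \int[mu]_y `|K (x, y)| <= D k.
Proof. by case: bK => _ _ _ h _ Lx; have [_ _ h1] := h k x Lx. Qed.
Let LV k : rI mu (\1_(L k) : E -> R) /\ \int[mu]_x (\1_(L k) x : R) <= V k.
Proof. by case: bK => _ _ _ _ [_ _ _ h _]. Qed.
Let Ktb k e : 0 < e -> exists s : seq E, forall y, L k y -> exists2 x, x \in s &
  nr mu (fun z => (K (y, z))%:C - (K (x, z))%:C) <= e.
Proof. by case: bK => _ _ _ _ [_ _ _ _ h]; exact: h. Qed.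

(** Unions of blocks, up to points where K vanishes; their indicators commute with the
   operator. *)
Definition saturated A := measurable A /\ forall k x y, L k x -> L k y -> A x -> A y.

Lemma saturatedT : saturated setT. Proof. by split. Qed.

Lemma saturatedL k : saturated (L k).
Proof. by split=> // l x y lx ly kx; rewrite -(dL lx kx). Qed.

Lemma saturatedC A : saturated A -> saturated (~` A).
Proof.
move=> [mA sA]; split; first exact: measurableC.
by move=> k x y kx ky nAx Ay; apply: nAx; exact: sA ky kx Ay.
Qed.

Definition first_blocks M : set E := \big[setU/set0]_(k < M) L k.

Lemma first_blocksP M x : first_blocks M x <-> exists2 k, (k < M)%N & L k x.
Proof.
rewrite /first_blocks -bigcup_mkord; split => [[k /= kM Lk]|[k kM Lk]]; by exists k.
Qed.

Lemma saturated_first M : saturated (first_blocks M).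
Proof.
split; first exact: bigsetU_measurable.
move=> k x y kx ky /first_blocksP[l lM lx]; apply/first_blocksP; exists l => //.
by rewrite -(dL kx lx).
Qed.

Lemma indK A x y : saturated A -> \1_A x * K (x, y) = \1_A y * K (x, y).
Proof.
move=> [_ sA]; have [->|/eqP/K0[k kx ky]] := eqVneq (K (x, y)) 0; first by rewrite !mulr0.
congr (_ * _); rewrite !indicE; congr (_%:R); congr nat_of_bool.
by apply/idP/idP; rewrite !inE; [exact: (sA k x y)|exact: (sA k y x)].
Qed.

Lemma sub_schur A d : saturated A -> 0 <= d -> (forall k x, L k x -> A x -> D k <= d) ->
  schur_kernel (fun z => \1_A z.1 * K z) d.
Proof.
move=> sA d0 hd; split.
- apply: measurable_funM => //.
  by apply: (@measurableT_comp _ _ _ _ _ _ (\1_A : E -> R)) => //; exact: measurable_indic sA.1.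
- by move=> x y /=; rewrite indK// yK.
- move=> x; have [[k kx]|nL] := pselect (exists k, L k x).
    exists (B k) => y /=; rewrite normrM; apply: le_trans (KB y kx).
    by rewrite ler_piMl// indicE; case: (_ \in _); rewrite ?normr1 ?normr0.
  exists 0 => y /=; rewrite (_ : K (x, y) = 0) ?mulr0 ?normr0//.
  by apply: contrapT => /K0[k kx _]; apply: nL; exists k.
- move=> x /=; have [[k kx]|nL] := pselect (exists k, L k x); last first.
    have e y : K (x, y) = 0 by apply: contrapT => /K0[k kx _]; apply: nL; exists k.
    split; first by under eq_fun do rewrite e mulr0; exact: rI0.
    by under eq_Rintegral do rewrite e mulr0 normr0; rewrite rint0.
  split; first by apply: rIZ; exact: KI kx.
  under eq_Rintegral do rewrite normrM.
  rewrite rintZ; last by apply: rI_norm; exact: KI kx.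
  rewrite indicE; have [Ax|nAx] := pselect (A x); last by rewrite memNset// normr0 mul0r.
  by rewrite mem_set// normr1 mul1r (le_trans (KD kx))//; exact: hd kx Ax.
Qed.

Lemma schurK : schur_kernel K (D 0%N).
Proof.
have := @sub_schur setT (D 0%N) saturatedT (D0 0) (fun k x _ _ => Ddec (leq0n k)).
by congr schur_kernel; apply/funext => z; rewrite indicT mul1r.
Qed.

Lemma kopA A F x : kop (fun z => \1_A z.1 * K z) F x = ic A x * kop K F x.
Proof.
rewrite /kop /=; have [[Ax e]|[Ax e]] := ic01 (R := R) A x; rewrite e ?mul1r ?mul0r.
  by apply: eq_ci => y; rewrite indicE mem_set// mul1r.
by rewrite (eq_ci mu (g := fun=> 0)) ?ci0// => y; rewrite indicE memNset// !mul0r.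
Qed.

Lemma kop_ic A F x : saturated A -> kop K (fun y => ic A y * F y) x = ic A x * kop K F x.
Proof.
move=> sA; rewrite -kopA; apply: eq_ci => y.
by rewrite /ic mulrA -rmorphM /= (indK x y sA) [_ * K _]mulrC.
Qed.

Lemma icM A x : ic A x * ic A x = ic A x :> R[i].
Proof. by have [[_ ->]|[_ ->]] := ic01 (R := R) A x; rewrite ?mul1r ?mul0r. Qed.

Lemma sub_nr A d F : saturated A -> 0 <= d -> (forall k x, L k x -> A x -> D k <= d) ->
  L2 mu F -> nr mu (fun x => ic A x * kop K F x) <= d ^+ 2 * nr mu (fun x => ic A x * F x).
Proof.
move=> sA d0 hd LF; have sK := sub_schur sA d0 hd.
have [_] := schur_nr sK (L2_ic sA.1 LF).
congr (_ <= _); congr nr; apply/funext => x.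
by rewrite kopA kop_ic// mulrA icM.
Qed.

Lemma kop_off F x : (forall k, ~ L k x) -> kop K F x = 0.
Proof.
move=> nL; rewrite /kop (eq_ci mu (g := fun=> 0)) ?ci0// => y.
rewrite (_ : K (x, y) = 0) ?mul0r//.
by apply: contrapT => /K0[k kx _]; exact: nL kx.
Qed.

Lemma kop_L2 F : L2 mu F -> L2 mu (kop K F). Proof. by move=> /(schur_nr schurK)[]. Qed.

Lemma kop_nr F : L2 mu F -> nr mu (kop K F) <= D 0%N ^+ 2 * nr mu F.
Proof. by move=> /(schur_nr schurK)[]. Qed.

(** Restricting an eigenfunction to a block gives an eigenfunction of the block, so
   the eigenvalue is at most D k unless the restriction vanishes. *)
Lemma eigen_block F s k (p : R) : L2 mu F -> 0 <= s -> 2 < p ->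
  (forall x, kop K (kop K F) x = (s ^+ 2)%:C * F x) ->
  s `^ p * nr mu (fun x => ic (L k) x * F x) <=
  D k `^ (p - 2) * nr mu (fun x => ic (L k) x * kop K F x).
Proof.
move=> LF s0 p2 eF.
set Fk := fun x => ic (L k) x * F x.
have LFk : L2 mu Fk by apply: L2_ic.
have eKFk : kop K Fk = fun x => ic (L k) x * kop K F x.
  by apply/funext => x; exact: (kop_ic F x (saturatedL k)).
have e : nr mu (kop K Fk) = s ^+ 2 * nr mu Fk.
  have e1 : ip mu (kop K Fk) (kop K Fk) = ip mu Fk (kop K (kop K Fk)).
    by apply: (kop_sym schurK) => //; exact: kop_L2.
  have e2 : ip mu Fk (kop K (kop K Fk)) = (s ^+ 2)%:C * ip mu Fk Fk.
    have -> : kop K (kop K Fk) = fun x => (s ^+ 2)%:C * Fk x.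
      apply/funext => x; rewrite eKFk (kop_ic _ _ (saturatedL k)) eF /Fk; ring.
    rewrite ipJ; [|exact: L2Z|exact: LFk].
    by rewrite (ipZ _ LFk LFk) cJM cJR -ipJ.
  rewrite e2 !ip_nr in e1.
  move: (nr mu Fk) (nr mu (kop K Fk)) e1 => a b e1.
  by case: e1 => -> _; rewrite mul0r subr0.
rewrite -eKFk e mulrA.
have h : nr mu (kop K Fk) <= D k ^+ 2 * nr mu Fk.
  rewrite eKFk; apply: (sub_nr (saturatedL k)) => //.
  by move=> l x lx kx; rewrite (dL lx kx).
have [n0|n0] := eqVneq (nr mu Fk) 0; first by rewrite n0 !mulr0.
rewrite ler_wpM2r ?nr_ge0//.
have sD : s <= D k.
  move: h; rewrite e ler_pM2r; last by rewrite lt_neqAle eq_sym n0 nr_ge0.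
  by rewrite ler_sqr// nnegrE.
have [->|sn0] := eqVneq s 0.
  rewrite powR0; last by rewrite gt_eqF// (lt_trans _ p2).
  by rewrite expr0n mulr0.
have sp : 0 < s by rewrite lt_neqAle eq_sym sn0.
have -> : s `^ p = s `^ (p - 2) * s `^ 2.
  by rewrite -[in RHS]powRD ?subrK//; apply/implyP.
rewrite powR_mulrn// ler_wpM2r ?exprn_ge0//.
by apply: ge0_ler_powR; rewrite ?nnegrE// subr_ge0 ltW.
Qed.

Lemma ind_first M x : \1_(first_blocks M) x = \sum_(k < M) \1_(L k) x :> R.
Proof.
have [[k kM kx]|nL] := pselect (exists2 k, (k < M)%N & L k x).
  rewrite indicE mem_set; last by apply/first_blocksP; exists k.
  rewrite (bigD1 (Ordinal kM))//= indicE mem_set// big1 ?addr0// => l lk.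
  rewrite indicE memNset// => lx; move/negP: lk; apply.
  by apply/eqP/val_inj => /=; exact: dL lx kx.
rewrite indicE memNset; last by move=> /first_blocksP.
by rewrite big1// => k _; rewrite indicE memNset// => kx; apply: nL; exists k.
Qed.

Lemma nr_ic A F : measurable A -> L2 mu F ->
  rI mu (fun x => \1_A x * cabs (F x) ^+ 2) /\
  nr mu (fun x => ic A x * F x) = \int[mu]_x (\1_A x * cabs (F x) ^+ 2).
Proof.
move=> mA LF; have e x : cabs (ic A x * F x) ^+ 2 = \1_A x * cabs (F x) ^+ 2.
  rewrite cabsM exprMn /ic cabsR real_normK ?num_real//.
  by rewrite indicE; case: (_ \in _); rewrite ?expr1n ?expr0n.
split; last by apply: eq_Rintegral => x _.
by have [_] := L2_ic mA LF; under eq_fun do rewrite e.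
Qed.

Lemma nr_first M F : L2 mu F ->
  nr mu (fun x => ic (first_blocks M) x * F x) =
  \sum_(k < M) nr mu (fun x => ic (L k) x * F x).
Proof.
move=> LF; rewrite (nr_ic (saturated_first M).1 LF).2.
under eq_Rintegral do rewrite ind_first mulr_suml.
rewrite rint_sum; last by move=> k _; exact: (nr_ic (mL k) LF).1.
by apply: eq_bigr => k _; rewrite (nr_ic (mL k) LF).2.
Qed.

Lemma first_cvg F : L2 mu F -> (forall x, (forall k, ~ L k x) -> F x = 0) ->
  (fun M => nr mu (fun x => ic (first_blocks M) x * F x - F x)) @ \oo --> (0 : R).
Proof.
move=> LF F0; apply: (nr_dct (g := fun x => cabs (F x)) _ LF.1 LF.2 _ _).2.
- by move=> M; apply: cmeasM; [exact: (cmeas_ic (saturated_first M).1)|exact: LF.1].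
- move=> x; have [[k kx]|nL] := pselect (exists k, L k x); last first.
    rewrite F0; last by move=> k kx; apply: nL; exists k.
    by rewrite (_ : (fun M => _) = fun=> 0); [exact: ctend_cst|apply/funext => M; rewrite mulr0].
  apply: cvg_near_cst; near=> M.
  have [[_ ->]|[h _]] := ic01 (R := R) (first_blocks M) x; first by rewrite mul1r subrr cabs0.
  by case: h; apply/first_blocksP; exists k => //; near: M; exact: nbhs_infty_gt.
- by move=> M x; rewrite cabsM ler_piMl ?cabs_ge0 ?ic_le1.
Unshelve. all: by end_near. Qed.

(** Bessel's inequality for K (x, .), integrated over a block. *)
Lemma bessel_block m (e : 'I_m -> E -> R[i]) k : (forall i, L2 mu (e i)) ->
  (forall i j, ip mu (e i) (e j) = (i == j)%:R) ->
  \sum_(i < m) nr mu (fun x => ic (L k) x * kop K (e i) x) <= B k * D k * V k.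
Proof.
move=> Le oe.
have pt x : L k x -> \sum_(i < m) cabs (kop K (e i) x) ^+ 2 <= B k * D k.
  move=> kx; have LKx := schur_section x schurK.
  have oj i j : ip mu (fun y => cj (e i y)) (fun y => cj (e j y)) = (i == j)%:R.
    transitivity (cj (ip mu (e i) (e j))).
      rewrite -ciJ; last exact: ip_cI.
      by apply: eq_ci => y; rewrite cJM.
    by rewrite oe -[(i == j)%:R]/((i == j)%:R) -(rmorph_nat (real_complex R)) cJR.
  have b := bessel (fun i => L2J (Le i)) oj LKx.
  apply: le_trans (_ : nr mu (fun y => (K (x, y))%:C) <= _).
    apply: le_trans b; apply: ler_sum => i _.
    by rewrite le_eqVlt; apply/orP; left; apply/eqP; congr (cabs _ ^+ 2); apply: eq_ci => y; rewrite cJK.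
  apply: le_trans (_ : \int[mu]_y (B k * `|K (x, y)|) <= _).
    apply: rint_le; [exact: LKx.2|by apply: rIZ; apply: rI_norm; exact: KI kx|].
    by move=> y; rewrite cabsR expr2 ler_wpM2r// KB.
  rewrite rintZ; last by apply: rI_norm; exact: KI kx.
  by rewrite ler_wpM2l// KD.
have i1 i := nr_ic (mL k) (kop_L2 (Le i)).
under eq_bigr do rewrite (i1 _).2.
rewrite -rint_sum; last by move=> i _; exact: (i1 i).1.
apply: le_trans (_ : \int[mu]_x (B k * D k * \1_(L k) x) <= _).
  apply: rint_le.
  - by apply: rI_sum => i _; exact: (i1 i).1.
  - by apply: rIZ; exact: (LV k).1.
  - move=> x; rewrite -mulr_sumr indicE.
    have [kx|nkx] := pselect (L k x); last by rewrite memNset// mul0r mulr0.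
    by rewrite mem_set// mul1r mulr1 pt.
rewrite rintZ; last exact: (LV k).1.
by rewrite ler_wpM2l ?mulr_ge0//; exact: (LV k).2.
Qed.

Lemma cvg_fin_sum (I : Type) (r : seq I) (u : nat -> I -> R) (l : I -> R) :
  (forall i, (fun m => u m i) @ \oo --> l i) ->
  (fun m => \sum_(i <- r) u m i) @ \oo --> \sum_(i <- r) l i.
Proof.
move=> h; elim: r => [|i r IH].
  by under eq_fun do rewrite big_nil; rewrite big_nil; exact: cvg_cst.
by under eq_fun do rewrite big_cons; rewrite big_cons; apply: cvgD.
Qed.

(** An eigenfunction has mass one, distributed over the blocks. On block k, s^p times the
   mass is at most D k^(p-2) times the mass of the image, and the masses of the images
   add up to at most the squared Hilbert-Schmidt norm of the block. *)
Lemma schatten_sum (p C : R) m (e : 'I_m -> E -> R[i]) (s : 'I_m -> R) : 2 < p ->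
  (forall M, \sum_(k < M) D k `^ (p - 2) * (B k * D k * V k) <= C) ->
  (forall i, L2 mu (e i)) -> (forall i j, ip mu (e i) (e j) = (i == j)%:R) ->
  (forall i, 0 <= s i) ->
  (forall i, {ae mu, forall x, kop K (kop K (e i)) x = ((s i) ^+ 2)%:C * e i x}) ->
  \sum_(i < m) s i `^ p <= C.
Proof.
move=> p2 hC Le oe s0 he.
pose g i := if s i == 0 then e i else fun x => ((s i) ^- 2)%:C * kop K (kop K (e i)) x.
have LKK i : L2 mu (kop K (kop K (e i))) by do 2!apply: kop_L2.
have Lg i : L2 mu (g i) by rewrite /g; case: ifP => _ //; exact: L2Z.
have ge i : {ae mu, forall x, g i x = e i x}.
  rewrite /g; case: ifPn => [_|si]; first exact: aeW.
  apply: filterS (he i) => x ->.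
  by rewrite mulrA -rmorphM mulVf ?mul1r// expf_neq0.
have Kge i x : kop K (g i) x = kop K (e i) x by exact: (kop_ae x schurK).
have KKge i : kop K (kop K (g i)) = kop K (kop K (e i)).
  by apply/funext => x; congr (kop K _ x); apply/funext => y.
have og i j : ip mu (g i) (g j) = (i == j)%:R.
  by rewrite -oe; apply: ip_ae => //; [exact: (Lg i).1|exact: (Le i).1|exact: (Lg j).1|exact: (Le j).1].
have ng i : nr mu (g i) = 1.
  have := og i i; rewrite ip_nr eqxx => h; exact: (congr1 (@complex.Re R) h).
have eig i : s i <> 0 -> forall x, kop K (kop K (g i)) x = ((s i) ^+ 2)%:C * g i x.
  move=> /eqP si x; rewrite KKge /g (negbTE si) mulrA -rmorphM mulfV ?mul1r//.
  exact: expf_neq0.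
have bnd i k : s i `^ p * nr mu (fun x => ic (L k) x * g i x) <=
    D k `^ (p - 2) * nr mu (fun x => ic (L k) x * kop K (g i) x).
  have [si|/eqP si] := eqVneq (s i) 0; last exact: eigen_block (eig i si).
  rewrite si powR0 ?mul0r ?mulr_ge0 ?powR_ge0 ?nr_ge0//.
  by rewrite gt_eqF// (lt_trans _ p2).
have lim : (fun M => \sum_(i < m) s i `^ p * nr mu (fun x => ic (first_blocks M) x * g i x)) @ \oo
    --> \sum_(i < m) s i `^ p.
  apply: cvg_fin_sum => i; have [si|/eqP si] := eqVneq (s i) 0.
    rewrite si powR0; last by rewrite gt_eqF// (lt_trans _ p2).
    by under eq_fun do rewrite mul0r; exact: cvg_cst.
  rewrite -[X in _ --> X]mulr1 -(ng i); apply: cvgM; first exact: cvg_cst.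
  apply: nr_cvg => //.
    by move=> M; apply: L2_ic => //; exact: (saturated_first M).1.
  apply: first_cvg => // x nL; move/eqP: (si) => si'.
  by rewrite /g (negbTE si') kop_off// mulr0.
apply: (seq_le lim) => M.
under eq_bigr do rewrite nr_first// mulr_sumr.
rewrite exchange_big /=; apply: le_trans (hC M); apply: ler_sum => k _.
apply: le_trans (_ : \sum_(i < m) D k `^ (p - 2) * nr mu (fun x => ic (L k) x * kop K (g i) x) <= _).
  by apply: ler_sum => i _.
by rewrite -mulr_sumr ler_wpM2l ?powR_ge0// bessel_block.
Qed.

Lemma kop_diff F x y : L2 mu F ->
  cabs (kop K F x - kop K F y) ^+ 2 <=
  nr mu (fun z => (K (x, z))%:C - (K (y, z))%:C) * nr mu F.
Proof.
move=> LF; have Lx := schur_section x schurK; have Ly := schur_section y schurK.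
have := cauchy_schwarz (L2B Lx Ly) (L2J LF); rewrite nrJ ipB//; last exact: L2J.
rewrite (_ : ip _ _ _ = kop K F x); last by apply: eq_ci => z; rewrite cJK.
by rewrite (_ : ip _ _ _ = kop K F y)//; apply: eq_ci => z; rewrite cJK.
Qed.

Lemma totally_bounded_first M e : 0 < e -> exists s : seq E, forall y, first_blocks M y ->
  exists2 x, x \in s & nr mu (fun z => (K (y, z))%:C - (K (x, z))%:C) <= e.
Proof.
move=> e0; elim: M => [|M [s hs]].
  by exists [::] => y /first_blocksP[].
have [t ht] := Ktb M e0; exists (s ++ t) => y /first_blocksP[k].
rewrite ltnS leq_eqVlt => /orP[/eqP->|kM] ky.
  by have [x xt hx] := ht y ky; exists x => //; rewrite mem_cat xt orbT.
have [|x xs hx] := hs y; first by apply/first_blocksP; exists k.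
by exists x => //; rewrite mem_cat xs.
Qed.

(** Pointwise convergence on a finite net gives uniform convergence, since the images
   vary on a block as little as the rows of K. *)
Lemma ultra_uniform (U : set_system nat) (F : nat -> E -> R[i]) (N : R) G :
  UltraFilter U -> (forall m, L2 mu (F m)) -> (forall m, nr mu (F m) <= N) ->
  (forall x e, 0 < e -> U [set m | cabs (kop K (F m) x - G x) < e]) ->
  forall M e, 0 < e ->
  U [set m | forall y, first_blocks M y -> cabs (kop K (F m) y - G y) <= e].
Proof.
move=> UU LF NF hG M e e0.
have N0 : 0 <= N := le_trans (nr_ge0 _ _) (NF 0%N).
have d0 : 0 < e / 5 by rewrite divr_gt0.
have d1 : 0 < (e / 5) ^+ 2 / (N + 1) by rewrite divr_gt0 ?exprn_gt0// ltr_wpDl.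
have [s hs] := totally_bounded_first M d1.
have close m x y : nr mu (fun z => (K (y, z))%:C - (K (x, z))%:C) <= (e / 5) ^+ 2 / (N + 1) ->
    cabs (kop K (F m) y - kop K (F m) x) <= e / 5.
  move=> h; rewrite -ler_sqr ?nnegrE ?cabs_ge0 ?(ltW d0)//.
  apply: le_trans (kop_diff y x (LF m)) _.
  apply: le_trans (ler_pM (nr_ge0 _ _) (nr_ge0 _ _) h (NF m)) _.
  rewrite mulrAC ler_pdivrMr ?ltr_wpDl// ler_wpM2l ?exprn_ge0 ?(ltW d0)//.
  by rewrite lerDl.
have US : U [set m | forall x, x \in s -> cabs (kop K (F m) x - G x) < e / 5].
  elim: (s) => [|x t IH]; first by apply: filterE => m x; rewrite in_nil.
  apply: filterS (filterI (hG x _ d0) IH) => m /= [h1 h2] y.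
  by rewrite inE => /orP[/eqP->|/h2].
apply: filterS (US) => m hm y My; have [x xs hx] := hs y My.
have [m' [/= hm' hy]] := filter_ex (filterI US (hG y _ d0)).
have h1 := close m x y hx; have h2 := close m' x y hx.
have h3 := hm x xs; have h4 := hm' x xs.
rewrite (_ : kop K (F m) y - G y = (kop K (F m) y - kop K (F m) x) + (kop K (F m) x - G x)
  - (kop K (F m') x - G x) - (kop K (F m') y - kop K (F m') x) + (kop K (F m') y - G y)); last by ring.
move: (kop K (F m) y - kop K (F m) x) (kop K (F m) x - G x) (kop K (F m') x - G x) (kop K (F m') y - kop K (F m') x) (kop K (F m') y - G y) h1 h2 h3 h4 hy => a b c d f h1 h2 h3 h4 h5.
have := cabsD (a + b - c - d) f; have := cabsD (a + b - c) (- d).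
have := cabsD (a + b) (- c); have := cabsD a b; rewrite !cabsN.
move: (cabs a) (cabs b) (cabs c) (cabs d) (cabs f) (cabs (a + b)) (cabs (a + b - c)) (cabs (a + b - c - d)) (cabs (a + b - c - d + f)) h1 h2 h3 h4 h5.
move=> *; lra.
Qed.

Lemma kop_compact (F : nat -> E -> R[i]) (N : R) :
  (forall m, L2 mu (F m)) -> (forall m, nr mu (F m) <= N) ->
  exists (s : nat -> nat) G, [/\ forall m, (s m < s m.+1)%N, L2 mu G,
    forall x, (forall k, ~ L k x) -> G x = 0 &
    (fun m => nr mu (fun x => kop K (F (s m)) x - G x)) @ \oo --> (0 : R)].
Proof.
move=> LF NF; have N0 : 0 <= N := le_trans (nr_ge0 _ _) (NF 0%N).
have [U [UU ooU]] := @ultraFilterLemma nat \oo _.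
have bx x m : cabs (kop K (F m) x) <= Num.sqrt (nr mu (fun z => (K (x, z))%:C) * N).
  rewrite -[leLHS]ger0_norm ?cabs_ge0// -sqrtr_sqr ler_wsqrtr//.
  have Lx := schur_section x schurK.
  have := cauchy_schwarz Lx (L2J (LF m)); rewrite nrJ.
  rewrite (_ : ip _ _ _ = kop K (F m) x); last by apply: eq_ci => z; rewrite cJK.
  by move=> h; apply: le_trans h _; rewrite ler_wpM2l ?nr_ge0.
have lim x := ultra_clim UU (bx x).
pose G x := projT1 (cid (lim x)).
have hG x e : 0 < e -> U [set m | cabs (kop K (F m) x - G x) < e].
  by rewrite /G; case: cid => l /= h; exact: h.
have unif := ultra_uniform UU LF NF hG.
pose SV M := \sum_(k < M) V k.
have SV0 M : 0 <= SV M.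
  apply: sumr_ge0 => k _; apply: le_trans (LV k).2; apply: rint_ge0 => x.
  by rewrite indicE.
pose ee M := (M.+1%:R * (1 + SV M))^-1.
have ee0 M : 0 < ee M by rewrite invr_gt0 mulr_gt0// ltr_pwDl.
have ee1 M : ee M <= M.+1%:R^-1.
  by rewrite lef_pV2 ?posrE ?mulr_gt0 ?ltr_pwDl// ler_peMr// lerDl.
have next m k : {j | (k < j)%N /\ forall y, first_blocks m y -> cabs (kop K (F j) y - G y) <= ee m}.
  apply: cid; have [j [/= h1 h2]] := filter_ex (filterI (unif m _ (ee0 m)) (ooU _ (nbhs_infty_gt k))).
  by exists j.
pose s := fix s m := if m is m'.+1 then projT1 (next m (s m')) else projT1 (next 0%N 0%N).
have sS m : (s m < s m.+1)%N by rewrite /=; case: (next _ _) => j /= [].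
have sG m y : first_blocks m y -> cabs (kop K (F (s m)) y - G y) <= ee m.
  by case: m => [|m] /=; case: (next _ _) => j /= [] _; exact.
have G0 x : (forall k, ~ L k x) -> G x = 0.
  move=> nL; apply: cabs_eq0; apply/eqP; rewrite eq_le cabs_ge0 andbT; rewrite leNgt; apply/negP => e0.
  have [m /=] := filter_ex (hG x _ e0).
  by rewrite kop_off// sub0r cabsN ltxx.
have cG x : ctend (fun m => kop K (F (s m)) x) (G x).
  have [[k kx]|nL] := pselect (exists k, L k x); last first.
    have nL' k : ~ L k x by move=> kx; apply: nL; exists k.
    rewrite G0// (_ : (fun m => _) = fun=> 0); first exact: ctend_cst.
    by apply/funext => m; rewrite kop_off.
  apply: (squeeze_cvgr _ (cvg_cst (0 : R)) (@cvg_harmonic R)).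
  near=> m; rewrite cabs_ge0/=; apply: le_trans (ee1 m); apply: sG.
  by apply/first_blocksP; exists k => //; near: m; exact: nbhs_infty_gt.
have mG : cmeas G.
  split; [apply: (@measurable_fun_cvg _ _ _ _ (fun m x => cRe (kop K (F (s m)) x)))
         |apply: (@measurable_fun_cvg _ _ _ _ (fun m x => cIm (kop K (F (s m)) x)))].
  - by move=> m; exact: (kop_L2 (LF _)).1.1.
  - by move=> x _; exact: ctend_Re.
  - by move=> m; exact: (kop_L2 (LF _)).1.2.
  - by move=> x _; exact: ctend_Im.
have [LG _] : L2 mu G /\ nr mu G <= D 0%N ^+ 2 * N.
  apply: (nr_fatou (F := fun m => kop K (F (s m)))) => // m; first exact: kop_L2.
  by apply: le_trans (kop_nr (LF _)) _; rewrite ler_wpM2l ?exprn_ge0.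
exists s, G; split => //.
pose A m := first_blocks m.
have sA m := saturated_first m.
have head m : nr mu (fun x => ic (A m) x * (kop K (F (s m)) x - G x)) <= m.+1%:R^-1.
  have Ld := L2B (kop_L2 (LF (s m))) LG.
  have IA : rI mu (\1_(A m) : E -> R).
    rewrite (_ : \1_(A m) = fun x => \sum_(k < m) \1_(L k) x); last by apply/funext => x; exact: ind_first.
    by apply: rI_sum => k _; exact: (LV k).1.
  rewrite (nr_ic (sA m).1 Ld).2.
  apply: le_trans (_ : \int[mu]_x (ee m ^+ 2 * \1_(A m) x) <= _).
    apply: rint_le; [exact: (nr_ic (sA m).1 Ld).1|exact: rIZ|] => x.
    rewrite indicE; have [Ax|nAx] := pselect (A m x); last by rewrite memNset// mul0r mulr0.
    by rewrite mem_set// mul1r mulr1 lerXn2r ?nnegrE ?cabs_ge0 ?(ltW (ee0 _))// sG.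
  rewrite rintZ//.
  have iA : \int[mu]_x (\1_(A m) x : R) <= SV m.
    under eq_Rintegral do rewrite ind_first.
    by rewrite rint_sum => [|k _]; [apply: ler_sum => k _; exact: (LV k).2|exact: (LV k).1].
  apply: le_trans (ler_wpM2l (exprn_ge0 _ (ltW (ee0 m))) iA) _.
  have eS : ee m * SV m <= 1.
    rewrite mulrC ler_pdivrMr ?mulr_gt0 ?ltr_pwDl// mul1r.
    by apply: (@le_trans _ _ (1 + SV m)); rewrite ?lerDr// ler_peMl ?addr_ge0// ler1n.
  rewrite expr2 -mulrA; apply: le_trans (ee1 m).
  by rewrite ler_piMr// ltW.
have tailK m : nr mu (fun x => ic (~` A m) x * kop K (F (s m)) x) <= D m ^+ 2 * N.
  have sC := saturatedC (sA m).
  apply: le_trans (sub_nr (d := D m) sC (D0 m) _ (LF (s m))) _.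
    move=> k x kx nA; apply: Ddec; rewrite leqNgt; apply/negP => km; apply: nA.
    by apply/first_blocksP; exists k.
  rewrite ler_wpM2l ?exprn_ge0//; apply: le_trans (NF (s m)).
  rewrite (nr_ic sC.1 (LF _)).2; apply: rint_le; [exact: (nr_ic sC.1 (LF _)).1|exact: (LF _).2|].
  move=> x; rewrite indicE ler_piMl ?exprn_ge0 ?cabs_ge0//.
  by case: (_ \in _).
have icC (B' : set E) x : ic (~` B') x = 1 - ic B' x :> R[i].
  have [[h ->]|[h ->]] := ic01 (R := R) B' x; have [[h' ->]|[h' ->]] := ic01 (R := R) (~` B') x;
  by rewrite ?subrr ?subr0//; case: h'.
have tailG : (fun m => nr mu (fun x => ic (~` A m) x * G x)) @ \oo --> (0 : R).
  have := first_cvg LG G0.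
  under [X in X @ _ --> _ -> _]eq_fun do rewrite nrBC.
  rewrite (_ : (fun m => _) = (fun m => nr mu (fun x => ic (~` A m) x * G x)))//.
  by apply/funext => m; congr nr; apply/funext => x; rewrite icC mulrBl mul1r.
apply: (seq_squeeze0 (v := fun m => 2 * m.+1%:R^-1 + (4 * N * (D m * D m) + 4 * nr mu (fun x => ic (~` A m) x * G x)))).
  move=> m; rewrite nr_ge0/=.
  have LK := kop_L2 (LF (s m)); have Ld := L2B LK LG.
  have mC := (saturatedC (sA m)).1; have mA := (sA m).1.
  have t1 := nrD_le (L2_ic mA Ld) (L2_ic mC Ld).
  have t2 := nrB_le (L2_ic mC LK) (L2_ic mC LG).
  rewrite (_ : (fun x => ic (A m) x * (kop K (F (s m)) x - G x) + ic (~` A m) x * (kop K (F (s m)) x - G x))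
    = fun x => kop K (F (s m)) x - G x) in t1; last by apply/funext => x; rewrite icC; ring.
  rewrite (_ : (fun x => ic (~` A m) x * kop K (F (s m)) x - ic (~` A m) x * G x)
    = fun x => ic (~` A m) x * (kop K (F (s m)) x - G x)) in t2; last by apply/funext => x; ring.
  have h1 := head m; have h2 := tailK m.
  move: (nr mu _) (nr mu _) (nr mu _) (nr mu _) (nr mu _) t1 t2 h1 h2 => a b c d f t1 t2 h1 h2.
  move: (D m) (m.+1%:R^-1) h1 h2 => q r h1 h2; nra.
apply: seq_add0; first by apply: seq_mul0; exact: cvg_harmonic.
apply: seq_add0; last exact: seq_mul0.
by apply: seq_mul0; have := cvgM Dlim Dlim; rewrite mulr0; apply.
Unshelve. all: by end_near. Qed.

End blocks.

(** * The Hankel operator of a block kernel *)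

Section hankel_operator.
Context {R : realType} {n : nat}.
Local Notation mu := (@lebesgue_rV R n).
Local Notation E := 'rV[R]_n.
Implicit Types (f g F G : E -> R[i]) (A U : set E).

(** Membership in the Paley-Wiener space only asserts that a transform in L^2 exists; one
   is chosen. *)
Definition weak_ft f : E -> R[i] := 
  if pselect (exists F, L2_fourier f F) is left h then projT1 (cid h) else fun=> 0.

Definition pw_op (K : E * E -> R) f : E -> R[i] := ift (kop K (weak_ft f)).

Lemma weak_ftP f F : L2_fourier f F -> L2_fourier f (weak_ft f).
Proof.
move=> h; rewrite /weak_ft; case: pselect => [h'|[]]; last by exists F.
by case: cid.
Qed.

Lemma pw_ft U f : paley_wiener U f ->
  [/\ L2 mu f, L2 mu (weak_ft f) & L2_fourier f (weak_ft f)].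
Proof.
move=> [/Lp2_L2 Lf [F wF _]]; have h := weak_ftP wF; split => //.
by apply/Lp2_L2; case: h.
Qed.

Lemma ift_lin (a : R[i]) f g x : cI mu f -> cI mu g ->
  ift (fun y => a * f y + g y) x = a * ift f x + ift g x.
Proof.
move=> If Ig; rewrite /ift.
have -> : (fun y => cj (a * f y + g y)) = (fun y => cj a * cj (f y) + cj (g y)).
  by apply/funext => y; rewrite cJD cJM.
by rewrite fourier_lin; [rewrite cJD cJM cJK|exact: cIJ..].
Qed.

Lemma X_bounded_support (k0 : nat) F : L2 mu F -> (forall x, ~ cube k0 x -> F x = 0) -> X F.
Proof.
move=> LF F0; have := trunc_X k0 LF; congr X; apply/funext => x; rewrite /trunc.
by have [[_ ->]|[h ->]] := ic01 (R := R) (cube k0) x; rewrite ?mul1r// mul0r F0.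
Qed.

Variables (K : E * E -> R) (L : nat -> set E) (D B V : nat -> R) (U : set E) (k0 : nat).
Hypothesis bK : block_kernel K L D B V.
Hypothesis LU : forall k x, L k x -> U x.
Hypothesis Lk0 : forall k x, L k x -> cube k0 x.

Let sK := schurK bK.

Lemma blocks_X F : L2 mu F -> (forall x, (forall k, ~ L k x) -> F x = 0) -> X F.
Proof.
move=> LF F0; apply: (X_bounded_support LF) => x nx; apply: F0 => k kx.
by apply: nx; exact: Lk0 kx.
Qed.

Lemma blocks_pw F : L2 mu F -> (forall x, (forall k, ~ L k x) -> F x = 0) ->
  paley_wiener U (ift F).
Proof.
move=> LF F0; have XF := blocks_X LF F0; split; first by apply/Lp2_L2; exact: (ift_L2 XF).1.
exists F; first exact: ift_L2_fourier.
by apply: aeW => x nU; apply: F0 => k kx; apply: nU; exact: LU kx.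
Qed.

Lemma kop_X F : L2 mu F -> X (kop K F).
Proof. by move=> LF; apply: blocks_X => [|x]; [exact: kop_L2 bK _ LF|exact: kop_off bK _ _]. Qed.

Lemma pw_op_ft U' f : paley_wiener U' f -> L2_fourier (pw_op K f) (kop K (weak_ft f)).
Proof. by move=> /pw_ft[_ LF _]; apply: ift_L2_fourier; exact: kop_X. Qed.

Lemma pw_op_pw U' f : paley_wiener U' f -> paley_wiener U (pw_op K f).
Proof.
by move=> /pw_ft[_ LF _]; apply: blocks_pw => [|x]; [exact: kop_L2 bK _ LF|exact: kop_off bK _ _].
Qed.

Lemma pw_op_L2 U' f : paley_wiener U' f -> L2 mu (pw_op K f).
Proof. by move=> /pw_op_pw[/Lp2_L2]. Qed.

Lemma pw_op_bounded : bounded_operator (paley_wiener U) (pw_op K).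
Proof.
split; first by move=> f; exact: pw_op_pw.
- move=> a f g pf pg; have [Lf LF wF] := pw_ft pf; have [Lg LG wG] := pw_ft pg.
  have wl := L2_fourier_lin a Lf Lg wF wG; have wl' := weak_ftP wl.
  have Ll : L2 mu (fun x => a * f x + g x) by exact: L2_lin.
  have e := L2_fourier_uniq Ll Ll (aeW _ (fun x => erefl)) wl' wl.
  apply: aeW => x; rewrite /pw_op -ift_lin; [|exact: (kop_X _).1..].
  congr (ift _ x); apply/funext => y.
  rewrite -(kop_lin a y sK)//; apply: (kop_ae y sK) => //; last exact: L2_lin.
  by apply/Lp2_L2; case: wl'.
- exists (D 0%N) => f pf; have [Lf LF wF] := pw_ft pf.
  have D0 : 0 <= D 0%N by case: bK => _ _ _ _ [h _ _ _ _]; case: (h 0%N).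
  rewrite !Lp_norm2//; last exact: pw_op_L2 pf.
  rewrite -EFinM lee_fin (ift_L2 (kop_X LF)).2.
  have -> : D 0%N * Num.sqrt (nr mu f) = Num.sqrt (D 0%N ^+ 2 * nr mu f).
    by rewrite sqrtrM ?exprn_ge0// sqrtr_sqr ger0_norm.
  by rewrite ler_wsqrtr// (weak_nr Lf wF) (kop_nr bK).
Qed.

Lemma pw_op_ip f g : paley_wiener U f -> paley_wiener U g ->
  ip mu (pw_op K f) g = ip mu f (pw_op K g).
Proof.
move=> pf pg; have [Lf LF wF] := pw_ft pf; have [Lg LG wG] := pw_ft pg.
rewrite (weak_ip (pw_op_L2 pf) Lg (pw_op_ft pf) wG).
rewrite (weak_ip Lf (pw_op_L2 pg) wF (pw_op_ft pg)).
exact: kop_sym sK LF LG.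
Qed.

Lemma pw_op_compact : compact_operator (paley_wiener U) (pw_op K).
Proof.
move=> u M pu Mu.
have LF m : L2 mu (weak_ft (u m)) by case: (pw_ft (pu m)).
have M0 : 0 <= M.
  have [Lu _ _] := pw_ft (pu 0%N); have := Mu 0%N; rewrite Lp_norm2// lee_fin.
  by apply: le_trans; rewrite sqrtr_ge0.
have NF m : nr mu (weak_ft (u m)) <= M ^+ 2.
  have [Lu _ wF] := pw_ft (pu m); have := Mu m; rewrite Lp_norm2// lee_fin -(weak_nr Lu wF).
  move=> h; rewrite -(sqr_sqrtr (nr_ge0 mu (u m))).
  by apply: lerXn2r; rewrite ?nnegrE ?sqrtr_ge0.
have [s [G [sS LG G0 cG]]] := kop_compact bK LF NF.
exists s, (ift G); split => //; first exact: blocks_pw.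
have XG := blocks_X LG G0.
have e m : Lp_norm 2%:E (fun x => pw_op K (u (s m)) x - ift G x) =
    (Num.sqrt (nr mu (fun x => kop K (weak_ft (u (s m))) x - G x)))%:E.
  have XK := kop_X (LF (s m)).
  have Xd : X (fun x => -1 * G x + kop K (weak_ft (u (s m))) x) by exact: X_lin.
  have -> : (fun x => pw_op K (u (s m)) x - ift G x) = ift (fun x => -1 * G x + kop K (weak_ft (u (s m))) x).
    by apply/funext => x; rewrite ift_lin; [rewrite mulN1r addrC|exact: XG.1|exact: XK.1].
  rewrite Lp_norm2; last exact: (ift_L2 Xd).1.
  rewrite (ift_L2 Xd).2; congr (Num.sqrt (nr _ _))%:E.
  by apply/funext => x; rewrite mulN1r addrC.
under eq_fun do rewrite e.
apply: cvg_EFin; first exact: nearW.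
by have := seq_sqrt cG; rewrite sqrtr0; apply.
Qed.

Lemma pw_op_schatten (p C : R) : 2 < p ->
  (forall M, \sum_(k < M) D k `^ (p - 2) * (B k * D k * V k) <= C) ->
  schatten_class p (paley_wiener U) (pw_op K).
Proof.
move=> p2 hC; split; [exact: pw_op_bounded|exact: pw_op_compact|].
exists (pw_op K).
  by split; [exact: pw_op_bounded|move=> f g pf pg; exact: pw_op_ip].
exists C => m e s pe oe he.
have ft i := pw_ft (pe i).
apply: (schatten_sum bK (e := fun i => weak_ft (e i)) p2 hC) => [i|i j|i|i].
- by case: (ft i).
- have [L1 _ w1] := ft i; have [L2' _ w2] := ft j.
  by rewrite -(weak_ip L1 L2' w1 w2) -(oe i j).
- by case: (he i).
- have [_ hi] := he i; have [Le LF wF] := ft i.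
  have pA := pw_op_pw (pe i); have wA := pw_op_ft (pe i).
  have [LA LFA wFA] := pw_ft pA; have wAA := pw_op_ft pA.
  have uA := L2_fourier_uniq LA LA (aeW _ (fun x => erefl)) wFA wA.
  have eK : kop K (weak_ft (pw_op K (e i))) = kop K (kop K (weak_ft (e i))).
    apply/funext => x; apply: (kop_ae x sK) => //.
    exact: kop_L2 bK _ LF.
  rewrite eK in wAA.
  have wl := L2_fourier_lin (((s i) ^+ 2)%:C - 1) Le Le wF wF.
  have Ll := L2_lin (((s i) ^+ 2)%:C - 1) Le Le.
  have hi' : {ae mu, forall x, pw_op K (pw_op K (e i)) x = (((s i) ^+ 2)%:C - 1) * e i x + e i x}.
    by apply: filterS hi => x ->; ring.
  have u := L2_fourier_uniq (pw_op_L2 pA) Ll hi' wAA wl.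
  by apply: filterS u => x ->; ring.
Qed.

(** The substitution z = x + y turns the integral of the kernel against F into the pairing
   of phi with a translate of F. *)
Lemma pw_op_hankel (phi : E -> R) : measurable U -> measurable_fun setT phi ->
  (forall x y, K (x, y) = \1_U x * \1_U y * phi (x + y)) ->
  hankel_extension U (fun g => ci mu (fun z => (phi z)%:C * g z)) (pw_op K).
Proof.
move=> mU mphi eK f F pf wF tF; have [Lf LF' wF'] := pw_ft pf.
exists (kop K (weak_ft f)); first exact: pw_op_ft pf.
have LF : L2 mu F by apply/Lp2_L2; case: wF.
have u := L2_fourier_uniq Lf Lf (aeW _ (fun x => erefl)) wF' wF.
apply: aeW => x Ux; rewrite (kop_ae x sK LF' LF u) /hankel_kernel.
have F0 y : ~ U y -> F y = 0.
  move=> nU; case: tF => _ [T [_ TU FT]]; apply: FT => Ty; apply: nU; exact: TU.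
have mF : cmeas F by case: LF.
rewrite -(ci_translate x (f := fun z => (phi z)%:C * F (z - x))); last first.
  apply: cmeasM; first exact: cmeasR.
  exact: (cmeas_comp (measurable_translate (- x)) mF).
apply: eq_ci => y; rewrite eK addrK addrC.
have -> : \1_U x = 1 :> R by rewrite indicE mem_set.
rewrite mul1r.
have [Uy|nUy] := pselect (U y); first by rewrite indicE mem_set// mul1r.
by rewrite F0// !mulr0.
Qed.

End hankel_operator.

(** * Calculus of C2 functions on R^n *)

Section segments.
Context {R : realType}.
Implicit Types (f df ddf : R -> R).

Lemma within_cts f df : (forall s : R, 0 <= s <= 1 -> is_derive s 1 f (df s)) ->
  {within `[0, 1], continuous f}.
Proof.
move=> h; apply: derivable_within_continuous => s; rewrite in_itv/= => s01.
by have [] := h s s01.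
Qed.

Lemma mean_value f df : (forall s : R, 0 <= s <= 1 -> is_derive s 1 f (df s)) ->
  exists2 c, 0 <= c <= 1 & f 1 - f 0 = df c.
Proof.
move=> h; have h' (s : R) : s \in `]0, 1[ -> is_derive s 1 f (df s).
  by move=> /subset_itv_oo_cc; rewrite in_itv/=; exact: h.
have [c c01 e] := MVT_segment ler01 h' (within_cts h).
by exists c; [rewrite in_itv/= in c01|rewrite e subr0 mulr1].
Qed.

Lemma der_sum (I : Type) (s : seq I) (h : I -> R -> R) (dh : I -> R) (x : R) :
  (forall i, is_derive x 1 (h i) (dh i)) ->
  is_derive x 1 (fun t => \sum_(i <- s) h i t) (\sum_(i <- s) dh i).
Proof.
move=> d; elim: s => [|i s IH].
  by under eq_fun do rewrite big_nil; rewrite big_nil; exact: der_cst.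
by under eq_fun do rewrite big_cons; rewrite big_cons; exact: derD.
Qed.

(** Rolle's theorem for f(s) + f'(s)(1-s) + A(1-s)^2/2, with A making the values at the
   ends equal. *)
Lemma taylor_lagrange f df ddf : (forall s : R, 0 <= s <= 1 -> is_derive s 1 f (df s)) ->
  (forall s : R, 0 <= s <= 1 -> is_derive s 1 df (ddf s)) ->
  exists2 c, 0 <= c <= 1 & f 1 - f 0 - df 0 = 2^-1 * ddf c.
Proof.
move=> h1 h2; pose A := 2 * (f 1 - f 0 - df 0).
pose g s := f s + df s * (1 - s) + A / 2 * (1 - s) ^+ 2.
have dg (s : R) : 0 <= s <= 1 -> is_derive s 1 g ((ddf s - A) * (1 - s)).
  move=> s01; have d1 : is_derive s 1 (fun s : R => 1 - s) (0 - 1).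
    exact: (derB (der_cst s 1) (der_id s)).
  have d2 : is_derive s 1 (fun s : R => (1 - s) * (1 - s)) ((0 - 1) * (1 - s) + (1 - s) * (0 - 1)).
    exact: derM.
  have h := derD (derD (h1 s s01) (derM (h2 s s01) d1)) (derZ (A / 2) d2).
  rewrite (_ : g = fun s => f s + df s * (1 - s) + A / 2 * ((1 - s) * (1 - s))).
    by apply: (der_eq h); field.
  by apply/funext => t; rewrite /g expr2.
have g01 : g 0 = g 1 by rewrite /g /A; field.
have [c c01 [_ dc]] := @Rolle R g 0 1 ltr01
  (fun s hs => let: DeriveDef h _ := dg s (etrans (esym (in_itv _ _)) (subset_itv_oo_cc hs)) in h)
  (within_cts dg) g01.
have c01' : 0 < c < 1 by rewrite in_itv/= in c01.
have [c0 c1] := andP c01'.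
exists c; first by rewrite !ltW.
have [|_ e] := dg c; first by rewrite !ltW.
move: dc; rewrite e => /eqP; rewrite mulf_eq0 [1 - c == 0]subr_eq0 [1 == c]eq_sym (lt_eqF c1) orbF subr_eq0 => /eqP ->.
by rewrite /A mulrA mulVf ?mul1r// pnatr_eq0.
Qed.

End segments.

Section c1.
Context {R : realType} {n : nat}.
Local Notation E := 'rV[R]_n.
Local Notation "'d_ i" := (fun f : E -> R => 'D_(delta_mx ord0 i : E) f) (at level 8, i at level 2).
Implicit Types (f : E -> R) (x y z p v : E) (W : set E) (r e : R).

Definition sball p r : set E := [set z | forall i, `|z ord0 i - p ord0 i| < r].

Lemma ball_sball p r : 0 < r -> ball p r = sball p r.
Proof.
move=> r0; apply/seteqP; split => z /=.
  by move=> [_ h] i; have := h ord0 i; rewrite /ball /= distrC.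
move=> h; split => // i j; rewrite (ord1 i) /ball /= distrC; exact: h.
Qed.

Lemma nbhs_sball p W : nbhs p W <-> exists2 r, 0 < r & sball p r `<=` W.
Proof.
split; first by move=> /nbhs_ballP[r /= r0 h]; exists r => //; rewrite -ball_sball.
by move=> [r r0 h]; apply/nbhs_ballP; exists r => //=; rewrite ball_sball.
Qed.

Lemma sball_center p r : 0 < r -> sball p r p.
Proof. by move=> r0 i; rewrite subrr normr0. Qed.

Lemma sball_sub p r r' : r <= r' -> sball p r `<=` sball p r'.
Proof. by move=> rr z h i; apply: lt_le_trans rr; exact: h. Qed.

Lemma sball_seg p r x y (s : R) : sball p r x -> sball p r y -> 0 <= s <= 1 ->
  sball p r (s *: (y - x) + x).
Proof.
move=> hx hy /andP[s0 s1] i; rewrite !mxE; have := hx i; have := hy i.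
rewrite !ltr_norml; move: (x ord0 i) (y ord0 i) (p ord0 i) => a b c /andP[h1 h2] /andP[h3 h4].
have [s1'|s1'] := ltP s 1; last first.
  have -> : s = 1 by apply/eqP; rewrite eq_le s1 s1'.
  by rewrite mul1r subrK; apply/andP.
have p1 : 0 <= s * (r - (b - c)) by rewrite mulr_ge0// subr_ge0 ltW.
have p2 : 0 < (1 - s) * (r - (a - c)) by rewrite mulr_gt0// subr_gt0.
have p3 : 0 <= s * (r + (b - c)) by rewrite mulr_ge0// addrC -lerBlDr sub0r ltW.
have p4 : 0 < (1 - s) * (r + (a - c)) by rewrite mulr_gt0 ?subr_gt0// addrC -ltrBlDr sub0r.
by apply/andP; split; lra.
Qed.

Lemma line_der f z v (t d : R) : is_derive (t *: v + z) v f d ->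
  is_derive t 1 (fun s => f (s *: v + z)) d.
Proof.
move=> /line_derive h.
have := @der_affine R (fun h => f (h *: v + (t *: v + z))) t 1 (- t) d.
rewrite !mul1r subrr => /(_ h).
rewrite (_ : (fun s : R => _) = fun s => f (s *: v + z))//.
by apply/funext => s; rewrite mul1r addrA -scalerDl subrK.
Qed.

Definition upd_coord (k : nat) x y : E := \row_i (if (i < k)%N then y ord0 i else x ord0 i).

Lemma sball_increment f p r (g : 'I_n -> R) e :
  (forall z, sball p r z -> forall i, derivable f z (delta_mx ord0 i) /\ `|'d_i f z - g i| <= e) ->
  forall x y, sball p r x -> sball p r y ->
  `|f y - f x - \sum_(i < n) g i * (y ord0 i - x ord0 i)| <=
  e * \sum_(i < n) `|y ord0 i - x ord0 i|.
Proof.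
move=> hf x y hx hy; pose z k := upd_coord k x y.
have hz k : sball p r (z k).
  by move=> i; rewrite mxE; case: ifP => _; [exact: hy|exact: hx].
have z0 : z 0%N = x by apply/rowP => i; rewrite mxE.
have zn : z n = y by apply/rowP => i; rewrite mxE ltn_ord.
have zS (k : 'I_n) : z k.+1 = (y ord0 k - x ord0 k) *: delta_mx ord0 k + z k.
  apply/rowP => i; rewrite !mxE eqxx ltnS leq_eqVlt.
  have [->|ik] := eqVneq i k; first by rewrite eqxx ltnn mulr1 subrK.
  by rewrite [(i : nat) == k](negbTE ik) mulr0 add0r.
have step (k : 'I_n) : `|f (z k.+1) - f (z k) - g k * (y ord0 k - x ord0 k)| <=
    e * `|y ord0 k - x ord0 k|.
  set c := y ord0 k - x ord0 k.
  pose psi (t : R) := f (t *: delta_mx ord0 k + z k).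
  have inb (s : R) : 0 <= s <= 1 -> sball p r ((c * s) *: delta_mx ord0 k + z k).
    move=> s01; have := sball_seg (hz k) (hz k.+1) s01.
    by rewrite zS addrK scalerA mulrC.
  have dpsi (s : R) : 0 <= s <= 1 -> is_derive s 1 (fun s => psi (c * s))
      (c * 'd_k f ((c * s) *: delta_mx ord0 k + z k)).
    move=> s01; apply: der_lin; apply: line_der; apply: DeriveDef => //.
    by have [] := hf _ (inb s s01) k.
  have [s s01 es] := mean_value dpsi.
  have -> : f (z k.+1) - f (z k) = c * 'd_k f ((c * s) *: delta_mx ord0 k + z k).
    by rewrite -es /psi mulr1 mulr0 scale0r add0r zS.
  rewrite [g k * c]mulrC -mulrBr normrM mulrC ler_wpM2r//.
  by have [] := hf _ (inb s s01) k.
have tele : f y - f x = \sum_(k < n) (f (z k.+1) - f (z k)).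
  by rewrite -(big_mkord xpredT (fun k => f (z k.+1) - f (z k))) telescope_sumr// zn z0.
rewrite tele -sumrB mulr_sumr; apply: le_trans (ler_norm_sum _ _ _) _.
by apply: ler_sum => k _; exact: step.
Qed.

Definition C1_on W f := forall x, W x -> forall i,
  derivable f x (delta_mx ord0 i) /\ {for x, continuous ('d_i f)}.

Lemma sum_norm_le v : \sum_(i < n) `|v ord0 i| <= n%:R * `|v|.
Proof.
apply: (@le_trans _ _ (\sum_(i < n) `|v|)); last by rewrite sumr_const card_ord mulr_natl.
apply: ler_sum => i _.
by rewrite [leRHS]/Num.norm /= mx_normrE; apply/bigmax_geP; right => /=; exists (ord0, i).
Qed.

Definition lindot (c : 'I_n -> R) v : R := \sum_(i < n) c i * v ord0 i.

Fact lindot_linear c : linear (lindot c).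
Proof.
move=> a u v; rewrite /lindot /GRing.scale /= mulr_sumr -big_split/=; apply: eq_bigr => i _.
by rewrite !mxE; ring.
Qed.

HB.instance Definition _ c := GRing.isLinear.Build R E R *:%R (lindot c) (@lindot_linear c).

Lemma lindot_cts c : continuous (lindot c).
Proof.
by apply: cts_sum => i x; apply: (@continuousM R E (cst (c i))); [exact: cst_continuous|exact: continuous_coord].
Qed.

Lemma cts_near f p e : {for p, continuous f} -> 0 < e -> \forall z \near p, `|f z - f p| <= e.
Proof.
move=> ci e0; have /cvgrPdist_le /(_ _ e0) h := ci.
by apply: filterS h => z; rewrite distrC.
Qed.

Lemma near_partials W f x e : open W -> C1_on W f -> W x -> 0 < e ->
  exists2 r, 0 < r & forall z, sball x r z -> W z /\
    forall i, `|'d_i f z - 'd_i f x| <= e.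
Proof.
move=> oW c1 Wx e0.
have h : \forall z \near x, W z /\ forall i, `|'d_i f z - 'd_i f x| <= e.
  apply: filterI; first exact: open_nbhs_nbhs.
  apply: (@filter_forall E 'I_n (fun i z => `|'d_i f z - 'd_i f x| <= e) (nbhs x) _) => i.
  by have [_ ci] := c1 x Wx i; exact: (cts_near ci e0).
by have /nbhs_sball[r r0 hr] := h; exists r.
Qed.

(** The increment is split along the coordinate directions; the mean value theorem applies
   to each step. *)
Lemma C1_diff W f x : open W -> C1_on W f -> W x ->
  differentiable f x /\ forall v, 'd f x v = lindot (fun i => 'd_i f x) v.
Proof.
move=> oW c1 Wx.
pose l := lindot (fun i => 'd_i f x).
have hl e : 0 < e -> \forall v \near (0 : E), `|f (v + x) - (f x + l v)| <= e * `|v|.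
  move=> e0.
  have e1 : 0 < e / n.+1%:R by rewrite divr_gt0.
  have [r r0 hr] := near_partials oW c1 Wx e1.
  have h : nbhs (0 : E) (sball 0 r) by apply/nbhs_sball; exists r.
  apply: filterS h => v hv.
  have hvx : sball x r (v + x) by move=> i; have := hv i; rewrite !mxE subr0 addrK.
  have inc := sball_increment (f := f) (p := x) (r := r) (g := fun i => 'd_i f x) (e := e / n.+1%:R) _ (sball_center x r0) hvx.
  have -> : f (v + x) - (f x + l v) =
    f (v + x) - f x - \sum_(i < n) 'd_i f x * ((v + x) ord0 i - x ord0 i).
    rewrite opprD addrA; congr (_ - _); apply: eq_bigr => i _.
    by rewrite mxE addrK.
  apply: le_trans (inc _) _.
    by move=> z /hr[Wz hz] i; split; [case: (c1 z Wz i)|exact: hz].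
  have -> : \sum_(i < n) `|(v + x) ord0 i - x ord0 i| = \sum_(i < n) `|v ord0 i|.
    by apply: eq_bigr => i _; rewrite mxE addrK.
  apply: le_trans (ler_wpM2l (ltW e1) (sum_norm_le v)) _.
  rewrite -mulrA ler_wpM2l ?(ltW e0)// mulrA ler_piMl//.
  by rewrite mulrC ler_pdivrMr// mul1r ler_nat.
have d : 'd f x = l :> (E -> R).
  by rewrite /l; apply: diff_unique; [exact: lindot_cts|apply/eqaddoP].
split; first by apply/diff_locallyP; rewrite d; split; [exact: lindot_cts|apply/eqaddoP].
by move=> v; rewrite d.
Qed.

Lemma C1_line W f p v (t : R) : open W -> C1_on W f -> W (t *: v + p) ->
  is_derive t 1 (fun s => f (s *: v + p)) (lindot (fun i => 'd_i f (t *: v + p)) v).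
Proof.
move=> oW c1 Wx; apply: line_der; have [df e] := C1_diff oW c1 Wx.
by apply: DeriveDef; [exact: diff_derivable|rewrite deriveE].
Qed.

Lemma Ck2_C1 W f : Ck_on 2 W f -> C1_on W f /\ forall i, C1_on W ('d_i f).
Proof.
move=> c2; split => [x Wx i|i x Wx j].
  have [_ h0] := c2 [::] x Wx isT; have [h1 _] := c2 [:: i] x Wx isT.
  by split; [exact: h0|].
have [_ h0] := c2 [:: i] x Wx isT; have [h1 _] := c2 [:: j; i] x Wx isT.
by split; [exact: h0|].
Qed.

Definition hess f p i j : R := 'd_j ('d_i f) p.

Definition qform (H : 'I_n -> 'I_n -> R) v : R :=
  \sum_(i < n) v ord0 i * \sum_(j < n) H i j * v ord0 j.

Lemma qform_bound (H : 'I_n -> 'I_n -> R) e v : (forall i j, `|H i j| <= e) ->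
  `|qform H v| <= n%:R * e * dotr v v.
Proof.
move=> hH; rewrite /qform; apply: le_trans (ler_norm_sum _ _ _) _.
have b i : `|v ord0 i * \sum_(j < n) H i j * v ord0 j| <=
    \sum_(j < n) e * 2^-1 * (v ord0 i * v ord0 i + v ord0 j * v ord0 j).
  rewrite mulr_sumr; apply: le_trans (ler_norm_sum _ _ _) _; apply: ler_sum => j _.
  rewrite !normrM mulrCA -mulrA; apply: ler_pM; rewrite ?mulr_ge0//.
  rewrite -!expr2 -[v ord0 i ^+ 2]real_normK ?num_real// -[v ord0 j ^+ 2]real_normK ?num_real//.
  have := sqr_ge0 (`|v ord0 i| - `|v ord0 j|).
  by move: `|_| `|_| => a c; rewrite sqrrB; lra.
apply: le_trans (ler_sum _ (fun i _ => b i)) _.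
rewrite (eq_bigr (fun i => n%:R * (e * 2^-1) * (v ord0 i * v ord0 i) + e * 2^-1 * dotr v v)); last first.
  move=> i _; rewrite -mulr_sumr big_split /= sumr_const card_ord -/(dotr v v) -mulr_natl; ring.
rewrite big_split /= -mulr_sumr -/(dotr v v) sumr_const card_ord -mulr_natl.
by rewrite le_eqVlt; apply/orP; left; apply/eqP; field.
Qed.

Lemma near_hess W f p e : open W -> Ck_on 2 W f -> W p -> 0 < e ->
  exists2 r, 0 < r & forall z, sball p r z -> W z /\
    forall i j, `|hess f z i j - hess f p i j| <= e.
Proof.
move=> oW c2 Wp e0; have [_ c1] := Ck2_C1 c2.
have h : \forall z \near p, W z /\ forall i j, `|hess f z i j - hess f p i j| <= e.
  apply: filterI; first exact: open_nbhs_nbhs.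
  apply: (@filter_forall E 'I_n (fun i z => forall j, `|hess f z i j - hess f p i j| <= e) (nbhs p) _) => i.
  apply: (@filter_forall E 'I_n (fun j z => `|hess f z i j - hess f p i j| <= e) (nbhs p) _) => j.
  by have [_ ci] := c1 i p Wp j; exact: (cts_near ci e0).
by have /nbhs_sball[r r0 hr] := h; exists r.
Qed.

(** Taylor's formula at order 2, uniform in the base point near p0: the Hessian is
   frozen at p0. *)
Lemma taylor2 W f p0 e : open W -> Ck_on 2 W f -> W p0 -> 0 < e ->
  exists2 r, 0 < r & sball p0 r `<=` W /\ forall p x, sball p0 r p -> sball p0 r x ->
    `|f x - f p - lindot (fun i => 'd_i f p) (x - p) - 2^-1 * qform (hess f p0) (x - p)|
    <= e * dotr (x - p) (x - p).
Proof.
move=> oW c2 Wp0 e0; have [c1 c1'] := Ck2_C1 c2.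
have e1 : 0 < e / n.+1%:R by rewrite divr_gt0.
have [r r0 hr] := near_hess oW c2 Wp0 e1.
exists r => //; split => [z /hr[]//|p x hp hx]; set v := x - p.
have inb (s : R) : 0 <= s <= 1 -> sball p0 r (s *: v + p) by exact: sball_seg.
have d1 (s : R) : 0 <= s <= 1 -> is_derive s 1 (fun s => f (s *: v + p))
    (lindot (fun i => 'd_i f (s *: v + p)) v).
  by move=> s01; apply: (C1_line oW c1); have [] := hr _ (inb s s01).
have d2 (s : R) : 0 <= s <= 1 -> is_derive s 1 (fun s => lindot (fun i => 'd_i f (s *: v + p)) v)
    (qform (hess f (s *: v + p)) v).
  move=> s01; have Ws : W (s *: v + p) by have [] := hr _ (inb s s01).
  rewrite /lindot /qform; apply: der_sum => i; rewrite mulrC.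
  under eq_fun do rewrite mulrC.
  rewrite [X in is_derive _ _ _ X]mulrC.
  by apply: derZ; apply: (C1_line oW (c1' i)).
have [s s01] := taylor_lagrange d1 d2.
rewrite scale1r scale0r add0r /v subrK -/v => ->.
rewrite -mulrBr; have -> : qform (hess f (s *: v + p)) v - qform (hess f p0) v =
    qform (fun i j => hess f (s *: v + p) i j - hess f p0 i j) v.
  rewrite /qform -sumrB; apply: eq_bigr => i _; rewrite -mulrBr -sumrB; congr (_ * _).
  by apply: eq_bigr => j _; rewrite mulrBl.
rewrite normrM ger0_norm// mulrC ler_pdivrMr//.
have [_ hs] := hr _ (inb s s01).
apply: le_trans (qform_bound _ hs) _.
have d0 := dotr_ge0 v.
apply: (@le_trans _ _ (e * dotr v v)); last by rewrite ler_peMr ?mulr_ge0 ?(ltW e0)// ler1n.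
rewrite ler_wpM2r// mulrA ler_pdivrMr// mulrC ler_wpM2l ?(ltW e0)//.
by rewrite ler_nat.
Qed.

Lemma lin_delta (g : 'I_n -> R) i : lindot g (delta_mx ord0 i) = g i.
Proof.
rewrite /lindot (bigD1 i)//= mxE !eqxx mulr1 big1 ?addr0// => j ji.
by rewrite mxE (negbTE ji) andbF mulr0.
Qed.

(** The mixed second difference of f over a small square, computed in two ways. *)
Lemma clairaut W f p i j : open W -> Ck_on 2 W f -> W p -> hess f p i j = hess f p j i.
Proof.
move=> oW c2 Wp; have [c1 c1'] := Ck2_C1 c2.
suff h e : 0 < e -> `|hess f p i j - hess f p j i| <= e + e.
  apply/eqP; rewrite -subr_eq0 -normr_eq0 eq_le normr_ge0 andbT leNgt; apply/negP => h0.
  have := h (`|hess f p i j - hess f p j i| / 3) (divr_gt0 h0 (ltr0Sn _ _)).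
  by move: `|_| h0 => a; lra.
move=> e0; have [r r0 hr] := near_hess oW c2 Wp e0.
pose t := r / 3; have t0 : 0 < t by rewrite divr_gt0.
pose ei k : E := delta_mx ord0 k.
pose pt (s u : R) k l := u *: ei l + (s *: ei k + p).
have inb (s u : R) k l : 0 <= s <= 1 -> 0 <= u <= 1 -> sball p r (pt (t * s) (t * u) k l).
  move=> /andP[s0 s1] /andP[u0 u1] m; rewrite !mxE eqxx/= addrA addrK.
  have b (q : bool) (w : R) : 0 <= w -> w <= 1 -> `|t * w * q%:R| <= t.
    move=> w0 w1; have t1 := ltW t0; rewrite ger0_norm; last by do 2!apply: mulr_ge0 => //.
    by case: q; rewrite ?mulr1 ?mulr0// ler_piMr.
  apply: le_lt_trans (ler_normD _ _) _.
  have := b (m == l) u u0 u1; have := b (m == k) s s0 s1.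
  by rewrite /t; move: `|_| `|_| => x y; lra.
pose D k l := (f (pt t t k l) - f (pt t 0 k l)) - (f (pt 0 t k l) - f (pt 0 0 k l)).
have main k l : exists2 z, sball p r z & D k l = t * (t * hess f z k l).
  pose phi (s : R) := f (pt (t * s) t k l) - f (pt (t * s) 0 k l).
  have ptE (s u : R) : pt s u k l = s *: ei k + (u *: ei l + p).
    by rewrite /pt addrCA.
  have ok (s u : R) : 0 <= s <= 1 -> 0 <= u <= 1 -> W (pt (t * s) (t * u) k l).
    by move=> s01 u01; have [] := hr _ (inb s u k l s01 u01).
  have ok1 (s : R) : 0 <= s <= 1 -> W (pt (t * s) t k l).
    by move=> s01; rewrite -[X in pt _ X](mulr1 t); apply: ok => //; rewrite ler01 lexx.
  have ok0 (s : R) : 0 <= s <= 1 -> W (pt (t * s) 0 k l).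
    by move=> s01; rewrite -[X in pt _ X](mulr0 t); apply: ok => //; rewrite ler01 lexx.
  have dphi (s : R) : 0 <= s <= 1 -> is_derive s 1 phi
      (t * ('d_k f (pt (t * s) t k l) - 'd_k f (pt (t * s) 0 k l))).
    move=> s01; rewrite mulrBr.
    have dd (u : R) : W (pt (t * s) u k l) ->
        is_derive s 1 (fun s => f (pt (t * s) u k l)) (t * 'd_k f (pt (t * s) u k l)).
      move=> Wu; apply: (@der_lin R (fun s => f (pt s u k l))).
      under eq_fun do rewrite ptE; rewrite ptE.
      have := @C1_line W f (u *: ei l + p) (ei k) (t * s) oW c1.
      by rewrite -ptE lin_delta ptE; apply; rewrite -ptE.
    by apply: derB; apply: dd; [exact: ok1|exact: ok0].
  have [s s01 es] := mean_value dphi.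
  have dpsi (u : R) : 0 <= u <= 1 -> is_derive u 1 (fun u => 'd_k f (pt (t * s) (t * u) k l))
      (t * hess f (pt (t * s) (t * u) k l) k l).
    move=> u01; apply: (@der_lin R (fun u => 'd_k f (pt (t * s) u k l))).
    have := @C1_line W ('d_k f) (t * s *: ei k + p) (ei l) (t * u) oW (c1' k) (ok _ _ s01 u01).
    by rewrite lin_delta.
  have [u u01 eu] := mean_value dpsi.
  exists (pt (t * s) (t * u) k l); first exact: inb.
  rewrite -eu mulr1 mulr0; move: es; rewrite /phi mulr1 mulr0 => <-.
  by rewrite /D.
have Dsym : D i j = D j i.
  rewrite /D /pt !scale0r !add0r.
  have -> : t *: ei j + (t *: ei i + p) = t *: ei i + (t *: ei j + p) by rewrite addrCA.
  ring.
have [z hz e1] := main i j; have [z' hz' e2] := main j i.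
have [_ /(_ i j) h1] := hr _ hz; have [_ /(_ j i) h2] := hr _ hz'.
have tn : t != 0 by rewrite gt_eqF.
have e3 : hess f z i j = hess f z' j i.
  have e4 := etrans (esym e1) (etrans Dsym e2).
  exact: (mulfI tn (mulfI tn e4)).
move: h1 h2; rewrite e3.
move: (hess f z' j i) (hess f p i j) (hess f p j i) => a b c h1 h2.
apply: le_trans (ler_distD a b c) _; rewrite distrC.
exact: lerD h1 h2.
Qed.

End c1.

(** * Curvature and strict convexity *)

Section quadratic_forms.
Context {R : realType}.

Lemma quad_disc (a b c : R) : (forall t, 0 <= a + 2 * t * b + t ^+ 2 * c) -> b ^+ 2 <= a * c.
Proof.
move=> h; have [c0|c0|c0] := ltgtP c 0.
- have a0 : 0 <= a by have := h 0; rewrite mulr0 mul0r expr0n mul0r !addr0.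
  exfalso.
  have n0 : 0 < - c by rewrite oppr_gt0.
  pose q := 1 + (a + 2 * `|b|) * (- c)^-1.
  have q1 : 1 <= q by rewrite lerDl mulr_ge0 ?invr_ge0 ?(ltW n0)// addr_ge0// mulr_ge0.
  have := h q; have qc : q * (- c) = - c + (a + 2 * `|b|) by rewrite /q mulrDl mul1r mulfVK ?gt_eqF.
  have -> : q ^+ 2 * c = - (q * (q * - c)) by ring.
  rewrite qc; have := ler_norm b; move: (`|b|) => z bz.
  move=> h'.
  have k1 : q * b <= q * z by rewrite ler_wpM2l// (le_trans ler01).
  have k2 : a <= q * a by rewrite ler_peMl.
  have k3 : - c <= q * - c by rewrite ler_peMl// ltW.
  have k4 : q * (- c + (a + 2 * z)) = q * - c + q * a + 2 * (q * z) by ring.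
  rewrite k4 in h'; lra.
- have c0' : c != 0 by rewrite gt_eqF.
  have := h (- b / c).
  have -> : a + 2 * (- b / c) * b + (- b / c) ^+ 2 * c = a - b ^+ 2 / c by field.
  by rewrite subr_ge0 ler_pdivrMr.
- rewrite c0 mulr0; have [->|b0] := eqVneq b 0; first by rewrite expr0n.
  have := h (- (a + 1) / (2 * b)); rewrite c0 mulr0 addr0.
  have -> : a + 2 * (- (a + 1) / (2 * b)) * b = - 1 by field.
  by rewrite oppr_ge0 ler10.
Qed.

Lemma dotr_mulmx n (x y : 'rV[R]_n) : dotr x y = (x *m y^T) ord0 ord0.
Proof. by rewrite mxE; apply: eq_bigr => i _; rewrite mxE. Qed.

Lemma dotrDl n (x y z : 'rV[R]_n) : dotr (x + y) z = dotr x z + dotr y z.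
Proof. by rewrite -big_split/=; apply: eq_bigr => i _; rewrite mxE mulrDl. Qed.

Lemma dotrZl n (a : R) (x y : 'rV[R]_n) : dotr (a *: x) y = a * dotr x y.
Proof. by rewrite mulr_sumr; apply: eq_bigr => i _; rewrite mxE mulrA. Qed.

Lemma dotrDr n (x y z : 'rV[R]_n) : dotr z (x + y) = dotr z x + dotr z y.
Proof. by rewrite dotrC dotrDl !(dotrC _ z). Qed.

Lemma dotrZr n (a : R) (x y : 'rV[R]_n) : dotr x (a *: y) = a * dotr x y.
Proof. by rewrite dotrC dotrZl dotrC. Qed.

Lemma dotrNl n (x y : 'rV[R]_n) : dotr (- x) y = - dotr x y.
Proof. by rewrite -scaleN1r dotrZl mulN1r. Qed.

Lemma dotr_mul n m (A : 'M[R]_(m, n)) (x : 'rV[R]_m) (y : 'rV[R]_n) :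
  dotr (x *m A) y = dotr x (y *m A^T).
Proof. by rewrite !dotr_mulmx trmx_mul trmxK mulmxA. Qed.

Lemma qform_mx n (H : 'M[R]_n) (v : 'rV[R]_n) : qform (fun i j => H i j) v = dotr (v *m H) v.
Proof.
rewrite dotr_mul dotrC /qform; apply: eq_bigr => i _; rewrite mulrC; congr (_ * _).
by rewrite mxE; apply: eq_bigr => j _; rewrite mxE mulrC.
Qed.

Lemma bilin_bound n (H : 'M[R]_n) : exists2 C, 0 < C &
  forall v : 'rV[R]_n, `|dotr (v *m H) v| <= C * dotr v v.
Proof.
pose e := \sum_(i < n) \sum_(j < n) `|H i j|.
have e0 : 0 <= e by apply: sumr_ge0 => i _; apply: sumr_ge0.
exists (n%:R * e + 1) => [|v]; first by rewrite ltr_wpDl// mulr_ge0.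
rewrite -qform_mx; apply: le_trans (qform_bound (e := e) v _) _.
  move=> i j; rewrite /e (bigD1 i)//= (bigD1 j)//= -addrA lerDl addr_ge0//.
    by apply: sumr_ge0.
  by apply: sumr_ge0 => k _; apply: sumr_ge0.
by rewrite ler_wpM2r ?dotr_ge0// lerDl.
Qed.

Lemma dotr_eq0 n (v : 'rV[R]_n) : dotr v v = 0 -> v = 0.
Proof.
move=> h; apply/rowP => i; rewrite mxE; apply/eqP.
have := h; rewrite /dotr => /eqP; rewrite psumr_eq0; last by move=> j _; rewrite -expr2 sqr_ge0.
by move=> /allP /(_ i (mem_index_enum i)) /=; rewrite mulf_eq0 orbb.
Qed.

(** A positive semidefinite symmetric matrix with nonzero determinant is positive definite:
   Cauchy-Schwarz for the form of S, between v and v S^-1. *)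
Lemma psd_det_pd n (S : 'M[R]_n) : S^T = S -> (forall v, 0 <= dotr (v *m S) v) ->
  \det S != 0 -> exists2 c, 0 < c & forall v : 'rV[R]_n, c * dotr v v <= dotr (v *m S) v.
Proof.
move=> symS psd dS; have uS : S \in unitmx by rewrite unitmxE unitfE.
have [C C0 hC] := bilin_bound (invmx S).
exists C^-1 => [|v]; first by rewrite invr_gt0.
pose w := v *m invmx S.
have wS : w *m S = v by rewrite /w -mulmxA mulVmx// mulmx1.
have cs : dotr (v *m S) w ^+ 2 <= dotr (v *m S) v * dotr (w *m S) w.
  apply: quad_disc => t; have := psd (v + t *: w).
  rewrite mulmxDl dotrDl !dotrDr -scalemxAl !dotrZl !dotrZr.
  have -> : dotr (w *m S) v = dotr (v *m S) w by rewrite dotr_mul symS dotrC.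
  by congr (_ <= _); ring.
have e1 : dotr (v *m S) w = dotr v v by rewrite dotr_mul symS wS.
have e2 : dotr (w *m S) w = dotr (v *m invmx S) v by rewrite wS dotrC.
rewrite e1 e2 in cs.
have vv := dotr_ge0 v.
rewrite mulrC ler_pdivrMr//.
have [v0|v0] := eqVneq (dotr v v) 0; first by rewrite v0 mulr_ge0// ltW.
have vp : 0 < dotr v v by rewrite lt_neqAle eq_sym v0.
rewrite -(ler_pM2r vp) -expr2; apply: le_trans cs _.
rewrite -mulrA ler_wpM2l ?psd//.
by apply: le_trans (ler_norm _) _; exact: hC.
Qed.

End quadratic_forms.

Section frames.
Context {R : realType} {m n : nat}.
Variables (T : 'M[R]_(m, n)) (nu : 'rV[R]_n).
Hypotheses (mn : (m + 1 = n)%N) (TT : T *m T^T = 1%:M) (Tnu : T *m nu^T = 0)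
  (nn : dotr nu nu = 1).

Lemma frame_complete : T^T *m T + nu^T *m nu = 1%:M.
Proof.
case: _ / mn T nu TT Tnu nn => T' nu' TT' Tnu' nn'.
pose M := col_mx T' nu'.
have MM : M *m M^T = 1%:M.
  rewrite /M tr_col_mx mul_col_row TT' Tnu' -[nu' *m T'^T]trmxK trmx_mul trmxK Tnu' trmx0.
  have -> : nu' *m nu'^T = 1%:M.
    by apply/matrixP => i j; rewrite !ord1 -dotr_mulmx nn' mxE eqxx.
  by rewrite -scalar_mx_block.
have := mulmx1C MM; rewrite /M tr_col_mx mul_row_col.
by [].
Qed.

Lemma frame_decomp (d : 'rV[R]_n) : d = d *m T^T *m T + dotr d nu *: nu.
Proof.
rewrite -[LHS]mulmx1 -frame_complete mulmxDr !mulmxA; congr (_ + _).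
rewrite [d *m nu^T]mx11_scalar -dotr_mulmx mul_scalar_mx//.
Qed.

Lemma frame_tangent (w : 'rV[R]_m) : dotr (w *m T) nu = 0.
Proof.
rewrite dotr_mul -[nu *m T^T]trmxK trmx_mul trmxK Tnu trmx0.
by rewrite /dotr big1// => i _; rewrite mxE mulr0.
Qed.

Lemma frame_dotr (w w' : 'rV[R]_m) : dotr (w *m T) (w' *m T) = dotr w w'.
Proof. by rewrite dotr_mul -mulmxA TT mulmx1. Qed.

Lemma frame_sqr (d : 'rV[R]_n) :
  dotr d d = dotr (d *m T^T) (d *m T^T) + dotr d nu ^+ 2.
Proof.
rewrite {1 2}(frame_decomp d); set w := d *m T^T; set a := dotr d nu.
rewrite !(dotrDl, dotrDr, dotrZl, dotrZr) frame_dotr [dotr nu _]dotrC frame_tangent nn.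
by ring.
Qed.

End frames.

Section gauss_map.
Context {R : realType} {n : nat}.
Local Notation E := 'rV[R]_n.
Local Notation "'d_ i" := (fun f : E -> R => 'D_(delta_mx ord0 i : E) f) (at level 8, i at level 2).

Definition hessmx (f : E -> R) p : 'M[R]_n := \matrix_(i, j) hess f p j i.

Lemma gradient_lindot (f : E -> R) p : lindot (fun i => 'd_i f p) = dotr (gradient f p).
Proof.
by apply/funext => v; apply: eq_bigr => i _; rewrite mxE.
Qed.

(** The derivative of the unit normal N *: grad is N times the Hessian plus a matrix with
   rows proportional to grad, which is killed by tangent vectors. *)
Lemma jacobian_unit_normal W (rho : E -> R) p k (T : 'M[R]_(k, n)) :
  open W -> Ck_on 2 W rho -> W p -> gradient rho p != 0 -> T *m (gradient rho p)^T = 0 ->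
  T *m 'J (unit_normal rho) p *m T^T = (enorm (gradient rho p))^-1 *: (T *m hessmx rho p *m T^T).
Proof.
move=> oW c2 Wp g0 Tg; have [c1 c1'] := Ck2_C1 c2.
pose N y := (enorm (gradient rho y))^-1.
have dg i : differentiable ('d_i rho) p by have [] := C1_diff oW (c1' i) Wp.
have gp : 0 < dotr (gradient rho p) (gradient rho p).
  rewrite lt_neqAle dotr_ge0 andbT eq_sym; apply: contraNneq g0 => h.
  by apply/eqP; exact: (dotr_eq0 h).
have dS : differentiable (fun y => dotr (gradient rho y) (gradient rho y)) p.
  rewrite (_ : (fun y => _) = \sum_(i < n) ('d_i rho * 'd_i rho)).
    by apply: differentiable_sum => i; exact: differentiableM.
  apply/funext => y; rewrite fct_sumE; apply: eq_bigr => i _.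
  by rewrite !mxE.
have dN : differentiable N p.
  apply: (@differentiableV _ _ (fun y => enorm (gradient rho y))); last first.
    by rewrite gt_eqF// sqrtr_gt0.
  apply: (differentiable_comp dS); apply/derivable1_diffP.
  by have [] := is_derive1_sqrt gp.
have dU : differentiable (unit_normal rho) p.
  rewrite (_ : unit_normal rho = \sum_(j < n) (fun y => (N y * 'd_j rho y) *: delta_mx ord0 j)).
    apply: differentiable_sum => j; apply: differentiableZl.
    exact: (@differentiableM _ _ N ('d_j rho)).
  apply/funext => y; rewrite fct_sumE -[LHS]/(N y *: gradient rho y) [gradient rho y]row_sum_delta scaler_sumr.
  by apply: eq_bigr => j _; rewrite mxE scalerA.
have JE : 'J (unit_normal rho) p = N p *: hessmx rho p +
    (\row_i 'd_i N p)^T *m gradient rho p.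
  apply/matrixP => i j; rewrite !mxE big_ord1 !mxE.
  rewrite -deriveE// derive_mx; last exact: diff_derivable.
  rewrite mxE.
  have dNi : derivable N p (delta_mx ord0 i) by exact: diff_derivable.
  have dji : derivable ('d_j rho) p (delta_mx ord0 i) by exact: diff_derivable.
  have h := is_deriveM (DeriveDef dNi erefl) (DeriveDef dji erefl).
  have -> : (fun t => unit_normal rho t ord0 j) = N * 'd_j rho.
    by apply/funext => y; rewrite !mxE.
  have [_ ->] := h; rewrite /GRing.scale /= /hess; ring.
rewrite JE mulmxDr mulmxDl -scalemxAr -scalemxAl mulmxA -[_ *m gradient rho p *m T^T]mulmxA.
by rewrite -[gradient rho p *m T^T]trmxK trmx_mul trmxK Tg trmx0 mulmx0 addr0.
Qed.

End gauss_map.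

(** * A strictly convex surface near a point *)

Section arithmetic.
Context {R : realType}.

(** The expansion G h - a s^2 of a defining function at the point h nu + s u, when the
   Hessian takes the value -2a at the tangent vector u *)
Lemma normal_expansion (a G' s h c1 c2' P e x k : R) : `|x - G' * h - k| <= e * (P * s ^+ 2 + h ^+ 2) ->
  k = 2^-1 * (s ^+ 2 * (- (2 * a)) + 2 * (s * h * c1) + h ^+ 2 * c2') ->
  0 < a -> 0 < e -> 0 < s -> e * P <= a / 8 -> 0 <= h -> h <= s * s * (2 * a / G') -> 0 < G' ->
  s * (2 * a / G' * (`|c1| + 1)) <= a / 8 -> s * s * ((2 * a / G') ^+ 2 * (`|c2'| + e + 1)) <= a / 8 ->
  `|x - (G' * h - s ^+ 2 * a)| <= s ^+ 2 * (3 * a / 8).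
Proof.
move=> hx kE a0 e0 s0 eP h0 hB G'0 k1 k2.
set B := 2 * a / G' in hB k1 k2; have B0 : 0 < B by rewrite /B divr_gt0// mulr_gt0.
have s20 : 0 < s ^+ 2 by rewrite exprn_gt0.
have x1 : `|s * h * c1| <= s ^+ 2 * (a / 8).
  rewrite !normrM (gtr0_norm s0) (ger0_norm h0).
  apply: (@le_trans _ _ (s * (s * s * B) * (`|c1| + 1))).
    by apply: ler_pM; rewrite ?mulr_ge0 ?(ltW s0)// ?ler_wpM2l ?(ltW s0)// lerDl.
  have -> : s * (s * s * B) * (`|c1| + 1) = s ^+ 2 * (s * (B * (`|c1| + 1))) by ring.
  by rewrite ler_wpM2l// ltW.
have hh : h ^+ 2 <= s ^+ 2 * (s * s * B ^+ 2).
  apply: (@le_trans _ _ ((s * s * B) ^+ 2)); first by apply: lerXn2r; rewrite ?nnegrE// (le_trans h0).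
  by rewrite le_eqVlt; apply/orP; left; apply/eqP; ring.
have x2 : h ^+ 2 * (`|c2'| + e) <= s ^+ 2 * (a / 8).
  apply: (@le_trans _ _ (s ^+ 2 * (s * s * B ^+ 2) * (`|c2'| + e + 1))).
    by apply: ler_pM => //; rewrite ?sqr_ge0 ?lerDl// addr_ge0// ltW.
  have -> : s ^+ 2 * (s * s * B ^+ 2) * (`|c2'| + e + 1) = s ^+ 2 * (s * s * (B ^+ 2 * (`|c2'| + e + 1))) by ring.
  by rewrite ler_wpM2l// ltW.
have z2 : h ^+ 2 * c2' <= h ^+ 2 * `|c2'| by rewrite ler_wpM2l ?sqr_ge0// ler_norm.
have z1 : - (h ^+ 2 * c2') <= h ^+ 2 * `|c2'|.
  by rewrite -mulrN ler_wpM2l ?sqr_ge0// -normrN ler_norm.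
have x4 : s ^+ 2 * (e * P) <= s ^+ 2 * (a / 8) by rewrite ler_wpM2l// ltW.
move: x1 x2 x4 hx z1 z2; rewrite kE !ler_norml mulrDr => /andP[y1 y2] x2 x4 /andP[i1 i2].
move: (h ^+ 2 * `|c2'|) x2 => zz x2.
move: (s * h * c1) (h ^+ 2 * c2') y1 y2 i1 i2 => y w y1 y2 i1 i2.
have -> : s ^+ 2 * (3 * a / 8) = 3 * (s ^+ 2 * (a / 8)) by ring.
have e3 : e * (P * s ^+ 2 + h ^+ 2) = s ^+ 2 * (e * P) + h ^+ 2 * e by ring.
have e4 : s ^+ 2 * - (2 * a) = - 2 * (s ^+ 2 * a) by ring.
rewrite e3 e4 in i1 i2.
have e5 : s ^+ 2 * a = 8 * (s ^+ 2 * (a / 8)) by field.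
rewrite e5 in i1 i2 *.
move: (s ^+ 2 * (a / 8)) (s ^+ 2 * (e * P)) (h ^+ 2 * e) (G' * h) y1 y2 x2 x4 i1 i2.
by clear; move=> ? ? ? ? ? ? ? ? ? ? ? ?; apply/andP; split; lra.
Qed.

Lemma small_reciprocal (A1 A2 A3 A4 : R) : 0 <= A1 -> 0 <= A2 -> 0 <= A3 -> 0 <= A4 ->
  exists s, [/\ 0 < s, s <= 1, s * A1 <= 1, s * A2 <= 1 & s * A3 <= 1 /\ s * A4 <= 1].
Proof.
move=> a1 a2 a3 a4; exists (1 + A1 + A2 + A3 + A4)^-1.
have d : 0 < 1 + A1 + A2 + A3 + A4 by lra.
by split; rewrite ?invr_gt0 ?invf_le1 ?[_^-1 * _]mulrC ?ler_pdivrMr ?mul1r//; try split;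
  rewrite ?[_^-1 * _]mulrC ?ler_pdivrMr ?mul1r//; lra.
Qed.

Lemma lt_sqr_succ (z : R) : 0 <= z -> z < (z + 1) * (z + 1). Proof. by move=> *; nra. Qed.

Lemma taylor_gap (a1 a2 a3 a4 : R) : - a4 <= a1 - a2 - 2^-1 * a3 -> a1 <= 0 -> a2 + 2^-1 * a3 <= a4.
Proof. by move=> *; lra. Qed.

Lemma le_of_eq (x y : R) : x = y -> x <= y. Proof. by move=> ->. Qed.

Lemma scaled_gap (t l k : R) : 0 < t -> t <= 1 -> 0 < k -> t * l <= - k -> l <= - k.
Proof. by move=> t0 t1 k0 h; have [l0|l0] := leP l (- k) => //; nra. Qed.

Lemma two_terms_lt (x y z : R) : z <= x -> y <= x -> 0 < x -> z + y < 2 ^+ 2 * x.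
Proof. by move=> *; rewrite expr2; lra. Qed.

Lemma linear_error (a b w q r Gb Gh u : R) : w <= b -> a + 2 * b <= Gb -> u <= 2 * a ->
  `|q| <= u -> `|r - Gh - 2^-1 * q| <= w + b -> `|r - Gh| <= Gb.
Proof. by move=> h1 h2 h3; rewrite !ler_norml => /andP[? ?] /andP[? ?]; apply/andP; split; lra. Qed.

Lemma opposite_bounds (a b : R) : a <= - b -> - a <= - b -> b <= 0. Proof. by move=> *; lra. Qed.

Lemma normal_below (x y : R) : 0 < y -> x - (y / 2 - y) <= 3 * y / 8 -> x <= 0. Proof. by move=> *; lra. Qed.

Lemma normal_above (x y : R) : 0 < y -> - (3 * y / 8) <= x - (2 * y - y) -> 0 <= x. Proof. by move=> *; lra. Qed.

Lemma inward_sign (x h G c e : R) : 0 < h -> 0 < e -> h * (`|c| + e) < G ->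
  - (e * h ^+ 2) <= x - G * h - 2^-1 * (h ^+ 2 * c) -> 0 < x.
Proof.
move=> h0 e0 hG hx; have h2 : 0 < h ^+ 2 by rewrite exprn_gt0.
have l1 : h * (h * (`|c| + e)) < h * G by rewrite ltr_pM2l.
have l2 : - (h ^+ 2 * c) <= h ^+ 2 * `|c|.
  by rewrite -mulrN ler_wpM2l ?(ltW h2)// -normrN ler_norm.
have l3 : 0 <= h ^+ 2 * `|c| by rewrite mulr_ge0// ltW.
have e1 : h * (h * (`|c| + e)) = h ^+ 2 * `|c| + e * h ^+ 2 by ring.
rewrite e1 [h * G]mulrC in l1; lra.
Qed.

Lemma arith_amgm (c0 U x b Z : R) : 0 < c0 -> 0 <= U -> 0 <= Z -> x ^+ 2 <= U * Z ->
  - (2 * (b * x)) <= c0 / 2 * U + 2 / c0 * Z * b ^+ 2.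
Proof.
move=> c0p U0 Z0 cs; have cn : c0 != 0 by rewrite gt_eqF.
have [U00|Un] := eqVneq U 0.
  have x0 : x = 0.
    by apply/eqP; rewrite -sqrf_eq0 eq_le sqr_ge0 andbT; apply: le_trans cs _; rewrite U00 mul0r.
  by rewrite U00 x0 !mulr0 oppr0 add0r mulr_ge0 ?sqr_ge0// mulr_ge0 ?divr_ge0 ?(ltW c0p).
have Up : 0 < U by rewrite lt_neqAle eq_sym Un.
have y0 : 0 < c0 / 2 * U by rewrite mulr_gt0// divr_gt0.
rewrite -subr_ge0 opprK -(pmulr_rge0 _ y0).
have -> : c0 / 2 * U * (c0 / 2 * U + 2 / c0 * Z * b ^+ 2 + 2 * (b * x)) =
  (c0 / 2 * U + b * x) ^+ 2 + (U * Z - x ^+ 2) * b ^+ 2 by field.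
by rewrite addr_ge0 ?sqr_ge0// mulr_ge0 ?sqr_ge0// subr_ge0.
Qed.

Lemma arith_lower (c0 U b qu x qn Z K : R) : c0 * U <= qu -> - (b ^+ 2 * qn) <= b ^+ 2 * K ->
  - (2 * x) <= c0 / 2 * U + 2 / c0 * Z * b ^+ 2 ->
  c0 / 2 * (U + b ^+ 2) - (c0 / 2 + 2 / c0 * Z + K) * b ^+ 2 <= qu + 2 * x + b ^+ 2 * qn.
Proof.
move=> h1 h2 h3.
move: (2 / c0 * Z) h3 => y h3.
have -> : c0 / 2 * (U + b ^+ 2) - (c0 / 2 + y + K) * b ^+ 2 =
  c0 * U - c0 / 2 * U - y * b ^+ 2 - b ^+ 2 * K by field.
move: (y * b ^+ 2) (b ^+ 2 * qn) (b ^+ 2 * K) h2 h3 => s t v h2 h3.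
have e : c0 * U = 2 * (c0 / 2 * U) by field.
move: (c0 / 2 * U) (c0 * U) e h1 h3 => z z' -> h1 h3; lra.
Qed.

Lemma arith_support (l q D c1 K b G dl k nu : R) : 0 < c1 -> 0 <= D -> 0 <= k -> 0 < G ->
  K = k * G ^+ 2 -> G * b = l + dl -> dl ^+ 2 <= nu * D -> k * nu <= c1 / 8 ->
  k * `|l| <= 2^-1 -> c1 * D - K * b ^+ 2 <= q -> l + 2^-1 * q <= c1 / 8 * D ->
  l <= - (c1 / 6 * D).
Proof.
move=> c10 D0 k0 G0 KE bE hd kn kl hq hl.
have Kb : K * b ^+ 2 = k * (l + dl) ^+ 2 by rewrite -bE KE; ring.
have h1 : k * (l + dl) ^+ 2 <= k * (2 * (l ^+ 2 + dl ^+ 2)).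
  by rewrite ler_wpM2l//; have := sqr_ge0 (l - dl); rewrite !sqrrD sqrrN; lra.
have h2 : k * l ^+ 2 <= 2^-1 * `|l|.
  by rewrite -real_normK ?num_real// expr2 mulrA ler_wpM2r.
have h3 : k * dl ^+ 2 <= c1 / 8 * D.
  by apply: le_trans (ler_wpM2l k0 hd) _; rewrite mulrA ler_wpM2r.
have h4 : k * (2 * (l ^+ 2 + dl ^+ 2)) = 2 * (k * l ^+ 2) + 2 * (k * dl ^+ 2) by ring.
rewrite Kb in hq; rewrite h4 in h1.
have e1 : c1 * D = 8 * (c1 / 8 * D) by field.
have e2 : c1 / 6 * D = 4 / 3 * (c1 / 8 * D) by field.
have y0 : 0 <= c1 / 8 * D by rewrite mulr_ge0// divr_ge0// ltW.
rewrite e1 in hq; rewrite e2.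
move: (c1 / 8 * D) (k * (l + dl) ^+ 2) (k * l ^+ 2) (k * dl ^+ 2) y0 h1 h2 h3 hq hl => y s t u y0 h1 h2 h3 hq hl.
have [l0|l0] := leP 0 l; first by rewrite (ger0_norm l0) in h2; lra.
by rewrite (ltr0_norm l0) in h2; lra.
Qed.

End arithmetic.

Section convex_surface.
Context {R : realType} {m n : nat}.
Local Notation E := 'rV[R]_n.
Local Notation "'d_ i" := (fun f : E -> R => 'D_(delta_mx ord0 i : E) f) (at level 8, i at level 2).

Lemma midpoint_eq (y z : E) : y - (2^-1 *: (z - y) + y) = 0 -> y = z.
Proof.
move/rowP => h; apply/rowP => i; have := h i; rewrite !mxE.
move: (y ord0 i) (z ord0 i) => a b hi; apply/eqP; rewrite -subr_eq0; apply/eqP.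
by have e : a - b = 2 * (a - (2^-1 * (b - a) + a)); [field|rewrite e hi mulr0].
Qed.

Lemma sqr_coord_le (d : E) i : d ord0 i ^+ 2 <= dotr d d.
Proof.
rewrite /dotr (bigD1 i)//= -expr2 lerDl.
by apply: sumr_ge0 => j _; rewrite -expr2 sqr_ge0.
Qed.

Lemma small_sball (p d : E) r : 0 < r -> dotr d d < r ^+ 2 -> sball p r (d + p).
Proof.
move=> r0 h i; rewrite mxE addrK -ltr_sqr ?nnegrE ?(ltW r0)//.
by rewrite real_normK ?num_real//; apply: le_lt_trans h; exact: sqr_coord_le.
Qed.

Lemma dotr_le_sup (d : E) r : (forall i, `|d ord0 i| <= r) -> dotr d d <= n%:R * r ^+ 2.
Proof.
move=> h; rewrite mulr_natl -[X in _ *+ X](card_ord n) -sumr_const; apply: ler_sum => i _.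
rewrite -expr2 -[leLHS]real_normK ?num_real//; apply: lerXn2r; rewrite ?nnegrE//.
by apply: le_trans (h i).
Qed.

Lemma dotr_cs (x y : E) : dotr x y ^+ 2 <= dotr x x * dotr y y.
Proof.
apply: quad_disc => t; have := dotr_ge0 (x + t *: y).
rewrite !(dotrDl, dotrDr, dotrZl, dotrZr) [dotr y x]dotrC.
by congr (_ <= _); ring.
Qed.

Lemma dotr_norm_le (x y : E) r : (forall i, `|x ord0 i| <= r) ->
  dotr x y ^+ 2 <= n%:R * r ^+ 2 * dotr y y.
Proof. by move=> h; apply: le_trans (dotr_cs x y) _; rewrite ler_wpM2r ?dotr_ge0// dotr_le_sup. Qed.

Variables (W : set E) (rho : E -> R) (p0 nu : E) (T : 'M[R]_(m, n)) (C : set E) (G : R).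
Hypotheses (mn : (m + 1 = n)%N) (oW : open W) (c2 : Ck_on 2 W rho) (Wp0 : W p0)
  (rho0 : rho p0 = 0) (G0 : 0 < G) (gE : gradient rho p0 = G *: nu) (nn : dotr nu nu = 1)
  (TT : T *m T^T = 1%:M) (Tnu : T *m nu^T = 0)
  (dS : 0 < \det (T *m hessmx rho p0 *m T^T))
  (Cconv : forall x y t, C x -> C y -> 0 <= t <= 1 -> C (t *: (y - x) + x))
  (Crho : forall y, C y -> W y -> rho y <= 0)
  (CW : forall y, W y -> rho y = 0 -> C y).

Let H := hessmx rho p0.
Let q (d : E) := dotr (d *m H) d.

Let symH : H^T = H.
Proof. by apply/matrixP => i j; rewrite !mxE; exact: (clairaut _ _ oW c2 Wp0). Qed.

Let qE d : qform (hess rho p0) d = q d.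
Proof.
rewrite /q -qform_mx; apply: eq_bigr => i _; congr (_ * _); apply: eq_bigr => j _.
by rewrite mxE (clairaut _ _ oW c2 Wp0).
Qed.

Let qD u v : q (u + v) = q u + 2 * dotr (u *m H) v + q v.
Proof.
rewrite /q mulmxDl !(dotrDl, dotrDr).
have -> : dotr (v *m H) u = dotr (u *m H) v by rewrite dotr_mul symH dotrC.
by ring.
Qed.

Let qZ a u : q (a *: u) = a ^+ 2 * q u.
Proof. by rewrite /q -scalemxAl dotrZl dotrZr; ring. Qed.

Lemma taylor_surface e : 0 < e -> exists2 r, 0 < r & sball p0 r `<=` W /\
  forall p x, sball p0 r p -> sball p0 r x ->
  `|rho x - rho p - dotr (gradient rho p) (x - p) - 2^-1 * q (x - p)| <= e * dotr (x - p) (x - p).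
Proof.
move=> e0; have [r r0 [rW h]] := taylor2 oW c2 Wp0 e0; exists r => //; split => // p x hp hx.
by rewrite -gradient_lindot -qE; exact: h.
Qed.

(** The intermediate value theorem on a segment normal to the surface *)
Lemma zero_between (u : E) a b r : sball p0 r `<=` W -> a <= b ->
  (forall h, a <= h <= b -> sball p0 r (h *: nu + (u + p0))) ->
  rho (a *: nu + (u + p0)) <= 0 -> 0 <= rho (b *: nu + (u + p0)) ->
  exists2 h, a <= h <= b & rho (h *: nu + (u + p0)) = 0.
Proof.
move=> rW ab inb ha hb; have [c1 _] := Ck2_C1 c2.
have cts : {within `[a, b], continuous (fun h : R => rho (h *: nu + (u + p0)))}.
  apply: derivable_within_continuous => h; rewrite in_itv/= => hab.
  by have [] := C1_line (v := nu) oW c1 (rW _ (inb h hab)).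
have [|h hab e] := IVT (v := 0) ab cts.
  by rewrite ge_min ha/= le_max hb orbT.
by exists h => //; rewrite in_itv/= in hab.
Qed.

Let dnu (u : E) h : dotr u nu = 0 -> dotr (h *: nu + u) (h *: nu + u) = dotr u u + h ^+ 2.
Proof. by move=> un; rewrite !(dotrDl, dotrDr, dotrZl, dotrZr) [dotr nu u]dotrC un nn; ring. Qed.

Let gdnu (u : E) h : dotr u nu = 0 -> dotr (gradient rho p0) (h *: nu + u) = G * h.
Proof. by move=> un; rewrite gE !(dotrDr, dotrZl, dotrZr) [dotr nu u]dotrC un nn; ring. Qed.

Let qT (w : 'rV[R]_m) : dotr (w *m (T *m H *m T^T)) w = q (w *m T).
Proof. by rewrite /q !mulmxA dotr_mul trmxK. Qed.

(** If the Hessian were negative at a tangent vector u, the surface would contain points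
   p0 +- s u + h nu with h of order s^2 > 0, and their midpoint would lie outside. *)
Lemma hess_psd (w : 'rV[R]_m) : 0 <= dotr (w *m (T *m H *m T^T)) w.
Proof.
rewrite qT leNgt; apply/negP; set u := w *m T => qu.
have Gn : G != 0 by rewrite gt_eqF.
have un : dotr u nu = 0 by exact: frame_tangent.
have [a aE] : {a | a = - q u / 2} by exists (- q u / 2).
have a0 : 0 < a by rewrite aE divr_gt0// oppr_gt0.
have quE : q u = - (2 * a) by rewrite aE; field.
pose P := dotr u u; have P0 : 0 <= P := dotr_ge0 u.
pose c1 := dotr (u *m H) nu; pose c2' := q nu.
have [e eE] : {e | e = a / (8 * (P + 1))} by exists (a / (8 * (P + 1))).
have e0 : 0 < e by rewrite eE divr_gt0// mulr_gt0// ltr_wpDl.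
have eP : e * P <= a / 8.
  have -> : e * P = a / 8 * (P / (P + 1)).
    have P1 : P + 1 != 0 by rewrite gt_eqF// ltr_wpDl.
    by rewrite eE; field.
  have a80 : 0 <= a / 8 by apply: divr_ge0 => //; exact: ltW.
  by rewrite ler_piMr// ler_pdivrMr ?ltr_wpDl// mul1r lerDl.
have [r r0 [rW tay]] := taylor_surface e0.
have [B BE] : {B | B = 2 * a / G} by exists (2 * a / G).
have B0 : 0 < B by rewrite BE divr_gt0// mulr_gt0.
pose A1 := B * (`|c1| + 1) / (a / 8); pose A2 := B ^+ 2 * (`|c2'| + e + 1) / (a / 8).
pose A3 := (P + B ^+ 2 + 1) / r; pose A4 := (B * (`|c2'| + e) + 1) / G.
have a8 : 0 < a / 8 by rewrite divr_gt0.
have A10 : 0 <= A1 by rewrite divr_ge0 ?(ltW a8)// mulr_ge0 ?(ltW B0)// addr_ge0.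
have A20 : 0 <= A2 by rewrite divr_ge0 ?(ltW a8)// mulr_ge0 ?sqr_ge0// !addr_ge0// ltW.
have A30 : 0 <= A3 by rewrite divr_ge0 ?(ltW r0)// !addr_ge0// sqr_ge0.
have A40 : 0 <= A4 by rewrite divr_ge0 ?(ltW G0)// addr_ge0// mulr_ge0 ?(ltW B0)// addr_ge0// ltW.
have [s [s0 s1 sA1 sA2 [sA3 sA4]]] := small_reciprocal A10 A20 A30 A40.
have k1 : s * (B * (`|c1| + 1)) <= a / 8.
  by move: sA1; rewrite mulrA ler_pdivrMr// mul1r.
have k2 : s * s * (B ^+ 2 * (`|c2'| + e + 1)) <= a / 8.
  move: sA2; rewrite mulrA ler_pdivrMr// mul1r => h; apply: le_trans h; rewrite -mulrA ler_piMl//.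
  by rewrite mulr_ge0 ?(ltW s0)// mulr_ge0 ?sqr_ge0// !addr_ge0// ltW.
have k3 : s * (P + B ^+ 2 + 1) <= r by move: sA3; rewrite mulrA ler_pdivrMr// mul1r.
have k4 : s * (B * (`|c2'| + e) + 1) <= G by move: sA4; rewrite mulrA ler_pdivrMr// mul1r.
have small h : 0 <= h -> h <= s * s * B -> s ^+ 2 * P + h ^+ 2 < r ^+ 2.
  move=> h0 hB.
  have h2 : h ^+ 2 <= s ^+ 2 * B ^+ 2.
    rewrite -exprMn; apply: lerXn2r; rewrite ?nnegrE ?mulr_ge0 ?(ltW s0) ?(ltW B0)//.
    by apply: le_trans hB _; rewrite -mulrA ler_piMl// mulr_ge0 ?(ltW s0) ?(ltW B0).
  have h3 : (s * (P + B ^+ 2 + 1)) ^+ 2 <= r ^+ 2.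
    by apply: lerXn2r; rewrite ?nnegrE ?(ltW r0)// mulr_ge0 ?(ltW s0)// !addr_ge0 ?sqr_ge0.
  apply: lt_le_trans h3; rewrite exprMn.
  have s20 : 0 < s ^+ 2 by rewrite exprn_gt0.
  apply: (@le_lt_trans _ _ (s ^+ 2 * (P + B ^+ 2))); first by rewrite mulrDr lerD2l.
  rewrite ltr_pM2l//; have := sqr_ge0 B; move: (B ^+ 2) => b b0.
  have : 0 <= P + b by rewrite addr_ge0.
  by move: (P + b) => z z0; rewrite expr2; exact: lt_sqr_succ.
have inb (sg : R) h : sg ^+ 2 = 1 -> 0 <= h -> h <= s * s * B ->
    sball p0 r (h *: nu + ((sg * s) *: u + p0)).
  move=> sg1 h0 hB; rewrite addrA; apply: small_sball => //.
  rewrite dnu; last by rewrite dotrZl un mulr0.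
  by rewrite dotrZl dotrZr mulrA -expr2 exprMn sg1 mul1r small.
have expand (sg : R) h : sg ^+ 2 = 1 -> 0 <= h -> h <= s * s * B ->
    `|rho (h *: nu + ((sg * s) *: u + p0)) - (G * h - s ^+ 2 * a)| <= s ^+ 2 * (3 * a / 8).
  move=> sg1 h0 hB; have sun : dotr ((sg * s) *: u) nu = 0 by rewrite dotrZl un mulr0.
  have := tay p0 _ (sball_center p0 r0) (inb sg h sg1 h0 hB).
  rewrite addrA addrK rho0 subr0 gdnu// dnu//.
  have -> : dotr ((sg * s) *: u) ((sg * s) *: u) = P * s ^+ 2.
    by rewrite dotrZl dotrZr mulrA -expr2 exprMn sg1 mul1r mulrC.
  have qq : q (h *: nu + (sg * s) *: u) =
      s ^+ 2 * (- (2 * a)) + 2 * (s * h * (sg * c1)) + h ^+ 2 * c2'.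
    rewrite addrC qD !qZ exprMn sg1 mul1r quE -scalemxAl dotrZl dotrZr -/c1 -/c2'.
    by ring.
  rewrite qq => tt.
  have ac : `|sg * c1| = `|c1|.
    rewrite normrM; have : `|sg| = 1.
      by apply/eqP; rewrite -[_ == _](@eqrXn2 _ 2)// -normrX sg1 normr1 expr1n.
    by move=> ->; rewrite mul1r.
  rewrite BE in hB k1 k2; by apply: (normal_expansion tt erefl a0 e0 s0 eP h0 hB G0); rewrite ?ac.
have s20 : 0 < s ^+ 2 by rewrite exprn_gt0.
pose h1 := s ^+ 2 * (a / (2 * G)); pose h2 := s * s * B.
have h10 : 0 < h1 by rewrite mulr_gt0// divr_gt0// mulr_gt0.
have h12 : h1 <= h2.
  rewrite /h1 /h2 -expr2 ler_wpM2l ?(ltW s20)//.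
  have -> : a / (2 * G) = B / 4 by rewrite BE; field.
  by rewrite ler_pdivrMr// ler_peMr ?(ltW B0)// ler1n.
have s2a : 0 < s ^+ 2 * a by rewrite mulr_gt0.
have zero (sg : R) : sg ^+ 2 = 1 -> exists2 h, h1 <= h <= h2 &
    C (h *: nu + ((sg * s) *: u + p0)).
  move=> sg1.
  have inb' h : h1 <= h <= h2 -> sball p0 r (h *: nu + ((sg * s) *: u + p0)).
    by move=> /andP[i1 i2]; apply: inb => //; apply: le_trans i1; exact: ltW.
  have [| |h hh rh] := zero_between (u := (sg * s) *: u) rW h12 inb'.
  - have := expand sg h1 sg1 (ltW h10) h12.
    have -> : G * h1 = s ^+ 2 * a / 2 by rewrite /h1; field.
    have -> : s ^+ 2 * (3 * a / 8) = 3 * (s ^+ 2 * a) / 8 by field.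
    by rewrite ler_norml => /andP[_]; exact: normal_below.
  - have := expand sg h2 sg1 (le_trans (ltW h10) h12) (lexx _).
    have -> : G * h2 = 2 * (s ^+ 2 * a) by rewrite /h2 BE; field.
    have -> : s ^+ 2 * (3 * a / 8) = 3 * (s ^+ 2 * a) / 8 by field.
    by rewrite ler_norml => /andP[+ _]; exact: normal_above.
  by exists h => //; apply: CW => //; apply: rW; exact: inb'.
have [ha /andP[ha1 ha2] Ca] := zero 1 (expr1n _ _).
have [hb /andP[hb1 hb2] Cb] := zero (- 1) (etrans (sqrrN _) (expr1n _ _)).
pose hm := (ha + hb) / 2.
have hm0 : 0 < hm by rewrite divr_gt0// addr_gt0// (lt_le_trans h10).
have hmB : hm <= s * s * B.
  rewrite /hm ler_pdivrMr// -/h2; have -> : h2 * 2 = h2 + h2 by ring.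
  exact: lerD.
have half : 0 <= (2^-1 : R) <= 1 by rewrite invr_ge0 ler0n/= invf_le1// ler1n.
have Cm : C (hm *: nu + p0).
  have := Cconv Ca Cb half; congr C; apply/rowP => i; by rewrite !mxE /hm; field.
have inm : sball p0 r (hm *: nu + p0).
  apply: small_sball => //; rewrite dotrZl dotrZr nn mulr1 -expr2.
  by apply: le_lt_trans (small hm (ltW hm0) hmB); rewrite lerDr mulr_ge0// ltW.
have := Crho Cm (rW _ inm).
have := tay p0 _ (sball_center p0 r0) inm; rewrite addrK rho0 subr0 qZ.
rewrite gE !dotrZl !dotrZr nn !mulr1 -expr2 -/c2' ler_norml => /andP[t1 _].
have sB : hm * (`|c2'| + e) < G.
  apply: lt_le_trans k4.
  apply: (@le_lt_trans _ _ (s * (B * (`|c2'| + e)))); last by rewrite [X in _ < X]mulrDr mulr1 ltrDl.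
  rewrite mulrA ler_wpM2r ?addr_ge0 ?(ltW e0)//; apply: le_trans hmB _.
  by rewrite -mulrA ler_piMl// mulr_ge0 ?(ltW s0) ?(ltW B0).
by rewrite leNgt (inward_sign hm0 e0 sB t1).
Qed.

(** Positivity on the tangent space extends to all directions at the cost of a multiple of
   the squared normal component, which absorbs the cross term. *)
Lemma hess_lower : exists c K, [/\ 0 < c, 0 <= K &
  forall d, c * dotr d d - K * dotr d nu ^+ 2 <= q d].
Proof.
have symS : (T *m H *m T^T)^T = T *m H *m T^T by rewrite !trmx_mul trmxK symH mulmxA.
have [c0 c00 hc] := psd_det_pd symS hess_psd (lt0r_neq0 dS).
pose z := nu *m H; pose Z := dotr z z; have Z0 : 0 <= Z := dotr_ge0 z.
exists (c0 / 2), (c0 / 2 + 2 / c0 * Z + `|q nu|); split => [||d].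
- by rewrite divr_gt0.
- by rewrite !addr_ge0// ?mulr_ge0 ?invr_ge0 ?(ltW c00).
pose w := d *m T^T; pose b := dotr d nu; set u := w *m T.
have dE : d = u + b *: nu by exact: (frame_decomp mn TT Tnu nn).
have uu : dotr u u = dotr w w by exact: frame_dotr.
have dd : dotr d d = dotr u u + b ^+ 2 by rewrite uu; exact: (frame_sqr mn TT Tnu nn).
have qu : c0 * dotr u u <= q u by rewrite uu /u -qT; exact: hc.
have cr : dotr (u *m H) nu = dotr u z by rewrite dotr_mul symH.
have cs := dotr_cs u z.
have qdE : q d = q u + 2 * (b * dotr u z) + b ^+ 2 * q nu.
  by rewrite {1}dE qD qZ dotrZr cr.
have nq : - (b ^+ 2 * q nu) <= b ^+ 2 * `|q nu|.
  by rewrite -mulrN ler_wpM2l ?sqr_ge0// -normrN ler_norm.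
have ag : - (2 * (b * dotr u z)) <= c0 / 2 * dotr u u + 2 / c0 * Z * b ^+ 2.
  exact: arith_amgm c00 (dotr_ge0 u) Z0 cs.
rewrite qdE dd -/b; exact: arith_lower qu nq ag.
Qed.

(** With rho x <= 0, Taylor's formula bounds the linear term by minus half the Hessian of
   x - p. The Hessian is positive up to the square of the normal component, and this
   component is of the order of the linear term itself. *)
Lemma support_near : exists r c, [/\ 0 < r, 0 < c, sball p0 r `<=` W &
  forall p x, sball p0 r p -> sball p0 r x -> rho p = 0 -> rho x <= 0 ->
  dotr (gradient rho p) (x - p) <= - (c * dotr (x - p) (x - p))].
Proof.
have [c1 [K [c10 K0 hq]]] := hess_lower.
have Gn : G != 0 by rewrite gt_eqF.
have c18 : 0 < c1 / 8 by rewrite divr_gt0.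
have [r1 r10 [r1W tay]] := taylor_surface c18.
have [k kE] : {k | k = K / G ^+ 2} by exists (K / G ^+ 2).
have k0 : 0 <= k by rewrite kE divr_ge0// sqr_ge0.
have KE : K = k * G ^+ 2 by rewrite kE; field.
have A0 : 0 <= k * n%:R / (c1 / 8) by rewrite divr_ge0 ?(ltW c18)// mulr_ge0.
have [e [e0 e1 eA _ _]] := small_reciprocal A0 A0 A0 A0.
have ekn : k * (n%:R * e ^+ 2) <= c1 / 8.
  move: eA; rewrite mulrA ler_pdivrMr// mul1r => h; apply: le_trans h.
  have -> : k * (n%:R * e ^+ 2) = e * (e * (k * n%:R)) by ring.
  by rewrite ler_piMl// mulr_ge0 ?(ltW e0)// mulr_ge0.
have [c1' _] := Ck2_C1 c2.
have [r2 r20 hr2] := near_partials oW c1' Wp0 e0.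
have [M ME] : {M | M = \sum_(i < n) `|'d_i rho p0| + 1} by eexists.
have M0 : 0 < M by rewrite ME ltr_wpDl// sumr_ge0.
have B0 : 0 <= 2 * k * (n%:R * (2 * M)) by rewrite !mulr_ge0// ltW.
have [s [s0 s1 sB _ _]] := small_reciprocal B0 B0 B0 B0.
pose r := Num.min (Num.min r1 r2) s.
have r0 : 0 < r by rewrite !lt_min r10 r20 s0.
have rr1 : r <= r1 by rewrite /r !ge_min lexx.
have rr2 : r <= r2 by rewrite /r !ge_min lexx !orbT.
have rs : r <= s by rewrite /r !ge_min lexx !orbT.
exists r, (c1 / 6); split => //; first by rewrite divr_gt0.
  by move=> z /(sball_sub rr1) /r1W.
move=> p x hp hx rp rx; set d := x - p.
have t := tay p x (sball_sub rr1 hp) (sball_sub rr1 hx); rewrite -/d rp subr0 in t.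
have [_ gp] := hr2 _ (sball_sub rr2 hp).
pose dl := dotr (gradient rho p0 - gradient rho p) d.
have gb : G * dotr d nu = dotr (gradient rho p) d + dl.
  by rewrite /dl dotrDl dotrNl addrC subrK gE dotrZl dotrC.
have D0 := dotr_ge0 d.
have dlb : dl ^+ 2 <= n%:R * e ^+ 2 * dotr d d.
  apply: dotr_norm_le => i; rewrite !mxE distrC; exact: gp.
have gM i : `|gradient rho p ord0 i| <= M.
  rewrite mxE -[X in `|X|](subrK ('d_i rho p0)); apply: le_trans (ler_normD _ _) _.
  rewrite ME addrC lerD//; last by apply: le_trans e1; exact: gp.
  by rewrite (bigD1 i)//= lerDl sumr_ge0.
have dr i : `|d ord0 i| <= 2 * r.
  rewrite !mxE -(subrKA (p0 ord0 i)); apply: le_trans (ler_normD _ _) _.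
  by rewrite mulr2n mulrDl mul1r lerD// ?[`|p0 ord0 i - _|]distrC ltW.
have lb : `|dotr (gradient rho p) d| <= n%:R * (M * (2 * r)).
  apply: le_trans (ler_norm_sum _ _ _) _.
  rewrite mulr_natl -[X in _ *+ X](card_ord n) -sumr_const; apply: ler_sum => i _.
  by rewrite normrM ler_pM.
apply: (arith_support c10 D0 k0 G0 KE gb dlb ekn _ (hq d)).
  apply: (@le_trans _ _ (2^-1 * (s * (2 * k * (n%:R * (2 * M)))))); last first.
    by rewrite -[leRHS]mulr1 ler_wpM2l.
  have -> : 2^-1 * (s * (2 * k * (n%:R * (2 * M)))) = k * (n%:R * (M * (2 * s))) by field.
  rewrite ler_wpM2l//; apply: le_trans lb _.
  by rewrite !ler_wpM2l// ltW.
move: t; rewrite ler_norml => /andP[t _]; move: t rx.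
move: (rho x) (dotr (gradient rho p) d) (q d) (c1 / 8 * dotr d d) => a1 a2 a3 a4.
exact: taylor_gap.
Qed.

(** By convexity, the quadratic gap near p forces a uniform gap far from p. *)
Lemma support_global : exists r c c', [/\ 0 < r, 0 < c, 0 < c', sball p0 r `<=` W &
  forall p x, sball p0 r p -> rho p = 0 -> C x ->
  dotr (gradient rho p) (x - p) <= - (c * dotr (x - p) (x - p)) \/
  dotr (gradient rho p) (x - p) <= - c'].
Proof.
have [r' [c [r'0 c0 rW sup]]] := support_near.
have [r rE] : {r | r = r' / 2} by eexists.
have r0 : 0 < r by rewrite rE divr_gt0.
have rr : r <= r' by rewrite rE ler_pdivrMr// ler_peMr ?(ltW r'0)// ler1n.
exists r, c, (c * r ^+ 2 / 4); split => //.
- by rewrite divr_gt0// mulr_gt0// exprn_gt0.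
- by move=> z /(sball_sub rr) /rW.
move=> p x hp rp Cx; have hp' := sball_sub rr hp; have Cp := CW (rW _ hp') rp.
have [hx|nx] := pselect (sball p0 r' x).
  by left; apply: sup => //; apply: Crho => //; exact: rW.
right; set d := x - p; pose N := enorm d.
have NE : N ^+ 2 = dotr d d by exact: enorm_sqr.
have rN : r <= N.
  rewrite leNgt; apply/negP => Nr; apply: nx => i.
  rewrite -(subrKA (p ord0 i)); apply: le_lt_trans (ler_normD _ _) _.
  have := hp i; have := coord_le_enorm d i; rewrite !mxE -/N => h1 h2.
  have -> : r' = r + r by rewrite rE; field.
  by apply: ltrD => //; exact: le_lt_trans h1 Nr.
have N0 : 0 < N by exact: lt_le_trans rN.
have [t tE] : {t | t = r / (2 * N)} by eexists.
have t0 : 0 < t by rewrite tE divr_gt0// mulr_gt0.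
have t1 : t <= 1.
  rewrite tE ler_pdivrMr ?mulr_gt0// mul1r; apply: le_trans rN _.
  by rewrite ler_peMl ?(ltW N0)// ler1n.
have t01 : 0 <= t <= 1 by rewrite (ltW t0).
pose x' := t *: d + p.
have Cx' : C x' by exact: Cconv.
have hx' : sball p0 r' x'.
  have -> : x' = t *: d + p by [].
  move=> i; rewrite !mxE -addrA; apply: le_lt_trans (ler_normD _ _) _.
  have -> : r' = r + r by rewrite rE; field.
  apply: ltrD; last exact: hp.
  rewrite normrM (gtr0_norm t0); have := coord_le_enorm d i; rewrite !mxE -/N => h1.
  apply: (@le_lt_trans _ _ (t * N)); first by rewrite ler_wpM2l// ltW.
  rewrite tE; have -> : r / (2 * N) * N = r / 2 by field; rewrite gt_eqF.
  by rewrite ltr_pdivrMr// ltr_pMr// ltr1n.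
have := sup p x' hp' hx' rp (Crho Cx' (rW _ hx')).
rewrite /x' addrK dotrZl !dotrZr -NE mulrA -expr2.
have -> : t ^+ 2 * N ^+ 2 = r ^+ 2 / 4 by rewrite tE; field; rewrite gt_eqF.
move=> h; have hc : 0 < c * (r ^+ 2 / 4) by rewrite mulr_gt0// divr_gt0// exprn_gt0.
rewrite -mulrA; move: (dotr _ _) (c * (r ^+ 2 / 4)) hc h => l k k0 h.
exact: scaled_gap t0 t1 k0 h.
Qed.

(** Above each small tangent vector, rho changes sign along the normal line. *)
Lemma surface_point r : 0 < r -> exists2 dl, 0 < dl & forall w : 'rV[R]_m,
  dotr w w <= dl ^+ 2 -> exists2 h, rho (h *: nu + (w *m T + p0)) = 0 &
  sball p0 r (h *: nu + (w *m T + p0)).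
Proof.
move=> r0; have [r1 r10 [rW tay]] := taylor_surface (ltr01 : 0 < (1 : R)).
have [Cq Cq0 hq] := bilin_bound H.
have A0 : 0 <= (Cq + 2) / G by rewrite divr_ge0 ?(ltW G0)// addr_ge0// ltW.
have B0 : 0 <= 2 / r by rewrite divr_ge0// ltW.
have D0 : 0 <= 2 / r1 by rewrite divr_ge0// ltW.
have [b [b0 _ bA bB [bD _]]] := small_reciprocal A0 B0 D0 D0.
have bG : (Cq + 2) * b <= G by move: bA; rewrite mulrA ler_pdivrMr// mul1r mulrC.
have br : 2 * b <= r by move: bB; rewrite mulrA ler_pdivrMr// mul1r mulrC.
have br1 : 2 * b <= r1 by move: bD; rewrite mulrA ler_pdivrMr// mul1r mulrC.
exists b => // w hw; set u := w *m T.
have un : dotr u nu = 0 by exact: frame_tangent.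
have uu : dotr u u = dotr w w by exact: frame_dotr.
have w0 : 0 <= dotr w w := dotr_ge0 w.
have inb r' h : 0 < r' -> 2 * b <= r' -> - b <= h <= b -> sball p0 r' (h *: nu + (u + p0)).
  move=> r'0 br' hb; rewrite addrA; apply: small_sball => //; rewrite dnu// uu.
  have hb2 : h ^+ 2 <= b ^+ 2.
    rewrite -[leLHS]real_normK ?num_real//; apply: lerXn2r; rewrite ?nnegrE ?(ltW b0)//.
    by rewrite ler_norml.
  have : (2 * b) ^+ 2 <= r' ^+ 2 by apply: lerXn2r; rewrite ?nnegrE ?(ltW r'0)// mulr_ge0// ltW.
  apply: lt_le_trans; rewrite exprMn; have : 0 < b ^+ 2 by rewrite exprn_gt0.
  move: (b ^+ 2) (h ^+ 2) (dotr w w) hw hb2 => x y z; exact: two_terms_lt.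
have bb : - b <= b by rewrite (le_trans _ (ltW b0))// oppr_le0 ltW.
have est h : h ^+ 2 = b ^+ 2 -> - b <= h <= b ->
    `|rho (h *: nu + (u + p0)) - G * h| <= G * b.
  move=> h2 hb; have := tay p0 _ (sball_center p0 r10) (inb r1 h r10 br1 hb).
  rewrite addrA addrK rho0 subr0 gdnu// dnu// uu h2 mul1r.
  have := hq (h *: nu + u); rewrite -/(q _) dnu// uu h2.
  have Gb : (Cq + 2) * b * b <= G * b by rewrite ler_wpM2r// ltW.
  have e1 : (Cq + 2) * b * b = Cq * b ^+ 2 + 2 * b ^+ 2 by ring.
  have Cw : Cq * (dotr w w + b ^+ 2) <= 2 * (Cq * b ^+ 2).
    have -> : 2 * (Cq * b ^+ 2) = Cq * (b ^+ 2 + b ^+ 2) by ring.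
    by rewrite ler_wpM2l ?(ltW Cq0)// lerD2r.
  rewrite e1 in Gb; exact: (linear_error hw Gb Cw).
have [| |h hh rh] := zero_between (u := u) rW bb (fun h => inb r1 h r10 br1).
- have := est (- b) (sqrrN b); rewrite lexx bb => /(_ isT).
  by rewrite mulrN opprK ler_norml => /andP[_]; rewrite gerDr.
- have := est b erefl; rewrite lexx bb => /(_ isT).
  by rewrite ler_norml => /andP[+ _]; rewrite lerBrDl addrN.
by exists h => //; exact: inb.
Qed.

(** The midpoint of two surface points is in C but not on the surface. *)
Lemma interior_point (I : set E) : (0 < m)%N ->
  (forall y, C y -> W y -> rho y <> 0 -> I y) -> exists z, I z.
Proof.
move=> m0 hI; have [r [c [r0 c0 rW sup]]] := support_near.
have [dl dl0 hs] := surface_point r0.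
pose w : 'rV[R]_m := dl *: delta_mx ord0 (Ordinal m0).
have ww : dotr w w = dl ^+ 2.
  rewrite dotrZl dotrZr mulrA -expr2 /dotr (bigD1 (Ordinal m0))//= mxE !eqxx mulr1 big1 ?addr0 ?mulr1//.
  by move=> i /negbTE i0; rewrite mxE i0 andbF mul0r.
have [h1 e1 b1] := hs w (le_of_eq ww).
have [|h2 e2 b2] := hs (- w).
  by rewrite dotrNl dotrC dotrNl opprK ww.
set y1 := _ + _ in e1 b1; set y2 := _ + _ in e2 b2.
have half : 0 <= (2^-1 : R) <= 1 by rewrite invr_ge0 ler0n/= invf_le1// ler1n.
pose z := 2^-1 *: (y2 - y1) + y1.
have bz : sball p0 r z by exact: sball_seg.
have Cz : C z by apply: Cconv => //; apply: CW => //; exact: rW.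
exists z; apply: hI => //; first exact: rW.
move=> rz; have s1 := sup z y1 bz b1 rz; have s2 := sup z y2 bz b2 rz.
rewrite e1 lexx in s1; rewrite e2 lexx in s2; have {}s1 := s1 isT; have {}s2 := s2 isT.
have zy : y2 - z = - (y1 - z).
  by apply/rowP => i; rewrite !mxE; field.
rewrite zy in s2; rewrite dotrC dotrNl dotrC dotrNl [dotr _ (- _)]dotrC dotrNl opprK in s2.
have n0 : dotr (y1 - z) (y1 - z) = 0.
  apply/eqP; rewrite eq_le dotr_ge0 andbT -(pmulr_rle0 _ c0).
  move: (dotr (gradient rho z) _) (c * dotr _ _) s1 s2 => a b; exact: opposite_bounds.
have y12 : y1 = y2 by apply: midpoint_eq; exact: dotr_eq0 n0.
have nuT : nu *m T^T = 0 by rewrite -[LHS]trmxK trmx_mul trmxK Tnu trmx0.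
have := congr1 (fun y => (y - p0) *m T^T) y12.
rewrite /y1 /y2 !addrA !addrK !mulmxDl -!scalemxAl nuT !scaler0 !add0r -!mulmxA TT !mulmx1.
move/rowP/(_ (Ordinal m0)); rewrite !mxE !eqxx mulr1.
move: dl0; move: (dl) => x x0 h; have : x + x = 0 by rewrite {1}h addNr.
by apply/eqP; rewrite gt_eqF// addr_gt0.
Qed.

End convex_surface.

(** * Lenses at a strictly convex surface *)

Section slab.
Context {R : realType} {n : nat}.
Local Notation mu := (@lebesgue_rV R n).
Local Notation E := 'rV[R]_n.

Lemma rint_ibox (a b : 'I_n -> R) : (forall i, a i <= b i) ->
  \int[mu]_x (\1_(ibox a b) x : R) = \prod_(i < n) (b i - a i).
Proof.
move=> ab; rewrite /Rintegral integral_indic//; last exact: measurable_ibox.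
transitivity (fine (mu (ibox a b))); first by congr (fine (mu _)); rewrite setIT.
rewrite [X in fine X](lebesgue_ibox a b) /=; apply: eq_bigr => i _.
by rewrite max_r// subr_ge0.
Qed.

(** S is contained in a slab of width of order s^2. Its translates by the multiples of a
   vector that crosses the slab are disjoint, and about 1 / s of them fit in a box of side
   of order s. *)
Lemma slab_volume (S : set E) (p : E) (g : E) (i0 : 'I_n) (gm C s : R) :
  measurable S -> 0 < gm -> gm <= `|g ord0 i0| -> 0 < C -> 0 < s -> 2 * C * s <= gm ->
  (forall x, S x -> (forall i, `|x ord0 i - p ord0 i| <= C * s) /\
    - (C * s ^+ 2) <= dotr g (x - p) <= 0) ->
  rI mu (\1_S : E -> R) /\
  \int[mu]_x (\1_S x : R) <= (2 * C + 3) ^+ n * (4 * C / gm) * s ^+ n.+1.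
Proof.
move=> mS gm0 hg C0 s0 sg hS.
have g0 : g ord0 i0 != 0 by rewrite -normr_gt0 (lt_le_trans gm0).
(* Along v the linear form grows by 2 C s^2, twice the thickness of the slab. *)
pose tau := 2 * C * s ^+ 2 / g ord0 i0.
pose v : E := tau *: delta_mx ord0 i0.
have gv : dotr g v = 2 * C * s ^+ 2.
  rewrite dotrZr /dotr (bigD1 i0)//= mxE !eqxx mulr1 big1 ?addr0.
    by rewrite /tau; field.
  by move=> i /negbTE ii; rewrite mxE ii andbF mulr0.
have X0 : 1 <= gm / (2 * C * s) by rewrite ler_pdivlMr ?mul1r// !mulr_gt0.
pose J := Num.trunc (gm / (2 * C * s)).
have J0 : 0 <= gm / (2 * C * s) by rewrite (le_trans ler01).
have /andP[J1 J2] := truncn_itv J0.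
have Jhalf : gm / (2 * C * s) / 2 <= J%:R.
  have J10 : 1 <= J%:R :> R.
    rewrite ler1n lt0n; apply: contraTneq J2 => J00.
    by rewrite -/J J00 -leNgt.
  rewrite ler_pdivrMr//; apply: le_trans (ltW J2) _.
  by rewrite -/J mulrC mulr2n mulrDl mul1r -[_.+1]addn1 natrD lerD2l.
pose bx := @ibox R n (fun i => p ord0 i - (C + 2) * s) (fun i => p ord0 i + (C + 1) * s).
have C1s : 0 < (C + 1) * s by rewrite mulr_gt0// addr_gt0.
have vb (j : nat) i : (j < J)%N -> `|(j%:R *: v) ord0 i| <= s.
  move=> jJ; rewrite !mxE; have [_|_] := eqVneq i i0; rewrite ?eqxx ?mulr1 ?andbF ?mulr0 ?normr0 ?(ltW s0)//.
  have cs0 : 0 <= 2 * C * s ^+ 2 by rewrite mulr_ge0 ?sqr_ge0// mulr_ge0// ltW.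
  rewrite /tau !normrM normfV -!normrM (ger0_norm cs0) ger0_norm//.
  rewrite mulrA ler_pdivrMr ?(lt_le_trans gm0)//.
  apply: (@le_trans _ _ (s * gm)); last by rewrite ler_wpM2l// ltW.
  apply: (@le_trans _ _ (gm / (2 * C * s) * (2 * C * s ^+ 2))).
    rewrite ler_wpM2r//.
    by apply: le_trans J1; rewrite ler_nat ltnW.
  by rewrite le_eqVlt; apply/orP; left; apply/eqP; field; rewrite gt_eqF//= gt_eqF.
have inbox (j : nat) x : (j < J)%N -> S (x - j%:R *: v) -> bx x.
  move=> jJ /hS[h _] i; have := h i; have := vb j i jJ; rewrite !mxE.
  move: (x ord0 i) (p ord0 i) (j%:R * _) => a b c; rewrite !ler_norml => /andP[c1 c2] /andP[d1 d2].
  have -> : (C + 2) * s = C * s + 2 * s by ring.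
  have -> : (C + 1) * s = C * s + s by ring.
  by move: (C * s) d1 d2 => y d1 d2; apply/andP; split; lra.
have disj (j k : nat) x : S (x - j%:R *: v) -> S (x - k%:R *: v) -> ~ (j < k)%N.
  move=> /hS[_ /andP[h1 h2]] /hS[_ /andP[h3 h4]] jk.
  have e : dotr g (x - j%:R *: v - p) = dotr g (x - k%:R *: v - p) + (k%:R - j%:R) * dotr g v.
    have X t : dotr g (x - t *: v - p) = dotr g x - t * dotr g v - dotr g p.
      by rewrite !dotrDr ![dotr g (- _)]dotrC !dotrNl [dotr _ g]dotrC dotrZr [dotr p g]dotrC.
    by rewrite !X; ring.
  rewrite e gv in h2; have kj : 1 <= k%:R - j%:R :> R.
    by rewrite -natrB ?(ltnW jk)// ler1n subn_gt0.
  have cs : 0 < C * s ^+ 2 by rewrite mulr_gt0// exprn_gt0.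
  have : C * s ^+ 2 * 2 <= (k%:R - j%:R) * (2 * C * s ^+ 2).
    have -> : (k%:R - j%:R) * (2 * C * s ^+ 2) = C * s ^+ 2 * 2 * (k%:R - j%:R) by ring.
    by rewrite ler_peMr// mulr_ge0// ltW.
  move: (C * s ^+ 2) (_ * (2 * C * s ^+ 2)) (dotr _ _) cs h3 h2 => y z t; clear; lra.
have sum_le x : \sum_(j < J) \1_S (x - j%:R *: v) <= \1_bx x :> R.
  have [[j hj]|no] := pselect (exists j : 'I_J, S (x - j%:R *: v)).
    rewrite (bigD1 j)//= big1 => [|k kj]; last first.
      rewrite indicE memNset// => hk; have [jk|kj'|e] := ltngtP j k.
      - exact: disj hj hk jk.
      - exact: disj hk hj kj'.
      - by move/negP: kj; apply; apply/eqP/val_inj.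
    rewrite addr0 [leLHS]indicE (mem_set hj) indicE mem_set//.
    exact: (inbox j x (ltn_ord j) hj).
  rewrite big1 ?indicE// => j _; rewrite indicE memNset// => hj; by apply: no; exists j.
have mbx : measurable bx by exact: measurable_ibox.
have [[_ Ibx] _] := X_ibox (fun i => p ord0 i - (C + 2) * s) (fun i => p ord0 i + (C + 1) * s).
have I1 : rI mu (\1_bx : E -> R) by move: Ibx; under eq_fun do rewrite cabsR ger0_norm//.
have Jp : (0 < J)%N.
  rewrite lt0n; apply/eqP => J00; move: Jhalf; rewrite J00 leNgt.
  by rewrite divr_gt0// (lt_le_trans ltr01).
have mS1 : measurable_fun setT (\1_S : E -> R) by exact: measurable_indic.
have IS : rI mu (\1_S : E -> R).
  apply: (rI_le I1 mS1) => x; rewrite ger0_norm ?indicE//.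
  have [Sx|nSx] := pselect (S x); last by rewrite memNset.
  by rewrite !mem_set//; apply: (inbox 0%N x Jp); rewrite scale0r subr0.
split => //.
have ISj (j : nat) : rI mu (fun x => \1_S (x - j%:R *: v) : R).
  exact: (rI_translate (- (j%:R *: v)) mS1).1.
have vol : \int[mu]_x (\1_bx x : R) = ((2 * C + 3) * s) ^+ n.
  rewrite rint_ibox.
    rewrite (eq_bigr (fun=> (2 * C + 3) * s)); last by move=> i _; ring.
    by rewrite prodr_const card_ord.
  move=> i; rewrite lerBlDr -addrA lerDl addr_ge0 ?(ltW C1s)//.
  by rewrite mulr_ge0 ?(ltW s0)// addr_ge0// ltW.
have hJ : J%:R * \int[mu]_x (\1_S x : R) <= ((2 * C + 3) * s) ^+ n.
  rewrite -vol; apply: le_trans (_ : \int[mu]_x (\sum_(j < J) \1_S (x - j%:R *: v)) <= _).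
    rewrite rint_sum//; under eq_bigr do rewrite (rint_translate (- _) mS1).
    by rewrite sumr_const card_ord mulr_natl.
  by apply: rint_le => //; apply: rI_sum.
have IS0 : 0 <= \int[mu]_x (\1_S x : R) by apply: rint_ge0 => x; rewrite indicE.
have h : gm / (2 * C * s) / 2 * \int[mu]_x (\1_S x : R) <= ((2 * C + 3) * s) ^+ n.
  by apply: le_trans hJ; rewrite ler_wpM2r.
have -> : (2 * C + 3) ^+ n * (4 * C / gm) * s ^+ n.+1 =
    (gm / (2 * C * s) / 2)^-1 * ((2 * C + 3) * s) ^+ n.
  by rewrite exprMn exprS; field; rewrite !gt_eqF.
by rewrite mulrC ler_pdivlMr ?divr_gt0// ?mulr_gt0// mulrC.
Qed.

End slab.
Section lenses.
Context {R : realType} {n : nat}.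
Local Notation mu := (@lebesgue_rV R n).
Local Notation E := 'rV[R]_n.
Implicit Types (U : set E) (c p g x y : E) (r s : R).

Lemma half_norm_le (x y : R) : `|x - y| <= `|y| / 2 -> `|y| / 2 <= `|x|.
Proof.
move=> hxy; have h1 : `|y| <= `|x| + `|x - y|.
  by rewrite {1}(_ : y = x - (x - y)) ?ler_normB//; ring.
by move: (`|y|) (`|x - y|) (`|x|) hxy h1 => a b c *; lra.
Qed.

(** The points whose row sees a symbol supported in the ball: for a kernel
   phi (x + y) on U with phi supported in sball c r, the row of x vanishes unless x is in
   the lens. *)
Definition lens U c r : set E := [set x | U x /\ exists2 y, U y & sball c r (x + y)].


Lemma open_lens U c r : 0 < r -> open U -> open (lens U c r).
Proof.
move=> r0 oU; have -> : lens U c r =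
    U `&` \bigcup_(y in U) ((fun x => x + y) @^-1` sball c r).
  by apply/seteqP; split => x [Ux [y Uy h]]; split => //; exists y.
apply: openI => //; apply: bigcup_open => y _.
rewrite (_ : _ @^-1` _ = sball (c - y) r); first by rewrite -ball_sball//; exact: ball_open.
by apply/seteqP; split => x h i; have := h i; rewrite !mxE opprB addrA.
Qed.

Lemma dotr_sup g x (A B : R) : (forall i, `|g ord0 i| <= A) -> (forall i, `|x ord0 i| <= B) ->
  `|dotr g x| <= n%:R * (A * B).
Proof.
move=> hA hB; rewrite mulr_natl -[X in _ *+ X](card_ord n) -sumr_const.
apply: le_trans (ler_norm_sum _ _ _) _; apply: ler_sum => i _.
by rewrite normrM ler_pM.
Qed.

(** The values of the affine function at the two points of a lens are nonpositive and
   add up to its value at their sum, which is close to its zero 2 p: both are small. *)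
Lemma lens_bounds U c p g r (k k' A B : R) : 0 < k -> 0 < k' ->
  (forall x, U x -> dotr g (x - p) <= - (k * dotr (x - p) (x - p)) \/ dotr g (x - p) <= - k') ->
  (forall i, `|g ord0 i| <= A) ->
  (forall z, sball c r z -> forall i, `|(z - 2 *: p) ord0 i| <= B) ->
  n%:R * (A * B) < k' ->
  forall x, lens U c r x -> - (n%:R * (A * B)) <= dotr g (x - p) <= 0 /\
    k * dotr (x - p) (x - p) <= n%:R * (A * B).
Proof.
move=> k0 k'0 sup hA hB ABk x [Ux [y Uy /hB hz]].
have le0 z : U z -> dotr g (z - p) <= 0.
  move=> /sup[] h; apply: le_trans h _; rewrite oppr_le0 ?(ltW k'0)//.
  by rewrite mulr_ge0 ?dotr_ge0// ltW.
have := dotr_sup hA hz; rewrite ler_norml => /andP[lo _].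
have e : dotr g (x + y - 2 *: p) = dotr g (x - p) + dotr g (y - p).
  by rewrite -dotrDr; congr dotr; apply/rowP => i; rewrite !mxE; ring.
have lo' : - (n%:R * (A * B)) <= dotr g (x - p).
  by apply: le_trans lo _; rewrite e gerDl le0.
split; first by rewrite lo' le0.
have [h|h] := sup x Ux.
  by have := le_trans lo' h; rewrite lerN2.
by have := le_trans lo' h; rewrite lerN2 leNgt ABk.
Qed.

(** Points a w s at depth of order s^2 under the boundary of the dilate of U, with
   tangential coordinates w. The balls of radius ka s^2 around them cut out lenses of
   volume of order s^(n+1), and lenses with w far apart are disjoint. *)
Definition lens_family (m : nat) U (a : 'rV[R]_m -> R -> E) (dl s0 ka C : R) (k0 : nat) :=
  [/\ 0 < dl, 0 < s0, 0 < ka, 0 < C &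
  forall (w : 'rV[R]_m) s, (forall i, `|w ord0 i| <= dl) -> 0 < s -> s <= s0 ->
  [/\ sball (a w s) (2 * ka * s ^+ 2) `<=` dilate2 U,
      rI mu (\1_(lens U (a w s) (ka * s ^+ 2)) : E -> R) /\
      \int[mu]_x (\1_(lens U (a w s) (ka * s ^+ 2)) x : R) <= C * s ^+ n.+1,
      (exists2 b, ~ dilate2 U b & forall i, `|(a w s - b) ord0 i| <= C * s ^+ 2),
      lens U (a w s) (ka * s ^+ 2) `<=` cube k0 &
      forall (w' : 'rV[R]_m) s' x, (forall i, `|w' ord0 i| <= dl) -> 0 < s' -> s' <= s0 ->
        lens U (a w s) (ka * s ^+ 2) x -> lens U (a w' s') (ka * s' ^+ 2) x ->
        forall j, `|(w - w') ord0 j| <= C * (s + s')]].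

End lenses.

Section surface_lenses.
Context {R : realType} {m n : nat}.
Local Notation mu := (@lebesgue_rV R n).
Local Notation E := 'rV[R]_n.
Variables (W : set E) (rho : E -> R) (p0 nu : E) (T : 'M[R]_(m, n)) (C U : set E) (G : R).
Hypotheses (mn : (m + 1 = n)%N) (oW : open W) (c2 : Ck_on 2 W rho) (Wp0 : W p0)
  (rho0 : rho p0 = 0) (G0 : 0 < G) (gE : gradient rho p0 = G *: nu) (nn : dotr nu nu = 1)
  (TT : T *m T^T = 1%:M) (Tnu : T *m nu^T = 0)
  (dS : 0 < \det (T *m hessmx rho p0 *m T^T))
  (Cconv : forall x y t, C x -> C y -> 0 <= t <= 1 -> C (t *: (y - x) + x))
  (Crho : forall y, C y -> W y -> rho y <= 0)
  (CW : forall y, W y -> rho y = 0 -> C y).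
Hypotheses (m0 : (0 < m)%N) (oU : open U) (UC : U `<=` C)
  (UW : forall y, W y -> rho y = 0 -> ~ U y)
  (CU : forall y, C y -> W y -> rho y <> 0 -> U y)
  (hull : forall p q r t, C p -> 0 < r -> sball q r `<=` U -> 0 < t -> t <= 1 ->
    sball (t *: (q - p) + p) (t * r) `<=` U).

(** Above w there is a surface point p w, and a w s is 2 p w moved towards twice an interior
   point by a distance of order s^2. Strict support at p w squeezes the lens between two
   parallel hyperplanes at distance of order s^2, inside a ball of radius of order s. *)
Lemma surface_lenses : exists a dl s0 ka K k0, @lens_family R n m U a dl s0 ka K k0.
Proof.
have [q Uq] := interior_point mn oW c2 Wp0 rho0 G0 gE nn TT Tnu dS Cconv Crho CW m0 CU.
have /nbhs_sball[R0 R00 qU] : nbhs q U by exact: open_nbhs_nbhs.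
have [r1 [k [k' [r10 k0 k'0 r1W sup]]]] :=
  support_global mn oW c2 Wp0 rho0 G0 gE nn TT Tnu dS Cconv Crho CW.
have [i0 gi0] : exists i0, gradient rho p0 ord0 i0 != 0.
  apply/not_existsP => g0; have e : nu = 0.
    apply/rowP => i; rewrite mxE; have /negP := g0 i.
    by rewrite negbK gE mxE mulf_eq0 gt_eqF//= => /eqP.
  by move: nn; rewrite e /dotr big1 => [/esym/eqP|i _]; rewrite ?oner_eq0// mxE mul0r.
(* The gradient varies little near p0, so its entry i0 stays above gm in modulus. *)
have [gm gmE] : {gm | gm = `|gradient rho p0 ord0 i0| / 2} by eexists.
have gm0 : 0 < gm by rewrite gmE divr_gt0// normr_gt0.
have [r2 r20 hr2] := near_partials oW (Ck2_C1 c2).1 Wp0 gm0.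
have [r rE] : {r | r = Num.min r1 r2} by eexists.
have r0 : 0 < r by rewrite rE lt_min r10.
have rr1 : r <= r1 by rewrite rE ge_min lexx.
have rr2 : r <= r2 by rewrite rE ge_min lexx orbT.
have [A AE] : {A | A = enorm (gradient rho p0) + gm} by eexists.
have grad_bd p : sball p0 r p -> (forall i, `|gradient rho p ord0 i| <= A) /\
    gm <= `|gradient rho p ord0 i0|.
  move=> /(sball_sub rr2)/hr2[_ h]; split => [i|].
    have := h i; have := coord_le_enorm (gradient rho p0) i; rewrite AE !mxE => h1 h2.
    rewrite -[X in `|X|](subrK ('D_(delta_mx ord0 i) rho p0)) addrC.
    by apply: le_trans (ler_normD _ _) _; rewrite lerD.
  have := h i0; rewrite gmE !mxE.
  move: ('D_ _ rho p) ('D_ _ rho p0) => x y hxy.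
  exact: half_norm_le.
have A0 : 0 < A by rewrite AE ltr_wpDl ?sqrtr_ge0.
have [Q QE] : {Q | Q = enorm (q - p0) + r} by eexists.
have Q0 : 0 < Q by rewrite QE ltr_wpDl ?sqrtr_ge0.
have Qbd p : sball p0 r p -> forall i, `|(q - p) ord0 i| <= Q.
  move=> hp i; have := hp i; have := coord_le_enorm (q - p0) i; rewrite QE !mxE => h1 h2.
  rewrite (_ : _ - _ = (q ord0 i - p0 ord0 i) - (p ord0 i - p0 ord0 i)); last by ring.
  by apply: le_trans (ler_normB _ _) _; rewrite lerD// ltW.
(* K2 s^2 bounds the sum of the two nonpositive linear terms at a pair of points of a lens. *)
have [K2 K2E] : {K2 | K2 = n%:R * (A * (R0 + 2 * Q))} by eexists.
have K20 : 0 <= K2.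
  by rewrite K2E mulr_ge0// mulr_ge0 ?(ltW A0)// addr_ge0 ?(ltW R00)// mulr_ge0// ltW.
(* k C3^2 >= K2 turns the strict support inequality into a width of at most C3 s. *)
have [C3 C3E] : {C3 | C3 = K2 + K2 / k + 1} by eexists.
have K2k : 0 <= K2 / k by rewrite divr_ge0// ltW.
have C31 : 1 <= C3 by rewrite C3E lerDr addr_ge0.
have C30 : 0 < C3 by exact: lt_le_trans C31.
have C3K : K2 <= C3 by rewrite C3E -addrA lerDl addr_ge0.
have C3k : K2 <= k * C3 ^+ 2.
  rewrite mulrC -ler_pdivrMr//; apply: (@le_trans _ _ C3); last by rewrite expr2 ler_peMl// ltW.
  by rewrite C3E addrAC lerDr addr_ge0.
have B1 : 0 <= (K2 + 1) / k' by rewrite divr_ge0 ?(ltW k'0)// addr_ge0.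
have B2 : 0 <= 2 * C3 / gm by rewrite divr_ge0 ?(ltW gm0)// mulr_ge0// ltW.
have [s0 [s00 s01 sB1 sB2 _]] := small_reciprocal B1 B2 (lexx 0) (lexx 0).
have [d d0 surf] := surface_point oW c2 Wp0 rho0 G0 gE nn TT Tnu r0.
have /choice[p hp] : forall w : 'rV[R]_m, exists p, dotr w w <= d ^+ 2 ->
    [/\ rho p = 0, sball p0 r p & (p - p0) *m T^T = w].
  move=> w; have [/surf[h rh bh]|_] := boolP (dotr w w <= d ^+ 2); last by exists 0.
  exists (h *: nu + (w *m T + p0)) => _; split => //.
  rewrite addrA addrK mulmxDl -mulmxA TT mulmx1 -scalemxAl.
  have -> : nu *m T^T = 0 by apply: trmx_inj; rewrite trmx_mul trmxK Tnu trmx0.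
  by rewrite scaler0 add0r.
have [dl dlE] : {dl | dl = d / m%:R} by eexists.
have mR : 1 <= m%:R :> R by rewrite ler1n.
have mR0 : 0 < m%:R :> R by rewrite ltr0n.
have dl0 : 0 < dl by rewrite dlE divr_gt0.
have wd (w : 'rV[R]_m) : (forall i, `|w ord0 i| <= dl) -> dotr w w <= d ^+ 2.
  move=> /dotr_le_sup h; apply: le_trans h _; rewrite dlE.
  have -> : m%:R * (d / m%:R) ^+ 2 = d ^+ 2 / m%:R by field; rewrite gt_eqF.
  by rewrite ler_pdivrMr// ler_peMr// sqr_ge0.
pose a (w : 'rV[R]_m) (s : R) : E := 2 *: p w + (2 * s ^+ 2) *: (q - p w).
have [K KE] : {K | K = (2 * C3 + 3) ^+ n * (4 * C3 / gm) + 2 * Q + n%:R * C3 } by eexists.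
have Ka : 0 < (2 * C3 + 3) ^+ n * (4 * C3 / gm).
  by rewrite mulr_gt0 ?exprn_gt0 ?divr_gt0 ?mulr_gt0// addr_gt0// mulr_gt0.
have Kb : 0 < 2 * Q by rewrite mulr_gt0.
have Kc : 0 <= n%:R * C3 by rewrite mulr_ge0// ltW.
have [k0' k0E] : {k0 | k0 = (Num.trunc (C3 + r + enorm p0)).+1} by eexists.
have near_p (w : 'rV[R]_m) s x : (forall i, `|w ord0 i| <= dl) -> 0 < s -> s <= s0 ->
    lens U (a w s) (R0 * s ^+ 2) x ->
    (forall i, `|x ord0 i - p w ord0 i| <= C3 * s) /\
    - (C3 * s ^+ 2) <= dotr (gradient rho (p w)) (x - p w) <= 0.
  move=> /wd/hp[rp bp pT] sp ss hx.
  have [g1 g2] := grad_bd _ bp.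
  have s1 : s <= 1 := le_trans ss s01.
  have ss0 : 0 <= s ^+ 2 by rewrite sqr_ge0.
  have s20 : 0 <= 2 * s ^+ 2 by exact: mulr_ge0.
  have hB z : sball (a w s) (R0 * s ^+ 2) z ->
      forall i, `|(z - 2 *: p w) ord0 i| <= (R0 + 2 * Q) * s ^+ 2.
    move=> hz i; have h1 := hz i; have h2 := Qbd _ bp i.
    have -> : (z - 2 *: p w) ord0 i = (z ord0 i - a w s ord0 i) + 2 * s ^+ 2 * (q - p w) ord0 i.
      by rewrite !mxE; ring.
    apply: le_trans (ler_normD _ _) _; rewrite [leRHS]mulrDl lerD ?(ltW h1)//.
    by rewrite normrM (ger0_norm s20) [leRHS]mulrAC ler_wpM2l.
  have nk : n%:R * (A * ((R0 + 2 * Q) * s ^+ 2)) = K2 * s ^+ 2 by rewrite K2E; ring.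
  have lt : n%:R * (A * ((R0 + 2 * Q) * s ^+ 2)) < k'.
    rewrite nk; apply: (@le_lt_trans _ _ (K2 * s0)).
      by rewrite ler_wpM2l// expr2; apply: le_trans ss; rewrite ler_piMr// ltW.
    move: sB1; rewrite mulrA ler_pdivrMr// mul1r; apply: lt_le_trans.
    by rewrite mulrDr mulr1 mulrC ltrDl.
  have [l1 l2] := lens_bounds k0 k'0
    (fun x Ux => sup (p w) x (sball_sub rr1 bp) rp (UC Ux)) g1 hB lt hx.
  rewrite nk in l1 l2; split => [i|]; last first.
    by move: l1 => /andP[l1 ->]; rewrite andbT; apply: le_trans l1; rewrite lerN2 ler_wpM2r.
  rewrite -ler_sqr ?nnegrE ?mulr_ge0 ?(ltW C30) ?(ltW sp)// real_normK ?num_real//.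
  have := sqr_coord_le (x - p w) i; rewrite !mxE => l3; apply: le_trans l3 _.
  rewrite -(ler_pM2l k0); apply: le_trans l2 _; rewrite exprMn [leRHS]mulrA.
  exact: ler_wpM2r ss0 _ _ C3k.
exists a, dl, s0, R0, K, k0'; split => //.
  by rewrite KE ltr_wpDr// addr_gt0.
move=> w s wdl sp ss; have s1 : s <= 1 := le_trans ss s01.
have ss0 : 0 < s ^+ 2 by rewrite exprn_gt0.
have s20 : 0 <= 2 * s ^+ 2 by rewrite mulr_ge0// ltW.
have ss1 : s ^+ 2 <= 1 by rewrite expr_le1// ltW.
have [rp bp pT] := hp _ (wd _ wdl); have [g1 g2] := grad_bd _ bp.
have Wp : W (p w) by apply: r1W; exact: sball_sub bp.
have Cp : C (p w) by exact: CW.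
have hx := near_p w s _ wdl sp ss.
split.
- move=> z hz; exists (2^-1 *: z); last by rewrite scalerA divff// scale1r.
  apply: (hull Cp R00 qU ss0 ss1) => i; have := hz i; rewrite !mxE => h.
  rewrite (_ : _ - _ = 2^-1 * (z ord0 i - (2 * p w ord0 i + 2 * s ^+ 2 * (q ord0 i - p w ord0 i)))); last by field.
  rewrite normrM ger0_norm ?invr_ge0// -(ltr_pM2l (ltr0Sn _ 1)) mulrA divff// mul1r.
  by apply: lt_le_trans h _; apply: le_of_eq; ring.
- have mL : measurable (lens U (a w s) (R0 * s ^+ 2)).
    by apply: open_measurable_rV; apply: open_lens => //; exact: mulr_gt0.
  have sg : 2 * C3 * s <= gm.
    move: sB2; rewrite mulrA ler_pdivrMr// mul1r mulrC; apply: le_trans.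
    by rewrite ler_wpM2l// mulr_ge0// ltW.
  have [h1 h2] := slab_volume mL gm0 g2 C30 sp sg hx.
  split => //; apply: le_trans h2 _; rewrite ler_wpM2r ?exprn_ge0 ?(ltW sp)// KE -addrA lerDl.
  by rewrite addr_ge0// ltW.
- exists (2 *: p w) => [[y Uy /(scalerI _) e]|i].
    by apply: (UW Wp rp); rewrite -e// pnatr_eq0.
  have -> : (a w s - 2 *: p w) ord0 i = 2 * s ^+ 2 * (q - p w) ord0 i by rewrite !mxE; ring.
  rewrite normrM (ger0_norm s20) mulrAC ler_wpM2r ?(ltW ss0)//.
  apply: (@le_trans _ _ (2 * Q)); first by rewrite ler_wpM2l//; exact: Qbd.
  by rewrite KE addrAC lerDr addr_ge0// ltW.
- move=> x /hx[h _] i.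
  have hb : `|x ord0 i| <= C3 + r + enorm p0.
    have -> : x ord0 i = (x ord0 i - p w ord0 i) + (p w ord0 i - p0 ord0 i) + p0 ord0 i by ring.
    apply: le_trans (ler_normD _ _) _; rewrite lerD ?coord_le_enorm//.
    apply: le_trans (ler_normD _ _) _; rewrite lerD ?(ltW (bp i))//.
    by apply: le_trans (h i) _; rewrite ler_piMr// ltW.
  have kb : C3 + r + enorm p0 < k0'%:R.
    rewrite k0E; have /truncn_itv/andP[//] : 0 <= C3 + r + enorm p0.
    by rewrite addr_ge0 ?sqrtr_ge0// addr_ge0// ltW.
  by have := le_lt_trans hb kb; rewrite ltr_norml => /andP[-> /ltW].
- move=> w' s' x w'dl s'p ss' /hx[hx1 _] /(near_p w' s' _ w'dl s'p ss')[hx2 _] j.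
  have [_ _ pT'] := hp _ (wd _ w'dl).
  have -> : (w - w') ord0 j = dotr (p w - p w') (row j T).
    have -> : w - w' = (p w - p w') *m T^T.
      by rewrite -{1}pT -{1}pT' -mulmxBl opprB addrA subrK.
    by rewrite mxE; apply: eq_bigr => i _; rewrite !mxE.
  apply: le_trans (dotr_sup (A := C3 * (s + s')) (B := 1) _ _) _.
  + move=> i; have -> : (p w - p w') ord0 i = (x ord0 i - p w' ord0 i) - (x ord0 i - p w ord0 i).
      by rewrite !mxE; ring.
    by apply: le_trans (ler_normB _ _) _; rewrite mulrDr addrC lerD.
  + move=> i; rewrite -(@ler_sqr _ `|_|) ?nnegrE// real_normK ?num_real// expr1n.
    apply: le_trans (sqr_coord_le (row j T) i) _.
    have /matrixP/(_ j j) := TT; rewrite !mxE eqxx mulr1n => <-.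
    by apply: le_of_eq; apply: eq_bigr => i' _; rewrite !mxE.
  rewrite mulr1 [leLHS]mulrA ler_wpM2r ?addr_ge0 ?(ltW sp) ?(ltW s'p)// KE.
  by rewrite -[leLHS]add0r lerD// addr_ge0// ltW.
Qed.

End surface_lenses.

Section curved_boundary.
Context {R : realType} {n : nat}.
Local Notation E := 'rV[R]_n.
Implicit Types (Omega : set E) (p q x y : E) (r t : R).

Lemma shift_continuous (c : E) : continuous (fun y : E => y + c).
Proof.
move=> x W /nbhs_sball[r r0 h]; apply/nbhs_sball; exists r => // y hy.
by apply: h => i; have := hy i; rewrite !mxE opprD addrACA subrr addr0.
Qed.

Lemma open_eball c r : open (eball c r : set E).
Proof.
have -> : eball c r = (fun y : E => enorm (y - c)) @^-1` [set z | z < r] by [].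
apply: open_comp; last exact: open_lt.
move=> x _; apply: (@continuous_comp _ _ _ (fun y : E => y - c) (@enorm R n)).
  exact: shift_continuous.
exact: enorm_continuous.
Qed.

Lemma convex_seg Omega x y t : convex_set (Omega : set (convex_lmodType E)) ->
  Omega x -> Omega y -> 0 <= t <= 1 -> Omega (t *: (y - x) + x).
Proof.
move=> cvx Ox Oy /andP[t0 t1].
have := cvx y x (Itv01 t0 t1); rewrite !inE => /(_ Oy Ox).
rewrite /conv /= => h; rewrite (_ : _ + _ = t *: y + (1 - t) *: x)//.
by apply/rowP => i; rewrite !mxE; ring.
Qed.

Lemma closureP_sball Omega x :
  closure Omega x <-> forall e, 0 < e -> exists2 y, Omega y & sball x e y.
Proof.
split=> [h e e0|h W /nbhs_sball[e e0 hW]].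
  by have [|y [Oy hy]] := h (sball x e); [apply/nbhs_sball; exists e|exists y].
by have [y Oy hy] := h e e0; exists y; split => //; exact: hW.
Qed.

Lemma closure_seg Omega x y t : convex_set (Omega : set (convex_lmodType E)) ->
  closure Omega x -> closure Omega y -> 0 <= t <= 1 -> closure Omega (t *: (y - x) + x).
Proof.
move=> cvx /closureP_sball hx /closureP_sball hy t01; apply/closureP_sball => e e0.
have e20 : 0 < e / 2 by rewrite divr_gt0.
have [x' Ox' hx'] := hx _ e20; have [y' Oy' hy'] := hy _ e20.
exists (t *: (y' - x') + x'); first exact: convex_seg.
move=> i; have := hx' i; have := hy' i; rewrite !mxE; move/andP: t01 => [t0 t1].
move: (x ord0 i) (y ord0 i) (x' ord0 i) (y' ord0 i) => a b a' b' h1 h2.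
have -> : t * (b' - a') + a' - (t * (b - a) + a) = t * (b' - b) + (1 - t) * (a' - a) by ring.
apply: le_lt_trans (ler_normD _ _) _; have t1' : 0 <= 1 - t by rewrite subr_ge0.
rewrite !normrM (ger0_norm t0) (ger0_norm t1').
apply: (@le_lt_trans _ _ (`|b' - b| + `|a' - a|)); last by rewrite [e]splitr ltrD.
by apply: lerD; rewrite ler_piMl// gerBl.
Qed.

(** Contracting a ball contained in a convex set towards a point of the closure keeps it
   inside: move the point slightly into the set. *)
Lemma convex_hull_ball Omega p q r t : convex_set (Omega : set (convex_lmodType E)) ->
  closure Omega p -> 0 < r -> sball q r `<=` Omega° -> 0 < t -> t <= 1 ->
  sball (t *: (q - p) + p) (t * r) `<=` Omega°.
Proof.
move=> cvx /closureP_sball hp r0 hq t0 t1.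
have sub : sball (t *: (q - p) + p) (t * r) `<=` Omega.
  move=> z hz.
  pose u : E := t^-1 *: (z - (t *: (q - p) + p)).
  have hu i : `|u ord0 i| < r.
    rewrite /u mxE normrM gtr0_norm ?invr_gt0// ltr_pdivrMl//.
    by have := hz i; rewrite !mxE.
  have zE : z = t *: (q + u - p) + p.
    by apply/rowP => i; rewrite !mxE; field; rewrite gt_eqF.
  have : nbhs (q + u) Omega°.
    apply: open_nbhs_nbhs; split; first exact: open_interior.
    by apply: hq => i; rewrite mxE addrAC subrr add0r.
  move=> /nbhs_sball[e e0 he].
  have [p' Op' hp'] := hp (t * e) (mulr_gt0 t0 e0).
  pose y : E := q + u + ((1 - t) / t) *: (p - p').
  have Oy : Omega y.
    apply: interior_subset; apply: he => i.
    have -> : y ord0 i - (q + u) ord0 i = (1 - t) / t * (p ord0 i - p' ord0 i).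
      by rewrite /y; move: (q + u) => v; rewrite !mxE; ring.
    rewrite normrM ger0_norm ?divr_ge0 ?subr_ge0 ?(ltW t0)// distrC.
    have := hp' i => h; rewrite mulrAC ltr_pdivrMr// [e * t]mulrC.
    by apply: le_lt_trans h; rewrite ler_piMl// gerBl ltW.
  have -> : z = t *: (y - p') + p'.
    by rewrite zE /y; apply/rowP => i; rewrite !mxE; field; rewrite gt_eqF.
  by apply: convex_seg => //; rewrite (ltW t0).
have tr : 0 < t * r by rewrite mulr_gt0.
by rewrite -open_subsetE// -ball_sball//; exact: ball_open.
Qed.

(** Gaussian curvature is the determinant of the tangential Hessian up to a positive factor.
   The Hessian is nonnegative by convexity, hence positive definite, and the surface is
   strictly convex. *)
Theorem curved_lenses Omega : (2 <= n)%N ->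
  convex_set (Omega : set (convex_lmodType E)) -> curved_boundary_neighborhood Omega ->
  exists (a : 'rV[R]_n.-1 -> R -> E) dl s0 ka K k0, lens_family Omega° a dl s0 ka K k0.
Proof.
move=> n2 cvx [c [r [r0 [p0 Mp0] _ pc]]].
have [U0 [rho [U0p [oU0 c2 gn0 MU] neg [k [T [TT Tg kE]] k0]]]] := pc p0 Mp0.
have W0 : open (U0 `&` eball c r) by apply: openI => //; exact: open_eball.
have c2W : Ck_on 2 (U0 `&` eball c r) rho by move=> l x [/c2 h _]; exact: h.
have gp0 := gn0 _ U0p.
have Wp0 : (U0 `&` eball c r) p0 by split => //; exact: Mp0.2.
have M0 y : U0 y -> rho y = 0 -> (boundary Omega `&` eball c r) y.
  by move=> Uy ry; have : [set y | U0 y /\ rho y = 0] y by []; rewrite -MU => -[].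
have rho0 : rho p0 = 0.
  by have [] : [set y | U0 y /\ rho y = 0] p0 by rewrite -MU.
have [G GE] : {G | G = enorm (gradient rho p0)} by eexists.
have G0 : 0 < G.
  rewrite lt_neqAle GE sqrtr_ge0 andbT eq_sym -GE; apply: contra gp0 => /eqP G0.
  by apply/eqP/dotr_eq0; rewrite -enorm_sqr -GE G0 expr0n.
pose nu : E := G^-1 *: gradient rho p0.
have gE : gradient rho p0 = G *: nu by rewrite scalerA divff ?gt_eqF// scale1r.
have nn : dotr nu nu = 1.
  by rewrite dotrZl dotrZr -enorm_sqr -GE; field; rewrite gt_eqF.
have Tnu : T *m nu^T = 0 by rewrite linearZ /= -scalemxAr Tg scaler0.
have dS : 0 < \det (T *m hessmx rho p0 *m T^T).
  move: k0; rewrite kE (jacobian_unit_normal W0 c2W Wp0 gp0 Tg) detZ -GE.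
  by rewrite pmulr_rgt0// exprn_gt0// invr_gt0.
have mn : (n.-1 + 1 = n)%N by rewrite addn1 prednK// ltnW.
have crho y : U0 y -> {for y, continuous rho}.
  by move=> Uy; have [] := c2 [::] y Uy isT.
have Crho y : closure Omega y -> (U0 `&` eball c r) y -> rho y <= 0.
  move=> cy [Uy _]; rewrite leNgt; apply/negP => ry.
  have : nbhs y (U0 `&` [set z | 0 < rho z]).
    apply: filterI; first exact: open_nbhs_nbhs.
    have ry2 : 0 < rho y / 2 by rewrite divr_gt0.
    apply: filterS (cts_near (crho y Uy) ry2) => z /=; rewrite ler_norml => /andP[h _].
    by apply: lt_le_trans ry2 _; move: h; move: (rho y) (rho z) => b d; lra.
  by move=> /cy[z [Oz [Uz]]] /=; rewrite ltNge neg.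
apply: (surface_lenses (W := U0 `&` eball c r) (C := closure Omega) mn W0 c2W Wp0 rho0 G0 gE nn TT Tnu dS) => //.
- by move=> x y t; exact: closure_seg.
- by move=> y [Uy _] /(M0 y Uy)[[]].
- by rewrite -ltnS prednK// ltnW.
- exact: open_interior.
- by move=> y /interior_subset; exact: subset_closure.
- by move=> y [Uy _] /(M0 y Uy)[[]].
- move=> y cy [Uy ey] ry; apply: contrapT => niy.
  have : (boundary Omega `&` eball c r `&` U0) y by [].
  by rewrite MU => -[_].
- by move=> p q r' t; exact: convex_hull_ball.
Qed.

End curved_boundary.

(** * Bumps and the symbol *)

Section bumps.
Context {R : realType} {n : nat}.
Local Notation mu := (@lebesgue_rV R n).
Local Notation leb := (@lebesgue_measure R).
Local Notation E := 'rV[R]_n.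
Implicit Types (f g : E -> R) (p x y z : E) (s : R) (K U : set E).

Definition theta : R -> R := sbump 1 (-1) 1.

Definition cbump p s : E -> R := rtensor (fun i t => theta (s^-1 * t + - (s^-1 * p ord0 i))).

Definition sbox p s : set E := [set x | forall i, x ord0 i \in `[p ord0 i - s, p ord0 i + s]].

Lemma smooth_cbump p s : smooth (cbump p s).
Proof. by apply: smooth_rtensor => i; apply: smooth1_affine; exact: smooth1_sbump. Qed.

Lemma theta_off (t : R) : 1 <= `|t| -> theta t = 0.
Proof.
move=> h; apply: sbump_off => //; rewrite negb_and -!leNgt.
by move: h; rewrite ler_normr => /orP[->|]; rewrite ?orbT// lerNr => ->.
Qed.

Lemma cbump01 p s x : 0 <= cbump p s x <= 1.
Proof.
apply/andP; split; first by apply: prodr_ge0 => i _; have /andP[] := sbump_ge0_le1 1 (-1) 1 (s^-1 * x ord0 i + - (s^-1 * p ord0 i)).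
by apply: prodr_ile1 => i _; exact: sbump_ge0_le1.
Qed.

Lemma cbump_off p s x : 0 < s -> ~ sball p s x -> cbump p s x = 0.
Proof.
move=> s0 /existsNP[i /negP]; rewrite -leNgt => h.
rewrite /cbump (rtensor_split _ i) theta_off ?mul0r//.
by rewrite -mulrBr normrM gtr0_norm ?invr_gt0// ler_pdivlMl// mulr1.
Qed.

Lemma sball_sbox p s x : sball p s x -> sbox p s x.
Proof.
move=> h i; rewrite in_itv /=; have := ltW (h i); rewrite ler_norml => /andP[h1 h2].
by rewrite lerBlDr -lerBlDl in h1 *; rewrite lerBlDl in h2; apply/andP; split; move: h1 h2;
  move: (x ord0 i) (p ord0 i) => a b h1 h2; lra.
Qed.

Lemma sbox_sball p s x : 0 < s -> sbox p s x -> sball p (2 * s) x.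
Proof.
move=> s0 h i; have := h i; rewrite in_itv /= => /andP[h1 h2].
rewrite ltr_norml; move: (x ord0 i) (p ord0 i) h1 h2 => a b h1 h2.
by apply/andP; split; lra.
Qed.

Lemma cbump_sbox p s x : 0 < s -> ~ sbox p s x -> cbump p s x = 0.
Proof. by move=> s0 h; apply: cbump_off => // /sball_sbox. Qed.

Lemma schwartz_cbump p s : 0 < s -> schwartz (fun x => (cbump p s x)%:C).
Proof.
move=> s0; have cK : compact (sbox p s) by exact: cube_compact.
by apply: (compact_schwartz cK (smooth_cbump p s)) => x; exact: cbump_sbox.
Qed.

(** The partial derivatives are bounded, as f is a Schwartz function. *)
Lemma compact_lipschitz K f : compact K -> smooth f -> (forall x, ~ K x -> f x = 0) ->
  exists2 M, 0 <= M & forall x y, `|f y - f x| <= M * \sum_(i < n) `|y ord0 i - x ord0 i|.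
Proof.
move=> cK sf f0; have [_ dec] := compact_schwartz cK sf f0.
have hd i : exists M : R, forall x, `|'D_(delta_mx ord0 i) f x| <= M.
  have [M hM] := dec 0%N [:: i]; exists M => x; apply: le_trans (hM x).
  rewrite expr0 mul1r; apply: le_trans (cRe_le_cabs _); rewrite lexx//.
have [M hM] := choice hd.
have M0 : 0 <= \sum_i `|M i| by apply: sumr_ge0.
exists (\sum_i `|M i|) => // x y.
pose r := 1 + \sum_(i < n) (`|x ord0 i| + `|y ord0 i|).
have inb z : (forall i, `|z ord0 i| <= `|x ord0 i| + `|y ord0 i|) -> sball 0 r z.
  move=> hz i; rewrite mxE subr0; apply: le_lt_trans (hz i) _; rewrite /r (bigD1 i)//=.
  by rewrite addrCA ltrDl ltr_pwDl//; apply: sumr_ge0 => j _; rewrite addr_ge0.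
have hx : sball 0 r x by apply: inb => i; rewrite lerDl.
have hy : sball 0 r y by apply: inb => i; rewrite lerDr.
have hb z : sball 0 r z -> forall i, derivable f z (delta_mx ord0 i) /\
    `|'D_(delta_mx ord0 i) f z - 0| <= \sum_i `|M i|.
  move=> _ i; split; first exact: (@smooth_der _ _ f [::] i z sf).
  rewrite subr0; apply: le_trans (hM i z) _; rewrite (bigD1 i)//=.
  by rewrite ler_wpDr ?ler_norm//; apply: sumr_ge0.
have := sball_increment (g := fun=> 0) hb hx hy.
by rewrite big1 ?subr0// => i _; rewrite mul0r.
Qed.

Lemma theta_lower (t : R) : `|t| <= 2^-1 -> flat 1 (2^-1) ^+ 2 <= theta t.
Proof.
rewrite ler_norml => /andP[h1 h2]; rewrite /theta /sbump expr2 !mul1r opprK.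
have h0 := flat1_ge0_le1 (2^-1 : R).
by apply: ler_pM; try (by case/andP: h0); apply: flat1_mono; lra.
Qed.

Lemma theta_sqr_int : rI leb (fun t => theta t ^+ 2) /\ 0 < \int[leb]_t theta t ^+ 2.
Proof.
have f0 : 0 < flat 1 (2^-1 : R).
  by rewrite /flat invr_gt0 ltr0n /= hornerC mul1r expR_gt0.
have mth : measurable_fun setT (fun t : measurableTypeR R => theta t ^+ 2).
  apply: measurable_funX; apply: continuous_measurable_fun; apply: smooth1_cts.
  exact: smooth1_sbump.
have ile (t : R) : `|theta t ^+ 2| <= \1_(Iab (-1) 1) t * (fun=> 1) t.
  rewrite mulr1 indIab ger0_norm ?sqr_ge0//.
  have [_|/negP h] := boolP (-1 < t <= 1).
    by have /andP[t0 t1] := sbump_ge0_le1 1 (-1) 1 t; rewrite expr_le1.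
  rewrite theta_off ?expr0n// leNgt; apply/negP; rewrite ltr_norml => /andP[h1 h2].
  by apply: h; rewrite h1 ltW.
have Ith := rI_le (rI_ind_mul (-1) 1 (@cts_cst R 1)) mth ile; split => //.
have [w wE] : {w | w = (flat 1 (2^-1) ^+ 2) ^+ 2 :> R} by eexists.
apply: (@lt_le_trans _ _ (\int[leb]_t (\1_(Iab (- 2^-1) (2^-1)) t * (fun=> w) t))).
  have dF (x : R) : is_derive x 1 (fun t => w * t) w.
    by apply: der_eq (derZ _ (der_id x)) _; rewrite mulr1.
  have h2 : - 2^-1 <= 2^-1 :> R by lra.
  rewrite (@ftc_ind R (fun=> w) (fun t => w * t) _ _ h2 (@cts_cst R w) dF).
  rewrite -mulrBr opprK mulr_gt0 ?wE ?exprn_gt0//; lra.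
apply: rint_le => //; first exact: (rI_ind_mul _ _ (@cts_cst R _)).
move=> t; rewrite indIab; have [/andP[h1 h2]|_] := boolP (_ < t <= _); last by rewrite mul0r sqr_ge0.
rewrite mul1r wE; apply: lerXn2r; rewrite ?nnegrE ?sqr_ge0//.
  by have /andP[] := sbump_ge0_le1 1 (-1) 1 t.
by apply: theta_lower; rewrite ler_norml h2 ltW.
Qed.

End bumps.

Section nets.
Context {R : realType} {n : nat}.
Local Notation E := 'rV[R]_n.

(** One point of P is chosen in each cell of a grid that meets P. *)
Lemma cube_net (P : set E) k0 (d : R) : 0 < d -> P `<=` cube k0 -> exists s : seq E,
  forall y, P y -> exists2 x, x \in s & P x /\ forall i, `|y ord0 i - x ord0 i| <= d.
Proof.
move=> d0 Pc; pose N := Num.trunc (2 * k0%:R / d).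
pose cell (y : E) i := Num.trunc ((y ord0 i + k0%:R) / d).
have pos y i : P y -> 0 <= (y ord0 i + k0%:R) / d.
  by move=> /Pc/(_ i)/andP[h _]; rewrite divr_ge0 ?(ltW d0)// -lerBlDr sub0r ltW.
have cellN y i : P y -> (cell y i < N.+1)%N.
  move=> Py; have := Pc _ Py i => /andP[_ h]; rewrite ltnS; apply: le_truncn.
  by rewrite ler_wpM2r ?invr_ge0 ?(ltW d0)// mulr2n mulrDl mul1r lerD2r.
pose code (y : E) : {ffun 'I_n -> 'I_N.+1} := [ffun i => inord (cell y i)].
have /choice[pt hpt] : forall f : {ffun 'I_n -> 'I_N.+1}, exists x, (exists2 y, P y & code y = f) ->
    P x /\ code x = f.
  move=> f; have [[y Py yf]|no] := pselect (exists2 y, P y & code y = f); last by exists 0.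
  by exists y.
exists [seq pt f | f <- enum [set: {ffun 'I_n -> 'I_N.+1}]%SET] => y Py.
exists (pt (code y)); first by apply: map_f; rewrite mem_enum finset.in_setT.
have [Px xy] := hpt (code y) (ex_intro2 _ _ y Py erefl); split => // i.
move: Px xy; move: (pt (code y)) => x Px /ffunP/(_ i); rewrite !ffunE => /(congr1 (@nat_of_ord N.+1)).
rewrite !inordK ?cellN// /cell => e.
have /andP[y1 y2] := truncn_itv (pos y i Py); have /andP[x1 x2] := truncn_itv (pos x i Px).
rewrite e in x1 x2; move: y1 y2 x1 x2; rewrite -!natr1.
move: ((Num.trunc _)%:R) => T.
rewrite ler_pdivlMr// ltr_pdivrMr// ler_pdivlMr// ltr_pdivrMr// mulrDl mul1r.
move: (T * d) (y ord0 i) (x ord0 i) => a b b' h1 h2 h3 h4.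
by rewrite ler_norml; apply/andP; split; lra.
Qed.

End nets.

Section bump_series.
Context {R : realType} {n : nat}.
Local Notation mu := (@lebesgue_rV R n).
Local Notation E := 'rV[R]_n.
Variables (U : set E) (J : nat -> finType) (A : forall k, J k -> E) (r c t : nat -> R)
  (eps : forall k, J k -> R).
Arguments A : clear implicits.
Arguments eps : clear implicits.
Hypotheses (oU : open U) (r0 : forall k, 0 < r k) (c0 : forall k, 0 < c k)
  (AU : forall k j, sball (A k j) (2 * r k) `<=` dilate2 U)
  (lens_level : forall k j k' j' x,
    lens U (A k j) (r k) x -> lens U (A k' j') (r k') x -> k = k')
  (lens_index : forall k j j' x,
    lens U (A k j) (r k) x -> lens U (A k j') (r k) x -> j = j')
  (shrink : forall k j, exists2 b, ~ dilate2 U b & forall i, `|(A k j - b) ord0 i| <= t k)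
  (r_to0 : r @ \oo --> (0 : R)) (t_to0 : t @ \oo --> (0 : R))
  (eps1 : forall k j, `|eps k j| = 1).

Definition level k : E -> R := fun z => c k * \sum_j eps k j * cbump (A k j) (r k) z.

(** The sum of all levels: at most one of them is nonzero at a given point. *)
Definition symbol : E -> R := fun z =>
  if pselect (exists k, level k z != 0) is left h then level (projT1 (cid h)) z else 0.

(** The point 2 x is the sum of x with itself. So disjoint lenses give disjoint balls. *)
Lemma sball_lens k j z : sball (A k j) (r k) z ->
  exists2 x, z = 2 *: x & lens U (A k j) (r k) x.
Proof.
move=> hz; have [x Ux xz] : dilate2 U z.
  by apply: (AU (j := j)); apply: sball_sub hz; rewrite ler_peMl ?(ltW (r0 k))// ler1n.
exists x => //; split => //; exists x => //.
by rewrite -mulr2n -scaler_nat xz.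
Qed.

Lemma sball_level k j k' j' z :
  sball (A k j) (r k) z -> sball (A k' j') (r k') z -> k = k'.
Proof.
move=> /sball_lens[x -> hx] /sball_lens[x' /(scalerI _) e hx'].
by apply: lens_level hx _; rewrite e ?pnatr_eq0//; exact: hx'.
Qed.

Lemma sball_index k j j' z :
  sball (A k j) (r k) z -> sball (A k j') (r k) z -> j = j'.
Proof.
move=> /sball_lens[x -> hx] /sball_lens[x' /(scalerI _) e hx'].
by apply: lens_index hx _; rewrite e ?pnatr_eq0//; exact: hx'.
Qed.

Lemma level_ball k j z : sball (A k j) (r k) z ->
  level k z = c k * (eps k j * cbump (A k j) (r k) z).
Proof.
move=> hj; rewrite /level (bigD1 j)//= big1 ?addr0// => j' jj'.
rewrite cbump_off ?mulr0// => hj'; move/negP: jj'; apply.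
by apply/eqP; exact: sball_index hj' hj.
Qed.

Lemma level_off k z : (forall j, ~ sball (A k j) (r k) z) -> level k z = 0.
Proof. by move=> h; rewrite /level big1 ?mulr0// => j _; rewrite cbump_off ?mulr0//; exact: h. Qed.

Lemma level_ne0 k z : level k z <> 0 -> exists j, sball (A k j) (r k) z.
Proof. by move=> h; apply: contrapT => /forallNP no; apply: h; exact: level_off. Qed.

Lemma level_bound k z : `|level k z| <= c k.
Proof.
have [[j hj]|no] := pselect (exists j, sball (A k j) (r k) z); last first.
  by rewrite level_off ?normr0 ?(ltW (c0 k))// => j hj; apply: no; exists j.
rewrite (level_ball hj) !normrM (gtr0_norm (c0 k)) eps1 mul1r ler_piMr ?(ltW (c0 k))//.
by have /andP[h0 h1] := cbump01 (A k j) (r k) z; rewrite ger0_norm.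
Qed.

Lemma symbol_ball k j z : sball (A k j) (r k) z -> symbol z = level k z.
Proof.
move=> hj; rewrite /symbol; case: pselect => [h|no].
  case: (cid h) => k' /= /eqP/level_ne0[j' hj'].
  by rewrite (sball_level hj' hj).
by apply/esym/eqP; apply: contra_notT no => h; exists k.
Qed.

Lemma symbol_ne0 z : symbol z <> 0 -> exists k j, sball (A k j) (r k) z.
Proof.
rewrite /symbol; case: pselect => // h _; have [k /eqP/level_ne0[j hj]] := h.
by exists k, j.
Qed.

Lemma symbol_cvg z : (fun N => \sum_(k < N) level k z) @ \oo --> symbol z.
Proof.
have [[k [j hj]]|no] := pselect (exists k j, sball (A k j) (r k) z); last first.
  have -> : symbol z = 0 by apply: contrapT => /symbol_ne0[k [j hj]]; apply: no; exists k, j.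
  rewrite (_ : (fun N => _) = fun=> 0); first exact: cvg_cst.
  apply/funext => N; rewrite big1// => k _; apply: level_off => j hj.
  by apply: no; exists k, j.
rewrite (symbol_ball hj); apply: cvg_near_cst; near=> N.
have kN : (k < N)%N by near: N; exists k.+1.
rewrite (bigD1 (Ordinal kN))//= big1 ?addr0// => k' kk'; apply: level_off => j' hj'.
by move/negP: kk'; apply; apply/eqP/val_inj => /=; exact: sball_level hj' hj.
Unshelve. all: by end_near. Qed.

Lemma smooth_level k : smooth (level k).
Proof.
rewrite (_ : level k = fun z => \sum_j (c k * eps k j) * cbump (A k j) (r k) z).
  by apply: smooth_sum => j; exact: smooth_cbump.
by apply/funext => z; rewrite /level mulr_sumr; apply: eq_bigr => j _; rewrite mulrA.
Qed.

Lemma measurable_symbol : measurable_fun setT symbol.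
Proof.
apply: (measurable_fun_cvg (h := fun N z => \sum_(k < N) level k z)).
  move=> N; apply: measurable_sum => k.
  by apply: continuous_measurable_rV; exact: (@smooth_cts _ _ (level k) [::] (smooth_level k)).
by move=> z _; exact: symbol_cvg.
Qed.

Lemma symbol_locally_bounded z : dilate2 U z ->
  exists2 e, 0 < e & exists B : R, forall y, sball z e y -> `|symbol y| <= B.
Proof.
move=> [x Ux <-]; have /nbhs_sball[e e0 he] : nbhs x U by exact: open_nbhs_nbhs.
have he' y : sball (2 *: x) (2 * e) y -> dilate2 U y.
  move=> hy; exists (2^-1 *: y); last by rewrite scalerA divff// scale1r.
  apply: he => i; have := hy i; rewrite !mxE => h.
  rewrite (_ : _ - _ = 2^-1 * (y ord0 i - 2 * x ord0 i)); last by field.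
  by rewrite normrM ger0_norm ?invr_ge0// mulrC ltr_pdivrMr// [e * _]mulrC.
have e2 : 0 < e / 2 by rewrite divr_gt0.
(* From level N on, every ball is so close to a point outside the dilate that it cannot
   meet sball z e. *)
have [N hN] : exists N, forall k, (N <= k)%N -> r k + t k < e.
  have : \forall k \near \oo, r k + t k < e.
    near=> k; rewrite [e]splitr ltrD//.
      apply: le_lt_trans (ler_norm _) _; rewrite -[r k]subr0 distrC.
      by near: k; move/cvgrPdist_lt : r_to0 => /(_ _ e2).
    apply: le_lt_trans (ler_norm _) _; rewrite -[t k]subr0 distrC.
    by near: k; move/cvgrPdist_lt : t_to0 => /(_ _ e2).
  by move=> [N _ hN]; exists N => k /hN.
exists e => //; exists (\sum_(k < N) c k) => y hy.
have S0 : 0 <= \sum_(k < N) c k by apply: sumr_ge0 => k _; exact: ltW.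
have [->|/eqP/symbol_ne0[k [j hj]]] := eqVneq (symbol y) 0; first by rewrite normr0.
have [kN|Nk] := ltnP k N.
  rewrite (symbol_ball hj); apply: le_trans (level_bound _ _) _.
  rewrite (bigD1 (Ordinal kN))//= lerDl; apply: sumr_ge0 => k' _; exact: ltW.
have [b nb hb] := shrink j; exfalso; apply: nb; apply: he' => i.
have h1 := hb i; have h2 := hj i; have h3 := hy i; have h4 := hN k Nk; move: h1; rewrite mxE => h1.
have -> : b ord0 i - (2 *: x) ord0 i = (y ord0 i - (2 *: x) ord0 i) -
    (y ord0 i - A k j ord0 i) - ((A k j) ord0 i + (- b) ord0 i) by rewrite !mxE; ring.
apply: le_lt_trans (ler_normB _ _) _.
apply: (@lt_le_trans _ _ (e + (r k + t k))); last by rewrite mulr2n mulrDl mul1r lerD2l ltW.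
rewrite addrA; apply: ltr_leD => //.
by apply: le_lt_trans (ler_normB _ _) _; exact: ltrD.
Unshelve. all: by end_near. Qed.

(** Only finitely many bumps meet a compact subset of the dilate, since the bumps
   concentrate at the boundary. *)
Lemma symbol_bounded K : compact K -> K `<=` dilate2 U ->
  exists N : nat, forall z, K z -> `|symbol z| <= N%:R /\ cube N z.
Proof.
move=> /compact_near_coveringP/(_ nat \oo (fun N z => `|symbol z| <= N%:R /\ cube N z)) cK KU.
suff h : \forall N \near \oo, K `<=` (fun z => `|symbol z| <= N%:R /\ cube N z).
  by have [N _ hN] := h; exists N => z; exact: (hN N (leqnn N)).
apply: cK => z /KU/symbol_locally_bounded[e e0 [B hB]].
pose M := B + e + \sum_i `|z ord0 i|.
exists (sball z e, [set N : nat | M < N%:R]) => /=.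
  split; first by apply/nbhs_sball; exists e.
  exact: nbhs_infty_gtr.
move=> [y N] [/= hy hN].
have B0 : 0 <= B by apply: le_trans (hB _ hy).
have S0 : 0 <= \sum_i `|z ord0 i| by apply: sumr_ge0.
split.
  apply: le_trans (hB _ hy) _; apply: le_trans (ltW hN).
  by rewrite /M -addrA lerDl addr_ge0// ltW.
have hc i : `|y ord0 i| < N%:R.
  apply: lt_trans hN; rewrite -(subrK (z ord0 i) (y ord0 i)).
  apply: le_lt_trans (ler_normD _ _) _; rewrite /M; apply: ltr_leD.
    by apply: lt_le_trans (hy i) _; rewrite lerDr.
  by rewrite (bigD1 i)//= lerDl; apply: sumr_ge0.
by move=> i; have := hc i; rewrite ltr_norml => /andP[-> /ltW].
Qed.

Lemma test_cI K (f : E -> R[i]) : compact K -> csmooth f -> vanishes_off K f -> cI mu f.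
Proof.
move=> cK [sRe sIm] f0.
have part (h : R[i] -> R) : h 0 = 0 -> smooth (fun x => h (f x)) -> rI mu (fun x => h (f x)).
  move=> h0 sh; have h_off x : ~ K x -> h (f x) = 0 by move=> /f0 ->.
  by have [/cI_Re] := schwartz_X (compact_schwartz cK sh h_off).
by apply: cI_ReIm; exact: part.
Qed.

Lemma symbol_test_cI K (f : E -> R[i]) : compact K -> K `<=` dilate2 U ->
  csmooth f -> vanishes_off K f -> cI mu (fun z => (symbol z)%:C * f z).
Proof.
move=> cK KU sf f0; have [N hN] := symbol_bounded cK KU.
have [mf If] := test_cI cK sf f0.
apply: (cI_le (rIZ N%:R If)); first by apply: cmeasM => //; apply: cmeasR; exact: measurable_symbol.
move=> z; rewrite cabsM cabsR; have [/hN[h _]|/f0 ->] := pselect (K z).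
  by rewrite ler_wpM2r// cabs_ge0.
by rewrite cabs0 !mulr0.
Qed.

Lemma symbol_distribution :
  distribution_on (dilate2 U) (fun g => ci mu (fun z => (symbol z)%:C * g z)).
Proof.
split=> [a f g [sf [K [cK KU f0]]] [sg [K' [cK' KU' g0]]]|K cK KU].
  rewrite -ci_lin; last 2 first.
  - exact: symbol_test_cI cK KU sf f0.
  - exact: symbol_test_cI cK' KU' sg g0.
  by apply: eq_ci => z; rewrite mulrDr mulrCA.
have [N hN] := symbol_bounded cK KU.
exists (N%:R * \int[mu]_x (1 * \1_(cube N) x)), 0%N => f M sf f0 fM.
have Ic := (@cube_dom R n N 1).1.
have If := symbol_test_cI cK KU sf f0.
apply: le_trans (cabs_ci If) _; rewrite mulrAC -rintZ//.
apply: rint_le; [exact: If.2|exact: rIZ|move=> z].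
have fz : cabs (f z) <= M by have := fM [::] z isT; rewrite /cpderiv /=; case: (f z).
have M0 : 0 <= M by exact: le_trans (cabs_ge0 _) fz.
rewrite cabsM cabsR mul1r; have [Kz|/f0 ->] := pselect (K z); last first.
  by rewrite cabs0 mulr0 !mulr_ge0// indicE.
have [h1 h2] := hN z Kz; rewrite indicE mem_set// mulr1.
by rewrite ler_pM// cabs_ge0.
Qed.

Variables (k0 : nat) (v : nat -> R).
Hypotheses (lens_vol : forall k j, rI mu (\1_(lens U (A k j) (r k)) : E -> R) /\
    \int[mu]_x (\1_(lens U (A k j) (r k)) x : R) <= v k)
  (lens_cube : forall k j, lens U (A k j) (r k) `<=` cube k0).

Definition mass k : R := c k * (2 * r k) ^+ n.

Hypotheses (mass_mono : forall k l, (k <= l)%N -> mass l <= mass k)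
  (mass_to0 : mass @ \oo --> (0 : R)).

Definition skernel (w : E * E) : R := \1_U w.1 * \1_U w.2 * symbol (w.1 + w.2).

Definition lenses k : set E := [set x | exists j, lens U (A k j) (r k) x].

Lemma measurable_lenses k : measurable (lenses k).
Proof.
rewrite (_ : lenses k = \bigcup_(j in [set: J k]) lens U (A k j) (r k)).
  by apply: open_measurable_rV; apply: bigcup_open => j _; exact: open_lens.
by apply/seteqP; split => x; [move=> [j hj]; exists j|move=> [j _ hj]; exists j].
Qed.

Lemma measurable_add_rV : measurable_fun setT (fun w : E * E => w.1 + w.2).
Proof.
apply: measurable_fun_rV => i; under eq_fun do rewrite mxE.
by apply: measurable_funD;
  [exact: (measurableT_comp (@measurable_coord R n i) measurable_fst)|
   exact: (measurableT_comp (@measurable_coord R n i) measurable_snd)].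
Qed.

Lemma measurable_skernel : measurable_fun setT skernel.
Proof.
have mU : measurable U by exact: open_measurable_rV.
have m1 : measurable_fun setT (\1_U : E -> R) by exact: measurable_indic.
apply: measurable_funM; first apply: measurable_funM.
- exact: (measurableT_comp m1 measurable_fst).
- exact: (measurableT_comp m1 measurable_snd).
- exact: (measurableT_comp measurable_symbol measurable_add_rV).
Qed.

Lemma skernel_sym x y : skernel (x, y) = skernel (y, x).
Proof. by rewrite /skernel /= [x + y]addrC; congr (_ * _); rewrite mulrC. Qed.

Lemma skernel_ne0 x y : skernel (x, y) <> 0 -> exists k j, [/\ U x, U y,
  sball (A k j) (r k) (x + y), lens U (A k j) (r k) x & lens U (A k j) (r k) y].
Proof.
rewrite /skernel /= !indicE => h.
have [Ux|nUx] := pselect (U x); last by case: h; rewrite memNset// mul0r mul0r.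
have [Uy|nUy] := pselect (U y); last by case: h; rewrite (memNset nUy) mulr0 mul0r.
have /symbol_ne0[k [j hj]] : symbol (x + y) <> 0 by move=> e; case: h; rewrite e mulr0.
by exists k, j; split => //; split => //; [exists y|exists x; rewrite // addrC].
Qed.

(** Near a point of a lens, the kernel only sees the bump of that lens. *)
Lemma skernel_lens k j x y : lens U (A k j) (r k) x -> skernel (x, y) <> 0 ->
  [/\ U x, U y, lens U (A k j) (r k) y & sball (A k j) (r k) (x + y)].
Proof.
move=> hx /skernel_ne0[k' [j' [Ux Uy b hx' hy]]].
have e := lens_level hx hx'; subst k'.
by have e := lens_index hx hx'; subst j'.
Qed.

Lemma skernel_level k x y : lenses k x -> U y -> skernel (x, y) = level k (x + y).
Proof.
move=> [j hx] Uy; have Ux := hx.1; rewrite /skernel /= !indicE !mem_set// !mul1r.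
have [[j' hj']|no] := pselect (exists j', sball (A k j') (r k) (x + y)).
  exact: symbol_ball hj'.
rewrite level_off => [|j' hj']; last by apply: no; exists j'.
apply: contrapT => /symbol_ne0[k' [j' hj']]; apply: no.
have hx' : lens U (A k' j') (r k') x by split => //; exists y.
by have e := lens_level hx hx'; subst k'; exists j'.
Qed.

Lemma skernel_bound k x y : lenses k x -> `|skernel (x, y)| <= c k.
Proof.
move=> Lx; have [->|/eqP/skernel_ne0[_ [_ [_ Uy _ _ _]]]] := eqVneq (skernel (x, y)) 0.
  by rewrite normr0 ltW.
by rewrite (skernel_level Lx Uy) level_bound.
Qed.

(** The row of x is supported in a translate of one ball. *)
Lemma skernel_mass k x : lenses k x ->
  rI mu (fun y => skernel (x, y)) /\ \int[mu]_y `|skernel (x, y)| <= mass k.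
Proof.
move=> Lx; have [j hx] := Lx.
pose bx := @ibox R n (fun i => A k j ord0 i - r k - x ord0 i) (fun i => A k j ord0 i + r k - x ord0 i).
have [[_ Ibx] _] := X_ibox (fun i => A k j ord0 i - r k - x ord0 i) (fun i => A k j ord0 i + r k - x ord0 i).
have I1 : rI mu (\1_bx : E -> R) by move: Ibx; under eq_fun do rewrite cabsR ger0_norm//.
have le y : `|skernel (x, y)| <= c k * \1_bx y.
  have [->|ne] := eqVneq (skernel (x, y)) 0; first by rewrite normr0 mulr_ge0 ?(ltW (c0 k))// indicE.
  have [_ _ _ hb] := skernel_lens hx (elimN eqP ne).
  rewrite indicE mem_set ?mulr1 ?skernel_bound// => i; have := hb i.
  rewrite mxE ltr_norml; move: (x ord0 i) (y ord0 i) (A k j ord0 i) (r k) => a b p q /andP[h1 h2].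
  by apply/andP; split; lra.
have mK : measurable_fun setT (fun y => skernel (x, y)).
  by apply: (measurableT_comp measurable_skernel); exact: measurable_pair1.
have IK := rI_le (rIZ (c k) I1) mK le; split => //.
apply: le_trans (rint_le (rI_norm IK) (rIZ (c k) I1) le) _.
rewrite rintZ// rint_ibox => [|i]; last first.
  by have := r0 k; move: (A k j ord0 i) (r k) (x ord0 i) => p q a q0; lra.
rewrite (eq_bigr (fun=> 2 * r k)); last by move=> i _; ring.
by rewrite prodr_const card_ord.
Qed.

Lemma lenses_vol k : rI mu (\1_(lenses k) : E -> R) /\
  \int[mu]_x (\1_(lenses k) x : R) <= #|J k|%:R * v k.
Proof.
have le x : \1_(lenses k) x <= \sum_j \1_(lens U (A k j) (r k)) x :> R.
  rewrite [leLHS]indicE; have [[j hj]|no] := pselect (lenses k x); last first.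
    by rewrite memNset//; apply: sumr_ge0 => j _; rewrite indicE.
  rewrite mem_set; last by exists j.
  rewrite (bigD1 j)//= indicE mem_set// lerDl; apply: sumr_ge0 => j' _; rewrite indicE//.
have Is : rI mu (fun x => \sum_j \1_(lens U (A k j) (r k)) x : R).
  by apply: rI_sum => j _; have [] := @lens_vol k j.
have IL : rI mu (\1_(lenses k) : E -> R).
  apply: (rI_le Is); first by apply: measurable_indic; exact: measurable_lenses.
  by move=> x; rewrite ger0_norm ?le// indicE.
split => //; apply: le_trans (rint_le IL Is le) _.
rewrite rint_sum => [|j _]; last by have [] := @lens_vol k j.
rewrite mulr_natl -sumr_const; apply: ler_sum => j _.
by have [] := @lens_vol k j.
Qed.

Lemma lenses_cube k : lenses k `<=` cube k0.
Proof. by move=> x [j]; exact: lens_cube. Qed.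

Lemma lenses_disjoint k l x : lenses k x -> lenses l x -> k = l.
Proof. by move=> [j hj] [j' hj']; exact: lens_level hj hj'. Qed.

Lemma level_lipschitz k : exists2 M, 0 <= M &
  forall x y, `|level k y - level k x| <= M * \sum_(i < n) `|y ord0 i - x ord0 i|.
Proof.
have /choice[M hM] : forall j, exists M, forall x y,
    `|cbump (A k j) (r k) y - cbump (A k j) (r k) x| <= M * \sum_(i < n) `|y ord0 i - x ord0 i|.
  move=> j; have cK : compact (sbox (A k j) (r k)) by exact: cube_compact.
  have [M _ hM] := compact_lipschitz cK (smooth_cbump (A k j) (r k))
    (fun x => cbump_sbox (p := A k j) (x := x) (r0 k)).
  by exists M.
exists (c k * \sum_j `|M j|); first by rewrite mulr_ge0 ?(ltW (c0 k))// sumr_ge0.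
move=> x y; rewrite /level -mulrBr -sumrB normrM (gtr0_norm (c0 k)) -mulrA ler_wpM2l ?(ltW (c0 k))//.
apply: le_trans (ler_norm_sum _ _ _) _; rewrite mulr_suml; apply: ler_sum => j _.
rewrite -mulrBr normrM eps1 mul1r; apply: le_trans (hM j x y) _.
by rewrite ler_wpM2r ?ler_norm// sumr_ge0.
Qed.

(** The level is Lipschitz and its lenses lie in a cube, so a fine net is enough. *)
Lemma lenses_totally_bounded k e : 0 < e -> exists s : seq E, forall y, lenses k y ->
  exists2 x, x \in s & nr mu (fun z => (skernel (y, z))%:C - (skernel (x, z))%:C) <= e.
Proof.
move=> e0; have [M M0 hM] := level_lipschitz k; have [IL _] := lenses_vol k.
have V0 : 0 <= \int[mu]_x (\1_(lenses k) x : R) by apply: rint_ge0 => x; rewrite indicE.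
pose Q := M * n%:R + \int[mu]_x (\1_(lenses k) x : R) + 1 + e^-1.
have Q1 : M * n%:R <= Q by rewrite /Q -!addrA lerDl !addr_ge0// invr_ge0 ltW.
have Q2 : \int[mu]_x (\1_(lenses k) x : R) <= Q.
  by rewrite /Q -!addrA addrCA lerDl !addr_ge0 ?invr_ge0 ?(ltW e0)// mulr_ge0.
have Q3 : e^-1 <= Q by rewrite /Q lerDr !addr_ge0// mulr_ge0.
have Q0 : 0 < Q by rewrite (lt_le_trans _ Q3)// invr_gt0.
have d0 : 0 < (Q ^+ 2)^-1 by rewrite invr_gt0 exprn_gt0.
have [s hs] := cube_net d0 (@lenses_cube k).
exists s => y Ly; have [x xs [Lx hxy]] := hs y Ly; exists x => //.
have mL := measurable_lenses k.
have le z : cabs ((skernel (y, z))%:C - (skernel (x, z))%:C) ^+ 2 <= (Q^-1) ^+ 2 * \1_(lenses k) z.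
  have -> : (skernel (y, z))%:C - (skernel (x, z))%:C = (skernel (y, z) - skernel (x, z))%:C.
    by rewrite rmorphB.
  rewrite cabsR; have [Lz|nLz] := pselect (lenses k z); last first.
    have off w : lenses k w -> skernel (w, z) = 0.
      move=> Lw; apply: contrapT => /skernel_ne0[k' [j' [_ _ _ hw hz]]]; apply: nLz.
      have kk : k' = k by apply: lenses_disjoint Lw; exists j'.
      by subst k'; exists j'.
    by rewrite !off// subrr normr0 expr0n mulr_ge0 ?indicE// sqr_ge0.
  have Uz : U z by case: Lz => j [].
  rewrite (skernel_level Ly Uz) (skernel_level Lx Uz) indicE mem_set// mulr1 lerXn2r ?nnegrE ?invr_ge0 ?(ltW Q0)//.
  apply: le_trans (hM _ _) _.
  apply: (@le_trans _ _ (M * \sum_(i < n) (Q ^+ 2)^-1)).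
    rewrite ler_wpM2l//; apply: ler_sum => i _; rewrite !mxE.
    by rewrite opprD addrACA subrr addr0.
  rewrite sumr_const card_ord -[_ *+ n]mulr_natl mulrA ler_pdivrMr ?exprn_gt0//.
  by rewrite expr2 mulrA mulVf ?gt_eqF// mul1r.
apply: le_trans (_ : \int[mu]_z ((Q^-1) ^+ 2 * \1_(lenses k) z) <= _).
  apply: rint_le => //; last exact: rIZ.
  apply: (rI_le (rIZ ((Q^-1) ^+ 2) IL)).
    apply: cmeas_sqr; apply: cmeasB; apply: cmeasR;
    by apply: (measurableT_comp measurable_skernel); exact: measurable_pair1.
  by move=> z; rewrite ger0_norm ?sqr_ge0.
rewrite rintZ//; apply: (@le_trans _ _ (Q^-1 ^+ 2 * Q)); first by rewrite ler_wpM2l// sqr_ge0.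
rewrite expr2 -mulrA mulVf ?gt_eqF// mulr1.
by rewrite -[leRHS]invrK lef_pV2 ?posrE ?invr_gt0.
Qed.

Lemma symbol_block_kernel :
  block_kernel skernel lenses mass c (fun k => #|J k|%:R * v k).
Proof.
split.
- by split; [exact: measurable_skernel|exact: skernel_sym].
- by split; [exact: measurable_lenses|exact: lenses_disjoint].
- move=> x y /skernel_ne0[k [j [_ _ _ hx hy]]]; exists k; by exists j.
- move=> k x Lx; have [h1 h2] := skernel_mass Lx.
  by split => // y; exact: skernel_bound.
split => //.
- by move=> k; rewrite /mass !mulr_ge0 ?exprn_ge0 ?mulr_ge0 ?(ltW (c0 k)) ?(ltW (r0 k)).
- exact: lenses_vol.
- exact: lenses_totally_bounded.
Qed.

Lemma symbol_hankel_schatten (p C : R) : 2 < p ->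
  (forall N, \sum_(k < N) mass k `^ (p - 2) * (c k * mass k * (#|J k|%:R * v k)) <= C) ->
  hankel_in_schatten p U (fun g => ci mu (fun z => (symbol z)%:C * g z)).
Proof.
move=> p2 hC; exists (pw_op skernel).
  apply: (pw_op_schatten symbol_block_kernel _ _ p2 hC).
  - by move=> k x [j []].
  - exact: lenses_cube.
apply: (pw_op_hankel symbol_block_kernel).
- exact: lenses_cube.
- exact: open_measurable_rV.
- exact: measurable_symbol.
- by [].
Qed.

End bump_series.

(** * The Fourier transform of a bump *)

Section theta_transform.
Context {R : realType}.

Lemma one_le_2pi : 1 <= 2 * pi :> R.
Proof. by have := @pi_ge2 R; lra. Qed.

Lemma arith_decay1 (a b p q : R) : a <= p -> b <= p -> 0 <= q -> a + b <= 2 * (p + q).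
Proof. by move=> *; lra. Qed.

Lemma arith_decay2 (a b m : R) : a <= 2 * m -> b <= 2 * m -> b + a <= 4 * m.
Proof. by move=> *; lra. Qed.

Local Notation leb := (@lebesgue_measure R).
Implicit Types (f g : R -> R) (t w : R).
Let I2 t : R := \1_(Iab (-2) 2) t.

(** Integration by parts; the boundary terms vanish. *)
Lemma parts_cos f g w : continuous f -> continuous g -> (forall t, is_derive t 1 f (g t)) ->
  f 2 = 0 -> f (-2) = 0 ->
  \int[leb]_t (I2 t * (g t * cos (w * t))) = w * \int[leb]_t (I2 t * (f t * sin (w * t))) /\
  \int[leb]_t (I2 t * (g t * sin (w * t))) = - w * \int[leb]_t (I2 t * (f t * cos (w * t))).
Proof.
move=> cf cg df f2 fm2.
have ctsM (u v : R -> R) : continuous u -> continuous v -> continuous (fun t : R => u t * v t : R).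
  by move=> cu cv t; apply: cvgM; [exact: cu|exact: cv].
have cc := @cts_cos_lin R w; have cs := @cts_sin_lin R w.
have I (u : R -> R) : continuous u -> rI leb (fun t => I2 t * u t) by exact: rI_ind_mul.
have m22 : -2 <= 2 :> R by lra.
have dc (t : R) : is_derive t 1 (fun t => cos (w * t)) (- w * sin (w * t)).
  by apply: der_eq (der_lin (der_cos _)) _; rewrite mulrN mulNr.
have ds (t : R) : is_derive t 1 (fun t => sin (w * t)) (w * cos (w * t)).
  exact: (der_lin (der_sin _)).
have key (u v : R -> R) : continuous u -> continuous v -> (forall t : R, is_derive t 1 u (v t)) ->
    \int[leb]_t (I2 t * (g t * u t)) = - \int[leb]_t (I2 t * (f t * v t)).
  move=> cu cv du; apply/eqP; rewrite -addr_eq0 -rintD; [|exact/I/ctsM|exact/I/ctsM].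
  have dF (t : R) : is_derive t 1 (fun t => f t * u t) (g t * u t + f t * v t) by exact: derM.
  have cF : continuous (fun t => g t * u t + f t * v t).
    by move=> t; apply: cvgD; [exact: ctsM|exact: ctsM].
  have := ftc_ind m22 cF dF; rewrite f2 fm2 !mul0r subr0 => e.
  by apply/eqP; rewrite -[RHS]e; congr Rintegral; apply/funext => t; rewrite mulrDr.
have Zc (a : R) (u : R -> R) : continuous u -> continuous (fun t => a * u t).
  by move=> cu; apply: ctsM => //; exact: cts_cst.
split.
  rewrite (key _ _ cc (Zc (- w) _ cs) dc) -rintZ; last exact/I/ctsM.
  rewrite -rintN; last by apply/I/ctsM => //; exact: Zc.
  by congr Rintegral; apply/funext => t; ring.
rewrite (key _ _ cs (Zc w _ cc) ds) -rintZ; last exact/I/ctsM.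
rewrite -rintN; last by apply/I/ctsM => //; exact: Zc.
by congr Rintegral; apply/funext => t; ring.
Qed.

Let dtheta := derive1 (@theta R).
Let ddtheta := derive1 dtheta.

Let s1 : smooth1 (@theta R). Proof. exact: smooth1_sbump. Qed.

Lemma dtheta2 : dtheta 2 = 0 /\ dtheta (-2) = 0.
Proof.
have off (a : R) : 1 < `|a| -> dtheta a = 0.
  move=> a1; rewrite /dtheta derive1E (near_eq_derive (g := fun=> 0)) ?derive_cst//.
  have : nbhs a [set z : R | 1 < `|z|].
    apply: open_nbhs_nbhs; split => //.
    apply: (open_comp (f := fun z : R => `|z|) (D := [set y | 1 < y])); last exact: open_gt.
    by move=> z _; exact: norm_continuous.
  by apply: filterS => z /ltW; exact: theta_off.
by split; apply: off; rewrite ?normrN ger0_norm// ltr1n.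
Qed.

Lemma theta2 : theta 2 = 0 :> R /\ theta (-2) = 0 :> R.
Proof. by split; apply: theta_off; rewrite ?normrN ger0_norm// ler1n. Qed.

Lemma theta_I2 t : I2 t * theta t = theta t.
Proof.
rewrite /I2 indIab; case: (boolP (-2 < t <= 2)) => [_|h]; first by rewrite mul1r.
rewrite theta_off ?mulr0// leNgt; apply/negP; rewrite ltr_norml => /andP[h1 h2].
by move/negP: h; apply; apply/andP; split; lra.
Qed.

Lemma cts_theta : continuous (@theta R). Proof. exact: smooth1_cts. Qed.

Lemma rI_theta : rI leb (fun t => theta t).
Proof.
by rewrite (_ : (fun t => theta t) = fun t => I2 t * theta t); [apply: rI_ind_mul; exact: cts_theta|apply/funext => t; rewrite theta_I2].
Qed.

(** Two integrations by parts give quadratic decay. *)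
Lemma ft1_theta_decay : exists C : R, forall x, cabs (ft1 (fun t => (theta t)%:C) x) <= C * (1 + x ^+ 2)^-1.
Proof.
have [d1 /smooth1_der[d2 s3]] := smooth1_der s1.
have c1 : continuous dtheta by apply: smooth1_cts; case: (smooth1_der s1).
have c2 : continuous ddtheta by apply: smooth1_cts.
have [t2 tm2] := theta2; have [dt2 dtm2] := dtheta2.
pose M := \int[leb]_t (I2 t * `|theta t|) + \int[leb]_t (I2 t * `|ddtheta t|).
have ca (u : R -> R) : continuous u -> continuous (fun t : R => `|u t| : R).
  by move=> cu t; apply: (@continuous_comp _ _ _ u (fun y => `|y|)); [exact: cu|exact: norm_continuous].
have bnd (u v : R -> R) : continuous u -> continuous v -> (forall t : R, `|v t| <= 1) ->
    `|\int[leb]_t (I2 t * (u t * v t))| <= \int[leb]_t (I2 t * `|u t|).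
  move=> cu cv v1.
  have cuv : continuous (fun t : R => u t * v t : R).
    by move=> t; apply: cvgM; [exact: cu|exact: cv].
  have Iuv := rI_ind_mul (-2) 2 cuv.
  apply: le_trans (rint_norm Iuv) _; apply: rint_le; first exact: rI_norm.
    by apply: rI_ind_mul; exact: ca.
  move=> t; rewrite normrM [in leLHS]ger0_norm; last by have /andP[] := ind_le1 (-2) 2 t.
  have /andP[i0 _] := ind_le1 (-2) 2 t; rewrite ler_wpM2l// normrM.
  by rewrite ler_piMr.
have cos1 w t : `|cos (w * t)| <= 1 :> R by rewrite ler_norml cos_geN1 cos_le1.
have sin1 w t : `|sin (w * t)| <= 1 :> R by rewrite ler_norml sin_geN1 sin_le1.
pose Ic u w := \int[leb]_t (I2 t * (u t * cos (w * t))).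
pose Is u w := \int[leb]_t (I2 t * (u t * sin (w * t))).
have ftE x : cabs (ft1 (fun t => (theta t)%:C) x) <= `|Ic (@theta R) (2 * pi * x)| + `|Is (@theta R) (2 * pi * x)|.
  have hRe : cRe (ft1 (fun t => (theta t)%:C) x) = Ic (@theta R) (2 * pi * x).
    rewrite /ft1 /ci /Ic /=; congr Rintegral; apply/funext => t /=.
    by rewrite mul0r subr0 cosN mulrA theta_I2.
  have hIm : cIm (ft1 (fun t => (theta t)%:C) x) = - Is (@theta R) (2 * pi * x).
    rewrite /Is -rintN; last first.
      by apply: rI_ind_mul => t; apply: cvgM; [exact: cts_theta|exact: cts_sin_lin].
    rewrite /ft1 /ci /=; congr Rintegral; apply/funext => t /=.
    by rewrite mul0r addr0 sinN mulrN [in RHS]mulrA theta_I2.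
  by apply: le_trans (cabs_le_ReIm _) _; rewrite hRe hIm normrN.
have A x : cabs (ft1 (fun t => (theta t)%:C) x) <= 2 * M.
  apply: le_trans (ftE x) _.
  have h1 := bnd _ _ cts_theta (@cts_cos_lin R (2 * pi * x)) (cos1 (2 * pi * x)).
  have h2 := bnd _ _ cts_theta (@cts_sin_lin R (2 * pi * x)) (sin1 (2 * pi * x)).
  have h3 : 0 <= \int[leb]_t (I2 t * `|ddtheta t|).
    by apply: rint_ge0 => t; have /andP[i0 _] := ind_le1 (-2) 2 t; rewrite mulr_ge0.
  exact: arith_decay1.
have B x : x ^+ 2 * cabs (ft1 (fun t => (theta t)%:C) x) <= 2 * M.
  set w := 2 * pi * x.
  have [e1 e2] := parts_cos w cts_theta c1 d1 t2 tm2.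
  have [e3 e4] := parts_cos w c1 c2 d2 dt2 dtm2.
  have h1 := bnd _ _ c2 (@cts_cos_lin R w) (cos1 w).
  have h2 := bnd _ _ c2 (@cts_sin_lin R w) (sin1 w).
  have h3 : 0 <= \int[leb]_t (I2 t * `|theta t|).
    by apply: rint_ge0 => t; have /andP[i0 _] := ind_le1 (-2) 2 t; rewrite mulr_ge0.
  rewrite e3 e2 mulNr mulrN mulrA normrN normrM in h1.
  rewrite e4 e1 mulrA normrM mulNr normrN in h2.
  have w2 : `|w * w| = w ^+ 2 by rewrite ger0_norm// -expr2 sqr_ge0.
  rewrite w2 in h1; rewrite w2 in h2.
  have xw : x ^+ 2 <= w ^+ 2.
    by rewrite /w exprMn ler_peMl ?sqr_ge0// exprn_ege1// one_le_2pi.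
  apply: le_trans (ler_wpM2l (sqr_ge0 x) (ftE x)) _; rewrite -/w.
  have q := normr_ge0 (Ic (@theta R) w); have q' := normr_ge0 (Is (@theta R) w).
  apply: (@le_trans _ _ (w ^+ 2 * (`|Ic (@theta R) w| + `|Is (@theta R) w|))).
    by rewrite ler_wpM2r// addr_ge0.
  by rewrite mulrDr /M addrC [X in 2 * X]addrC; exact: arith_decay1.
exists (4 * M) => x; rewrite ler_pdivlMr; last by rewrite ltr_pwDl// sqr_ge0.
by rewrite mulrDr mulr1 [_ * x ^+ 2]mulrC addrC; exact: arith_decay2 (A x) (B x).
Qed.

Lemma rI_ft1_theta : rI leb (fun x => cabs (ft1 (fun t => (theta t)%:C) x)).
Proof.
have [C hC] := ft1_theta_decay.
apply: (rI_le (rIZ C (@rI_oneDsqr R).1)); last by move=> x; rewrite ger0_norm ?cabs_ge0.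
by apply: cmeas_cabs; apply: cmeas_ft1; apply: cIR; exact: rI_theta.
Qed.

End theta_transform.

Section affine_integrals.
Context {R : realType}.
Local Notation leb := (@lebesgue_measure R).
Variables (s c : R).
Hypothesis s0 : 0 < s.
Let phi (t : measurableTypeR R) : measurableTypeR R := s * t + c.

Let mphi : measurable_fun setT phi.
Proof.
apply: continuous_measurable_fun => t; apply: cvgD; last exact: cvg_cst.
by apply: cvgM; [exact: cvg_cst|exact: cvg_id].
Qed.

Let sn : s != 0. Proof. by rewrite gt_eqF. Qed.
Let ss : 0 < `|s|. Proof. by rewrite normr_gt0. Qed.

Lemma rI_affine (f : R -> R) : @measurable_fun _ _ (measurableTypeR R) (measurableTypeR R) setT f ->
  rI leb f <-> rI leb (fun t => f (s * t + c)).
Proof. by move=> mf; have := rI_change_var mphi ss (lebesgue_affine c sn) mf. Qed.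

Lemma rint_affine (f : R -> R) : @measurable_fun _ _ (measurableTypeR R) (measurableTypeR R) setT f ->
  \int[leb]_t f t = s * \int[leb]_t f (s * t + c).
Proof.
by move=> mf; rewrite (rint_change_var mphi ss (lebesgue_affine c sn) mf) gtr0_norm.
Qed.

Lemma cI_affine (f : R -> R[i]) : @cmeas _ (measurableTypeR R) R f ->
  cI leb f <-> cI leb (fun t => f (s * t + c)).
Proof. by move=> mf; have := cI_change_var mphi ss (lebesgue_affine c sn) mf. Qed.

Lemma ci_affine (f : R -> R[i]) : @cmeas _ (measurableTypeR R) R f ->
  ci leb f = s%:C * ci leb (fun t => f (s * t + c)).
Proof.
by move=> mf; rewrite (ci_change_var mphi ss (lebesgue_affine c sn) mf) gtr0_norm.
Qed.

End affine_integrals.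

Section bump_transform.
Context {R : realType} {n : nat}.
Local Notation mu := (@lebesgue_rV R n).
Local Notation leb := (@lebesgue_measure R).
Local Notation E := 'rV[R]_n.
Implicit Types (p x y : E) (s : R).

Definition theta_hat : R -> R[i] := ft1 (fun t => (theta t)%:C).

Definition bump_hat s x : R := \prod_(i < n) (s * cabs (theta_hat (s * x ord0 i))).

Definition theta_hat_norm : R := \int[leb]_t cabs (theta_hat t).

Definition theta_norm2 : R := \int[leb]_t theta t ^+ 2.

Lemma cI_dilate (f : R -> R[i]) s : 0 < s -> cI leb f -> cI leb (fun t => f (s * t)).
Proof.
move=> s0 If; have := (@cI_affine R s 0 s0 f If.1).1 If.
by under eq_fun do rewrite addr0.
Qed.

Lemma ft1_dilate (f : R -> R[i]) s (x : R) : 0 < s -> cI leb f ->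
  ft1 (fun t => f (s^-1 * t)) x = s%:C * ft1 f (s * x).
Proof.
move=> s0 If; have si : 0 < s^-1 by rewrite invr_gt0.
rewrite /ft1 (@ci_affine R s 0 s0); last first.
  by apply: cmeasM; [have [] := cI_dilate si If|exact: cmeas_cis_lin].
congr (_ * _); apply: eq_ci => t /=; rewrite addr0 mulKf ?gt_eqF//.
by congr (_ * cis _); ring.
Qed.

Lemma cI_theta : cI leb (fun t => (theta t)%:C : R[i]).
Proof. by apply: cIR; exact: rI_theta. Qed.

Lemma cbump_shift p s x : cbump p s x = cbump 0 s (x - p).
Proof. by apply: eq_bigr => i _; rewrite !mxE; congr theta; ring. Qed.

Lemma X_cbump p s : 0 < s -> X (fun x => (cbump p s x)%:C).
Proof. by move=> s0; apply: schwartz_X; exact: schwartz_cbump. Qed.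

(** The transform of a translate only changes by a unimodular factor, so all bumps of one
   size have transforms of the same modulus. *)
Lemma fourier_cbump p s x : 0 < s -> fourier (fun y => (cbump p s y)%:C) x =
  cis (- (2 * pi * dotr x p)) * fourier (fun y => (cbump 0 s y)%:C) x.
Proof.
move=> s0; have [I0 _] := X_cbump 0 s0; have [Ip _] := X_cbump p s0.
rewrite /fourier -[cintegral _]/(ci mu _) -[cintegral _ in RHS]/(ci mu _).
rewrite -(ci_translate p) -?ciZ; last 2 first.
- by have [] := fourier_cI x I0.
- by have [] := fourier_cI x Ip.
apply: eq_ci => y; rewrite cbump_shift addrK mulrCA -cisD; congr (_ * cis _).
by rewrite dotrDr; ring.
Qed.

Lemma cabs_fourier_cbump s x : 0 < s ->
  cabs (fourier (fun y => (cbump 0 s y)%:C) x) = bump_hat s x.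
Proof.
move=> s0; have -> : (fun y => (cbump 0 s y)%:C) = tensor (fun (i : 'I_n) t => (theta (s^-1 * t))%:C).
  apply/funext => y; rewrite /tensor real_prod; congr (_%:C); apply: eq_bigr => i _.
  by rewrite mxE mulr0 oppr0 addr0.
have If : cI leb (fun t => (theta (s^-1 * t))%:C : R[i]).
  by apply: (cI_dilate (f := fun t => (theta t)%:C)); [rewrite invr_gt0|exact: cI_theta].
rewrite fourier_tensor// cabs_prod; apply: eq_bigr => i _.
by rewrite (@ft1_dilate (fun t => (theta t)%:C))// ?cabsM ?cabsR ?gtr0_norm//; exact: cI_theta.
Qed.

Lemma bump_hat_ge0 s x : 0 < s -> 0 <= bump_hat s x.
Proof. by move=> s0; apply: prodr_ge0 => i _; rewrite mulr_ge0 ?cabs_ge0// ltW. Qed.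

Lemma bump_hat_int s : 0 < s -> rI mu (bump_hat s) /\ \int[mu]_x bump_hat s x = theta_hat_norm ^+ n.
Proof.
move=> s0; have m0 := rI_meas (@rI_ft1_theta R).
have I1 : rI leb (fun t => s * cabs (theta_hat (s * t))).
  apply: rIZ; have := (@rI_affine R s 0 s0 _ m0).1 (@rI_ft1_theta R).
  by under eq_fun do rewrite addr0.
have [h1 h2] := @rint_tensor R n (fun _ t => s * cabs (theta_hat (s * t))) (fun=> I1).
split => //; rewrite h2 prodr_const card_ord /theta_hat_norm; congr (_ ^+ n).
rewrite (@rint_affine R s 0 s0 _ m0) -rintZ; last exact: (@rI_affine R s 0 s0 _ m0).1 (@rI_ft1_theta R).
by apply: congr1; apply/funext => t; rewrite addr0.
Qed.

Lemma cbump_norm2 p s : 0 < s -> rI mu (fun x => cbump p s x ^+ 2) /\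
  \int[mu]_x cbump p s x ^+ 2 = s ^+ n * theta_norm2 ^+ n.
Proof.
move=> s0; have [Ith _] := @theta_sqr_int R.
pose f (i : 'I_n) t := theta (s^-1 * t + - (s^-1 * p ord0 i)) ^+ 2 : R.
have mf i : @measurable_fun _ _ (measurableTypeR R) (measurableTypeR R) setT (f i).
  apply: measurable_funX; apply: continuous_measurable_fun; apply: smooth1_cts.
  exact: (smooth1_affine _ _ (smooth1_sbump _ _ _)).
have fE i t : f i (s * t + p ord0 i) = theta t ^+ 2.
  by rewrite /f; congr (theta _ ^+ 2); field; rewrite gt_eqF.
have If i : rI leb (f i).
  apply/(@rI_affine R s (p ord0 i) s0 _ (mf i)).
  by under eq_fun do rewrite fE.
have eE : (fun x : E => cbump p s x ^+ 2) = fun x => \prod_(i < n) f i (x ord0 i).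
  by apply/funext => x; rewrite /cbump /rtensor -prodrXl.
have [h1 h2] := rint_tensor If; rewrite eE; split => //; rewrite h2.
rewrite -exprMn -[in RHS](card_ord n) -prodr_const; apply: eq_bigr => i _.
rewrite (@rint_affine R s (p ord0 i) s0 _ (mf i)) /theta_norm2; congr (_ * _).
by apply: congr1; apply/funext => t; rewrite fE.
Qed.

(** Choosing the signs one after the other, the cross terms can be made nonpositive. *)
Lemma signs_nr (J : finType) (F : J -> E -> R[i]) : (forall j, L2 mu (F j)) ->
  exists2 eps : J -> R, (forall j, `|eps j| = 1) &
    nr mu (fun x => \sum_j (eps j)%:C * F j x) <= \sum_j nr mu (F j).
Proof.
move=> LF; suff : forall l : seq J, uniq l -> exists2 eps : J -> R, (forall j, `|eps j| = 1) &
    nr mu (fun x => \sum_(j <- l) (eps j)%:C * F j x) <= \sum_(j <- l) nr mu (F j).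
  by move=> /(_ (index_enum J) (index_enum_uniq J)).
elim=> [_|j l IH /= /andP[jl /IH[eps e1 he]]].
  exists (fun=> 1) => [_|]; first by rewrite normr1.
  rewrite big_nil (_ : (fun x => _) = fun=> 0) /nr; last by apply/funext => x; rewrite big_nil.
  by under eq_Rintegral do rewrite cabs0 expr0n; rewrite rint0.
pose S x := \sum_(j <- l) (eps j)%:C * F j x.
have LS : L2 mu S by apply: L2_sum => i _; exact: L2Z.
pose e : R := if 0 <= cRe (ip mu (F j) S) then -1 else 1.
have ea : `|e| = 1 by rewrite /e; case: ifP; rewrite ?normrN normr1.
exists (fun i => if i == j then e else eps i) => [i|]; first by case: ifP.
rewrite big_cons (_ : (fun x => _) = fun x => e%:C * F j x + S x); last first.
  apply/funext => x; rewrite big_cons eqxx; congr (_ + _); apply: eq_big_seq => i il.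
  by rewrite ifN//; apply: contraNneq jl => <-.
rewrite nr_lin// cabsR ea expr1n mul1r -addrA lerD2l.
apply: le_trans he; rewrite gerDl pmulr_rle0//.
rewrite cReM /= mul0r subr0 /e; case: ifPn; first by rewrite mulN1r oppr_le0.
by rewrite mul1r -ltNge => /ltW.
Qed.

(** All transforms have the same modulus, so an L^2 bound for a weighted sum gives the
   square root cancellation in L^1. *)
Lemma signs_fourier (J : finType) (a : J -> E) s : 0 < s ->
  exists2 eps : J -> R, (forall j, `|eps j| = 1) &
  (\int[mu]_x cabs (\sum_j (eps j)%:C * fourier (fun y => (cbump (a j) s y)%:C) x)) ^+ 2 <=
  #|J|%:R * (theta_hat_norm ^+ n) ^+ 2.
Proof.
move=> s0; have [Ih hE] := bump_hat_int s0.
pose q (x : E) : R[i] := (Num.sqrt (bump_hat s x))%:C.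
pose F (j : J) x := cis (- (2 * pi * dotr x (a j))) * q x.
have mh := rI_meas Ih.
have mq : cmeas q by apply: cmeasR; exact: (measurableT_comp (continuous_measurable_fun (@sqrt_continuous R)) mh).
have q2 x : cabs (q x) ^+ 2 = bump_hat s x.
  by rewrite /q cabsR ger0_norm ?sqrtr_ge0// sqr_sqrtr// bump_hat_ge0.
have Lq : L2 mu q by split => //; under eq_fun do rewrite q2.
have nq : nr mu q = theta_hat_norm ^+ n by rewrite -hE /nr; under eq_Rintegral do rewrite q2.
have mF j : cmeas (F j).
  apply: cmeasM => //; have := cmeas_cis_dotr1 (a j).
  by under eq_fun do rewrite dotrC.
have aF j x : cabs (F j x) = cabs (q x) by rewrite /F cabsM cis_cabs mul1r.
have LF j : L2 mu (F j).
  by split => //; under eq_fun do rewrite aF q2.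
have nF j : nr mu (F j) = theta_hat_norm ^+ n.
  by rewrite -nq /nr; under eq_Rintegral do rewrite aF.
have [eps e1 he] := signs_nr LF; exists eps => //.
pose S x := \sum_j (eps j)%:C * F j x.
have LS : L2 mu S by apply: L2_sum => i _; exact: L2Z.
have -> : \int[mu]_x cabs (\sum_j (eps j)%:C * fourier (fun y => (cbump (a j) s y)%:C) x) =
    \int[mu]_x (cabs (q x) * cabs (S x)).
  apply: congr1; apply/funext => x.
  under eq_bigr do rewrite fourier_cbump// mulrA.
  rewrite -mulr_suml cabsM cabs_fourier_cbump// -q2 /S.
  under [in RHS]eq_bigr do rewrite /F mulrA.
  by rewrite -mulr_suml cabsM expr2; ring.
apply: le_trans (cauchy_schwarz_abs Lq LS) _; rewrite nq expr2 mulrCA.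
apply: ler_wpM2l; first by apply: exprn_ge0; apply: rint_ge0 => t; exact: cabs_ge0.
apply: le_trans he _; rewrite (eq_bigr (fun=> theta_hat_norm ^+ n)) => [|j _]; last exact: nF.
by rewrite sumr_const mulr_natl.
Qed.

End bump_transform.

(** * The symbol is unbounded *)

Section unbounded_symbol.
Context {R : realType} {n : nat}.
Local Notation mu := (@lebesgue_rV R n).
Local Notation E := 'rV[R]_n.

Lemma bounded_ae (psi : E -> R[i]) : Lp +oo%E psi ->
  cmeas psi /\ exists2 B : R, 0 <= B & {ae mu, forall x, cabs (psi x) <= B}.
Proof.
move=> [mRe mIm]; rewrite /Lp_norm unlock; case: ifPn => [_ sup|mu0 _]; split => //.
  have := ess_sup_inf.ess_sup_ge mu (abse \o (fun x => (cabs (psi x))%:E)).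
  move: sup; case: (ess_sup_inf.ess_sup _ _) => [r _ h|//|_ h].
    exists `|r| => //; apply: filterS h => x /=; rewrite lee_fin ger0_norm ?cabs_ge0//.
    by move=> h; exact: le_trans h (ler_norm _).
  by exists 0 => //; apply: filterS h => x /=.
exists 0 => //; exists setT; split => //=.
by apply/eqP; rewrite eq_le measure_ge0 andbT leNgt.
Qed.

(** psi is replaced by 0 on the null set where the bound fails. *)
Lemma bounded_pairing (psi : E -> R[i]) (B : R) g : cmeas psi -> 0 <= B ->
  {ae mu, forall x, cabs (psi x) <= B} -> cI mu (fourier g) ->
  cabs (ci mu (fun x => psi x * fourier g x)) <= B * \int[mu]_x cabs (fourier g x).
Proof.
move=> mpsi B0 hB Ig; pose A := [set x | cabs (psi x) <= B].
have mA : measurable A.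
  have := cmeas_cabs mpsi measurableT (measurable_itv `]-oo, B]).
  by rewrite setTI set_itvE.
have mc : cmeas (fun x => ic A x * psi x) by apply: cmeasM => //; exact: cmeas_ic.
have -> : ci mu (fun x => psi x * fourier g x) = ci mu (fun x => ic A x * psi x * fourier g x).
  apply: ci_ae; [exact: cmeasM Ig.1|exact: cmeasM Ig.1|].
  by apply: filterS hB => x hx; rewrite /ic indicE mem_set// mul1r.
have le x : cabs (ic A x * psi x * fourier g x) <= B * cabs (fourier g x).
  rewrite cabsM ler_wpM2r ?cabs_ge0//.
  by have [[Ax ->]|[_ ->]] := ic01 A x; rewrite ?mul1r// mul0r cabs0.
have I1 := cI_le (rIZ B Ig.2) (cmeasM mc Ig.1) le.
by apply: le_trans (cabs_ci I1) _; rewrite -rintZ; [apply: rint_le => //; [exact: I1.2|exact: rIZ Ig.2]|exact: Ig.2].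
Qed.

Variables (U : set E) (J : nat -> finType) (A : forall k, J k -> E) (r c t : nat -> R)
  (eps : forall k, J k -> R).
Arguments A : clear implicits.
Arguments eps : clear implicits.
Hypotheses (oU : open U) (r0 : forall k, 0 < r k) (c0 : forall k, 0 < c k)
  (AU : forall k j, sball (A k j) (2 * r k) `<=` dilate2 U)
  (lens_level : forall k j k' j' x,
    lens U (A k j) (r k) x -> lens U (A k' j') (r k') x -> k = k')
  (lens_index : forall k j j' x,
    lens U (A k j) (r k) x -> lens U (A k j') (r k) x -> j = j')
  (eps1 : forall k j, `|eps k j| = 1)
  (signs : forall k, (\int[mu]_x cabs (\sum_j (eps k j)%:C *
      fourier (fun y => (cbump (A k j) (r k) y)%:C) x)) ^+ 2 <=
    #|J k|%:R * (@theta_hat_norm R ^+ n) ^+ 2)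
  (large : forall M, exists k, M < (c k * r k ^+ n) ^+ 2 * #|J k|%:R).

Let phi := symbol A r c eps.
Let g k x : R[i] := \sum_j (eps k j)%:C * (cbump (A k j) (r k) x)%:C.

Lemma test_g k : test_function (dilate2 U) (g k).
Proof.
have gE x : g k x = (\sum_j eps k j * cbump (A k j) (r k) x)%:C.
  by rewrite rmorph_sum; apply: eq_bigr => j _; rewrite rmorphM.
split.
  rewrite (_ : g k = fun x => (\sum_j eps k j * cbump (A k j) (r k) x)%:C); last exact/funext.
  by apply: csmooth_real; apply: smooth_sum => j; exact: smooth_cbump.
exists (\bigcup_(j in [set: J k]) sbox (A k j) (r k)); split.
- rewrite -bigsetU_fset_set; last exact: finite_finset.
  rewrite big_seq; elim/big_ind : _ => [|X Y|j _]; [exact: compact0|exact: compactU|].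
  exact: cube_compact.
- by move=> x [j _ /(sbox_sball (r0 k))]; exact: AU.
- move=> x nx; rewrite /g big1// => j _; rewrite cbump_sbox ?mulr0// => hx; apply: nx.
  by exists j.
Qed.

(** The bumps are disjointly supported, so only squares of bumps occur and the signs
   cancel. *)
Lemma pairing_g k : ci mu (fun x => (phi x)%:C * g k x) =
  (c k * (#|J k|%:R * (r k ^+ n * @theta_norm2 R ^+ n)))%:C.
Proof.
have pE x : (phi x)%:C * g k x = (c k * \sum_j cbump (A k j) (r k) x ^+ 2)%:C.
  have [[j hj]|no] := pselect (exists j, sball (A k j) (r k) x); last first.
    rewrite /g big1 => [|j _]; last by rewrite cbump_off ?mulr0// => hj; apply: no; exists j.
    rewrite big1 ?mulr0// => j _; rewrite cbump_off ?expr0n// => hj; apply: no; exists j => //.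
  rewrite /phi (symbol_ball c eps r0 AU lens_level hj) (level_ball c eps r0 AU lens_index hj).
  have off i : i != j -> cbump (A k i) (r k) x = 0.
    move=> ij; rewrite cbump_off// => hi; move/negP: ij; apply; apply/eqP.
    exact: sball_index r0 AU lens_index _ _ _ _ hi hj.
  rewrite /g (bigD1 j)//= big1 ?addr0 => [|i /off ->]; last by rewrite mulr0.
  rewrite (bigD1 j)//= big1 ?addr0 => [|i /off ->]; last by rewrite expr0n.
  rewrite -!rmorphM; congr (_%:C).
  rewrite -mulrA mulrACA -!expr2.
  by rewrite -[eps k j ^+ 2]real_normK ?num_real// eps1 expr1n mul1r.
under eq_fun do rewrite pE.
rewrite ciR rintZ; last by apply: rI_sum => j _; have [] := cbump_norm2 (A k j) (r0 k).
rewrite rint_sum => [|j _]; last by have [] := cbump_norm2 (A k j) (r0 k).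
rewrite (eq_bigr (fun=> r k ^+ n * @theta_norm2 R ^+ n)) => [|j _]; last first.
  by have [] := cbump_norm2 (A k j) (r0 k).
by rewrite sumr_const mulr_natl.
Qed.

Lemma fourier_g k x : fourier (g k) x =
  \sum_j (eps k j)%:C * fourier (fun y => (cbump (A k j) (r k) y)%:C) x.
Proof.
have I j : cI mu (fun y => (cbump (A k j) (r k) y)%:C * cis (- (2 * pi * dotr x y))).
  by apply: fourier_cI; have [] := X_cbump (A k j) (r0 k).
rewrite /fourier -[cintegral _]/(ci mu _).
under eq_bigr => j _ do rewrite -[cintegral _]/(ci mu _) -ciZ//.
rewrite -ci_sum => [|j _]; last exact: cIZ.
by apply: eq_ci => y; rewrite mulr_suml; apply: eq_bigr => j _; rewrite mulrA.
Qed.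

Lemma fourier_g_cI k : cI mu (fourier (g k)).
Proof.
have e : fourier (g k) = fun x => \sum_j (eps k j)%:C * fourier (fun y => (cbump (A k j) (r k) y)%:C) x.
  by apply/funext => x; exact: fourier_g.
rewrite e; apply: cI_sum => j _; apply: cIZ; have s0 := r0 k.
split; first by apply: cmeas_fourier; have [[]] := X_cbump (A k j) s0.
rewrite (_ : (fun x => _) = bump_hat (r k)); first by have [] := @bump_hat_int R n _ s0.
by apply/funext => x; rewrite fourier_cbump// cabsM cis_cabs mul1r cabs_fourier_cbump.
Qed.

(** A bounded symbol pairs with g k at most like the L^1 norm of the transform of g k, which
   the choice of signs makes smaller than the sum of the norms by the square root of the
   number of bumps. *)
Lemma symbol_unbounded : ~ admits_bounded_symbol U (fun g => ci mu (fun z => (phi z)%:C * g z)).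
Proof.
move=> [psi /bounded_ae[mpsi [B B0 hB]] hpsi].
have t0 : 0 < @theta_norm2 R by have [] := @theta_sqr_int R.
pose M := (B * @theta_hat_norm R ^+ n) ^+ 2 / (@theta_norm2 R ^+ n) ^+ 2.
have [k hk] := large M.
have M0 : 0 <= M by rewrite divr_ge0// sqr_ge0.
have N0 : 0 < #|J k|%:R :> R.
  by rewrite lt_neqAle eq_sym ler0n andbT; apply: contraTneq hk => ->; rewrite mulr0 -leNgt.
have key := bounded_pairing mpsi B0 hB (fourier_g_cI k).
have e : ci mu (fun x => psi x * fourier (g k) x) = ci mu (fun x => (phi x)%:C * g k x).
  exact: hpsi (test_g k).
have p0 : 0 <= c k * (#|J k|%:R * (r k ^+ n * @theta_norm2 R ^+ n)).
  by rewrite !mulr_ge0 ?exprn_ge0 ?(ltW (c0 k)) ?(ltW (r0 k))//; apply: rint_ge0 => y; exact: sqr_ge0.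
rewrite e pairing_g cabsR (ger0_norm p0) in key.
have key2 : (c k * (#|J k|%:R * (r k ^+ n * @theta_norm2 R ^+ n))) ^+ 2 <=
    B ^+ 2 * (#|J k|%:R * (@theta_hat_norm R ^+ n) ^+ 2).
  apply: (@le_trans _ _ ((B * \int[mu]_x cabs (fourier (g k) x)) ^+ 2)).
    by rewrite lerXn2r ?nnegrE ?(le_trans p0 key).
  rewrite exprMn ler_wpM2l ?sqr_ge0//; apply: le_trans (signs k).
  by under eq_Rintegral do rewrite fourier_g.
rewrite /M ltr_pdivrMr ?exprn_gt0// in hk.
suff h : (c k * r k ^+ n) ^+ 2 * #|J k|%:R * (@theta_norm2 R ^+ n) ^+ 2 <= (B * @theta_hat_norm R ^+ n) ^+ 2.
  by rewrite ltNge h in hk.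
rewrite -(ler_pM2l N0); apply: le_trans (le_trans _ key2) _; apply: le_of_eq; ring.
Qed.

End unbounded_symbol.

(** * The counterexample *)

Section parameters.
Context {R : realType}.

Lemma level_gap (x x' w w' B : R) : 0 < x -> x' <= x / 2 -> x / 2 <= w -> w' <= x' * (3 / 4) ->
  `|w - w'| <= B -> B <= x / 16 -> False.
Proof. by move=> x0 h1 h2 h3 h4 h5; have := le_trans (ler_norm _) (le_trans h4 h5) => h; lra. Qed.

Lemma index_gap (x M B : R) (i j : nat) : 0 < x -> 0 < M -> i != j ->
  `|x * (2^-1 + i%:R / (4 * M)) - x * (2^-1 + j%:R / (4 * M))| <= B -> B <= x / (16 * M) -> False.
Proof.
move=> x0 M0 ij h1 h2.
have e : x * (2^-1 + i%:R / (4 * M)) - x * (2^-1 + j%:R / (4 * M)) = (i%:R - j%:R) * (x / (4 * M)).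
  by field; rewrite gt_eqF.
have q0 : 0 < x / (4 * M) by rewrite divr_gt0// mulr_gt0.
have d1 : 1 <= `|i%:R - j%:R| :> R.
  have [ij'|ji|e'] := ltngtP i j; last by move: ij; rewrite e' eqxx.
    by rewrite distrC -natrB ?(ltnW ij')// normr_nat ler1n subn_gt0.
  by rewrite -natrB ?(ltnW ji)// normr_nat ler1n subn_gt0.
have h3 : x / (4 * M) <= x / (16 * M).
  apply: le_trans (le_trans _ h1) h2; rewrite e normrM (gtr0_norm q0).
  by rewrite ler_peMl// ltW.
have e2 : x / (16 * M) = x / (4 * M) / 4 by field; rewrite gt_eqF.
by move: h3; rewrite e2; move: (x / (4 * M)) q0 => y y0; lra.
Qed.

(** Since p > 4, the exponents l m (p - 4) are unbounded as l grows. *)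
Lemma choose_exponent (m : nat) (p : R) : (0 < m)%N -> 4 < p -> exists l : nat,
  (2 <= l)%N /\ p + 1 + m%:R <= (l * m)%:R * (p - 4).
Proof.
move=> m0 p4; have p40 : 0 < p - 4 by rewrite subr_gt0.
pose x := (p + 1 + m%:R) / (p - 4).
have m0' : 0 <= m%:R :> R by [].
have x1 : 1 <= x by rewrite ler_pdivlMr// mul1r; lra.
have /truncn_itv/andP[_ x2] : 0 <= x by exact: le_trans x1.
exists (Num.trunc x).+1; split.
  by rewrite ltnS truncn_ge_nat// (le_trans ler01).
have l1 : x <= ((Num.trunc x).+1 * m)%:R.
  by apply: le_trans (ltW x2) _; rewrite ler_nat leq_pmulr.
by move: l1; rewrite ler_pdivrMr.
Qed.

Lemma geometric_sum (N : nat) : \sum_(k < N) 2^-1 ^+ k <= 2 :> R.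
Proof.
suff -> : \sum_(k < N) 2^-1 ^+ k = 2 - 2 * 2^-1 ^+ N :> R.
  by rewrite gerBl mulr_ge0// exprn_ge0// invr_ge0.
elim: N => [|N IH]; first by rewrite big_ord0 expr0; ring.
by rewrite big_ord_recr /= IH exprS; field.
Qed.

(** The ratio of the Schatten sums of consecutive levels: the terms with l m gain
   l m (p - 4), against the loss p + m. *)
Lemma pow_half (l m : nat) (p : R) : p + 1 + m%:R <= (l * m)%:R * (p - 4) ->
  (2 `^ (1 - (l * m)%:R)) `^ p * ((2 ^+ (2 * l)) ^+ m) ^+ 2 * 2 ^+ m <= 2^-1 :> R.
Proof.
move=> h; rewrite -!exprM -!powR_mulrn// -powRrM -!powRD ?pnatr_eq0 ?implybT//.
rewrite -[leRHS]powR_inv1//; apply: ler_powR; first by rewrite ler1n.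
have -> : (2 * l * (m * 2))%:R = 4 * (l * m)%:R :> R by rewrite !natrM; ring.
by move: (l * m)%:R (m%:R) h => a b h; lra.
Qed.

Lemma powR_expr (q p : R) k : 0 <= q -> (q ^+ k) `^ p = (q `^ p) ^+ k.
Proof.
by move=> q0; rewrite -(powR_mulrn k q0) -powRrM mulrC powRrM powR_mulrn// powR_ge0.
Qed.

Lemma quarter_half (q : R) l m : (2 <= l * m)%N -> q = 2 `^ (1 - (l * m)%:R) -> 0 < q <= 2^-1.
Proof.
move=> lm ->; rewrite powR_gt0//= -[leRHS]powR_inv1//; apply: ler_powR; first by rewrite ler1n.
by move: lm; rewrite -(ler_nat R) => lm; lra.
Qed.

(** All quantities are geometric in k. Collecting the ratios leaves the k-th power of the
   number that pow_half bounds by one half. *)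
Lemma schatten_term (q p b B sg ka K : R) (n m : nat) k : (m.+1 = n)%N ->
  0 < q -> 0 < sg -> 0 < ka -> 0 < B -> b = 2^-1 / B ->
  let s := sg * b ^+ k in let c := q ^+ k / (ka * s ^+ 2) ^+ n in
  let D := 2 ^+ n * q ^+ k in
  D `^ (p - 2) * (c * D * ((B ^+ k) ^+ m * (K * s ^+ n.+1))) =
  (2 ^+ n) `^ (p - 2) * (2 ^+ n * K / (ka ^+ n * sg ^+ m)) *
  (q `^ p * (B ^+ m) ^+ 2 * 2 ^+ m) ^+ k.
Proof.
move=> mn q0 sg0 ka0 B0 bE s c D.
have b0 : 0 < b by rewrite bE divr_gt0// invr_gt0.
have s0 : 0 < s by rewrite mulr_gt0// exprn_gt0.
have q2 : q `^ p = q `^ (p - 2) * q ^+ 2.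
  by rewrite -[q ^+ 2]powR_mulrn ?(ltW q0)// -powRD ?subrK// (gt_eqF q0) implybT.
have zE : (q `^ p * (B ^+ m) ^+ 2 * 2 ^+ m) ^+ k =
    (q `^ (p - 2)) ^+ k * (q ^+ k) ^+ 2 * ((B ^+ k) ^+ m) ^+ 2 * (2 ^+ m) ^+ k.
  by rewrite q2 !(exprMn, exprAC _ k); congr (_ * _ * _ * _); rewrite -!exprM; congr (_ ^+ _); lia.
have sm : s ^+ m * ((B ^+ k) ^+ m * (2 ^+ m) ^+ k) = sg ^+ m.
  rewrite /s exprMn [(2 ^+ m) ^+ k]exprAC -!exprMn -mulrA -!exprMn.
  have -> : b * (B * 2) = 1 by rewrite bE; field; rewrite gt_eqF.
  by rewrite expr1n mulr1.
rewrite zE /D powRM ?exprn_ge0 ?(ltW q0)// (@powR_expr q _ k (ltW q0)) -sm.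
have sE : s ^+ n.+1 * s ^+ m = (s ^+ 2) ^+ n by rewrite -exprD -exprM; congr (_ ^+ _); lia.
rewrite /c exprMn -sE.
have s1 : s ^+ n.+1 != 0 by rewrite expf_neq0// gt_eqF.
have s2 : s ^+ m != 0 by rewrite expf_neq0// gt_eqF.
have s3 : ka ^+ n != 0 by rewrite expf_neq0// gt_eqF.
have s4 : (B ^+ k) ^+ m != 0 by rewrite !expf_neq0// gt_eqF.
have s5 : (2 ^+ m) ^+ k != 0 :> R by rewrite !expf_neq0// pnatr_eq0.
move: ((2 ^+ n) `^ (p - 2)) ((q `^ (p - 2)) ^+ k) => x8 x9.
move: (s ^+ n.+1) (s ^+ m) (ka ^+ n) ((B ^+ k) ^+ m) ((2 ^+ m) ^+ k) (q ^+ k) (2 ^+ n) s1 s2 s3 s4 s5.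
by move=> x1 x2 x3 x4 x5 x6 x7 h1 h2 h3 h4 h5; field; rewrite h1 h2 h3 h4 h5.
Qed.

Lemma square_count (q : R) l m k : q = 2 `^ (1 - (l * m)%:R) ->
  (q ^+ k) ^+ 2 * ((2 ^+ (2 * l)) ^+ k) ^+ m = 2 ^+ (2 * k).
Proof.
move=> qE; have q2 : q * 2 ^+ (l * m) = 2.
  by rewrite qE -powR_mulrn// -powRD ?pnatr_eq0 ?implybT// subrK powRr1.
rewrite -!exprM (_ : 2 * l * (k * m) = l * m * (2 * k))%N; last by lia.
by rewrite [(k * 2)%N]mulnC exprM [2 ^+ (l * m * _)]exprM -exprM -exprMn q2.
Qed.

Lemma pow_cvg0 (C q : R) : 0 < q <= 2^-1 -> (fun k : nat => C * q ^+ k) @ \oo --> (0 : R).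
Proof.
move=> /andP[q0 q1]; rewrite -[X in _ --> X](mulr0 C); apply: cvgMr; apply: cvg_expr.
by rewrite gtr0_norm// (le_lt_trans q1)// invf_lt1// ltr1n.
Qed.

Lemma pow4_large (M : R) : exists k : nat, M < 2 ^+ (2 * k).
Proof.
exists (Num.trunc `|M|).+1.
have /truncn_itv/andP[_ h] : 0 <= `|M| by [].
apply: le_lt_trans (ler_norm M) _; apply: lt_le_trans h _.
rewrite -natrX ler_nat; apply: leq_trans (ltnW (ltn_expl _ (ltnSn 1))) _.
by rewrite leq_exp2l// leq_pmull.
Qed.

End parameters.

Section construction.
Context {R : realType} {m n : nat}.
Local Notation E := 'rV[R]_n.
Local Notation mu := (@lebesgue_rV R n).

(** Level k has N = 2^(2 l k m) lenses of width s of order 2^(-k) N^(-1/m), and amplitude c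
   such that the mass c r^n of a bump is d = 2^k / sqrt N. Lenses of one level are disjoint
   because the coordinates w are spaced by much more than s; lenses of different levels are
   disjoint because on level k the coordinates are of order 2^(-k), and s is much smaller.
   The Schatten sum converges geometrically because p > 4, while d sqrt N = 2^k, which a
   bounded symbol would bound, is unbounded. *)
Lemma lens_family_counterexample (U : set E) (a : 'rV[R]_m -> R -> E) (dl s0 ka K p : R) k0 :
  (m.+1 = n)%N -> (0 < m)%N -> open U -> lens_family U a dl s0 ka K k0 -> 4 < p ->
  exists phihat : (E -> R[i]) -> R[i],
    [/\ distribution_on (dilate2 U) phihat, hankel_in_schatten p U phihat &
        ~ admits_bounded_symbol U phihat].
Proof.
move=> mn m0 oU [dl0 s00 ka0 K0 LF] p4.
have [l [l2 hl]] := choose_exponent m0 p4.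
have lm2 : (2 <= l * m)%N by rewrite (leq_trans l2)// leq_pmulr.
have [q qE] : {q | q = 2 `^ (1 - (l * m)%:R) :> R} by eexists.
have q12 := quarter_half lm2 qE; have /andP[q0 q1] := q12.
(* 32 K sg <= dl: the widths are small against the spacing of the coordinates. *)
have [sg sgE] : {sg | sg = Num.min s0 (dl / (32 * K))} by eexists.
have sg0 : 0 < sg by rewrite sgE lt_min s00 divr_gt0// mulr_gt0.
have sgs : sg <= s0 by rewrite sgE ge_min lexx.
have sgK : K * sg <= dl / 32.
  have : sg <= dl / (32 * K) by rewrite sgE ge_min lexx orbT.
  rewrite -(ler_pM2l K0) => h; apply: le_trans h _.
  by apply: le_of_eq; field; rewrite gt_eqF.
have [B BE] : {B | B = 2 ^+ (2 * l) :> R} by eexists.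
have B0 : 0 < B by rewrite BE exprn_gt0.
have [b bE] : {b | b = 2^-1 / B} by eexists.
have b0 : 0 < b by rewrite bE divr_gt0// invr_gt0.
have B1 : 1 <= B by rewrite BE exprn_ege1// ler1n.
have b1 : b <= 2^-1 by rewrite bE ler_pdivrMr// ler_peMr// invr_ge0.
have b12 : 0 < b <= 2^-1 by rewrite b0.
pose M k := (2 ^ (2 * l * k))%N.
have ME k : (M k)%:R = B ^+ k :> R by rewrite /M natrX BE -exprM.
have Mp k : 0 < (M k)%:R :> R by rewrite ME exprn_gt0.
pose J k : finType := {ffun 'I_m -> 'I_(M k)}.
pose s k := sg * b ^+ k.
have sE k : s k = sg * (2^-1 ^+ k / (M k)%:R) by rewrite /s bE expr_div_n ME.
have sp k : 0 < s k by rewrite mulr_gt0// exprn_gt0.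
have ss k : s k <= s0.
  apply: le_trans sgs; rewrite ler_piMr ?(ltW sg0)// exprn_ile1// ?(ltW b0)//.
  by apply: le_trans b1 _; rewrite invf_le1// ler1n.
(* On level k the coordinates lie between dl 2^-k / 2 and 3/4 of dl 2^-k, on a grid of step
   dl 2^-k / (4 M k). *)
pose w k (j : J k) : 'rV[R]_m := \row_i (dl * 2^-1 ^+ k * (2^-1 + (j i : nat)%:R / (4 * (M k)%:R))).
have half0 k : 0 < 2^-1 ^+ k :> R by rewrite exprn_gt0// invr_gt0.
have half1 k : 2^-1 ^+ k <= 1 :> R by rewrite exprn_ile1 ?invr_ge0// invf_le1// ler1n.
have w_lo k (j : J k) i : dl * 2^-1 ^+ k / 2 <= w k j ord0 i.
  rewrite mxE ler_wpM2l ?mulr_ge0 ?(ltW dl0) ?(ltW (half0 k))// lerDl.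
  by rewrite divr_ge0// mulr_ge0// ltW.
have w_hi k (j : J k) i : w k j ord0 i <= dl * 2^-1 ^+ k * (3 / 4).
  rewrite mxE ler_wpM2l ?mulr_ge0 ?(ltW dl0) ?(ltW (half0 k))//.
  have : (j i : nat)%:R / (4 * (M k)%:R) <= 4^-1 :> R.
    rewrite invfM mulrCA ler_piMr ?invr_ge0// ler_pdivrMr// mul1r ler_nat.
    exact: ltnW (ltn_ord _).
  by move=> h; lra.
have wdl k (j : J k) i : `|w k j ord0 i| <= dl.
  have x0 : 0 < dl * 2^-1 ^+ k by rewrite mulr_gt0.
  have x1 : dl * 2^-1 ^+ k <= dl by rewrite ler_piMr// ltW.
  rewrite ger0_norm; last by apply: le_trans (w_lo k j i); rewrite divr_ge0// ltW.
  by apply: le_trans (w_hi k j i) _; apply: le_trans x1; rewrite ler_piMr ?(ltW x0)//; lra.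
pose A k (j : J k) := a (w k j) (s k).
pose r k := ka * s k ^+ 2.
have r0 k : 0 < r k by rewrite mulr_gt0// exprn_gt0.
pose c k := q ^+ k / r k ^+ n.
have c0 k : 0 < c k by rewrite divr_gt0// exprn_gt0.
have LFk k j := LF (w k j) (s k) (wdl k j) (sp k) (ss k).
have AU k j : sball (A k j) (2 * r k) `<=` dilate2 U.
  by rewrite /r mulrA; case: (LFk k j).
have sK k : K * s k <= dl * 2^-1 ^+ k / (32 * (M k)%:R).
  rewrite sE mulrA; apply: (@le_trans _ _ (dl / 32 * (2^-1 ^+ k / (M k)%:R))).
    by rewrite ler_wpM2r// divr_ge0 ?(ltW (Mp k))// ltW.
  by apply: le_of_eq; field; rewrite gt_eqF.
have M1 k : 1 <= (M k)%:R :> R by rewrite ler1n expn_gt0.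
have lens_gap k (j : J k) k' (j' : J k') x : (k < k')%N ->
    lens U (A k j) (r k) x -> lens U (A k' j') (r k') x -> False.
  move=> kk' hx hx'; have [_ _ _ _ meet] := LFk k j.
  have h := meet _ _ x (wdl k' j') (sp k') (ss k') hx hx' (Ordinal m0).
  move: h; rewrite !mxE => h.
  have x0 : 0 < dl * 2^-1 ^+ k by rewrite mulr_gt0.
  have xx : dl * 2^-1 ^+ k' <= dl * 2^-1 ^+ k / 2.
    rewrite -mulrA ler_wpM2l ?(ltW dl0)// -exprSr.
    by apply: ler_wiXn2l; rewrite ?invr_ge0// invf_le1// ler1n.
  have s1 i : K * s i <= dl * 2^-1 ^+ i / 32.
    apply: le_trans (sK i) _; rewrite ler_wpM2l ?mulr_ge0 ?(ltW dl0) ?(ltW (half0 i))//.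
    by rewrite lef_pV2 ?posrE ?mulr_gt0// ler_peMr.
  have l1 := w_lo k j (Ordinal m0); have l2' := w_hi k' j' (Ordinal m0); rewrite !mxE in l1 l2'.
  apply: (level_gap x0 xx l1 l2' h); rewrite mulrDr.
  have := s1 k; have := s1 k'; move: xx x0.
  by move: (K * _) (K * _) (dl * _) (dl * _) => u v y z; lra.
have lens_level k j k' j' x :
    lens U (A k j) (r k) x -> lens U (A k' j') (r k') x -> k = k'.
  move=> hx hx'; have [kk'|kk'|//] := ltngtP k k'.
    by have := lens_gap _ _ _ _ _ kk' hx hx'.
  by have := lens_gap _ _ _ _ _ kk' hx' hx.
have lens_index k j j' x : lens U (A k j) (r k) x -> lens U (A k j') (r k) x -> j = j'.
  move=> hx hx'; apply/ffunP => i; apply/eqP; apply: contraT => ij; exfalso.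
  have [_ _ _ _ meet] := LFk k j.
  have h := meet _ _ x (wdl k j') (sp k) (ss k) hx hx' i.
  move: h; rewrite !mxE => h.
  have x0 : 0 < dl * 2^-1 ^+ k by rewrite mulr_gt0.
  apply: (index_gap x0 (Mp k) _ h) => //.
  have -> : dl * 2^-1 ^+ k / (16 * (M k)%:R) = 2 * (dl * 2^-1 ^+ k / (32 * (M k)%:R)).
    by field; rewrite gt_eqF.
  by rewrite mulrDr [leRHS]mulr_natl [leRHS]mulr2n lerD// sK.
have [eps heps] : {eps : forall k, J k -> R | forall k, (forall j, `|eps k j| = 1) /\
    (\int[mu]_x cabs (\sum_j (eps k j)%:C *
      fourier (fun y => (cbump (A k j) (r k) y)%:C) x)) ^+ 2 <=
    #|J k|%:R * (@theta_hat_norm R ^+ n) ^+ 2}.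
  exists (fun k => s2val (cid2 (signs_fourier (A k) (r0 k)))) => k.
  by split; [exact: (s2valP (cid2 (signs_fourier (A k) (r0 k))))|exact: (s2valP' (cid2 (signs_fourier (A k) (r0 k))))].
have eps1 k j : `|eps k j| = 1 by have [] := heps k.
pose t k := K * s k ^+ 2.
have s2le (C : R) k : 0 <= C -> 0 <= C * s k ^+ 2 <= C * sg ^+ 2 * b ^+ k.
  move=> C0; rewrite mulr_ge0 ?sqr_ge0//= /s exprMn mulrA ler_wpM2l//; first by rewrite mulr_ge0 ?sqr_ge0.
  rewrite expr2 ler_piMr ?exprn_ge0 ?(ltW b0)// exprn_ile1 ?(ltW b0)//.
  by apply: le_trans b1 _; rewrite invf_le1// ler1n.
have r_to0 : r @ \oo --> (0 : R).
  apply: (seq_squeeze0 (v := fun k => ka * sg ^+ 2 * b ^+ k)); last exact: pow_cvg0.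
  by move=> k; apply: s2le; exact: ltW.
have t_to0 : t @ \oo --> (0 : R).
  apply: (seq_squeeze0 (v := fun k => K * sg ^+ 2 * b ^+ k)); last exact: pow_cvg0.
  by move=> k; apply: s2le; exact: ltW.
have shrink k j : exists2 b, ~ dilate2 U b & forall i, `|(A k j - b) ord0 i| <= t k.
  by have [_ _ ? _ _] := LFk k j.
pose v k := K * s k ^+ n.+1.
have lens_vol k j : rI mu (\1_(lens U (A k j) (r k)) : E -> R) /\
    \int[mu]_x (\1_(lens U (A k j) (r k)) x : R) <= v k.
  by have [_ ? _ _ _] := LFk k j.
have lens_cube k j : lens U (A k j) (r k) `<=` cube k0 by have [_ _ _ ? _] := LFk k j.
have massE k : mass (n := n) r c k = 2 ^+ n * q ^+ k.
  have rn : r k ^+ n != 0 by rewrite expf_neq0// gt_eqF.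
  have e : (2 * r k) ^+ n = 2 ^+ n * r k ^+ n by exact: exprMn.
  by rewrite /mass e /c; move: (r k ^+ n) rn => z z0; field.
have q1' : q <= 1 by apply: le_trans q1 _; rewrite invf_le1// ler1n.
have mass_mono k k' : (k <= k')%N -> mass (n := n) r c k' <= mass (n := n) r c k.
  by move=> kk'; rewrite !massE ler_wpM2l ?exprn_ge0// ler_wiXn2l// ltW.
have mass_to0 : mass (n := n) r c @ \oo --> (0 : R).
  rewrite (_ : mass _ _ = fun k => 2 ^+ n * q ^+ k); last exact/funext.
  exact: pow_cvg0.
have NE k : #|J k|%:R = (B ^+ k) ^+ m :> R.
  by rewrite card_ffun !card_ord natrX ME.
exists (fun g => ci mu (fun z => (symbol A r c eps z)%:C * g z)); split.
- exact: symbol_distribution oU r0 c0 AU lens_level lens_index shrink r_to0 t_to0 eps1.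
- have p2 : 2 < p by apply: lt_trans p4; rewrite ltr_nat.
  pose C := (2 ^+ n) `^ (p - 2) * (2 ^+ n * K / (ka ^+ n * sg ^+ m)).
  have C0 : 0 <= C.
    rewrite mulr_ge0 ?powR_ge0// divr_ge0 ?mulr_ge0 ?exprn_ge0 ?(ltW K0) ?(ltW ka0) ?(ltW sg0)//.
  apply: (@symbol_hankel_schatten R n U J A r c eps oU r0 c0 AU lens_level lens_index eps1 k0 v
    lens_vol lens_cube mass_mono mass_to0 p (C * 2) p2) => N.
  apply: (@le_trans _ _ (C * \sum_(k < N) 2^-1 ^+ k)); last by rewrite ler_wpM2l// geometric_sum.
  rewrite mulr_sumr; apply: ler_sum => k _; rewrite massE NE.
  have -> := schatten_term p K k mn q0 sg0 ka0 B0 bE.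
  rewrite ler_wpM2l// lerXn2r ?nnegrE ?invr_ge0//.
    by rewrite !mulr_ge0 ?powR_ge0 ?exprn_ge0// ltW.
  by rewrite qE BE; exact: pow_half.
- apply: (symbol_unbounded r0 c0 AU lens_level lens_index eps1) => [k|X]; first by have [] := heps k.
  have [k hk] := pow4_large X; exists k; apply: lt_le_trans hk _; apply: le_of_eq.
  have -> : c k * r k ^+ n = q ^+ k by rewrite /c divfK// expf_neq0// gt_eqF.
  by rewrite NE BE (square_count _ qE).
Qed.

End construction.

Theorem theorem1p1 (R : realType) (n : nat) (Omega : set 'rV[R]_n)
    (hn : (2 <= n)%N)
    (Omega_convex : convex_set (Omega : set (convex_lmodType 'rV[R]_n)))
    (Omega_curved : curved_boundary_neighborhood Omega)
    (p : R) (hp : 4 < p) :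
  exists phihat : ('rV[R]_n -> R[i]) -> R[i],
    [/\ distribution_on (dilate2 Omega°) phihat,
        hankel_in_schatten p Omega° phihat &
        ~ admits_bounded_symbol Omega° phihat].
Proof.
have [a [dl [s0 [ka [K [k0 LF]]]]]] := curved_lenses hn Omega_convex Omega_curved.
have n0 : (0 < n)%N by rewrite ltnW.
apply: (lens_family_counterexample _ _ _ LF hp); first by rewrite prednK.
- by rewrite -ltnS prednK.
- exact: open_interior.
Qed.
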